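(* Let $(Z_n)_{n\ge 0}$ be a Markov-additive process on $\mathbb{Z}^d\times\{1,\dots,p\}$ which is irreducible, aperiodic, has finite exponential moments, and is non-centered (its global drift $m$ is non-zero). Then there exist a continuous function $c:\mathbb{S}^{d-1}\to\mathbb{R}^d$, for each $i,j\in\{1,\dots,p\}$ a continuous function $\chi_{i,j}:\mathbb{S}^{d-1}\to\mathbb{R}$, and positive constants $C_1,C_2$ such that $C_1\le \chi_{i,j}\le C_2$ and $$G\big((0,i),(x,j)\big)\sim \chi_{i,j}\!\left(\frac{x}{\|x\|}\right)\|x\|^{-\frac{d-1}{2}}\, e^{-c\left(\frac{x}{\|x\|}\right)\cdot x}\qquad\text{as } \|x\|\to+\infty,\ x\in\mathbb{Z}^d.$$
   Context: Fix integers $d,p\ge 1$. A Markov-additive process on $\mathbb{Z}^d\times\{1,\dots,p\}$ is a Markov chain $(Z_n)_{n\ge0}=(A_n,M_n)_{n\ge0}$ such that $\mathbb{P}_{(x,i)}((A_1,M_1)=(x',i'))=\mathbb{P}_{(0,i)}((A_1,M_1)=(x'-x,i'))$ for all $x,x'\in\mathbb{Z}^d$, $i,i'\in\{1,\dots,p\}$. Its jump matrix is the $p\times p$ matrix of sub-probability measures $\mu_{i,j}(x)=\mathbb{P}_{(0,i)}((A_1,M_1)=(x,j))$ on $\mathbb{Z}^d$. Aperiodic means: for every state $(x,i)$, $\gcd\{n\ge1:\mathbb{P}_{(x,i)}(Z_n=(x,i))>0\}=1$. Finite exponential moments means $\sum_{x\in\mathbb{Z}^d}e^{\alpha\|x\|}\mu_{i,j}(x)<\infty$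 for all $i,j$ and all $\alpha>0$. The matrix $\big(\sum_x\mu_{i,j}(x)\big)_{i,j}$ is the transition matrix of the chain $(M_n)$, which under these assumptions has a unique stationary distribution $\pi=(\pi_1,\dots,\pi_p)$. The local drifts are $m_{i,j}=\sum_x x\,\mu_{i,j}(x)\in\mathbb{R}^d$ and the global drift is $m=\sum_{i,j}\pi_i m_{i,j}$. The Green function is $G((z,i),(x,j))=\sum_{n\ge0}\mathbb{P}_{(z,i)}(Z_n=(x,j))$. *)

(* Defs.v *)
From HB Require Import structures.
From mathcomp Require Import all_boot all_order all_algebra.
From mathcomp Require Import all_classical all_reals all_analysis.
Set Implicit Arguments. Unset Strict Implicit. Unset Printing Implicit Defensive.
Import Order.TTheory GRing.Theory Num.Theory.
Import numFieldNormedType.Exports.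
Local Open Scope classical_set_scope.
Local Open Scope ring_scope.

Section MAP.
Variables (R : realType) (d p : nat).

Definition state := ('rV[int]_d * 'I_p)%type.

(* A jump matrix: mu i j x = P_(0,i)((A_1,M_1) = (x,j)). *)
Definition jump := 'I_p -> 'I_p -> 'rV[int]_d -> R.

Definition toR (x : 'rV[int]_d) : 'rV[R]_d := map_mx (fun z : int => z%:~R) x.
Definition enorm (v : 'rV[R]_d) : R := Num.sqrt (\sum_(k < d) v 0 k ^+ 2).
Definition dotp (u v : 'rV[R]_d) : R := \sum_(k < d) u 0 k * v 0 k.
Definition sphere : set 'rV[R]_d := [set u | enorm u = 1].

(* Nonnegative countable sums are taken with esum in \bar R;
   a signed absolutely summable sum is (sum of positive part) - (sum of negative part). *)
Definition sumR (T : choiceType) (f : T -> R) : R :=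
  fine (\esum_(t in setT) ((Num.max (f t) 0)%:E)) -
  fine (\esum_(t in setT) ((Num.max (- f t) 0)%:E)).

Definition is_jump_matrix (mu : jump) : Prop :=
  (forall i j x, 0 <= mu i j x) /\
  (forall i, \sum_(j < p) \esum_(x in setT) (mu i j x)%:E = 1%E).

Definition P1 (mu : jump) (s t : state) : R := mu s.2 t.2 (t.1 - s.1).

Fixpoint Pn (mu : jump) (n : nat) (s t : state) : \bar R :=
  match n with
  | 0 => (if s == t then 1 else 0)%:E
  | n'.+1 => \esum_(u in setT) (Pn mu n' s u * (P1 mu u t)%:E)%E
  end.

Definition green (mu : jump) (s t : state) : \bar R :=
  \esum_(n in [set: nat]) Pn mu n s t.

Definition irreducible (mu : jump) : Prop :=
  forall s t : state, exists n, (0 < Pn mu n s t)%E.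

(* gcd {n >= 1 : P_s(Z_n = s) > 0} = 1, i.e. 1 is the only common divisor. *)
Definition aperiodic (mu : jump) : Prop :=
  forall (s : state) (k : nat),
    (forall n, (0 < n)%N -> (0 < Pn mu n s s)%E -> (k %| n)%N) -> k = 1%N.

Definition finite_exp_moments (mu : jump) : Prop :=
  forall i j (a : R), 0 < a ->
    (\esum_(x in setT) (expR (a * enorm (toR x)) * mu i j x)%:E < +oo)%E.

Definition Mtrans (mu : jump) (i j : 'I_p) : R := fine (\esum_(x in setT) (mu i j x)%:E).

Definition local_drift (mu : jump) (i j : 'I_p) : 'rV[R]_d :=
  \row_(k < d) sumR (fun x : 'rV[int]_d => (x 0 k)%:~R * mu i j x).

Definition stationary (mu : jump) (pi : 'I_p -> R) : Prop :=
  (forall i, 0 <= pi i) /\ \sum_(i < p) pi i = 1 /\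
  (forall j, \sum_(i < p) pi i * Mtrans mu i j = pi j).

Definition global_drift (mu : jump) (pi : 'I_p -> R) : 'rV[R]_d :=
  \sum_(i < p) \sum_(j < p) pi i *: local_drift mu i j.

(* Non-centered: the global drift (w.r.t. the (unique) stationary distribution) is nonzero. *)
Definition non_centered (mu : jump) : Prop :=
  forall pi, stationary mu pi -> global_drift mu pi != 0.

End MAP.

(* Main.v *)
Require Import Defs.
From HB Require Import structures.
From mathcomp Require Import all_boot all_order all_algebra.
From mathcomp Require Import all_classical all_reals all_analysis.
From mathcomp Require Import ring lra zify.
Set Implicit Arguments. Unset Strict Implicit. Unset Printing Implicit Defensive.
Import Order.TTheory GRing.Theory Num.Theory.
Import numFieldNormedType.Exports.
From mathcomp Require Import complex.
Import Normc.
Local Open Scope classical_set_scope.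
Local Open Scope ring_scope.

Local Arguments normc {R} x : simpl never.

(** Mark every step landing in a fixed type [i0] with probability 1/2 and decompose
    paths at the marks: the Green function becomes a negligible term plus the sum of
    the convolution powers [kap * nu^n] of positive measures [nu] and [kap] on Z^d
    having exponential moments on the convex body [D = {alpha : phi(alpha) <= 1}],
    [phi] being the Laplace transform of [nu]. A nonzero drift gives, through the
    Poisson equation of the modulating chain, a point with [phi < 1], so for each
    direction [u] the linear form [u] is maximal on [D] at a point [c u], where
    [phi = 1] and [grad phi = lam u] with [lam > 0]; tilting by [c u] turns [nu] into
    a probability measure with drift along [u]. The sum over [n] of the tilted powers
    at [x = r u] concentrates on [|n - r / lam| = O(sqrt r)] and is compared with
    binomial averages over blocks of [L] consecutive powers; their local limit theorem
    needs no aperiodicity, has a covariance proportional to [S + (L/2) m^T m], and [L]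
    is sent to infinity last. *)

(** * Unordered sums *)

Section UnorderedSums.
Variable R : realType.
Implicit Types T : choiceType.
Local Open Scope ereal_scope.

Lemma esum_ge_term T (f : T -> \bar R) x :
  (forall y, 0 <= f y) -> f x <= \esum_(y in setT) f y.
Proof.
move=> f0; rewrite (esumID [set x])//=.
by rewrite setTI esum_set1// leeDl// esum_ge0.
Qed.

Lemma esumZl_le T (c : \bar R) (f : T -> \bar R) : (forall y, 0 <= f y) -> 0 <= c ->
  \esum_(y in setT) (c * f y) <= c * \esum_(y in setT) f y.
Proof.
move=> f0 c0; apply: ge_ereal_sup => /= _ [A [finA _] <-].
rewrite -ge0_mule_fsumr//.
by apply: lee_wpmul2l => //; apply: esum_ge; exists A.
Qed.

Lemma esumZl T (c : \bar R) (f : T -> \bar R) : (forall y, 0 <= f y) -> 0 <= c ->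
  \esum_(y in setT) (c * f y) = c * \esum_(y in setT) f y.
Proof.
move=> f0 c0; apply/eqP; rewrite eq_le esumZl_le//=.
case: c c0 => [r| |//] r0.
- rewrite lee_fin in r0.
  have [->|rn0] := eqVneq r 0%R.
    by rewrite mul0e esum_ge0// => x _; rewrite mul0e.
  have -> : \esum_(y in [set: T]) f y =
            \esum_(y in [set: T]) ((r^-1)%:E * (r%:E * f y)).
    by apply: eq_esum => y _; rewrite muleA -EFinM mulVf// mul1e.
  have le_inv : r%:E * (\esum_(y in setT) ((r^-1)%:E * (r%:E * f y))) <=
      r%:E * ((r^-1)%:E * (\esum_(y in setT) (r%:E * f y))).
    apply: lee_wpmul2l => //; apply: esumZl_le.
      by move=> y; rewrite mule_ge0.
    by rewrite lee_fin invr_ge0.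
  by apply: (le_trans le_inv); rewrite muleA -EFinM divff// mul1e.
- have [[x fx]|f_le0] := pselect (exists x, 0 < f x).
    have : +oo * f x <= \esum_(y in setT) (+oo * f y).
      by apply: (@esum_ge_term _ (fun y => +oo * f y)) => y; rewrite mule_ge0.
    by rewrite gt0_mulye// leye_eq => /eqP ->; rewrite leey.
  have f_eq0 y : f y = 0.
    apply/eqP; rewrite eq_le f0 andbT leNgt; apply/negP => fy.
    by apply: f_le0; exists y.
  rewrite [X in _ * X]esum1 ?mule0//.
  by apply: esum_ge0 => y _; rewrite f_eq0 mule0.
Qed.

Lemma esumZr T (c : \bar R) (f : T -> \bar R) : (forall y, 0 <= f y) -> 0 <= c ->
  \esum_(y in setT) (f y * c) = (\esum_(y in setT) f y) * c.
Proof.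
move=> f0 c0; rewrite muleC -esumZl//.
by apply: eq_esum => y _; rewrite muleC.
Qed.

Lemma exchange_esum (T T' : choiceType) (a : T -> T' -> \bar R) :
  (forall x y, 0 <= a x y) ->
  \esum_(x in setT) \esum_(y in setT) a x y =
  \esum_(y in setT) \esum_(x in setT) a x y.
Proof.
move=> a0; rewrite !esum_esum//.
rewrite (reindex_esum (setT `*`` (fun _ : T' => setT)) _ (fun z => (z.2, z.1)))//.
split => //=.
- by move=> [a1 a2] [b1 b2] _ _ [] -> ->.
- by move=> [a1 a2] _; exists (a2, a1).
Qed.

Lemma esum_prod (T T' : choiceType) (a : T * T' -> \bar R) : (forall z, 0 <= a z) ->
  \esum_(z in setT) a z = \esum_(x in setT) \esum_(y in setT) a (x, y).
Proof.
move=> a0; rewrite esum_esum//.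
have -> : [set: T] `*`` (fun=> [set: T']) = setT by apply/seteqP; split.
by apply: eq_esum => -[].
Qed.

Lemma reindex_esum_bij (T T' : choiceType) (e : T -> T') (a : T' -> \bar R) :
  bijective e -> \esum_(y in setT) a y = \esum_(x in setT) a (e x).
Proof.
move=> be; apply: reindex_esum; split => //.
- by move=> x y _ _; apply: (bij_inj be).
- by move=> y _; case: be => g eg ge; exists (g y).
Qed.

Lemma esum_subl (T : zmodType) (x : T) (a : T -> \bar R) :
  \esum_(y in setT) a y = \esum_(y in setT) a (x - y)%R.
Proof.
by apply: reindex_esum_bij; exists (fun y => x - y)%R => y; rewrite opprB addrC subrK.
Qed.

Lemma esum_addr (T : zmodType) (x : T) (a : T -> \bar R) :
  \esum_(y in setT) a y = \esum_(y in setT) a (y + x)%R.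
Proof.
by apply: reindex_esum_bij; exists (fun y => y - x)%R => y; rewrite ?addrK ?subrK.
Qed.

Lemma esum_single T (f : T -> \bar R) y :
  (forall x, x != y -> f x = 0) -> 0 <= f y -> \esum_(x in setT) f x = f y.
Proof.
move=> fz f0; rewrite (esumID [set y])/=.
  rewrite !setTI esum_set1// esum1 ?adde0// => x /= /eqP; exact: fz.
by move=> x _; have [->//|/fz ->] := eqVneq x y.
Qed.

Lemma esum_finType (T : finType) (f : T -> \bar R) : (forall x, 0 <= f x) ->
  \esum_(x in setT) f x = \sum_x f x.
Proof.
move=> f0.
have -> : \esum_(x in setT) f x =
    \esum_(x in [set: T]) (\sum_y (if x == y then f y else 0)).
  by apply: eq_esum => x _; rewrite -big_mkcond (eq_bigl (pred1 x)) ?big_pred1_eq.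
rewrite esum_sum; last by move=> x y _ _; case: ifP.
by apply: eq_bigr => y _; rewrite (@esum_single _ _ y) ?eqxx// => x /negPf ->.
Qed.

Lemma esum_int (a : int -> \bar R) : (forall k, 0 <= a k) ->
  \esum_(k in setT) a k =
  \esum_(n in [set: nat]) a (Posz n) + \esum_(n in [set: nat]) a (Negz n).
Proof.
move=> a0; rewrite (esumID [set k : int | 0 <= k]%R)// !setTI; congr (_ + _).
- rewrite (reindex_esum setT _ Posz)//; split => //.
  + by move=> m n _ _ [].
  + by case=> [n|n] //= _; exists n.
- rewrite (reindex_esum setT _ Negz)//; split => //.
  + by move=> m n _ _ [].
  + by case=> [n|n] //= _; exists n.
Qed.

Lemma esum_nat_recl (a : nat -> \bar R) : (forall n, 0 <= a n) ->
  \esum_(n in [set: nat]) a n = a 0%N + \esum_(n in [set: nat]) a n.+1.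
Proof.
move=> a0; rewrite (esumID [set 0%N])// setTI esum_set1//; congr (_ + _).
rewrite setTI (reindex_esum setT _ succn)//; split => //.
- by move=> m n _ _ [].
- by case=> //= m _; exists m.
Qed.

Lemma esum_nat_addr_le (a : nat -> \bar R) k : (forall n, 0 <= a n) ->
  \esum_(n in [set: nat]) a (n + k)%N <= \esum_(n in [set: nat]) a n.
Proof.
move=> a0; elim: k => [|k IH]; first by under eq_esum do rewrite addn0.
apply: le_trans IH; rewrite [leRHS]esum_nat_recl//.
apply: (@le_trans _ _ (\esum_(n in [set: nat]) a (n.+1 + k)%N)); last by rewrite leeDr.
by apply: le_esum => n _; rewrite addnS addSn.
Qed.

Lemma esum_nat_le (a : nat -> \bar R) M : (forall n, 0 <= a n) ->
  (forall n, \sum_(k < n) a k <= M) -> \esum_(k in [set: nat]) a k <= M.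
Proof.
move=> a0 aM; rewrite -nneseries_esumT//.
apply: lime_le; first by apply: is_cvg_nneseries.
by apply: nearW => n; rewrite big_mkord.
Qed.

Lemma esum_nat_ge (a : nat -> \bar R) n : (forall k, 0 <= a k) ->
  \sum_(k < n) a k <= \esum_(k in [set: nat]) a k.
Proof.
move=> a0; rewrite -nneseries_esumT// -(big_mkord xpredT).
exact: nneseries_lim_ge.
Qed.

End UnorderedSums.

(** * Summable families of real numbers *)

Section SummableFamilies.
Variable R : realType.
Implicit Types (T : choiceType) (c : R).

Definition rsummable T (f : T -> R) := summable [set: T] (EFin \o f).

Lemma rsummable_esum T (f : T -> R) : (forall x, 0 <= f x) ->
  rsummable f = (\esum_(x in setT) (f x)%:E < +oo)%E :> Prop.
Proof.
by move=> f0; rewrite /rsummable /summable; under eq_esum do rewrite /= ger0_norm//.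
Qed.

Lemma rsummable_le T (f g : T -> R) :
  (forall x, `|f x| <= g x) -> rsummable g -> rsummable f.
Proof.
move=> fg; apply: le_lt_trans; apply: le_esum => x _.
by rewrite lee_fin (le_trans (fg x))// ler_norm.
Qed.

Lemma rsummable_norm T (f : T -> R) : rsummable f -> rsummable (fun x => `|f x|).
Proof. by apply: le_lt_trans; apply: le_esum => x _ /=; rewrite normr_id. Qed.

Lemma rsummable_funrpos T (f : T -> R) : rsummable f -> rsummable f^\+.
Proof.
move=> /rsummable_norm; apply: rsummable_le => x.
by rewrite ger0_norm// /funrpos ge_max ler_norm normr_ge0.
Qed.

Lemma rsummable_funrneg T (f : T -> R) : rsummable f -> rsummable f^\-.
Proof.
move=> /rsummable_norm; apply: rsummable_le => x.
by rewrite ger0_norm// /funrneg ge_max -normrN ler_norm normr_ge0.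
Qed.

Lemma rsummableD T (f g : T -> R) :
  rsummable f -> rsummable g -> rsummable (fun x => f x + g x).
Proof. exact: summableD. Qed.

Lemma rsummableN T (f : T -> R) : rsummable f -> rsummable (fun x => - f x).
Proof. by move=> sf; rewrite /rsummable summableN in sf. Qed.

Lemma rsummableB T (f g : T -> R) :
  rsummable f -> rsummable g -> rsummable (fun x => f x - g x).
Proof. by move=> sf sg; apply: rsummableD => //; exact: rsummableN. Qed.

Lemma rsummableZ T c (f : T -> R) : rsummable f -> rsummable (fun x => c * f x).
Proof.
move=> sf; rewrite /rsummable /summable /=.
under eq_esum do rewrite normrM EFinM.
by rewrite esumZl// lte_mul_pinfty ?lee_fin.
Qed.

Lemma rsummable0 T : rsummable (fun _ : T => 0).
Proof. by rewrite /rsummable /summable esum1// => x _ /=; rewrite normr0. Qed.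

Lemma rsummable_sum T (I : Type) (r : seq I) (P : pred I) (f : I -> T -> R) :
  (forall i, P i -> rsummable (f i)) ->
  rsummable (fun x => \sum_(i <- r | P i) f i x).
Proof.
move=> sf; elim: r => [|i r IH].
  by under eq_fun do rewrite big_nil; exact: rsummable0.
under eq_fun do rewrite big_cons.
have [Pi|Pi] := boolP (P i) => //.
by apply: rsummableD => //; apply: sf.
Qed.

Lemma rsummable_mulr T (f g : T -> R) c :
  rsummable f -> (forall x, `|g x| <= c) -> rsummable (fun x => f x * g x).
Proof.
move=> sf gc; apply: (@rsummable_le _ _ (fun x => c * `|f x|)).
  by move=> x; rewrite normrM mulrC ler_wpM2r.
exact/rsummableZ/rsummable_norm.
Qed.

Lemma eq_sumR T (f g : T -> R) : (forall x, f x = g x) -> sumR f = sumR g.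
Proof. by move=> fg; congr sumR; apply/funext. Qed.

Lemma ge0_sumR T (f : T -> R) : (forall x, 0 <= f x) ->
  sumR f = fine (\esum_(x in setT) (f x)%:E).
Proof.
move=> f0; rewrite /sumR.
have -> : \esum_(t in [set: T]) (Num.max (- f t) 0)%:E = 0%E.
  by apply: esum1 => t _; rewrite max_r// oppr_le0.
rewrite subr0; congr fine; apply: eq_esum => t _.
by rewrite max_l.
Qed.

Lemma ge0_sumRE T (f : T -> R) : (forall x, 0 <= f x) -> rsummable f ->
  (sumR f)%:E = \esum_(x in setT) (f x)%:E.
Proof.
move=> f0 sf; rewrite ge0_sumR// fineK// ge0_fin_numE; last first.
  by apply: esum_ge0 => *; rewrite lee_fin.
by rewrite -rsummable_esum.
Qed.

Lemma sumR_ge0 T (f : T -> R) : (forall x, 0 <= f x) -> 0 <= sumR f.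
Proof.
by move=> f0; rewrite ge0_sumR// fine_ge0// esum_ge0// => x _; rewrite lee_fin.
Qed.

Lemma ge0_sumRD T (f g : T -> R) : (forall x, 0 <= f x) -> (forall x, 0 <= g x) ->
  rsummable f -> rsummable g -> sumR (fun x => f x + g x) = sumR f + sumR g.
Proof.
move=> f0 g0 sf sg; apply: EFin_inj.
rewrite [RHS]EFinD (ge0_sumRE f0 sf) (ge0_sumRE g0 sg) ge0_sumRE; last 2 first.
- by move=> x; rewrite addr_ge0.
- exact: rsummableD.
by rewrite -esumD; try by move=> *; rewrite lee_fin.
Qed.

Lemma sumR_posneg T (f : T -> R) : sumR f = sumR f^\+ - sumR f^\-.
Proof. by rewrite [in RHS]ge0_sumR// [X in _ - X]ge0_sumR. Qed.

Lemma ge0_sumRB T (f g : T -> R) : (forall x, 0 <= f x) -> (forall x, 0 <= g x) ->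
  rsummable f -> rsummable g -> sumR (fun x => f x - g x) = sumR f - sumR g.
Proof.
move=> f0 g0 sf sg; rewrite sumR_posneg; set h := fun x => f x - g x.
have sh : rsummable h by exact: rsummableB.
have [sp sn] := (rsummable_funrpos sh, rsummable_funrneg sh).
apply/eqP; rewrite subr_eq addrAC eq_sym subr_eq -!ge0_sumRD//; apply/eqP/eq_sumR => x.
have -> : h^\+ x + g x = h x + h^\- x + g x.
  by rewrite -[in h x](funrposBneg h) /= subrK.
by rewrite /h addrAC subrK.
Qed.

Lemma sumRD T (f g : T -> R) : rsummable f -> rsummable g ->
  sumR (fun x => f x + g x) = sumR f + sumR g.
Proof.
move=> sf sg.
have [[fp fn] [gp gn]] := ((rsummable_funrpos sf, rsummable_funrneg sf),
                           (rsummable_funrpos sg, rsummable_funrneg sg)).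
have -> : sumR (fun x => f x + g x) =
          sumR (fun x => (f^\+ x + g^\+ x) - (f^\- x + g^\- x)).
  apply: eq_sumR => x; rewrite -{1}(funrposBneg f) -{1}(funrposBneg g) /=.
  by rewrite opprD addrACA.
rewrite ge0_sumRB; try exact: rsummableD; try by move=> x; rewrite addr_ge0.
by rewrite !ge0_sumRD// (sumR_posneg f) (sumR_posneg g) opprD addrACA.
Qed.

Lemma sumRN T (f : T -> R) : sumR (fun x => - f x) = - sumR f.
Proof.
rewrite /sumR opprB; congr (_ - fine _).
by apply: eq_esum => x _; rewrite opprK.
Qed.

Lemma sumRB T (f g : T -> R) : rsummable f -> rsummable g ->
  sumR (fun x => f x - g x) = sumR f - sumR g.
Proof.
by move=> sf sg; rewrite sumRD//; [rewrite sumRN | exact: rsummableN].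
Qed.

Lemma ge0_sumRZ T c (f : T -> R) : 0 <= c -> (forall x, 0 <= f x) ->
  sumR (fun x => c * f x) = c * sumR f.
Proof.
move=> c0 f0; rewrite !ge0_sumR//; last by move=> x; rewrite mulr_ge0.
under eq_esum do rewrite EFinM.
rewrite esumZl//.
have : (0 <= \esum_(x in [set: T]) (f x)%:E)%E by apply: esum_ge0 => x _; rewrite lee_fin.
case: (\esum_(_ in _) _)%E => [r||]//= _; rewrite mulr0.
have [->|cn] := eqVneq c 0; first by rewrite mul0e.
by rewrite gt0_muley// lte_fin lt_neqAle eq_sym cn.
Qed.

Lemma sumRZ T c (f : T -> R) : sumR (fun x => c * f x) = c * sumR f.
Proof.
wlog c0 : c / 0 <= c => [wlog_ge0|].
  have [c0|c0] := leP 0 c; first exact: wlog_ge0.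
  have := wlog_ge0 (- c); rewrite oppr_ge0 (ltW c0) => /(_ isT).
  rewrite mulNr => /(congr1 -%R); rewrite opprK => <-; rewrite -sumRN.
  by apply: eq_sumR => x; rewrite mulNr opprK.
rewrite sumR_posneg (sumR_posneg f) mulrBr -!ge0_sumRZ//.
by rewrite (ge0_funrposM _ c0) (ge0_funrnegM _ c0).
Qed.

Lemma le_sumR T (f g : T -> R) : rsummable f -> rsummable g ->
  (forall x, f x <= g x) -> sumR f <= sumR g.
Proof.
move=> sf sg fg; rewrite -subr_ge0 -sumRB//; apply: sumR_ge0 => x.
by rewrite subr_ge0.
Qed.

Lemma le_norm_sumR T (f g : T -> R) : rsummable g -> (forall x, `|f x| <= g x) ->
  `|sumR f| <= sumR g.
Proof.
move=> sg fg; have sf := rsummable_le fg sg.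
rewrite ler_norml -sumRN; apply/andP; split; apply: le_sumR => //.
- exact: rsummableN.
- by move=> x; rewrite lerNl (le_trans _ (fg x))// -normrN ler_norm.
- by move=> x; rewrite (le_trans _ (fg x))// ler_norm.
Qed.

Lemma sumR0 T : sumR (fun _ : T => 0 : R) = 0.
Proof. by rewrite ge0_sumR// esum1. Qed.

Lemma sumR_sum T (I : Type) (r : seq I) (P : pred I) (f : I -> T -> R) :
  (forall i, P i -> rsummable (f i)) ->
  sumR (fun x => \sum_(i <- r | P i) f i x) = \sum_(i <- r | P i) sumR (f i).
Proof.
move=> sf; elim: r => [|i r IH].
  by rewrite big_nil; under eq_fun do rewrite big_nil; exact: sumR0.
rewrite big_cons; under eq_fun do rewrite big_cons.
have [Pi|Pi] := boolP (P i) => //.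
by rewrite sumRD ?IH//; [exact: sf | exact: rsummable_sum].
Qed.

Lemma sumR_ge_term T (f : T -> R) x : (forall y, 0 <= f y) -> rsummable f -> f x <= sumR f.
Proof.
move=> f0 sf; rewrite -lee_fin ge0_sumRE//.
by apply: (@esum_ge_term _ _ (fun y => (f y)%:E)) => y; rewrite lee_fin.
Qed.

Lemma sumR_ge_two_terms T (f : T -> R) x y : (forall z, 0 <= f z) -> rsummable f ->
  x != y -> f x + f y <= sumR f.
Proof.
move=> f0 sf xy; rewrite -lee_fin ge0_sumRE// (esumID [set x])/=; last first.
  by move=> z _; rewrite lee_fin.
rewrite !setTI esum_set1 ?lee_fin// EFinD leeD2l//.
apply: esum_ge; exists [set y]; last by rewrite fsbig_set1.
by split=> // z ->; apply/eqP; rewrite eq_sym.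
Qed.

Definition rconv (T : zmodType) (f h : T -> R) (x : T) : R :=
  sumR (fun y => f y * h (x - y)).

Section Convolution.
Variables (T : zmodType) (f h : T -> R).
Hypotheses (f_ge0 : forall x, 0 <= f x) (h_ge0 : forall x, 0 <= h x).

Lemma rconv_ge0 x : 0 <= rconv f h x.
Proof. by apply: sumR_ge0 => y; rewrite mulr_ge0. Qed.

Hypotheses (summable_f : rsummable f) (summable_h : rsummable h).

Lemma rconv_esum x : (rconv f h x)%:E = \esum_(y in setT) (f y * h (x - y))%:E.
Proof.
rewrite /rconv ge0_sumRE//; first by move=> y; rewrite mulr_ge0.
apply: (@rsummable_mulr _ _ _ (sumR h)) => // y.
by rewrite ger0_norm//; exact: sumR_ge_term.
Qed.

Let summable_translate (g : T -> R) c y : (forall x, `|g x| <= c) ->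
  rsummable (fun z => h z * g (y + z)).
Proof. by move=> gc; apply: rsummable_mulr => // z; exact: gc. Qed.

Let summable_iterated (g : T -> R) c : (forall x, `|g x| <= c) ->
  rsummable (fun y => f y * sumR (fun z => h z * g (y + z))).
Proof.
move=> gc; apply: (@rsummable_mulr _ _ _ (sumR (fun z => c * `|h z|))) => // y.
apply: le_norm_sumR; first exact/rsummableZ/rsummable_norm.
by move=> z; rewrite normrM mulrC ler_wpM2r.
Qed.

Let esum_rconv_mul (g : T -> R) c : (forall x, 0 <= g x) -> (forall x, `|g x| <= c) ->
  \esum_(x in setT) (rconv f h x * g x)%:E =
  \esum_(y in setT) (f y * sumR (fun z => h z * g (y + z)))%:E.
Proof.
move=> g0 gc.
have -> : \esum_(x in setT) (rconv f h x * g x)%:E =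
    \esum_(x in setT) \esum_(y in setT) (f y * h (x - y) * g x)%:E.
  apply: eq_esum => x _; rewrite EFinM rconv_esum -esumZr ?lee_fin//.
  by move=> y; rewrite lee_fin mulr_ge0.
rewrite exchange_esum; last by move=> x y; rewrite lee_fin !mulr_ge0.
apply: eq_esum => y _; rewrite EFinM ge0_sumRE//; last 2 first.
- by move=> z; rewrite mulr_ge0.
- exact: summable_translate gc.
rewrite -esumZl ?lee_fin//; last by move=> z; rewrite lee_fin mulr_ge0.
rewrite (esum_addr (- y)); apply: eq_esum => z _.
by rewrite -!EFinM [y + _]addrC subrK mulrA.
Qed.

Lemma rsummable_rconv_mul (g : T -> R) c : (forall x, 0 <= g x) ->
  (forall x, `|g x| <= c) -> rsummable (fun x => rconv f h x * g x).
Proof.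
move=> g0 gc; rewrite rsummable_esum; last by move=> x; rewrite mulr_ge0 ?rconv_ge0.
rewrite (esum_rconv_mul g0 gc) -rsummable_esum; first exact: summable_iterated gc.
by move=> y; rewrite mulr_ge0// sumR_ge0// => z; rewrite mulr_ge0.
Qed.

Lemma rsummable_rconv : rsummable (rconv f h).
Proof.
have := @rsummable_rconv_mul (fun=> 1) 1 (fun=> ler01).
by under eq_fun do rewrite mulr1; apply => x; rewrite normr1.
Qed.

Lemma sumR_rconv_mul (g : T -> R) c : (forall x, `|g x| <= c) ->
  sumR (fun x => rconv f h x * g x) =
  sumR (fun y => f y * sumR (fun z => h z * g (y + z))).
Proof.
move=> gc.
have ge0_case (k : T -> R) : (forall x, 0 <= k x) -> (forall x, `|k x| <= c) ->
    sumR (fun x => rconv f h x * k x) =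
    sumR (fun y => f y * sumR (fun z => h z * k (y + z))).
  move=> k0 kc; rewrite ge0_sumR; last by move=> x; rewrite mulr_ge0 ?rconv_ge0.
  rewrite (esum_rconv_mul k0 kc) -ge0_sumR// => y.
  by rewrite mulr_ge0// sumR_ge0// => z; rewrite mulr_ge0.
have gpos x : `|g^\+ x| <= c.
  by rewrite ger0_norm// (le_trans _ (gc x))// ge_max normr_ge0 ler_norm.
have gneg x : `|g^\- x| <= c.
  by rewrite ger0_norm// (le_trans _ (gc x))// ge_max normr_ge0 -normrN ler_norm.
have gE x : g x = g^\+ x - g^\- x by rewrite -[in LHS](funrposBneg g).
under eq_sumR do rewrite gE mulrBr.
rewrite sumRB; [|exact: rsummable_rconv_mul gpos|exact: rsummable_rconv_mul gneg].
rewrite !ge0_case// -sumRB; [|exact: summable_iterated gpos|exact: summable_iterated gneg].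
apply: eq_sumR => y; rewrite -mulrBr; congr (_ * _).
rewrite -sumRB; [|exact: summable_translate gpos|exact: summable_translate gneg].
by apply: eq_sumR => z; rewrite -mulrBr gE.
Qed.

End Convolution.

End SummableFamilies.

(** * Elementary inequalities *)

Section Inequalities.
Variable R : realType.
Implicit Types a s t x y : R.

Lemma expR_sub1_le_mul s : expR s - 1 <= s * expR s.
Proof.
have : (1 - s) * expR s <= expR (- s) * expR s.
  by rewrite ler_pM2r ?expR_gt0//; exact: expR_ge1Dx.
by rewrite -expRD addNr expR0; lra.
Qed.

Lemma norm_expR_sub1_le s : `|expR s - 1| <= `|s| * expR `|s|.
Proof.
have exp_le := expR_sub1_le_mul s; have exp_ge := expR_ge1Dx s.
have [s0|s0] := leP 0 s.
  by rewrite (ger0_norm s0) ger0_norm //; lra.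
have expN_ge1 : 1 <= expR (- s) by have := expR_ge1Dx (- s); lra.
have exp_le1 : expR s <= 1 by rewrite -(expR0 R) ler_expR ltW.
rewrite (ltr0_norm s0) ler0_norm; last lra.
nra.
Qed.

Lemma expR_le_quadratic s : expR s <= 1 + s + s ^+ 2 * expR `|s|.
Proof.
have exp_le := expR_sub1_le_mul s; have exp_ge := expR_ge1Dx s.
have exp_norm : 1 + `|s| <= expR `|s| := expR_ge1Dx _.
have norm_s := normr_ge0 s.
have [s0|s0] := leP 0 s.
  rewrite (ger0_norm s0) in exp_norm *.
  have : s * (expR s - 1) <= s * (s * expR s) by rewrite ler_wpM2l.
  nra.
rewrite (ltr0_norm s0) in exp_norm norm_s *.
have : - s * (1 - expR s) <= - s * (- s) by rewrite ler_wpM2l//; lra.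
have : s ^+ 2 * 1 <= s ^+ 2 * expR (- s) by rewrite ler_wpM2l ?sqr_ge0//; lra.
nra.
Qed.

Lemma expR_ge_quadratic (B : R) s : 1 <= B -> `|s| <= B ->
  1 + s + s ^+ 2 / (4 * B) <= expR s.
Proof.
move=> B1; rewrite ler_norml => /andP[sB1 sB2].
have Bp : 0 < 4 * B by lra.
have [s2|s2] := leP (-2) s.
  have half := expR_ge1Dx (s / 2).
  have square_le : (1 + s / 2) ^+ 2 <= expR s.
    have -> : expR s = expR (s / 2) ^+ 2 by rewrite expr2 -expRD; congr expR; lra.
    by rewrite ler_sqr ?nnegrE ?expR_ge0//; lra.
  apply: le_trans square_le.
  have : s ^+ 2 / (4 * B) <= s ^+ 2 / 4.
    by rewrite ler_wpM2l ?sqr_ge0// lef_pV2 ?posrE; lra.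
  nra.
apply: le_trans (expR_ge0 s).
have : s ^+ 2 / (4 * B) <= - s / 4.
  rewrite ler_pdivrMr//.
  have -> : - s / 4 * (4 * B) = - s * B by lra.
  by nra.
lra.
Qed.

Lemma expRN_le_inv y : 0 <= y -> expR (- y) <= (1 + y)^-1.
Proof.
by move=> y0; rewrite expRN lef_pV2 ?posrE ?expR_gt0// ?expR_ge1Dx//; lra.
Qed.

Lemma norm_expRN_taylor1_le y : 0 <= y -> `|expR (- y) - (1 - y)| <= y ^+ 2.
Proof.
move=> y0; have exp_ge := expR_ge1Dx (- y); have exp_le := expRN_le_inv y0.
have inv_le : (1 + y)^-1 <= 1 - y + y ^+ 2.
  rewrite -div1r ler_pdivrMr; last lra.
  have : 0 <= y ^+ 3 by rewrite exprn_ge0.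
  rewrite exprS; lra.
rewrite ger0_norm; lra.
Qed.

Lemma mean1_expRN_le (Y y : R) : 0 <= y <= Y ->
  (1 + expR (- y)) / 2 <= expR (- (y / (2 * (1 + Y)))).
Proof.
move=> /andP[y0 yY]; apply: le_trans (expR_ge1Dx _).
have Y1 : 0 < 1 + Y by lra.
have exp_le := expRN_le_inv y0.
have inv_le : (1 + y)^-1 <= 1 - y / (1 + Y).
  have -> : (1 + y)^-1 = 1 - y / (1 + y) by field; rewrite gt_eqF//; lra.
  by rewrite lerD2l lerN2 ler_wpM2l// lef_pV2 ?posrE; lra.
have -> : y / (2 * (1 + Y)) = y / (1 + Y) / 2 by field; rewrite gt_eqF.
lra.
Qed.

Lemma exprn_le_expR (n : nat) a t : 0 < a -> 0 <= t ->
  t ^+ n <= (n%:R / a) ^+ n * expR (a * t).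
Proof.
move=> a0 t0; case: n => [|n].
  by rewrite !expr0 mul1r -(expR0 R) ler_expR mulr_ge0// ltW.
have n0 : 0 < (n.+1)%:R :> R by rewrite ltr0n.
have -> : expR (a * t) = expR (a * t / n.+1%:R) ^+ n.+1.
  by rewrite -expRM_natl; congr expR; field.
rewrite -exprMn lerXn2r ?nnegrE//.
  by rewrite mulr_ge0 ?expR_ge0// divr_ge0// ltW.
have tE (m : R) : 0 < m -> t = m / a * (a * t / m).
  by move=> m0; field; rewrite !gt_eqF.
rewrite {1}(tE _ n0).
rewrite ler_wpM2l//; first by rewrite divr_ge0// ltW.
by apply: le_trans (expR_ge1Dx _); rewrite lerDr.
Qed.

Lemma exprn_expRN_bounded (n : nat) a : 0 < a -> exists2 C : R, 0 <= C &
  forall t, 0 <= t -> t ^+ n * expR (- (a * t)) <= C.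
Proof.
move=> a0; exists ((n%:R / a) ^+ n); first by rewrite exprn_ge0// divr_ge0// ltW.
by move=> t t0; rewrite expRN ler_pdivrMr ?expR_gt0//; exact: exprn_le_expR.
Qed.

Lemma exprn_gauss_le (n : nat) a : 0 < a -> exists2 C : R, 0 <= C &
  forall t, 0 <= t -> t ^+ n * expR (- (a * t ^+ 2)) <= C * expR (- (a / 2 * t ^+ 2)).
Proof.
move=> a0; have a2 : 0 < a / 2 by rewrite divr_gt0.
exists (1 + (n%:R / (a / 2)) ^+ n).
  by rewrite addr_ge0// exprn_ge0// divr_ge0// ltW.
move=> t t0; set e := expR (a / 2 * t ^+ 2).
have e0 : 0 < e := expR_gt0 _.
have e1 : 1 <= e by rewrite -(expR0 R) ler_expR mulr_ge0 ?sqr_ge0 ?ltW.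
have -> : expR (- (a * t ^+ 2)) = (e * e)^-1.
  by rewrite -expRD -expRN; congr expR; lra.
rewrite expRN -/e invfM mulrA ler_pM2r ?invr_gt0// ler_pdivrMr//.
apply: (@le_trans _ _ (1 + (t ^+ 2) ^+ n)).
  have [t1|/ltW t1] := leP t 1.
    by rewrite (le_trans (exprn_ile1 _ t0 t1))// lerDl !exprn_ge0.
  by rewrite -exprM (le_trans (ler_weXn2l t1 (leq_pmull n (isT : (0 < 2)%N))))// lerDr.
by rewrite mulrDl mul1r lerD// exprn_le_expR// sqr_ge0.
Qed.

Lemma MVT_norm_le (f df : R -> R) (M : R) y :
  (forall x, is_derive x 1 f (df x)) -> (forall x, `|x| <= `|y| -> `|df x| <= M) ->
  `|f y - f 0| <= M * `|y|.
Proof.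
move=> fd fM.
have fc : continuous f.
  by move=> x; apply/differentiable_continuous/derivable1_diffP; have [] := fd x.
have [y0|y0] := leP 0 y.
  have [c] := MVT_segment y0 (fun x _ => fd x) (continuous_subspaceT fc).
  rewrite in_itv /= => /andP[c0 cy] ->; rewrite subr0 normrM ler_wpM2r//.
  by apply: fM; rewrite !ger0_norm.
have [c] := MVT_segment (ltW y0) (fun x _ => fd x) (continuous_subspaceT fc).
rewrite in_itv /= => /andP[cy c0] MVT; rewrite distrC MVT sub0r normrM normrN ler_wpM2r//.
by apply: fM; rewrite ler0_norm// ltr0_norm// lerN2.
Qed.

Lemma norm_sin_le y : `|sin y| <= `|y|.
Proof.
have := @MVT_norm_le sin cos 1 y (fun x => is_derive_sin x).
by rewrite sin0 subr0 mul1r; apply => x _; exact: cos_max.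
Qed.

Lemma oneBcosE y : 1 - cos y = 2 * sin (y / 2) ^+ 2.
Proof.
have -> : cos y = cos (y / 2 + y / 2) by congr cos; lra.
by rewrite cosD; have := cos2Dsin2 (y / 2); lra.
Qed.

Lemma oneBcos_ge0 y : 0 <= 1 - cos y.
Proof. by rewrite subr_ge0 cos_le1. Qed.

Lemma oneBcos_le_sqr y : 1 - cos y <= y ^+ 2 / 2.
Proof.
rewrite oneBcosE; have sin_le := norm_sin_le (y / 2).
have : `|sin (y / 2)| ^+ 2 <= `|y / 2| ^+ 2 by rewrite lerXn2r ?nnegrE.
rewrite !real_normK ?num_real//; lra.
Qed.

Let derive_sinBid x : is_derive x 1 (fun x : R => sin x - x) (cos x - 1).
Proof. exact: is_deriveB. Qed.

Lemma norm_sinBid_le_cube y : `|sin y - y| <= `|y| ^+ 3 / 2.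
Proof.
have := @MVT_norm_le _ _ (`|y| ^+ 2 / 2) y derive_sinBid.
rewrite sin0 !subr0 => sin_le; rewrite exprSr mulrAC; apply: sin_le => x xy.
rewrite distrC ger0_norm ?oneBcos_ge0// (le_trans (oneBcos_le_sqr x))//.
by rewrite -[x ^+ 2]real_normK ?num_real// ler_wpM2r// lerXn2r ?nnegrE.
Qed.

Lemma norm_sinBid_le_sqr y : `|sin y - y| <= y ^+ 2.
Proof.
have sinB_le : `|sin y - y| <= 2 * `|y|.
  have := @MVT_norm_le _ _ 2 y derive_sinBid; rewrite sin0 !subr0; apply => x _.
  by have := cos_geN1 x; have := cos_le1 x; rewrite ler_norml; lra.
have := norm_sinBid_le_cube y; have y0 := normr_ge0 y.
rewrite -[y ^+ 2]real_normK ?num_real//; have [y2|y2] := leP `|y| 2; nra.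
Qed.

Lemma norm_cos_taylor2_le y : `|cos y - 1 + y ^+ 2 / 2| <= `|y| ^+ 3.
Proof.
pose f := fun x : R => cos x + x ^+ 2 / 2.
have fd x : is_derive x 1 f (x - sin x).
  have -> : f = (fun x : R => cos x + 2^-1 * (x * x)).
    by apply/funext => z; rewrite /f expr2 mulrC.
  have -> : x - sin x = - sin x + 2^-1 * (x * 1 + x * 1) by lra.
  apply: is_deriveD; apply: is_deriveZ; exact: is_deriveM.
have := @MVT_norm_le f (fun x => x - sin x) (`|y| ^+ 2) y fd.
have -> : f y - f 0 = cos y - 1 + y ^+ 2 / 2.
  by rewrite /f cos0 expr0n /= ; lra.
rewrite -exprSr; apply => x xy.
rewrite distrC; apply: (le_trans (norm_sinBid_le_sqr x)).
by rewrite -[x ^+ 2]real_normK ?num_real// lerXn2r ?nnegrE.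
Qed.

Lemma sin_ge_quarter s : 0 <= s <= pi / 2 -> s / 4 <= sin s.
Proof.
move=> /andP[s0 spi].
have pi2 : (pi : R) / 2 < 2 := @pihalf_lt2 R.
have [->|sn] := eqVneq s 0; first by rewrite sin0; lra.
have sp : 0 < s by rewrite lt_neqAle eq_sym sn.
have sin_s : 0 <= sin s by apply: sin_ge0_pi; rewrite s0 /=; lra.
have cos_s : 0 <= cos s by apply: cos_ge0_pihalf; rewrite spi andbT; lra.
have pythagoras := cos2Dsin2 s.
have mul_cos_le : s * cos s <= sin s.
  have [c] := MVT_segment s0 (fun x _ => is_derive_sin x)
    (continuous_subspaceT (@continuous_sin R)).
  rewrite in_itv /= => /andP[c0 cs]; rewrite sin0 !subr0 => ->.
  rewrite mulrC ler_wpM2r//.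
  have [->//|ne] := eqVneq c s.
  rewrite ltW// ltr_cos ?in_itv /= ?c0 ?s0 /=; lra.
have [c2|c2] := leP (1/2) (cos s); first by nra.
nra.
Qed.

Lemma oneBcos_ge_sqr t : `|t| <= pi -> t ^+ 2 / 32 <= 1 - cos t.
Proof.
move=> tpi; rewrite oneBcosE.
have ge0_case s : 0 <= s <= pi -> s ^+ 2 / 32 <= 2 * sin (s / 2) ^+ 2.
  move=> /andP[s0 spi].
  have := @sin_ge_quarter (s / 2); have -> : 0 <= s / 2 <= pi / 2 by lra.
  move=> /(_ isT); nra.
have [t0|t0] := leP 0 t.
  by apply: ge0_case; rewrite t0 /= -(ger0_norm t0).
have := ge0_case (- t); rewrite mulNr sinN sqrrN sqrrN; apply.
by rewrite -(ltr0_norm t0) normr_ge0.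
Qed.

Lemma sqrtrX x (n : nat) : 0 <= x -> Num.sqrt (x ^+ n) = Num.sqrt x ^+ n.
Proof.
move=> x0; rewrite -{1}[x]sqr_sqrtr// -exprM mulnC exprM sqrtr_sqr.
by rewrite ger0_norm// exprn_ge0// sqrtr_ge0.
Qed.

Lemma powRN_half x (n : nat) : 0 < x -> x `^ (- (n%:R / 2)) = (Num.sqrt x ^+ n)^-1.
Proof.
move=> x0; rewrite powRN; congr (_^-1).
by rewrite mulrC powRrM powR12_sqrt ?ltW// powR_mulrn// sqrtr_ge0.
Qed.

Lemma expRN_le_invsqrt a x : 0 < a -> 1 <= x -> expR (- (a * x)) <= a^-1 / Num.sqrt x.
Proof.
move=> a0 x1; have x0 : 0 < x by lra.
have sx0 : 0 < Num.sqrt x by rewrite sqrtr_gt0.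
have ax0 : 0 < a * x by rewrite mulr_gt0.
apply: (le_trans (expRN_le_inv (ltW ax0))); apply: (@le_trans _ _ (a * x)^-1).
  by rewrite lef_pV2 ?posrE ?lerDr//; lra.
rewrite invfM ler_wpM2l ?invr_ge0 ?(ltW a0)// lef_pV2 ?posrE//.
by rewrite -{2}(sqr_sqrtr (ltW x0)) expr2 ler_peMl ?(ltW sx0)// -[leLHS]sqrtr1 ler_wsqrtr.
Qed.

Lemma norm_invsqrtD_le x0 x y : 0 < x0 -> x0 <= x -> 0 <= y ->
  `|(Num.sqrt (x + y))^-1 - (Num.sqrt x)^-1| <= y / (x0 * Num.sqrt x0).
Proof.
move=> x0_gt0 x0x y0; have x_gt0 : 0 < x by exact: lt_le_trans x0x.
set q := Num.sqrt x0; set s := Num.sqrt x; set t := Num.sqrt (x + y).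
have q0 : 0 < q by rewrite sqrtr_gt0.
have s0 : 0 < s by rewrite sqrtr_gt0.
have t0 : 0 < t by rewrite sqrtr_gt0; lra.
have st : s <= t by rewrite ler_wsqrtr//; lra.
have qs : q <= s by rewrite ler_wsqrtr.
have -> : t^-1 - s^-1 = - ((t - s) / (t * s)) by field; rewrite !gt_eqF.
rewrite normrN ger0_norm; last by rewrite divr_ge0 ?subr_ge0 ?mulr_ge0// ltW.
have -> : x0 = q ^+ 2 by rewrite sqr_sqrtr// ltW.
have -> : y = (t - s) * (t + s).
  rewrite -subr_sqr !sqr_sqrtr//; [ring|exact: ltW|lra].
rewrite -[leRHS]mulrA ler_wpM2l ?subr_ge0//.
rewrite ler_pdivlMr ?mulr_gt0 ?exprn_gt0// mulrC ler_pdivrMr ?mulr_gt0//.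
rewrite [leLHS]mulrC expr2; apply: ler_pM; rewrite ?mulr_ge0 ?(ltW q0)//; first lra.
by apply: ler_pM; rewrite ?(ltW q0)//; exact: le_trans st.
Qed.

Lemma sqrt_exprn_expRN_small (n : nat) a (M e : R) : 0 < a -> 0 <= M -> 0 < e ->
  exists2 r0 : R, 1 <= r0 &
  forall r, r0 <= r -> Num.sqrt r ^+ n * (M * expR (- (a * r))) <= e.
Proof.
move=> a0 M0 e0; have [C C0 exp_bound] := exprn_expRN_bounded n.+1 a0.
have MC : 0 <= M * C / e by rewrite divr_ge0 ?mulr_ge0// ltW.
exists (1 + M * C / e) => [|r r_large]; first by rewrite lerDl.
have r1 : 1 <= r by apply: le_trans r_large; rewrite lerDl.
have r0 : 0 < r by exact: lt_le_trans r1.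
have sqrt_le : Num.sqrt r <= r.
  rewrite -[leRHS]sqr_sqrtr ?(ltW r0)// expr2 ler_peMr ?sqrtr_ge0//.
  by rewrite -[leLHS]sqrtr1 ler_wsqrtr.
apply: (@le_trans _ _ (r ^+ n * (M * expR (- (a * r))))).
  by rewrite ler_wpM2r ?mulr_ge0 ?expR_ge0// lerXn2r ?nnegrE ?sqrtr_ge0// ltW.
rewrite -(ler_pM2l r0) mulrA -exprS mulrCA.
apply: (@le_trans _ _ (M * C)); first by rewrite ler_wpM2l// exp_bound// ltW.
by rewrite -ler_pdivrMr//; apply: le_trans r_large; rewrite lerDr.
Qed.

End Inequalities.

(** * Vectors and quadratic forms *)

Section Vectors.
Variable R : realType.
Implicit Types c r : R.

Lemma norm_coord_le d (v : 'rV[R]_d) k : `|v 0 k| <= `|v|.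
Proof.
rewrite [`|v|]mx_normrE.
exact: (le_bigmax 0 (fun i : 'I_1 * 'I_d => `|v i.1 i.2|) (0, k)).
Qed.

Lemma norm_rV_le d (v : 'rV[R]_d) r : 0 <= r -> (forall k, `|v 0 k| <= r) -> `|v| <= r.
Proof.
move=> r0 vr; rewrite [`|v|]mx_normrE; apply/bigmax_leP; split => // -[i k] _ /=.
by rewrite (ord1 i).
Qed.

Lemma dotpE d (u v : 'rV[R]_d) : dotp u v = (u *m v^T) 0 0.
Proof. by rewrite !mxE; apply: eq_bigr => k _; rewrite mxE. Qed.

Lemma dotpC d (u v : 'rV[R]_d) : dotp u v = dotp v u.
Proof. by apply: eq_bigr => k _; rewrite mulrC. Qed.

Lemma mulmx_trC d (u v : 'rV[R]_d) : u *m v^T = v *m u^T.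
Proof. by apply/matrixP => i j; rewrite !ord1 -!dotpE dotpC. Qed.

Lemma dotpDr d (u v w : 'rV[R]_d) : dotp u (v + w) = dotp u v + dotp u w.
Proof. by rewrite /dotp -big_split; apply: eq_bigr => k _; rewrite mxE mulrDr. Qed.

Lemma dotpNr d (u v : 'rV[R]_d) : dotp u (- v) = - dotp u v.
Proof. by rewrite /dotp -sumrN; apply: eq_bigr => k _; rewrite mxE mulrN. Qed.

Lemma dotpZr d c (u v : 'rV[R]_d) : dotp u (c *: v) = c * dotp u v.
Proof. by rewrite /dotp mulr_sumr; apply: eq_bigr => k _; rewrite mxE mulrCA. Qed.

Lemma dotpDl d (u v w : 'rV[R]_d) : dotp (u + v) w = dotp u w + dotp v w.
Proof. by rewrite dotpC dotpDr !(dotpC w). Qed.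

Lemma dotpNl d (u v : 'rV[R]_d) : dotp (- u) v = - dotp u v.
Proof. by rewrite dotpC dotpNr dotpC. Qed.

Lemma dotpZl d c (u v : 'rV[R]_d) : dotp (c *: u) v = c * dotp u v.
Proof. by rewrite dotpC dotpZr dotpC. Qed.

Lemma dotp0r d (u : 'rV[R]_d) : dotp u 0 = 0.
Proof. by rewrite /dotp big1// => k _; rewrite mxE mulr0. Qed.

Lemma dotp_sumr d (u : 'rV[R]_d) (I : finType) (F : I -> 'rV[R]_d) :
  dotp u (\sum_i F i) = \sum_i dotp u (F i).
Proof.
elim/big_rec2: _ => [|i a b _ <-]; last by rewrite dotpDr.
by rewrite dotp0r.
Qed.

Lemma dotp_row_mx d (s t : R) (u v : 'rV[R]_d) :
  dotp (row_mx s%:M u : 'rV_(1 + d)) (row_mx t%:M v) = s * t + dotp u v.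
Proof.
rewrite !dotpE tr_row_mx mul_row_col mxE tr_scalar_mx mul_scalar_mx.
by rewrite !mxE.
Qed.

Lemma dotp_ge0 d (v : 'rV[R]_d) : 0 <= dotp v v.
Proof. by apply: sumr_ge0 => k _; rewrite -expr2 sqr_ge0. Qed.

Lemma enorm_ge0 d (v : 'rV[R]_d) : 0 <= enorm v.
Proof. exact: sqrtr_ge0. Qed.

Lemma enorm_sqr d (v : 'rV[R]_d) : enorm v ^+ 2 = dotp v v.
Proof.
rewrite sqr_sqrtr; first by apply: eq_bigr => k _; rewrite expr2.
by apply: sumr_ge0 => k _; rewrite sqr_ge0.
Qed.

Lemma enormZ d a (v : 'rV[R]_d) : enorm (a *: v) = `|a| * enorm v.
Proof.
rewrite -sqrtr_sqr /enorm -sqrtrM ?sqr_ge0// mulr_sumr; congr Num.sqrt.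
by apply: eq_bigr => k _; rewrite mxE exprMn.
Qed.

Lemma norm_coord_le_enorm d (v : 'rV[R]_d) k : `|v 0 k| <= enorm v.
Proof.
rewrite -sqrtr_sqr ler_wsqrtr// (bigD1 k)//= lerDl.
by apply: sumr_ge0 => i _; rewrite sqr_ge0.
Qed.

Lemma norm_le_enorm d (v : 'rV[R]_d) : `|v| <= enorm v.
Proof. by apply: norm_rV_le => [|k]; rewrite ?enorm_ge0// norm_coord_le_enorm. Qed.

Lemma enorm_le_norm d (v : 'rV[R]_d) : enorm v <= d%:R * `|v|.
Proof.
rewrite -[leRHS]ger0_norm ?mulr_ge0// -sqrtr_sqr ler_wsqrtr//.
apply: (@le_trans _ _ (\sum_(k < d) `|v| ^+ 2)).
  apply: ler_sum => k _; rewrite -[_ 0 k ^+ 2]real_normK ?num_real//.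
  by rewrite lerXn2r ?nnegrE ?norm_coord_le.
rewrite sumr_const card_ord -[leLHS]mulr_natl exprMn ler_wpM2r ?sqr_ge0//.
by rewrite -natrX ler_nat; case: d {v} => // n; rewrite expnS expn1 leq_pmulr.
Qed.

Lemma dotp_le0_eq0 d (v : 'rV[R]_d) : dotp v v <= 0 -> v = 0.
Proof.
rewrite -enorm_sqr => v_le0; apply/eqP; rewrite -normr_le0 (le_trans (norm_le_enorm v))//.
by rewrite leNgt; apply/negP => v_gt0; have := exprn_gt0 2 v_gt0; lra.
Qed.

Lemma norm_dotp_le d (u v : 'rV[R]_d) : `|dotp u v| <= d%:R * `|u| * enorm v.
Proof.
apply: (le_trans (ler_norm_sum _ _ _)).
apply: (@le_trans _ _ (\sum_(k < d) `|u| * enorm v)).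
  apply: ler_sum => k _; rewrite normrM.
  by apply: ler_pM => //; rewrite ?norm_coord_le ?norm_coord_le_enorm.
by rewrite sumr_const card_ord -[leLHS]mulr_natl mulrA.
Qed.

Lemma sphere_norm_le1 d (u : 'rV[R]_d) : sphere u -> `|u| <= 1.
Proof. by move=> su; rewrite -[leRHS]su; exact: norm_le_enorm. Qed.

Lemma sphere_dotp d (u : 'rV[R]_d) : sphere u -> dotp u u = 1.
Proof. by move=> su; rewrite -enorm_sqr su expr1n. Qed.

Lemma sphere_normalize d (v : 'rV[R]_d) : 0 < enorm v -> sphere ((enorm v)^-1 *: v).
Proof. by move=> v0; rewrite /sphere /= enormZ gtr0_norm ?invr_gt0// mulVf ?gt_eqF. Qed.

Lemma sphere_neq0 d : (0 < d)%N -> @sphere R d !=set0.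
Proof.
move=> d0; exists (delta_mx 0 (Ordinal d0)).
rewrite /sphere /= /enorm (bigD1 (Ordinal d0))//= mxE !eqxx expr1n big1 ?addr0 ?sqrtr1//.
by move=> k kn; rewrite mxE (negPf kn) andbF expr0n.
Qed.

Lemma toRD d (x y : 'rV[int]_d) : toR R (x + y) = toR R x + toR R y.
Proof. by apply/rowP => k; rewrite !mxE intrD. Qed.

Lemma toRN d (x : 'rV[int]_d) : toR R (- x) = - toR R x.
Proof. by apply/rowP => k; rewrite !mxE mulrNz. Qed.

Lemma toR0 d : toR R (0 : 'rV[int]_d) = 0.
Proof. by apply/rowP => k; rewrite !mxE. Qed.

Lemma toR_row_mx d (t : int) (w : 'rV[int]_d) :
  toR R (row_mx t%:M w : 'rV_(1 + d)) = row_mx (t%:~R)%:M (toR R w).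
Proof.
rewrite /toR map_row_mx; congr row_mx.
by apply/matrixP => i j; rewrite !ord1 !mxE.
Qed.

Lemma dotp_delta d (v : 'rV[R]_d) k : dotp v (toR R (delta_mx 0 k)) = v 0 k.
Proof.
rewrite /dotp (bigD1 k)//= !mxE !eqxx mulr1 big1 ?addr0// => j jk.
by rewrite !mxE (negPf jk) mulr0.
Qed.

Definition l1norm d (x : 'rV[int]_d) : R := \sum_k `|(x 0 k)%:~R|.

Lemma l1norm_ge0 d (x : 'rV[int]_d) : 0 <= l1norm x.
Proof. exact: sumr_ge0. Qed.

Lemma l1normD d (x y : 'rV[int]_d) : l1norm (x + y) <= l1norm x + l1norm y.
Proof.
by rewrite /l1norm -big_split /=; apply: ler_sum => k _; rewrite mxE intrD ler_normD.
Qed.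

Lemma norm_coord_le_l1norm d (x : 'rV[int]_d) k : `|(x 0 k)%:~R : R| <= l1norm x.
Proof. by rewrite /l1norm (bigD1 k)//= lerDl sumr_ge0. Qed.

Lemma enorm_le_l1norm d (x : 'rV[int]_d) : enorm (toR R x) <= l1norm x.
Proof.
rewrite /enorm -[leRHS]ger0_norm ?l1norm_ge0// -sqrtr_sqr ler_wsqrtr//.
rewrite expr2 {1}/l1norm mulr_suml; apply: ler_sum => k _.
rewrite mxE -real_normK ?num_real// expr2 ler_wpM2l//.
exact: norm_coord_le_l1norm.
Qed.

Lemma l1norm_le_enorm d (x : 'rV[int]_d) : l1norm x <= d%:R * enorm (toR R x).
Proof.
rewrite /l1norm; apply: (@le_trans _ _ (\sum_(k < d) enorm (toR R x))).
  by apply: ler_sum => k _; have := norm_coord_le_enorm (toR R x) k; rewrite mxE.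
by rewrite sumr_const card_ord mulr_natl.
Qed.

Lemma norm_dotp_le_l1norm d (v : 'rV[R]_d) x : `|dotp v (toR R x)| <= `|v| * l1norm x.
Proof.
rewrite /dotp /l1norm mulr_sumr; apply: (le_trans (ler_norm_sum _ _ _)).
by apply: ler_sum => k _; rewrite normrM mxE ler_wpM2r// norm_coord_le.
Qed.

Lemma norm_dotp_le_enorm_l1norm d (v : 'rV[R]_d) x :
  `|dotp v (toR R x)| <= enorm v * l1norm x.
Proof.
by rewrite (le_trans (norm_dotp_le_l1norm v x))// ler_wpM2r ?l1norm_ge0// norm_le_enorm.
Qed.

End Vectors.

Section BlockDeterminants.
Variable F : comUnitRingType.

Lemma det_block_ul m n (A : 'M[F]_m) (B : 'M[F]_(m, n)) (C : 'M[F]_(n, m)) (D : 'M[F]_n) :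
  A \in unitmx -> \det (block_mx A B C D) = \det A * \det (D - C *m invmx A *m B).
Proof.
move=> uA; transitivity (\det (block_mx 1%:M 0 (- C *m invmx A) 1%:M *m block_mx A B C D)).
  by rewrite det_mulmx det_lblock !det1 !mul1r.
rewrite mulmx_block !mul1mx !mul0mx !addr0 mulmxKV// addNr det_ublock.
by rewrite !mulNmx addrC.
Qed.

Lemma det_block_dr m n (A : 'M[F]_m) (B : 'M[F]_(m, n)) (C : 'M[F]_(n, m)) (D : 'M[F]_n) :
  D \in unitmx -> \det (block_mx A B C D) = \det (A - B *m invmx D *m C) * \det D.
Proof.
move=> uD; transitivity (\det (block_mx 1%:M (- B *m invmx D) 0 1%:M *m block_mx A B C D)).
  by rewrite det_mulmx det_ublock !det1 !mul1r.
rewrite mulmx_block !mul1mx !mul0mx !add0r mulmxKV// addrN det_lblock.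
by rewrite !mulNmx.
Qed.

End BlockDeterminants.

Section QuadraticForms.
Variable R : realType.
Implicit Types a b c : R.

Definition qform d (A : 'M[R]_d) (v : 'rV[R]_d) : R := (v *m A *m v^T) 0 0.

Lemma qformZ d (A : 'M[R]_d) c v : qform A (c *: v) = c ^+ 2 * qform A v.
Proof. by rewrite /qform linearZ /= -!scalemxAl -scalemxAr scalerA mxE expr2. Qed.

Lemma qform_addmx d (A B : 'M[R]_d) v : qform (A + B) v = qform A v + qform B v.
Proof. by rewrite /qform mulmxDr mulmxDl mxE. Qed.

Lemma qform_oppmx d (A : 'M[R]_d) v : qform (- A) v = - qform A v.
Proof. by rewrite /qform mulmxN mulNmx mxE. Qed.

Lemma qform_scalemx d c (A : 'M[R]_d) v : qform (c *: A) v = c * qform A v.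
Proof. by rewrite /qform -scalemxAr -scalemxAl mxE. Qed.

Lemma qform_scalar_mx d c (v : 'rV[R]_d) : qform c%:M v = c * dotp v v.
Proof. by rewrite /qform mul_mx_scalar -scalemxAl mxE dotpE. Qed.

Lemma qform_outer d (m v : 'rV[R]_d) : qform (m^T *m m) v = dotp v m ^+ 2.
Proof.
by rewrite /qform mulmxA -mulmxA (mulmx_trC m v) mxE big_ord1 -dotpE expr2.
Qed.

Definition schur d (A : 'M[R]_(1 + d)) : 'M[R]_d :=
  drsubmx A - (A 0 0)^-1 *: ((ursubmx A)^T *m ursubmx A).

Section SchurComplement.
Variables (d : nat) (A : 'M[R]_(1 + d)).
Hypothesis A_sym : A^T = A.

Lemma sym_block_mxE : A = block_mx (A 0 0)%:M (ursubmx A) (ursubmx A)^T (drsubmx A).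
Proof.
rewrite -[LHS]submxK; congr block_mx.
  by apply/matrixP => i j; rewrite !ord1 !mxE /=; congr (A _ _); apply/val_inj.
by rewrite trmx_ursub A_sym.
Qed.

Lemma schur_sym : (schur A)^T = schur A.
Proof.
rewrite /schur linearB linearZ /= trmx_mul trmxK; congr (_ - _).
by rewrite trmx_drsub A_sym.
Qed.

Lemma qform_row_mx t (w : 'rV[R]_d) : qform A (row_mx t%:M w) =
  A 0 0 * t ^+ 2 + 2 * t * dotp (ursubmx A) w + qform (drsubmx A) w.
Proof.
rewrite /qform {1}sym_block_mxE mul_row_block tr_row_mx mul_row_col tr_scalar_mx.
rewrite !mul_mx_scalar mul_scalar_mx mulmxDl mulmx_trC -scalemxAl dotpE.
by move: (ursubmx A *m w^T) (w *m _ *m _) => p q; rewrite !mxE /=; ring.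
Qed.

Hypothesis A_neq0 : A 0 0 != 0.

Lemma qform_schur t (w : 'rV[R]_d) : qform A (row_mx t%:M w) =
  A 0 0 * (t + dotp (ursubmx A) w / A 0 0) ^+ 2 + qform (schur A) w.
Proof.
rewrite qform_row_mx /schur qform_addmx qform_oppmx qform_scalemx qform_outer dotpC.
by field.
Qed.

Lemma det_schur : \det A = A 0 0 * \det (schur A).
Proof.
rewrite {1}sym_block_mxE det_block_ul ?det_scalar1; last first.
  by rewrite unitmxE det_scalar1 unitfE.
by rewrite invmx_scalar mul_mx_scalar -scalemxAl.
Qed.

End SchurComplement.

Definition qform_bounded d a b (A : 'M[R]_d) :=
  A^T = A /\ forall v, a * dotp v v <= qform A v <= b * dotp v v.

Lemma qform_bounded_scalar_mx d c : qform_bounded c c (c%:M : 'M[R]_d).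
Proof. by split; [rewrite tr_scalar_mx | move=> v; rewrite qform_scalar_mx lexx]. Qed.

Lemma qform_bounded_schur d a b (A : 'M[R]_(1 + d)) : 0 < a -> qform_bounded a b A ->
  a <= A 0 0 /\ qform_bounded a b (schur A).
Proof.
move=> a0 [A_sym A_bounds].
have a_le : a <= A 0 0.
  have := A_bounds (row_mx 1%:M 0); rewrite qform_row_mx// dotp_row_mx !dotp0r.
  have -> : qform (drsubmx A) 0 = 0 by rewrite /qform trmx0 mulmx0 mxE.
  by rewrite expr1n !mulr1 mulr0 !addr0 !mulr1 => /andP[].
have A0 : 0 < A 0 0 by exact: lt_le_trans a_le.
split => //; split; first exact: schur_sym.
move=> w; set bw := dotp (ursubmx A) w.
have /andP[lower _] := A_bounds (row_mx (- (bw / A 0 0))%:M w).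
have /andP[_ upper] := A_bounds (row_mx 0%:M w).
move: lower upper; rewrite !qform_schur ?gt_eqF// !dotp_row_mx -/bw addNr expr0n !mulr0.
rewrite !add0r => lower upper; apply/andP; split.
  by apply: le_trans lower; rewrite ler_pM2l// lerDr -expr2 sqr_ge0.
by apply: le_trans upper; rewrite lerDr mulr_ge0 ?sqr_ge0// ltW.
Qed.

Lemma qform_bounded_det_gt0 d a b (A : 'M[R]_d) : 0 < a -> qform_bounded a b A -> 0 < \det A.
Proof.
move=> a0; elim: d A => [A _|d IH]; first by rewrite det_mx00.
rewrite -[d.+1]/(1 + d)%N => A A_bounded.
have [a_le schur_bounded] := qform_bounded_schur a0 A_bounded.
have A0 : 0 < A 0 0 by exact: lt_le_trans a_le.
by rewrite det_schur ?(proj1 A_bounded) ?gt_eqF// mulr_gt0// IH.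
Qed.

Definition bordered_mx d (S : 'M[R]_d) (m : 'rV[R]_d) : 'M[R]_(1 + d) :=
  block_mx 0 (- m) m^T S.

Lemma det_bordered_mx d (S : 'M[R]_d) m : S \in unitmx ->
  \det (bordered_mx S m) = (m *m invmx S *m m^T) 0 0 * \det S.
Proof. by move=> uS; rewrite det_block_dr// sub0r !mulNmx opprK det_mx11. Qed.

Lemma det_add_rank1 d (S : 'M[R]_d) m c : S \in unitmx ->
  \det (S + c *: (m^T *m m)) = \det S + c * \det (bordered_mx S m).
Proof.
move=> uS; transitivity (\det (block_mx 1%:M (- c *: m) m^T S : 'M[R]_(1 + d))).
  by rewrite det_block_ul ?unitmx1// invmx1 mulmx1 -scalemxAr scaleNr opprK det1 mul1r.
rewrite det_block_dr// det_bordered_mx// det_mx11.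
by rewrite -!scalemxAl !mxE mulNr opprK mulrDl mul1r mulrA.
Qed.

Lemma det_bordered_mx_gt0 d a b (S : 'M[R]_d) m : 0 < a -> qform_bounded a b S ->
  m != 0 -> 0 < \det (bordered_mx S m).
Proof.
move=> a0 S_bounded m0; have detS := qform_bounded_det_gt0 a0 S_bounded.
have uS : S \in unitmx by rewrite unitmxE unitfE gt_eqF.
rewrite det_bordered_mx// pmulr_lgt0//.
pose v := m *m invmx S; have mE : m = v *m S by rewrite mulmxKV.
have -> : (m *m invmx S *m m^T) 0 0 = qform S v.
  by rewrite -/v {1}mE trmx_mul (proj1 S_bounded) mulmxA.
have /andP[lower _] := proj2 S_bounded v; apply: lt_le_trans lower.
rewrite mulr_gt0// lt0r dotp_ge0 andbT; apply: contra_neq m0 => v0.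
by rewrite mE (@dotp_le0_eq0 _ _ v) ?v0// mul0mx.
Qed.

End QuadraticForms.

(** * Gaussian lattice sums *)

Section GaussIntegerSums.
Import gauss_integral_proof.
Variable R : realType.
Implicit Types h s x y : R.
Local Notation g := (@gauss_fun R).
Local Notation Phi := (@integral0_gauss R).
Local Notation mu := (@lebesgue_measure R).

Lemma le_gauss_fun x y : 0 <= x -> x <= y -> g y <= g x.
Proof.
move=> x0 xy; rewrite ler_expR lerN2 lerXn2r ?nnegrE//.
exact: le_trans xy.
Qed.

Lemma integrable_gauss_itv (a b : R) : mu.-integrable `[a, b] (EFin \o g).
Proof. exact: (@integrableS _ _ _ mu setT) (integrableT_gauss). Qed.

Lemma integral0_gauss_MVT x y : 0 <= x -> x <= y ->
  g y * (y - x) <= Phi y - Phi x <= g x * (y - x).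
Proof.
move=> x0 xy.
have y0 : 0 <= y by exact: le_trans xy.
have derPhi z : z \in `]x, y[%R -> is_derive z 1 Phi (g z).
  rewrite in_itv /= => /andP[xz zy].
  have [||||] := @continuous_FTC1_closed R g 0 z (z + 1).
  - by rewrite ltrDl.
  - exact: integrable_gauss_itv.
  - exact: le_lt_trans xz.
  - exact: continuous_gauss_fun.
  move=> d1 d2; apply: (DeriveDef d1).
  by rewrite -derive1E d2.
have ctsPhi : {within `[x, y], continuous Phi}.
  apply: (@continuous_subspaceW _ _ _ `[0, y]).
    by move=> z /=; rewrite !in_itv /= => /andP[xz ->]; rewrite (le_trans x0).
  apply: parameterized_integral_continuous => //.
  exact: integrable_gauss_itv.
have [c] := MVT_segment xy derPhi ctsPhi.
rewrite in_itv /= => /andP[xc cy] ->.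
by rewrite !ler_wpM2r ?subr_ge0// le_gauss_fun// (le_trans x0).
Qed.

Lemma cvg_integral0_gauss : Phi x @[x --> +oo] --> Num.sqrt pi / 2.
Proof.
have : Num.sqrt (Phi x ^+ 2) @[x --> +oo] --> Num.sqrt (pi / 4 : R).
  by apply: continuous_cvg; [exact: sqrt_continuous|exact: cvg_integral0_gauss_sqr].
rewrite sqrtrM ?pi_ge0// sqrtrV// (_ : 4 = 2 ^+ 2); last by rewrite expr2 -natrM.
rewrite sqrtr_sqr ger0_norm//.
rewrite (_ : (fun _ => Num.sqrt _) = integral0_gauss)//.
by apply/funext => r; rewrite sqrtr_sqr// ger0_norm// integral0_gauss_ge0.
Qed.

Lemma le_integral0_gauss x y : 0 <= x -> x <= y -> Phi x <= Phi y.
Proof.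
move=> x0 xy; have /andP[slope_ge _] := integral0_gauss_MVT x0 xy.
by rewrite -subr_ge0; apply: le_trans slope_ge; rewrite mulr_ge0 ?gauss_fun_ge0// subr_ge0.
Qed.

Lemma integral0_gauss_le x : 0 <= x -> Phi x <= Num.sqrt pi / 2.
Proof.
move=> x0; rewrite -(cvg_lim (@Rhausdorff R) cvg_integral0_gauss).
apply: limr_ge; first by apply/cvg_ex; eexists; exact: cvg_integral0_gauss.
near=> z; apply: le_integral0_gauss => //; near: z; exact: nbhs_pinfty_ge.
Unshelve. all: by end_near. Qed.

Lemma integral0_gauss0 : Phi 0 = 0.
Proof. by rewrite /integral0_gauss set_itv1 Rintegral_set1. Qed.

Lemma gauss_nat_partial_sum_bounds h y n : 0 < h -> 0 <= y -> y <= h ->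
  Phi (h *+ n) - h <= h * \sum_(k < n) g (y + h *+ k) <= Num.sqrt pi / 2 + h.
Proof.
move=> h0 y0 yh.
have hn k : 0 <= y + h *+ k by rewrite addr_ge0// mulrn_wge0// ltW.
have step k : h * g (y + h *+ k.+1) <= Phi (y + h *+ k.+1) - Phi (y + h *+ k) <=
    h * g (y + h *+ k).
  have := @integral0_gauss_MVT (y + h *+ k) (y + h *+ k.+1) (hn k).
  rewrite lerD2l ler_pMn2l// leqnSn => /(_ isT).
  have -> : y + h *+ k.+1 - (y + h *+ k) = h by rewrite mulrS; ring.
  by rewrite !(mulrC h).
have lower m : Phi (y + h *+ m) - Phi y <= h * \sum_(k < m) g (y + h *+ k).
  elim: m => [|m IH]; first by rewrite mulr0n addr0 big_ord0 mulr0 subrr.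
  by rewrite big_ord_recr /= mulrDr; have /andP[_] := step m; lra.
have upper m : h * \sum_(k < m.+1) g (y + h *+ k) <= h + (Phi (y + h *+ m) - Phi y).
  elim: m => [|m IH].
    rewrite mulr0n addr0 big_ord_recr big_ord0 /= add0r mulr0n addr0 subrr addr0.
    by rewrite ger_pMr// gauss_fun_le1.
  by rewrite big_ord_recr /= mulrDr; have /andP[+ _] := step m; lra.
have Py : Phi y <= h.
  have /andP[_ ] := integral0_gauss_MVT (lexx 0) y0.
  rewrite integral0_gauss0 !subr0 => /le_trans; apply.
  by apply: le_trans yh; rewrite ler_piMl// gauss_fun_le1.
have Py0 : 0 <= Phi y := integral0_gauss_ge0 y.
apply/andP; split.
  have := lower n; have : Phi (h *+ n) <= Phi (y + h *+ n); last lra.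
  by apply: le_integral0_gauss; rewrite ?mulrn_wge0 ?lerDr// ltW.
case: n => [|n].
  by rewrite big_ord0 mulr0 addr_ge0 ?divr_ge0 ?sqrtr_ge0// ltW.
have := upper n; have := integral0_gauss_le (hn n); lra.
Qed.

Lemma gauss_nat_sum_bounds h y : 0 < h -> 0 <= y -> y <= h ->
  ((Num.sqrt pi / 2 - h)%:E <= (\esum_(k in [set: nat]) (h * g (y + h *+ k))%:E)
     <= (Num.sqrt pi / 2 + h)%:E)%E.
Proof.
move=> h0 y0 yh.
have g0 k : 0 <= h * g (y + h *+ k) by rewrite mulr_ge0 ?gauss_fun_ge0 ?ltW.
have upper : ((\esum_(k in [set: nat]) (h * g (y + h *+ k))%:E)
     <= (Num.sqrt pi / 2 + h)%:E)%E.
  apply: esum_nat_le => n; first by rewrite lee_fin.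
  rewrite sumEFin lee_fin -mulr_sumr.
  by have /andP[] := gauss_nat_partial_sum_bounds n h0 y0 yh.
rewrite upper andbT.
have sum_fin : \esum_(k in [set: nat]) (h * g (y + h *+ k))%:E \is a fin_num.
  rewrite ge0_fin_numE; first by apply: le_lt_trans upper _; exact: ltry.
  by apply: esum_ge0 => k _; rewrite lee_fin.
rewrite -(fineK sum_fin) lee_fin lerBlDr; set v := fine _.
have le_v z : 0 <= z -> Phi z <= v + h.
  move=> z0; pose n := (Num.truncn (z / h)).+1.
  have zn : z <= h *+ n.
    rewrite -mulr_natl -ler_pdivrMr//; apply/ltW; exact: truncnS_gt.
  apply: (le_trans (le_integral0_gauss z0 zn)).
  have /andP[+ _] := gauss_nat_partial_sum_bounds n h0 y0 yh.
  rewrite lerBlDr => /le_trans; apply; rewrite lerD2r mulr_sumr.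
  rewrite -lee_fin /v fineK// -sumEFin.
  by apply: esum_nat_ge => k; rewrite lee_fin.
rewrite -(cvg_lim (@Rhausdorff R) cvg_integral0_gauss).
apply: limr_le; first by apply/cvg_ex; eexists; exact: cvg_integral0_gauss.
near=> z; apply: le_v; near: z; exact: nbhs_pinfty_ge.
Unshelve. all: by end_near. Qed.

Lemma gauss_int_sum_bounds h s : 0 < h ->
  ((Num.sqrt pi - 2 * h)%:E <= (\esum_(k in [set: int]) (h * g (h * k%:~R + s))%:E)
     <= (Num.sqrt pi + 2 * h)%:E)%E.
Proof.
move=> h0.
pose j := Num.floor (s / h); pose s0 := s - h * j%:~R.
have floor_bounds : j%:~R <= s / h < (j + 1)%:~R.
  by rewrite floor_le floorD1_gt.
have s00 : 0 <= s0.
  by move/andP: floor_bounds => [+ _]; rewrite ler_pdivlMr// /s0 subr_ge0 mulrC.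
have s0h : s0 <= h.
  move/andP: floor_bounds => [_]; rewrite ltr_pdivrMr// intrD mulrDl mul1r => /ltW.
  by rewrite /s0 lerBlDl [h * _]mulrC.
rewrite (esum_addr (- j)) esum_int; last first.
  by move=> k; rewrite lee_fin mulr_ge0 ?gauss_fun_ge0 ?ltW.
have -> : \esum_(n in [set: nat]) (h * g (h * (Posz n - j)%:~R + s))%:E =
    \esum_(n in [set: nat]) (h * g (s0 + h *+ n))%:E.
  apply: eq_esum => n _; congr (_ * g _)%:E.
  by rewrite /s0 intrB -mulr_natr pmulrn; ring.
have -> : \esum_(n in [set: nat]) (h * g (h * (Negz n - j)%:~R + s))%:E =
    \esum_(n in [set: nat]) (h * g (h - s0 + h *+ n))%:E.
  apply: eq_esum => n _; congr (_ * _)%:E.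
  rewrite /gauss_fun -[in RHS]sqrrN; congr (expR (- _ ^+ 2)).
  by rewrite /s0 intrB NegzE -mulr_natr mulrNz -pmulrn -natr1; ring.
have /andP[l1 u1] := gauss_nat_sum_bounds h0 s00 s0h.
have /andP[l2 u2] : ((Num.sqrt pi / 2 - h)%:E <=
    (\esum_(k in [set: nat]) (h * g (h - s0 + h *+ k))%:E)
     <= (Num.sqrt pi / 2 + h)%:E)%E by apply: gauss_nat_sum_bounds => //; lra.
have -> : Num.sqrt pi - 2 * h = (Num.sqrt pi / 2 - h) + (Num.sqrt pi / 2 - h) by lra.
have -> : Num.sqrt pi + 2 * h = (Num.sqrt pi / 2 + h) + (Num.sqrt pi / 2 + h) by lra.
by rewrite !EFinD; apply/andP; split; apply: leeD.
Qed.

Lemma gauss_int_sum_bounds_scaled (a h s : R) : 0 < a -> 0 < h ->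
  ((Num.sqrt (2 * pi) / Num.sqrt a - 2 * h)%:E <=
   (\esum_(k in [set: int]) (h * expR (- (a * (h * k%:~R + s) ^+ 2) / 2))%:E)
     <= (Num.sqrt (2 * pi) / Num.sqrt a + 2 * h)%:E)%E.
Proof.
move=> a0 h0; pose b : R := Num.sqrt (a / 2).
have a2 : 0 < a / 2 by rewrite divr_gt0.
have b0 : 0 < b by rewrite sqrtr_gt0.
have b2 : b ^+ 2 = a / 2 by rewrite sqr_sqrtr// ltW.
have sqrtE : Num.sqrt (2 * pi) / Num.sqrt a = Num.sqrt pi / b.
  rewrite /b !sqrtrM ?sqrtrV// ?ltW// invfM invrK; ring.
have -> : (\esum_(k in [set: int]) (h * expR (- (a * (h * k%:~R + s) ^+ 2) / 2))%:E =
   (b^-1)%:E * \esum_(k in [set: int]) ((h * b) * g ((h * b) * k%:~R + s * b))%:E)%E.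
  rewrite -esumZl ?lee_fin ?invr_ge0 ?ltW//; last first.
    by move=> k; rewrite lee_fin !mulr_ge0 ?gauss_fun_ge0 ?ltW.
  apply: eq_esum => k _; rewrite -EFinM; congr EFin.
  rewrite [RHS]mulrA [X in _ = X * _]mulrC mulfK ?gt_eqF//; congr (_ * expR _).
  have -> : h * b * k%:~R + s * b = b * (h * k%:~R + s) by ring.
  by rewrite exprMn b2; lra.
have hb0 : 0 < h * b by rewrite mulr_gt0.
have /andP[l u] := gauss_int_sum_bounds (s * b) hb0.
have bi : (0 <= (b^-1)%:E)%E by rewrite lee_fin invr_ge0 ltW.
have := lee_wpmul2l bi l; have := lee_wpmul2l bi u.
rewrite -!EFinM sqrtE mulrBr mulrDr.
have -> : b^-1 * (2 * (h * b)) = 2 * h by field; rewrite gt_eqF.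
by rewrite [b^-1 * Num.sqrt pi]mulrC => -> ->.
Qed.

End GaussIntegerSums.
Section GaussLatticeSums.
Variable R : realType.

Lemma esum_row_mx d (a : 'rV[int]_(1 + d) -> \bar R) : (forall x, (0 <= a x)%E) ->
  \esum_(x in setT) a x =
  \esum_(w in [set: 'rV[int]_d]) \esum_(t in [set: int]) a (row_mx t%:M w).
Proof.
move=> a0; rewrite (@reindex_esum_bij R _ _ (fun z : 'rV[int]_d * int => row_mx z.2%:M z.1)).
  by rewrite esum_prod.
exists (fun x => (rsubmx x, lsubmx x 0 0)) => [[w t] | x] /=.
  by rewrite row_mxKr row_mxKl mxE.
rewrite -[RHS]hsubmxK; congr row_mx.
by apply/matrixP => i j; rewrite !ord1 mxE.
Qed.

Definition gauss_term d (A : 'M[R]_d) (h : R) (k : 'rV[int]_d) : R :=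
  h ^+ d * expR (- qform A (h *: toR R k) / 2).

Lemma gauss_term_ge0 d (A : 'M[R]_d) h k : 0 <= h -> 0 <= gauss_term A h k.
Proof. by move=> h0; rewrite mulr_ge0 ?expR_ge0// exprn_ge0. Qed.

(* The factor (2 pi)^(d/2) / sqrt (det A) is the Gaussian integral of exp(- qform A / 2). *)
Definition gauss_const d (A : 'M[R]_d) : R := Num.sqrt (2 * pi) ^+ d / Num.sqrt (\det A).

Lemma gauss_const_ge0 d (A : 'M[R]_d) : 0 <= gauss_const A.
Proof. by rewrite divr_ge0 ?exprn_ge0 ?sqrtr_ge0. Qed.

Lemma gauss_const_schur d (A : 'M[R]_(1 + d)) : A^T = A -> 0 < A 0 0 ->
  gauss_const A = gauss_const (schur A) * (Num.sqrt (2 * pi) / Num.sqrt (A 0 0)).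
Proof.
move=> A_sym A0; rewrite /gauss_const det_schur ?gt_eqF//.
rewrite [Num.sqrt (A 0 0 * _)]sqrtrM ?(ltW A0)// invfM.
by rewrite [_ ^+ (1 + d)]exprS; ring.
Qed.

Lemma gauss_const_le d (a b : R) (A : 'M[R]_d) : 0 < a -> qform_bounded a b A ->
  gauss_const A <= (Num.sqrt (2 * pi) / Num.sqrt a) ^+ d.
Proof.
move=> a0; elim: d A => [A _|d IH].
  by rewrite /gauss_const det_mx00 !expr0 sqrtr1 divr1.
rewrite -[d.+1]/(1 + d)%N => A A_bounded.
have [a_le schur_bounded] := qform_bounded_schur a0 A_bounded.
have A0 : 0 < A 0 0 by exact: lt_le_trans a_le.
rewrite gauss_const_schur ?(proj1 A_bounded)// exprS mulrC.
rewrite ler_pM ?gauss_const_ge0 ?divr_ge0 ?sqrtr_ge0 ?IH//.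
by rewrite ler_wpM2l ?sqrtr_ge0// lef_pV2 ?posrE ?sqrtr_gt0// ler_wsqrtr.
Qed.

Section SchurSlices.
Variables (d : nat) (A : 'M[R]_(1 + d)) (h : R).
Hypotheses (A_sym : A^T = A) (A_gt0 : 0 < A 0 0) (h_gt0 : 0 < h).
Let r := Num.sqrt (2 * pi) / Num.sqrt (A 0 0).

Lemma gauss_term_schur t w :
  gauss_term A h (row_mx t%:M w) = gauss_term (schur A) h w *
    (h * expR (- (A 0 0 * (h * t%:~R + h * (dotp (ursubmx A) (toR R w) / A 0 0)) ^+ 2) / 2)).
Proof.
rewrite /gauss_term toR_row_mx !qformZ qform_schur ?gt_eqF//.
have -> : h ^+ (1 + d) = h ^+ d * h by rewrite addnC exprD expr1.
rewrite mulrACA -expRD; congr (_ * expR _).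
by rewrite -mulrDr exprMn; lra.
Qed.

(* Completing the square, each line parallel to the first axis carries a shifted
   one-dimensional Gaussian sum. *)
Lemma gauss_lattice_sum_slices (S : R) :
  (\esum_(w in setT) (gauss_term (schur A) h w)%:E = S%:E)%E ->
  ((S * (r - 2 * h))%:E <= \esum_(k in setT) (gauss_term A h k)%:E <=
   (S * (r + 2 * h))%:E)%E.
Proof.
move=> sumS; have term0 w : (0 <= (gauss_term (schur A) h w)%:E)%E.
  by rewrite lee_fin gauss_term_ge0// ltW.
have S0 : 0 <= S by rewrite -lee_fin -sumS esum_ge0.
have slicesE : \esum_(k in setT) (gauss_term A h k)%:E =
   \esum_(w in setT) ((gauss_term (schur A) h w)%:E * \esum_(t in [set: int])
     (h * expR (- (A 0 0 * (h * t%:~R + h * (dotp (ursubmx A) (toR R w) / A 0 0)) ^+ 2) / 2))%:E)%E.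
  rewrite esum_row_mx; last by move=> x; rewrite lee_fin gauss_term_ge0// ltW.
  apply: eq_esum => w _; rewrite -esumZl//; last first.
    by move=> t; rewrite lee_fin mulr_ge0 ?expR_ge0// ltW.
  by apply: eq_esum => t _; rewrite gauss_term_schur.
apply/andP; split; last first.
  rewrite slicesE EFinM -sumS -esumZr//; last first.
    by rewrite lee_fin addr_ge0 ?mulr_ge0 ?divr_ge0 ?sqrtr_ge0// ltW.
  apply: le_esum => w _; apply: lee_wpmul2l => //.
  by have /andP[_] := gauss_int_sum_bounds_scaled
    (h * (dotp (ursubmx A) (toR R w) / A 0 0)) A_gt0 h_gt0.
have [rh|rh] := leP 0 (r - 2 * h); last first.
  apply: (@le_trans _ _ 0%E); first by rewrite lee_fin mulr_ge0_le0// ltW.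
  by apply: esum_ge0 => k _; rewrite lee_fin gauss_term_ge0// ltW.
rewrite slicesE EFinM -sumS -esumZr//.
apply: le_esum => w _; apply: lee_wpmul2l => //.
by have /andP[] := gauss_int_sum_bounds_scaled
  (h * (dotp (ursubmx A) (toR R w) / A 0 0)) A_gt0 h_gt0.
Qed.

End SchurSlices.

Lemma gauss_lattice_sum d (a b : R) : 0 < a -> exists2 C : R, 0 <= C &
  forall (A : 'M[R]_d) h, qform_bounded a b A -> 0 < h <= 1 -> exists2 S : R,
    (\esum_(k in setT) (gauss_term A h k)%:E = S%:E)%E & `|S - gauss_const A| <= C * h.
Proof.
move=> a0; elim: d => [|d [C C0 IH]].
  exists 1 => // A h _ /andP[h0 _].
  exists 1; last by rewrite /gauss_const det_mx00 sqrtr1 divr1 subrr normr0 mul1r ltW.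
  have -> : [set: 'rV[int]_0] = [set 0].
    by apply/seteqP; split => // x _ /=; apply/matrixP => i [].
  rewrite esum_set1 ?lee_fin ?gauss_term_ge0 ?ltW//.
  by rewrite /gauss_term expr0 mul1r /qform mxE big_ord0 oppr0 mul0r expR0.
pose r0 := Num.sqrt (2 * pi) / Num.sqrt a; pose J0 := r0 ^+ d.
have r00 : 0 <= r0 by rewrite divr_ge0 ?sqrtr_ge0.
have J00 : 0 <= J0 by rewrite exprn_ge0.
exists (C * r0 + 2 * (J0 + C)); first by rewrite addr_ge0 ?mulr_ge0 ?addr_ge0.
rewrite -[d.+1]/(1 + d)%N => A h A_bounded h01; have /andP[h0 h1] := h01.
have [a_le schur_bounded] := qform_bounded_schur a0 A_bounded.
have A0 : 0 < A 0 0 by exact: lt_le_trans a_le.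
have [S sumS S_close] := IH _ _ schur_bounded h01.
have /andP[] := gauss_lattice_sum_slices (proj1 A_bounded) A0 h0 sumS.
set V := (\esum_(k in setT) _)%E; set r := _ / _ => lower upper.
have V_fin : V \is a fin_num.
  rewrite ge0_fin_numE; first by apply: le_lt_trans upper _; exact: ltry.
  by apply: esum_ge0 => k _; rewrite lee_fin gauss_term_ge0// ltW.
exists (fine V); first by rewrite fineK.
move: lower upper; rewrite -(fineK V_fin) !lee_fin => lower upper.
rewrite gauss_const_schur ?(proj1 A_bounded)// -/r; set J := gauss_const (schur A) in S_close *.
have Sr : `|(S - J) * r| <= C * h * r0.
  rewrite normrM ler_pM// ger0_norm ?divr_ge0 ?sqrtr_ge0//.
  by rewrite ler_wpM2l ?sqrtr_ge0// lef_pV2 ?posrE ?sqrtr_gt0// ler_wsqrtr.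
have S_le : S <= J0 + C.
  have Ch : C * h <= C by rewrite ler_piMr.
  have := gauss_const_le a0 schur_bounded; rewrite -/J -/r0 -/J0.
  by move: S_close; rewrite ler_norml => /andP[_]; lra.
have Sh : S * (2 * h) <= 2 * (J0 + C) * h by rewrite mulrCA -mulrA ler_pM2l// ler_pM2r.
by move: Sr; rewrite !ler_norml => /andP[Srl Sru]; apply/andP; split; lra.
Qed.

End GaussLatticeSums.

(** * Fourier analysis on the integer lattice *)

Section ComplexModulus.
Variable R : realType.
Local Open Scope complex_scope.
Implicit Types (z w : R[i]) (t : R).

Lemma normc_ge0 z : 0 <= normc z.
Proof. by case: z => a b; exact: sqrtr_ge0. Qed.

Lemma normcX z n : normc (z ^+ n) = normc z ^+ n.
Proof. by elim: n => [|n IH]; [exact: normc1 | rewrite !exprS normcM IH]. Qed.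

Lemma normcD_le z w : normc (z + w) <= normc z + normc w.
Proof. exact: le_normcD. Qed.

Lemma distcC z w : normc (z - w) = normc (w - z).
Proof. by rewrite -(normcN (z - w)) opprB. Qed.

Lemma normc_real t : normc t%:C = `|t|.
Proof. by rewrite /normc /= expr0n addr0 sqrtr_sqr. Qed.

Lemma normc_sum_le (I : Type) (r : seq I) (P : pred I) (F : I -> R[i]) :
  normc (\sum_(i <- r | P i) F i) <= \sum_(i <- r | P i) normc (F i).
Proof.
elim/big_rec2: _ => [|i y1 y2 _ IH]; first by rewrite normc0.
by apply: (le_trans (normcD_le _ _)); rewrite lerD2l.
Qed.

Lemma sqr_normc z : normc z ^+ 2 = Re z ^+ 2 + Im z ^+ 2.
Proof. by case: z => a b; rewrite /normc sqr_sqrtr// addr_ge0 ?sqr_ge0. Qed.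

Lemma norm_Re_le_normc z : `|Re z| <= normc z.
Proof.
by case: z => a b; rewrite /normc /= -sqrtr_sqr ler_wsqrtr// lerDl sqr_ge0.
Qed.

Lemma normc_le_ReIm z : normc z <= `|Re z| + `|Im z|.
Proof.
rewrite {1}(complexE z); apply: (le_trans (normcD_le _ _)).
by rewrite normcM !normc_real /normc /= expr0n add0r expr1n sqrtr1 mul1r.
Qed.

Lemma normc_exprB_le z w n c : normc z <= c -> normc w <= c ->
  normc (z ^+ n - w ^+ n) <= n%:R * c ^+ n.-1 * normc (z - w).
Proof.
move=> zc wc; rewrite subrXX normcM mulrC ler_wpM2r ?normc_ge0//.
apply: (le_trans (normc_sum_le _ _ _)).
rewrite -[n in n%:R]card_ord -sum1_card natr_sum mulr_suml; apply: ler_sum => i _.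
rewrite mul1r normcM !normcX.
have -> : n.-1 = (n.-1 - i + i)%N by rewrite subnK// -ltnS (ltn_predK (ltn_ord i)).
rewrite exprD; apply: ler_pM; rewrite ?exprn_ge0 ?normc_ge0//;
  rewrite ?lerXn2r ?nnegrE ?normc_ge0 ?(le_trans (normc_ge0 z))//.
by rewrite subnK// ?lerXn2r ?nnegrE ?normc_ge0 ?(le_trans (normc_ge0 z))//
   -ltnS (ltn_predK (ltn_ord i)).
Qed.

Definition cis t : R[i] := cos t +i* sin t.

Lemma cisD t u : cis (t + u) = cis t * cis u.
Proof. by rewrite /cis cosD sinD [X in _ +i* X]addrC. Qed.

Lemma cis0 : cis 0 = 1.
Proof. by rewrite /cis cos0 sin0. Qed.

Lemma cis_sum (I : Type) (r : seq I) (P : pred I) (F : I -> R) :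
  cis (\sum_(i <- r | P i) F i) = \prod_(i <- r | P i) cis (F i).
Proof. by elim/big_rec2: _ => [|i y1 y2 _ <-]; rewrite ?cis0// cisD. Qed.

Lemma cisMn t n : cis (t *+ n) = cis t ^+ n.
Proof.
by elim: n => [|n IH]; rewrite ?mulr0n ?cis0// mulrS cisD IH exprS.
Qed.

Lemma cis_int2pi (a : int) : cis (pi *+ 2 *~ a) = 1.
Proof.
case: a => n; first by rewrite -pmulrn cisMn /cis cos2pi sin2pi expr1n.
rewrite NegzE mulrNz -pmulrn /cis cosN sinN.
have := cisMn (pi *+ 2) n.+1; rewrite /cis cos2pi sin2pi.
by rewrite (_ : 1 +i* 0 = 1)// expr1n => -[-> ->]; rewrite oppr0.
Qed.

Lemma normc_cis t : normc (cis t) = 1.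
Proof. by rewrite /cis /normc cos2Dsin2 sqrtr1. Qed.

Lemma normc_cisB1_le t : normc (cis t - 1) <= 2 * `|t|.
Proof.
apply: (le_trans (normc_le_ReIm _)); rewrite /cis /= subr0.
have sin_le := norm_sin_le t.
have : `|cos t - 1| <= `|t|; last lra.
rewrite distrC ger0_norm ?oneBcos_ge0// oneBcosE.
have half_le : `|sin (t / 2)| <= `|t| / 2.
  by apply: (le_trans (norm_sin_le _)); rewrite normrM [`|2^-1|]ger0_norm.
have half_le1 : `|sin (t / 2)| <= 1 := sin_max _.
rewrite -[sin _ ^+ 2]real_normK ?num_real//.
have := normr_ge0 (sin (t / 2)); nra.
Qed.

Lemma cis_neq1 t : 0 < `|t| -> `|t| < 2 * pi -> cis t != 1.
Proof.
move=> t0 tpi; apply/eqP => -[cos1 _].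
have : 1 - cos `|t| = 0.
  by case: (leP 0 t) => t_sgn; rewrite ?(ger0_norm t_sgn) ?(ltr0_norm t_sgn) ?cosN cos1 subrr.
rewrite oneBcosE => /eqP; rewrite mulf_eq0 pnatr_eq0 /= sqrf_eq0 => /eqP sin_half.
have := @sin_gt0_pi R (`|t| / 2); rewrite sin_half ltxx => absurd.
by have : false by apply: absurd; apply/andP; split; lra.
Qed.

End ComplexModulus.

Section Fourier.
Variables (R : realType) (d : nat).
Local Open Scope complex_scope.
Local Notation X := 'rV[int]_d.
Implicit Types (F h : X -> R) (th : 'rV[R]_d) (x y : X).
Local Notation ang th x := (dotp th (toR R x)).
Local Notation grid_idx n := {ffun 'I_d -> 'I_(n.*2)}.

Definition fourier F th : R[i] :=
  sumR (fun x => F x * cos (ang th x)) +i* sumR (fun x => F x * sin (ang th x)).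

Lemma rsummable_cos F th : rsummable F -> rsummable (fun x => F x * cos (ang th x)).
Proof. by move=> sF; apply: rsummable_mulr => // x; exact: cos_max. Qed.

Lemma rsummable_sin F th : rsummable F -> rsummable (fun x => F x * sin (ang th x)).
Proof. by move=> sF; apply: rsummable_mulr => // x; exact: sin_max. Qed.

Lemma fourier_rconv F h th : (forall x, 0 <= F x) -> (forall x, 0 <= h x) ->
  rsummable F -> rsummable h -> fourier (rconv F h) th = fourier F th * fourier h th.
Proof.
move=> F0 h0 sF sh.
have sFc := rsummable_cos th sF; have sFs := rsummable_sin th sF.
have shc := rsummable_cos th sh; have shs := rsummable_sin th sh.
rewrite /fourier (@sumR_rconv_mul R X F h F0 h0 sF sh (fun x => cos (ang th x)) 1); last first.
  by move=> x; exact: cos_max.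
rewrite (@sumR_rconv_mul R X F h F0 h0 sF sh (fun x => sin (ang th x)) 1); last first.
  by move=> x; exact: sin_max.
set c := sumR (fun x => h x * cos _); set s := sumR (fun x => h x * sin _).
have cosE y : F y * sumR (fun z => h z * cos (ang th (y + z))) =
    c * (F y * cos (ang th y)) - s * (F y * sin (ang th y)).
  have -> : sumR (fun z => h z * cos (ang th (y + z))) =
      cos (ang th y) * c - sin (ang th y) * s.
    rewrite -!sumRZ -sumRB; [|exact: rsummableZ..].
    by apply: eq_sumR => z; rewrite toRD dotpDr cosD; ring.
  by ring.
have sinE y : F y * sumR (fun z => h z * sin (ang th (y + z))) =
    c * (F y * sin (ang th y)) + s * (F y * cos (ang th y)).
  have -> : sumR (fun z => h z * sin (ang th (y + z))) =
      sin (ang th y) * c + cos (ang th y) * s.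
    rewrite -!sumRZ -sumRD; [|exact: rsummableZ..].
    by apply: eq_sumR => z; rewrite toRD dotpDr sinD; ring.
  by ring.
rewrite (eq_sumR cosE) (eq_sumR sinE) sumRB; [|exact: rsummableZ..].
rewrite sumRD; [|exact: rsummableZ..].
by rewrite !sumRZ; apply/eqP; rewrite eq_complex /=; apply/andP; split; apply/eqP; ring.
Qed.

Lemma fourier_sum (I : Type) (r : seq I) (P : pred I) (c : I -> R) (F : I -> X -> R) th :
  (forall i, P i -> rsummable (F i)) ->
  fourier (fun x => \sum_(i <- r | P i) c i * F i x) th =
  \sum_(i <- r | P i) (c i)%:C * fourier (F i) th.
Proof.
move=> sF.
have exchange (g : X -> R) : (forall x, `|g x| <= 1) ->
    sumR (fun x => (\sum_(i <- r | P i) c i * F i x) * g x) =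
    \sum_(i <- r | P i) c i * sumR (fun x => F i x * g x).
  move=> g1; rewrite (eq_sumR (g := fun x => \sum_(i <- r | P i) c i * (F i x * g x))).
    rewrite sumR_sum => [|i Pi]; first by apply: eq_bigr => i _; rewrite sumRZ.
    by apply/rsummableZ/(rsummable_mulr (c := 1)) => //; exact: sF.
  by move=> x; rewrite mulr_suml; apply: eq_bigr => i _; rewrite mulrA.
rewrite /fourier !exchange; try by move=> x; rewrite (cos_max, sin_max).
elim/big_rec3: _ => //= i [a b] y1 y2 _ [-> ->].
by apply/eqP; rewrite eq_complex /= !mul0r subr0 addr0 !eqxx.
Qed.

Lemma normc_fourier_le F th : (forall x, 0 <= F x) -> rsummable F ->
  normc (fourier F th) <= 2 * sumR F.
Proof.
move=> F0 sF; apply: (le_trans (normc_le_ReIm _)); rewrite /fourier /=.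
have bound (g : X -> R) : (forall x, `|g x| <= 1) -> `|sumR (fun x => F x * g x)| <= sumR F.
  by move=> g1; apply: le_norm_sumR => // x; rewrite normrM ger0_norm// ler_piMr.
have := bound _ (fun x => cos_max (ang th x)); have := bound _ (fun x => sin_max (ang th x)).
lra.
Qed.

Definition zgrid n (k : grid_idx n) : X := \row_j ((k j)%:Z - n%:Z).

Definition grid n k : 'rV[R]_d := (pi / n%:R) *: toR R (@zgrid n k).

Lemma zgrid_inj n : injective (@zgrid n).
Proof.
move=> k1 k2 /rowP k12; apply/ffunP => j; apply/val_inj.
by have := k12 j; rewrite !mxE => /addIr [].
Qed.

Lemma notin_zgrid n x : x \notin range (@zgrid n) ->
  exists j, n%:R <= `|(x 0 j)%:~R| :> R.
Proof.
move=> xn; apply: contrapT => all_lt; move/negP: xn; apply; rewrite inE.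
have x_lt j : `|x 0 j| < n%:Z.
  rewrite -(ltr_int R) intr_norm -pmulrn ltNge; apply/negP => n_le.
  by apply: all_lt; exists j.
have shift_lt j : (absz (x 0%R j + n%:Z)%R < n.*2)%N.
  by have := x_lt j; rewrite -addnn; case: (x 0 j) => m; lia.
exists [ffun j => Ordinal (shift_lt j)] => //.
apply/rowP => j; rewrite !mxE ffunE /= abszE ger0_norm ?addrK//.
by have := x_lt j; case: (x 0 j) => m; lia.
Qed.

Lemma norm_grid_le_pi n (k : grid_idx n) : `|grid k| <= pi.
Proof.
apply: norm_rV_le => [|j]; first exact: pi_ge0.
have n0 : (0 < n)%N by rewrite -double_gt0; exact: leq_ltn_trans (ltn_ord (k j)).
have np : 0 < n%:R :> R by rewrite ltr0n.
rewrite /grid !mxE normrM ger0_norm ?divr_ge0 ?pi_ge0//.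
rewrite -[leRHS]mulr1 -mulrA ler_pM2l ?pi_gt0// ler_pdivrMl// mulr1.
rewrite intrB -!pmulrn ler_norml.
have : ((k j)%:R <= (n.*2)%:R :> R) by rewrite ler_nat ltnW.
have : (0 <= (k j)%:R :> R) by [].
by have -> : (n.*2)%:R = n%:R + n%:R :> R; [rewrite -natrD addnn | lra].
Qed.

Lemma sum_cis_grid n (a : int) : (0 < n)%N ->
  \sum_(k < n.*2) cis (pi / n%:R * (k%:Z - n%:Z)%:~R * a%:~R : R) =
  if cis (pi / n%:R * a%:~R : R) == 1 then (n.*2)%:R else 0.
Proof.
move=> n0; have np : 0 < n%:R :> R by rewrite ltr0n.
pose z := cis (pi / n%:R * a%:~R : R).
have z_n : z ^+ n = cis (pi * a%:~R).
  by rewrite /z -cisMn; congr cis; rewrite -mulr_natr; field; rewrite gt_eqF.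
have z_2n : z ^+ n.*2 = 1.
  rewrite -addnn exprD z_n -cisD -(cis_int2pi R a); congr cis.
  by rewrite -mulrzr; lra.
have -> : \sum_(k < n.*2) cis (pi / n%:R * (k%:Z - n%:Z)%:~R * a%:~R : R) =
    cis (- (pi * a%:~R)) * \sum_(k < n.*2) z ^+ k.
  rewrite mulr_sumr; apply: eq_bigr => k _; rewrite /z -cisMn -cisD; congr cis.
  by rewrite intrB -!pmulrn -mulr_natr; field; rewrite gt_eqF.
rewrite -/z; have [z1|z1] := eqVneq z 1.
  have -> : cis (- (pi * a%:~R)) = 1 :> R[i].
    have : cis (- (pi * a%:~R)) * z ^+ n = 1 by rewrite z_n -cisD addNr cis0.
    by rewrite z1 expr1n mulr1.
  rewrite z1 mul1r; under eq_bigr do rewrite expr1n.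
  by rewrite sumr_const card_ord.
have : (z - 1) * \sum_(k < n.*2) z ^+ k = 0 by rewrite -subrX1 z_2n subrr.
by move/eqP; rewrite mulf_eq0 subr_eq0 (negPf z1) /= => /eqP ->; rewrite mulr0.
Qed.

Definition grid_kernel n (y : X) : R :=
  (\sum_(k : grid_idx n) cos (ang (grid k) y)) / (n.*2)%:R ^+ d.

Lemma grid_kernel_prod n y : (0 < n)%N -> grid_kernel n y =
  Re (\prod_(j < d) \sum_(k < n.*2) cis (pi / n%:R * (k%:Z - n%:Z)%:~R * (y 0 j)%:~R : R))
   / (n.*2)%:R ^+ d.
Proof.
move=> n0; rewrite /grid_kernel; congr (_ / _).
rewrite bigA_distr_bigA /=.
have Re_sum (I : finType) (G : I -> R[i]) : Re (\sum_i G i) = \sum_i Re (G i).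
  by elim/big_rec2: _ => //= i y1 y2 _ <-; case: (G i); case: y2.
rewrite Re_sum; apply: eq_bigr => k _; rewrite -cis_sum /cis /=; congr cos.
by rewrite /dotp; apply: eq_bigr => j _; rewrite !mxE.
Qed.

Lemma grid_kernel01 n y : (0 < n)%N -> grid_kernel n y = 0 \/ grid_kernel n y = 1.
Proof.
move=> n0; rewrite grid_kernel_prod//.
have N0 : (n.*2)%:R ^+ d != 0 :> R by rewrite expf_neq0// pnatr_eq0 double_eq0 -lt0n.
have [all1|] := boolP [forall j : 'I_d, cis (pi / n%:R * (y 0 j)%:~R : R) == 1].
  right; rewrite (eq_bigr (fun=> (n.*2)%:R)); last first.
    by move=> j _; rewrite sum_cis_grid// (forallP all1 j).
  rewrite prodr_const card_ord.
  have -> : (n.*2)%:R ^+ d = ((n.*2)%:R ^+ d)%:C :> R[i] by rewrite rmorphXn rmorph_nat.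
  by rewrite /= divff.
rewrite negb_forall => /existsP[j yj]; left.
by rewrite (bigD1 j)//= sum_cis_grid// (negPf yj) mul0r /= mul0r.
Qed.

Lemma norm_grid_kernel_le1 n y : (0 < n)%N -> `|grid_kernel n y| <= 1.
Proof. by move=> n0; have [->|->] := grid_kernel01 y n0; rewrite ?normr1 ?normr0. Qed.

Lemma grid_kernel_0 n : (0 < n)%N -> grid_kernel n 0 = 1.
Proof.
move=> n0; rewrite /grid_kernel (eq_bigr (fun=> 1)); last first.
  by move=> k _; rewrite toR0 dotp0r cos0.
rewrite sumr_const card_ffun !card_ord natrX divff//.
by rewrite expf_neq0// pnatr_eq0 double_eq0 -lt0n.
Qed.

Lemma grid_kernel_eq0 n y : (0 < n)%N -> y != 0 -> (forall j, `|y 0 j| < (n.*2)%:Z) ->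
  grid_kernel n y = 0.
Proof.
move=> n0 y0 y_lt; rewrite grid_kernel_prod//.
have np : 0 < n%:R :> R by rewrite ltr0n.
have /rV0Pn[j yj] := y0.
rewrite (bigD1 j)//= sum_cis_grid// ifN; first by rewrite mul0r /= mul0r.
have norm_angle : `|pi / n%:R * (y 0 j)%:~R| = pi / n%:R * `|y 0 j|%:~R :> R.
  by rewrite normrM ger0_norm ?divr_ge0 ?pi_ge0// intr_norm.
have pn : 0 < pi / n%:R :> R by rewrite divr_gt0 ?pi_gt0.
apply: cis_neq1; rewrite norm_angle; first by rewrite mulr_gt0// ltr0z normr_gt0.
apply: (@lt_le_trans _ _ (pi / n%:R * (n.*2)%:R)).
  by rewrite ltr_pM2l// -[(n.*2)%:R]/((n.*2)%:Z%:~R) ltr_int.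
rewrite -addnn natrD le_eqVlt; apply/orP; left; apply/eqP.
by field; rewrite gt_eqF.
Qed.

Definition inverse_dft n F x : R := (\sum_(k : grid_idx n)
  Re (fourier F (grid k) * cis (- ang (grid k) x))) / (n.*2)%:R ^+ d.

Lemma inverse_dftE n F x : rsummable F ->
  inverse_dft n F x = sumR (fun y => F y * grid_kernel n (y - x)).
Proof.
move=> sF; rewrite /inverse_dft.
rewrite (eq_sumR (g := fun y => ((n.*2)%:R ^+ d)^-1 *
   \sum_(k : grid_idx n) F y * cos (ang (grid k) (y - x)))); last first.
  by move=> y; rewrite /grid_kernel -mulr_sumr; ring.
rewrite sumRZ mulrC; congr (_ * _); rewrite sumR_sum; last first.
  by move=> k _; apply: rsummable_mulr => // y; exact: cos_max.
apply: eq_bigr => k _; rewrite /fourier /cis /= cosN sinN mulrN opprK.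
rewrite mulrC [X in _ + X]mulrC -!sumRZ.
rewrite -sumRD; [|exact/rsummableZ/rsummable_cos|exact/rsummableZ/rsummable_sin].
by apply: eq_sumR => y; rewrite toRD toRN dotpDr dotpNr cosB; ring.
Qed.

Lemma inverse_dft_ge n F x : (0 < n)%N -> (forall y, 0 <= F y) -> rsummable F ->
  F x <= inverse_dft n F x.
Proof.
move=> n0 F0 sF; rewrite inverse_dftE//.
have := @sumR_ge_term R _ (fun y => F y * grid_kernel n (y - x)) x.
rewrite subrr grid_kernel_0// mulr1; apply.
  by move=> y; have [->|->] := grid_kernel01 (y - x) n0; rewrite ?mulr0 ?mulr1.
by apply: rsummable_mulr => // y; exact: norm_grid_kernel_le1.
Qed.

End Fourier.

Section InversionLimit.
Variable R : realType.

Lemma sumR_tail_small (T : choiceType) (F : T -> R) eps : (forall y, 0 <= F y) ->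
  rsummable F -> 0 < eps -> exists s : seq T, sumR (fun y => F y * (y \notin s)%:R) <= eps.
Proof.
move=> F0 sF eps0.
have : ((sumR F - eps)%:E < \esum_(y in setT) (F y)%:E)%E.
  by rewrite -(ge0_sumRE F0 sF) lte_fin ltrBlDr ltrDl.
move=> /ereal_sup_gt[_ [A [finA _] <-]] /ltW sumA.
pose s : seq T := finmap.enum_fset (fset_set A); exists s.
have mem_s y : (y \in s) = (y \in A) by exact: in_fset_set.
have summable_ind (b : T -> bool) : rsummable (fun y => F y * (b y)%:R).
  by apply: (rsummable_mulr (c := 1)) => // y; case: (b y); rewrite ?normr1 ?normr0.
have split_s : sumR F = sumR (fun y => F y * (y \notin s)%:R) + sumR (fun y => F y * (y \in s)%:R).
  rewrite -sumRD//; apply: eq_sumR => y; case: (y \in s); by rewrite mulr0 mulr1 (add0r, addr0).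
suff : sumR F - eps <= sumR (fun y => F y * (y \in s)%:R) by rewrite split_s; lra.
rewrite -lee_fin ge0_sumRE//; last by move=> y; rewrite mulr_ge0.
apply: (le_trans sumA); apply: esum_ge; exists A => //.
apply: lee_fsum => // y Ay; rewrite lee_fin mem_s.
by rewrite (_ : y \in A = true) ?mulr1//; apply/mem_set.
Qed.

Lemma inverse_dft_cvg d (F : 'rV[int]_d -> R) x eps : (forall y, 0 <= F y) ->
  rsummable F -> 0 < eps ->
  exists n0 : nat, forall n, (n0 <= n)%N -> (0 < n)%N -> `|F x - inverse_dft n F x| <= eps.
Proof.
move=> F0 sF eps0; have [s tail_s] := sumR_tail_small F0 sF eps0.
pose n0 := (\sum_(y <- s) \sum_(j < d) absz ((y - x)%R 0%R j))%N.
exists n0.+1 => n n0n n_gt0; have dft_ge := inverse_dft_ge x n_gt0 F0 sF.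
rewrite distrC ger0_norm ?subr_ge0// lerBlDl; apply: le_trans (lerD (lexx _) tail_s).
pose at_x y := (y == x)%:R * F x.
have esum_at_x : \esum_(y in setT) (at_x y)%:E = (F x)%:E.
  rewrite (@esum_single _ _ _ x) /at_x ?eqxx ?mul1r ?lee_fin// => y /negPf ->.
  by rewrite mul0r.
have at_x0 y : 0 <= at_x y by rewrite mulr_ge0.
have summable_at_x : rsummable at_x by rewrite rsummable_esum// esum_at_x ltry.
have <- : sumR at_x = F x by rewrite ge0_sumR// esum_at_x.
have summable_tail : rsummable (fun y => F y * (y \notin s)%:R).
  by apply: (rsummable_mulr (c := 1)) => // y; case: (_ \notin _); rewrite ?normr1 ?normr0.
rewrite inverse_dftE// -sumRD//; apply: le_sumR.
- by apply: rsummable_mulr => // y; exact: norm_grid_kernel_le1.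
- exact: rsummableD.
move=> y; rewrite /at_x; have [->|yx] := eqVneq y x.
  by rewrite subrr grid_kernel_0// mul1r mulr1 lerDl mulr_ge0.
rewrite mul0r add0r ler_wpM2l//.
have [ys|_] := boolP (y \in s) => /=; last first.
  by rewrite (le_trans (ler_norm _))// norm_grid_kernel_le1.
rewrite grid_kernel_eq0 ?subr_eq0// => j; rewrite -abszE ltz_nat.
apply: (@leq_ltn_trans n0); last by rewrite (leq_trans n0n)// -addnn leq_addr.
by rewrite /n0 (big_rem y)//= (bigD1 j)//= -addnA leq_addr.
Qed.

End InversionLimit.

Section LocalLimit.
Variables (R : realType) (d : nat).
Local Open Scope complex_scope.
Local Notation X := 'rV[int]_d.
Local Notation ang th x := (dotp th (toR R x)).
Local Notation grid_idx n := {ffun 'I_d -> 'I_(n.*2)}.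
Local Notation mesh n K := (pi / n%:R * Num.sqrt K).
Implicit Types (F : X -> R) (Q : 'M[R]_d) (K : R) (x : X).

Lemma mesh_gt0 n K : (0 < n)%N -> 0 < K -> 0 < mesh n K.
Proof. by move=> n0 K0; rewrite mulr_gt0 ?divr_gt0 ?pi_gt0 ?ltr0n ?sqrtr_gt0. Qed.

Lemma mesh_small K (eps : R) : 0 < eps -> exists2 n0 : nat, (0 < n0)%N &
  forall n, (n0 <= n)%N -> mesh n K <= eps.
Proof.
move=> e0; pose n0 := (Num.truncn (pi * Num.sqrt K / eps)).+1.
exists n0 => // n nn.
have np : 0 < n%:R :> R by rewrite ltr0n (leq_trans _ nn).
rewrite mulrAC ler_pdivrMr// [leRHS]mulrC -ler_pdivrMr//.
apply: (@le_trans _ _ n0%:R); last by rewrite ler_nat.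
by apply/ltW; exact: truncnS_gt.
Qed.

Definition grid_gauss n K Q : R :=
  (\sum_(k : grid_idx n) expR (- (K * qform Q (grid R k)) / 2)) / (n.*2)%:R ^+ d.

Lemma sum_gauss_term_zgrid n K Q : (0 < n)%N -> 0 <= K ->
  \sum_(k : grid_idx n) gauss_term Q (mesh n K) (zgrid k) =
  (2 * pi * Num.sqrt K) ^+ d * grid_gauss n K Q.
Proof.
move=> n0 K0; have np : 0 < n%:R :> R by rewrite ltr0n.
have termE (k : grid_idx n) : gauss_term Q (mesh n K) (zgrid k) =
    mesh n K ^+ d * expR (- (K * qform Q (grid R k)) / 2).
  rewrite /gauss_term; congr (_ * expR _).
  by rewrite /grid !qformZ exprMn sqr_sqrtr//; ring.
under eq_bigr do rewrite termE.
rewrite -mulr_sumr /grid_gauss [RHS]mulrCA [LHS]mulrC; congr (_ * _).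
rewrite -exprVn -exprMn; congr (_ ^+ _).
by rewrite -mul2n natrM; field; rewrite gt_eqF.
Qed.

Lemma esum_zgrid n (G : X -> R) : (forall x, 0 <= G x) ->
  (\esum_(x in setT) (G x)%:E =
   (\sum_(k : grid_idx n) G (zgrid k))%:E +
   \esum_(x in ~` range (@zgrid d n)) (G x)%:E)%E.
Proof.
move=> G0; rewrite (esumID (range (@zgrid d n))) ?setTI; last first.
  by move=> *; rewrite lee_fin.
congr (_ + _)%E; rewrite -sumEFin -esum_finType; last by move=> *; rewrite lee_fin.
by rewrite esum_image// => k1 k2 _ _; exact: zgrid_inj.
Qed.

Lemma grid_gauss_le (a b : R) : 0 < a -> exists2 C : R, 0 <= C & forall Q K n,
  qform_bounded a b Q -> 0 < K -> (0 < n)%N -> mesh n K <= 1 ->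
  grid_gauss n K Q <= C / Num.sqrt K ^+ d.
Proof.
move=> a0; have [C C0 sum_close] := @gauss_lattice_sum R d a b a0.
pose J := (Num.sqrt (2 * pi) / Num.sqrt a) ^+ d.
have J0 : 0 <= J by rewrite exprn_ge0// divr_ge0 ?sqrtr_ge0.
exists (J + C) => [|Q K n Q_bounded K0 n0 h1]; first by rewrite addr_ge0.
have h0 := mesh_gt0 n0 K0; have sK : 0 < Num.sqrt K by rewrite sqrtr_gt0.
have term0 x : 0 <= gauss_term Q (mesh n K) x by rewrite gauss_term_ge0// ltW.
have [|S sumS S_close] := sum_close Q (mesh n K) Q_bounded; first by rewrite h0.
have grid_le : (2 * pi * Num.sqrt K) ^+ d * grid_gauss n K Q <= S.
  rewrite -sum_gauss_term_zgrid ?(ltW K0)// -lee_fin -sumS (esum_zgrid n)// leeDl//.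
  by apply: esum_ge0 => x _; rewrite lee_fin.
have S_le : S <= J + C.
  have : C * mesh n K <= C by rewrite ler_piMr.
  have := gauss_const_le a0 Q_bounded; rewrite -/J.
  by move: S_close; rewrite ler_norml => /andP[_]; lra.
rewrite ler_pdivlMr ?exprn_gt0// mulrC; apply: le_trans (le_trans grid_le S_le).
rewrite exprMn -mulrA ler_peMl ?exprn_ege1//; last by have := @pi_ge2 R; lra.
by rewrite mulr_ge0 ?exprn_ge0 ?sqrtr_ge0// divr_ge0 ?sumr_ge0 ?exprn_ge0.
Qed.

Lemma inverse_dft_gauss_close F Q K (a M q : R) n x : 0 <= M ->
  (forall th, `|th| <= pi ->
     normc (fourier F th * cis (- ang th x) - (a * expR (- (K * qform Q th) / 2))%:C) <=
     M * expR (- (q * dotp th th))) ->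
  `|inverse_dft n F x - a * grid_gauss n K Q| <= M * grid_gauss n q 2%:M.
Proof.
move=> M0 F_close; rewrite /inverse_dft /grid_gauss !mulrA -mulrBl !mulr_sumr -sumrB normrM.
rewrite [`|_^-1|]ger0_norm ?invr_ge0 ?exprn_ge0// ler_wpM2r ?invr_ge0 ?exprn_ge0//.
apply: (le_trans (ler_norm_sum _ _ _)); apply: ler_sum => k _.
have -> : - (q * qform 2%:M (grid R k)) / 2 = - (q * dotp (grid R k) (grid R k)).
  by rewrite qform_scalar_mx; field.
apply: le_trans (F_close _ (norm_grid_le_pi R k)).
apply: le_trans (norm_Re_le_normc _); rewrite le_eqVlt; apply/orP; left; apply/eqP.
by congr `|_|; case: (_ * cis _).
Qed.

Lemma le_of_fourier_gauss_bound : exists2 C : R, 0 <= C &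
  forall F (M q : R), (forall x, 0 <= F x) -> rsummable F -> 0 <= M -> 0 < q ->
  (forall th, `|th| <= pi -> normc (fourier F th) <= M * expR (- (q * dotp th th))) ->
  forall x, F x <= C * M / Num.sqrt q ^+ d.
Proof.
have [C C0 gauss_le] := @grid_gauss_le 2 2 (ltr0n _ 2).
exists C => // F M q F0 sF M0 q0 F_le x.
have [n n0 mesh_le] := mesh_small q (ltr01 : 0 < 1 :> R).
have := @inverse_dft_gauss_close F 0 0 0 M q n x M0.
rewrite mul0r subr0 => dft_le; apply: (le_trans (inverse_dft_ge x n0 F0 sF)).
apply: (le_trans (ler_norm _)); apply: (le_trans (dft_le _)) => [th th_pi|].
  by rewrite mul0r subr0 normcM normc_cis mulr1 F_le.
rewrite mulrAC mulrC; apply: ler_wpM2r => //; apply: gauss_le => //.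
- exact: qform_bounded_scalar_mx.
- exact: mesh_le.
Qed.

Lemma gauss_term_off_grid (a b : R) Q K n x : 0 < a -> qform_bounded a b Q ->
  0 < K -> (0 < n)%N -> x \notin range (@zgrid d n) ->
  gauss_term Q (mesh n K) x <=
  expR (- (K * a / 4)) * gauss_term ((a / 2)%:M : 'M[R]_d) (mesh n K) x.
Proof.
move=> a0 Q_bounded K0 n0 /(notin_zgrid R)[j xj].
have np : 0 < n%:R :> R by rewrite ltr0n.
rewrite /gauss_term mulrCA ler_pM2l ?exprn_gt0 ?mesh_gt0// -expRD ler_expR.
have /andP[qf_ge _] := proj2 Q_bounded (mesh n K *: toR R x).
have K_le : K <= dotp (mesh n K *: toR R x) (mesh n K *: toR R x).
  rewrite dotpZl dotpZr mulrA -expr2 exprMn sqr_sqrtr ?(ltW K0)// mulrAC ler_peMl ?(ltW K0)//.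
  have pn : 2 <= pi / n%:R * `|(x 0 j)%:~R| :> R.
    by rewrite mulrAC ler_pdivlMr//; apply: ler_pM => //; exact: pi_ge2.
  apply: (@le_trans _ _ ((pi / n%:R * `|(x 0 j)%:~R|) ^+ 2)).
    by rewrite -[leLHS](expr1n _ 2) lerXn2r ?nnegrE//; lra.
  rewrite exprMn ler_wpM2l ?sqr_ge0// real_normK ?num_real//.
  rewrite /dotp (bigD1 j)//= !mxE -expr2 lerDl.
  by apply: sumr_ge0 => i _; rewrite -expr2 sqr_ge0.
rewrite qform_scalar_mx; move: qf_ge K_le; set D := dotp _ _ => qf_ge K_le.
have : a * K <= a * D by rewrite ler_pM2l.
lra.
Qed.

Lemma grid_gauss_cvg (a b : R) : 0 < a -> exists2 C : R, 0 <= C & forall Q K n,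
  qform_bounded a b Q -> 1 <= K -> (0 < n)%N -> mesh n K <= 1 ->
  `|(2 * pi * Num.sqrt K) ^+ d * grid_gauss n K Q - gauss_const Q| <=
  C * (mesh n K + (Num.sqrt K)^-1).
Proof.
move=> a0; have a2 : 0 < a / 2 by rewrite divr_gt0.
have [C C0 sum_close] := @gauss_lattice_sum R d a b a0.
have [C' C'0 half_close] := @gauss_lattice_sum R d (a / 2) (a / 2) a2.
pose J := gauss_const ((a / 2)%:M : 'M[R]_d); pose E := (J + C') * (4 / a).
have JC0 : 0 <= J + C' by rewrite addr_ge0 ?gauss_const_ge0.
have E0 : 0 <= E by rewrite mulr_ge0// divr_ge0// ltW.
exists (C + E) => [|Q K n Q_bounded K1 n0 h1]; first by rewrite addr_ge0.
have K0 : 0 < K by exact: lt_le_trans K1.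
have sK0 : 0 < Num.sqrt K by rewrite sqrtr_gt0.
set h := mesh n K in h1 *; have h0 : 0 < h := mesh_gt0 n0 K0.
have h01 : 0 < h <= 1 by rewrite h0.
have term0 (A : 'M[R]_d) z : 0 <= gauss_term A h z by rewrite gauss_term_ge0// ltW.
have [S sumS S_close] := sum_close Q h Q_bounded h01.
have [S' sumS' S'_close] := half_close _ h (qform_bounded_scalar_mx d (a / 2)) h01.
rewrite -sum_gauss_term_zgrid ?(ltW K0)// -/h; set G := \sum_(k : _) _.
have SE : (S%:E = G%:E + \esum_(x in ~` range (@zgrid d n)) (gauss_term Q h x)%:E)%E.
  by rewrite -sumS (esum_zgrid n).
have S_ge : G <= S.
  by rewrite -lee_fin SE leeDl// esum_ge0// => z _; rewrite lee_fin.
have S_le : S - G <= expR (- (K * a / 4)) * S'.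
  rewrite lerBlDl -lee_fin SE EFinD leeD2l// EFinM -sumS'.
  rewrite -esumZl ?lee_fin ?expR_ge0//; last by move=> z; rewrite lee_fin.
  rewrite esum_mkcond; apply: le_esum => z _; rewrite in_setC.
  case: ifPn => [zn|_]; last by rewrite -EFinM lee_fin mulr_ge0 ?expR_ge0.
  by rewrite -EFinM lee_fin; apply: gauss_term_off_grid Q_bounded _ _ _.
have exp_le : expR (- (K * a / 4)) <= 4 / a / Num.sqrt K.
  have a4 : 0 < a / 4 by rewrite divr_gt0.
  have -> : K * a / 4 = a / 4 * K by ring.
  by rewrite -[4 / a]invf_div; exact: expRN_le_invsqrt.
have S'0 : 0 <= S' by rewrite -lee_fin -sumS' esum_ge0// => z _; rewrite lee_fin.
have S'_le : S' <= J + C'.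
  move: S'_close; rewrite ler_norml -/J => /andP[_].
  by have : C' * h <= C' by [rewrite ler_piMr]; lra.
have off_le : S - G <= E / Num.sqrt K.
  rewrite (le_trans S_le)// /E -[leRHS]mulrA mulrC; apply: ler_pM => //; exact: expR_ge0.
have h_part : 0 <= E * h by rewrite mulr_ge0// ltW.
have s_part : 0 <= C / Num.sqrt K by rewrite divr_ge0// ltW.
move: S_close; rewrite mulrDl !mulrDr !ler_norml => /andP[Sl Su].
by apply/andP; split; lra.
Qed.

Lemma inverse_dft_limit (a b a' M : R) : 0 < a -> 0 < a' -> 0 <= M ->
  exists2 C : R, 0 <= C & forall F Q K c x n,
  qform_bounded a b Q -> 1 <= K -> `|c| <= M ->
  (0 < n)%N -> mesh n K <= 1 -> mesh n (K * a') <= 1 ->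
  (forall th, `|th| <= pi ->
     normc (fourier F th * cis (- ang th x) - (c * expR (- (K * qform Q th) / 2))%:C) <=
     M / Num.sqrt K * expR (- (K * a' * dotp th th))) ->
  `|Num.sqrt K ^+ d * inverse_dft n F x - c * (gauss_const Q / (2 * pi) ^+ d)| <=
  C * (mesh n K + (Num.sqrt K)^-1).
Proof.
move=> a0 a'0 M0.
have [C1 C10 gauss_le] := @grid_gauss_le 2 2 (ltr0n _ 2).
have [C2 C20 gauss_cvg] := @grid_gauss_cvg a b a0.
pose Ca := M * C1 / Num.sqrt a' ^+ d.
have Ca0 : 0 <= Ca by rewrite divr_ge0 ?mulr_ge0 ?exprn_ge0 ?sqrtr_ge0.
exists (Ca + M * C2) => [|F Q K c x n Q_bounded K1 cM n0 h1 h'1 F_close].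
  by rewrite addr_ge0 ?mulr_ge0.
have K0 : 0 < K by exact: lt_le_trans K1.
set s := Num.sqrt K; have s0 : 0 < s by rewrite sqrtr_gt0.
set e := grid_gauss n K Q; set P := (2 * pi) ^+ d : R.
have P1 : 1 <= P by rewrite exprn_ege1//; have := @pi_ge2 R; lra.
have fourier_error : `|s ^+ d * inverse_dft n F x - s ^+ d * (c * e)| <= Ca / s.
  rewrite -mulrBr normrM ger0_norm ?exprn_ge0 ?sqrtr_ge0//.
  have dft_gauss := @inverse_dft_gauss_close _ _ _ _ _ _ n _ (divr_ge0 M0 (ltW s0)) F_close.
  have gauss'_le := gauss_le _ (K * a') n (qform_bounded_scalar_mx d 2) (mulr_gt0 K0 a'0) n0 h'1.
  apply: (@le_trans _ _ (s ^+ d * (M / s * (C1 / Num.sqrt (K * a') ^+ d)))).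
    rewrite ler_wpM2l ?exprn_ge0 ?(ltW s0)// (le_trans dft_gauss)//.
    by rewrite ler_wpM2l// divr_ge0// ltW.
  rewrite le_eqVlt; apply/orP; left; apply/eqP; rewrite /Ca sqrtrM ?(ltW K0)// exprMn -/s.
  by field; rewrite !gt_eqF// ?exprn_gt0 ?sqrtr_gt0.
have riemann_error :
    `|s ^+ d * (c * e) - c * (gauss_const Q / P)| <= M * (C2 * (mesh n K + s^-1)).
  have -> : s ^+ d * (c * e) - c * (gauss_const Q / P) =
      c * (((2 * pi * s) ^+ d * e - gauss_const Q) / P).
    by rewrite [(2 * pi * s) ^+ d]exprMn -/P; field; rewrite gt_eqF//; lra.
  rewrite normrM; apply: ler_pM => //.
  rewrite normrM [`|P^-1|]ger0_norm ?invr_ge0; last lra.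
  apply: le_trans (gauss_cvg Q K n Q_bounded K1 n0 h1).
  by rewrite ler_piMr// invf_le1//; lra.
rewrite -(subrK (s ^+ d * (c * e)) (s ^+ d * inverse_dft n F x)) -addrA.
apply: (le_trans (ler_normD _ _)); rewrite mulrDl lerD//; last by rewrite -mulrA.
by rewrite (le_trans fourier_error)// ler_wpM2l// lerDr ltW// mesh_gt0.
Qed.

(* The mesh is refined with [K] fixed, so neither the aliasing of the discrete
   inversion formula nor the Riemann sum contributes to the error. *)
Lemma local_limit (a b a' M : R) : 0 < a -> 0 < a' -> 0 <= M ->
  exists2 C : R, 0 <= C & forall F Q K c x,
  (forall y, 0 <= F y) -> rsummable F -> qform_bounded a b Q -> 1 <= K -> `|c| <= M ->
  (forall th, `|th| <= pi ->
     normc (fourier F th * cis (- ang th x) - (c * expR (- (K * qform Q th) / 2))%:C) <=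
     M / Num.sqrt K * expR (- (K * a' * dotp th th))) ->
  `|Num.sqrt K ^+ d * F x - c * (gauss_const Q / (2 * pi) ^+ d)| <= C / Num.sqrt K.
Proof.
move=> a0 a'0 M0; have [C C0 dft_limit] := @inverse_dft_limit a b a' M a0 a'0 M0.
exists C => // F Q K c x F0 sF Q_bounded K1 cM F_close.
have s0 : 0 < Num.sqrt K by rewrite sqrtr_gt0 (lt_le_trans _ K1).
apply/ler_addgt0Pr => eta eta0.
have C1 : 0 < C + 1 by rewrite ltr_wpDl.
have [na dft_close] : exists n0 : nat, forall n, (n0 <= n)%N -> (0 < n)%N ->
    `|F x - inverse_dft n F x| <= eta / 2 / Num.sqrt K ^+ d.
  by apply: inverse_dft_cvg => //; rewrite !divr_gt0// exprn_gt0.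
have [nb _ mesh_le] : exists2 n0 : nat, (0 < n0)%N & forall n, (n0 <= n)%N ->
    mesh n K <= Num.min (eta / 2 / (C + 1)) 1.
  by apply: mesh_small; rewrite lt_min ltr01 andbT !divr_gt0.
have [nc nc0 mesh'_le] := mesh_small (K * a') (ltr01 : 0 < 1 :> R).
pose n := maxn na (maxn nb nc).
have [nan nbn ncn] : [/\ na <= n, nb <= n & nc <= n]%N.
  by split; rewrite /n !leq_max leqnn ?orbT.
have n0 : (0 < n)%N by exact: leq_trans ncn.
have /andP[h_eta h1] : (mesh n K <= eta / 2 / (C + 1)) && (mesh n K <= 1).
  by rewrite -le_min mesh_le.
have h0 : 0 < mesh n K by rewrite mesh_gt0// (lt_le_trans _ K1).
have Ch : C * mesh n K <= eta / 2.
  by move: h_eta; rewrite ler_pdivlMr// => h_eta; lra.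
have aliasing : `|Num.sqrt K ^+ d * F x - Num.sqrt K ^+ d * inverse_dft n F x| <= eta / 2.
  rewrite -mulrBr normrM ger0_norm ?exprn_ge0 ?(ltW s0)//.
  by rewrite mulrC -ler_pdivlMr ?exprn_gt0// dft_close.
have := dft_limit F Q K c x n Q_bounded K1 cM n0 h1 (mesh'_le n ncn) F_close.
move: aliasing; rewrite mulrDr !ler_norml => /andP[? ?] /andP[? ?].
by apply/andP; split; lra.
Qed.

End LocalLimit.

(** * Lattice measures with exponential moments *)

Section LatticeMeasures.
Variables (R : realType) (d : nat).
Local Open Scope complex_scope.
Local Notation X := 'rV[int]_d.
Local Notation ang th x := (dotp th (toR R x)).
Local Notation l1 := (@l1norm R d).
Implicit Types (xi : X -> R) (th v : 'rV[R]_d) (x y : X) (a b c eps : R).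

Definition exp_moment_le (del M : R) xi := [/\ forall x, 0 <= xi x,
  rsummable (fun x => expR (del * l1 x) * xi x) &
  sumR (fun x => expR (del * l1 x) * xi x) <= M].

Definition mean xi : 'rV[R]_d := \row_k sumR (fun x => (x 0 k)%:~R * xi x).

Definition second_moment xi : 'M[R]_d :=
  \matrix_(i, j) sumR (fun x => (x 0 i)%:~R * (x 0 j)%:~R * xi x).

Lemma second_moment_sym xi : (second_moment xi)^T = second_moment xi.
Proof.
by apply/matrixP => i j; rewrite !mxE; apply: eq_sumR => x; rewrite [_ * (x 0 i)%:~R]mulrC.
Qed.

Section ExpMoment.
Variables (del M : R) (xi : X -> R).
Hypotheses (del_gt0 : 0 < del) (xi_moment : exp_moment_le del M xi).

Lemma exp_moment_ge0 x : 0 <= xi x.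
Proof. by case: xi_moment. Qed.

Lemma exp_moment_bound_ge0 : 0 <= M.
Proof.
case: xi_moment => xi0 _; apply: le_trans; apply: sumR_ge0 => x.
by rewrite mulr_ge0 ?expR_ge0.
Qed.

Section Dominated.
Variables (f : X -> R) (c : R).
Hypotheses (c_ge0 : 0 <= c) (f_le : forall x, `|f x| <= c * expR (del * l1 x)).

Let dominated x : `|f x * xi x| <= c * (expR (del * l1 x) * xi x).
Proof. by rewrite normrM (ger0_norm (exp_moment_ge0 x)) mulrA ler_wpM2r// exp_moment_ge0. Qed.

Lemma exp_moment_rsummable_mul : rsummable (fun x => f x * xi x).
Proof. by case: xi_moment => _ s _; exact: rsummable_le dominated (rsummableZ _ s). Qed.

Lemma exp_moment_sumR_mul_le : `|sumR (fun x => f x * xi x)| <= c * M.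
Proof.
case: xi_moment => _ s sM; apply: (le_trans (le_norm_sumR (rsummableZ _ s) dominated)).
by rewrite sumRZ ler_wpM2l.
Qed.

End Dominated.

Section PolynomiallyBounded.
Variables (n : nat) (f : X -> R) (c : R).
Hypotheses (c_ge0 : 0 <= c) (f_le : forall x, `|f x| <= c * l1 x ^+ n).

Let bound_ge0 : 0 <= c * (n%:R / del) ^+ n.
Proof. by rewrite mulr_ge0// exprn_ge0// divr_ge0// ltW. Qed.

Let f_le_exp x : `|f x| <= c * (n%:R / del) ^+ n * expR (del * l1 x).
Proof.
apply: (le_trans (f_le x)); rewrite -mulrA ler_wpM2l//.
by apply: exprn_le_expR => //; exact: l1norm_ge0.
Qed.

Lemma exp_moment_rsummable_poly : rsummable (fun x => f x * xi x).
Proof. exact: exp_moment_rsummable_mul f_le_exp. Qed.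

Lemma exp_moment_sumR_poly_le :
  `|sumR (fun x => f x * xi x)| <= c * (n%:R / del) ^+ n * M.
Proof. exact: exp_moment_sumR_mul_le bound_ge0 f_le_exp. Qed.

End PolynomiallyBounded.

Lemma exp_moment_rsummable : rsummable xi.
Proof.
have := @exp_moment_rsummable_poly 0 (fun=> 1) 1 ler01.
under eq_fun do rewrite mul1r; apply => x.
by rewrite normr1 expr0 mulr1.
Qed.

Lemma exp_moment_sumR_le : sumR xi <= M.
Proof.
have one_le x : `|1 : R| <= 1 * l1 x ^+ 0 by rewrite normr1 expr0 mulr1.
have := exp_moment_sumR_poly_le ler01 one_le.
by under eq_sumR do rewrite mul1r; rewrite expr0 !mul1r => /(le_trans (ler_norm _)).
Qed.

Let norm_angX_le n v x : `|ang v x ^+ n| <= enorm v ^+ n * l1 x ^+ n.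
Proof.
rewrite normrX -exprMn lerXn2r ?nnegrE ?mulr_ge0 ?enorm_ge0 ?l1norm_ge0//.
exact: norm_dotp_le_enorm_l1norm.
Qed.

Let enormX_ge0 n v : 0 <= enorm v ^+ n.
Proof. by rewrite exprn_ge0 ?enorm_ge0. Qed.

Lemma rsummable_angX n v : rsummable (fun x => ang v x ^+ n * xi x).
Proof. exact: exp_moment_rsummable_poly (enormX_ge0 n v) (norm_angX_le n v). Qed.

Lemma norm_sumR_angX_le n v :
  `|sumR (fun x => ang v x ^+ n * xi x)| <= enorm v ^+ n * (n%:R / del) ^+ n * M.
Proof. exact: exp_moment_sumR_poly_le (enormX_ge0 n v) (norm_angX_le n v). Qed.

Lemma dotp_mean v : dotp v (mean xi) = sumR (fun x => ang v x * xi x).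
Proof.
rewrite (eq_sumR (g := fun x => \sum_k v 0 k * ((x 0 k)%:~R * xi x))); last first.
  by move=> x; rewrite /dotp mulr_suml; apply: eq_bigr => k _; rewrite mxE mulrA.
rewrite sumR_sum; first by apply: eq_bigr => k _; rewrite sumRZ mxE.
move=> k _; apply: rsummableZ; apply: (exp_moment_rsummable_poly (n := 1) ler01) => x.
by rewrite mul1r expr1 norm_coord_le_l1norm.
Qed.

Lemma qform_second_moment v :
  qform (second_moment xi) v = sumR (fun x => ang v x ^+ 2 * xi x).
Proof.
have s2 i j : rsummable (fun x => (x 0 i)%:~R * (x 0 j)%:~R * xi x).
  apply: (exp_moment_rsummable_poly (n := 2) ler01) => x.
  by rewrite mul1r normrM expr2 ler_pM ?norm_coord_le_l1norm.
rewrite (eq_sumR (g := fun x => \sum_j \sum_i v 0 i * v 0 j *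
    ((x 0 i)%:~R * (x 0 j)%:~R * xi x))); last first.
  move=> x; rewrite expr2 {2}/dotp mulr_sumr mulr_suml; apply: eq_bigr => j _.
  rewrite /dotp !mulr_suml; apply: eq_bigr => i _; rewrite !mxE; ring.
rewrite sumR_sum; last by move=> j _; apply: rsummable_sum => i _; exact: rsummableZ.
rewrite /qform mxE; apply: eq_bigr => j _.
rewrite sumR_sum; last by move=> i _; exact: rsummableZ.
rewrite !mxE mulr_suml; apply: eq_bigr => i _; rewrite sumRZ !mxE; ring.
Qed.

Lemma norm_dotp_mean_le v : `|dotp v (mean xi)| <= enorm v / del * M.
Proof.
by have := norm_sumR_angX_le 1 v; rewrite !expr1 mul1r dotp_mean; under eq_sumR do rewrite expr1.
Qed.

Lemma qform_second_moment_bounds v :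
  0 <= qform (second_moment xi) v <= enorm v ^+ 2 * (2 / del) ^+ 2 * M.
Proof.
rewrite qform_second_moment (le_trans (ler_norm _) (norm_sumR_angX_le 2 v)) andbT.
by apply: sumR_ge0 => x; rewrite mulr_ge0 ?sqr_ge0 ?exp_moment_ge0.
Qed.

Lemma fourier_taylor2 th :
  normc (fourier xi th -
    ((sumR xi - qform (second_moment xi) th / 2) +i* dotp th (mean xi))) <=
  2 * (3 / del) ^+ 3 * M * enorm th ^+ 3.
Proof.
have s := exp_moment_rsummable; have s1 := rsummable_angX 1 th.
have s2 := rsummableZ 2^-1 (rsummable_angX 2 th).
have sc := rsummable_cos th s; have ss := rsummable_sin th s.
have norm_ang3 x : `|ang th x| ^+ 3 <= enorm th ^+ 3 * l1 x ^+ 3.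
  by rewrite -normrX norm_angX_le.
have ReE : sumR (fun x => xi x * cos (ang th x)) -
    (sumR xi - qform (second_moment xi) th / 2) =
    sumR (fun x => (cos (ang th x) - 1 + ang th x ^+ 2 / 2) * xi x).
  rewrite qform_second_moment mulrC -sumRZ opprB addrCA -sumRB// addrC -sumRD//.
    by apply: eq_sumR => x; ring.
  exact: rsummableB.
have ImE : sumR (fun x => xi x * sin (ang th x)) - dotp th (mean xi) =
    sumR (fun x => (sin (ang th x) - ang th x) * xi x).
  by rewrite dotp_mean -sumRB//; apply: eq_sumR => x; ring.
apply: (le_trans (normc_le_ReIm _)); rewrite /fourier /= ReE ImE.
have Re_le := exp_moment_sumR_poly_le (enormX_ge0 3 th)
  (fun x => le_trans (norm_cos_taylor2_le (ang th x)) (norm_ang3 x)).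
have sin_le x : `|sin (ang th x) - ang th x| <= enorm th ^+ 3 * l1 x ^+ 3.
  apply: (le_trans (norm_sinBid_le_cube _)); apply: le_trans (norm_ang3 x).
  by have : 0 <= `|ang th x| ^+ 3 by []; lra.
have Im_le := exp_moment_sumR_poly_le (enormX_ge0 3 th) sin_le.
lra.
Qed.

Lemma fourier_lipschitz0 th :
  normc (fourier xi th - (sumR xi)%:C) <= 3 / del * M * enorm th.
Proof.
have s := exp_moment_rsummable; have t0 := enorm_ge0 th.
have sc := rsummable_cos th s; have ss := rsummable_sin th s.
apply: (le_trans (normc_le_ReIm _)); rewrite /fourier /= subr0.
have -> : sumR (fun x => xi x * cos (ang th x)) - sumR xi =
    sumR (fun x => (cos (ang th x) - 1) * xi x).
  by rewrite -sumRB//; apply: eq_sumR => x; ring.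
have -> : sumR (fun x => xi x * sin (ang th x)) = sumR (fun x => sin (ang th x) * xi x).
  by apply: eq_sumR => x; ring.
have cos_le x : `|cos (ang th x) - 1| <= 2 * enorm th * l1 x ^+ 1.
  have := norm_Re_le_normc (cis (ang th x) - 1); rewrite /= => /le_trans; apply.
  apply: (le_trans (normc_cisB1_le _)); rewrite expr1 -mulrA ler_pM2l//.
  exact: norm_dotp_le_enorm_l1norm.
have sin_le x : `|sin (ang th x)| <= enorm th * l1 x ^+ 1.
  by apply: (le_trans (norm_sin_le _)); rewrite expr1 norm_dotp_le_enorm_l1norm.
have := exp_moment_sumR_poly_le t0 sin_le.
have := exp_moment_sumR_poly_le (mulr_ge0 (ler0n _ 2) t0) cos_le.
rewrite !expr1; lra.
Qed.

End ExpMoment.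

Definition spread eps xi := eps <= xi 0 /\ forall k, eps <= xi (delta_mx 0 k).

Lemma normc_phase (z : R[i]) : exists a b,
  a ^+ 2 + b ^+ 2 = 1 /\ normc z = a * Re z + b * Im z.
Proof.
have sqr_z := sqr_normc z; have [z0|z0] := eqVneq (normc z) 0.
  have /eqP : Re z ^+ 2 = 0.
    by move: sqr_z; rewrite z0; have := sqr_ge0 (Re z); have := sqr_ge0 (Im z); lra.
  rewrite sqrf_eq0 => /eqP Re0.
  by exists 1, 0; rewrite expr1n expr0n /= z0 Re0 addr0 mul1r mul0r addr0.
exists (Re z / normc z), (Im z / normc z); split.
  by rewrite !exprMn -mulrDl -sqr_z exprVn divff// expf_neq0.
by apply: (mulIf z0); rewrite -expr2 sqr_z; field.
Qed.

Lemma phase_cos_sin_le1 a b t : a ^+ 2 + b ^+ 2 = 1 -> a * cos t + b * sin t <= 1.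
Proof.
by move=> ab; have := cos2Dsin2 t; have := sqr_ge0 (a - cos t);
   have := sqr_ge0 (b - sin t); nra.
Qed.

Lemma oneBcos_le_phase a b t : a ^+ 2 + b ^+ 2 = 1 ->
  1 - cos t <= 2 * (1 - a) + 2 * (1 - (a * cos t + b * sin t)).
Proof.
by move=> ab; have := cos2Dsin2 t; have := sqr_ge0 (1 - 2 * a + cos t);
   have := sqr_ge0 (2 * b - sin t); nra.
Qed.

Section SpreadMeasure.
Variables (xi : X -> R) (eps : R).
Hypotheses (xi_ge0 : forall x, 0 <= xi x) (xi_summable : rsummable xi).
Hypotheses (eps_ge0 : 0 <= eps) (xi_spread : spread eps xi).

(* Choosing the optimal phase (a, b) turns the deficit of the modulus into a sum of
   nonnegative terms, of which the atoms 0 and e_k already give the bound. *)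
Lemma normc_fourier_coord_deficit th k : `|th| <= pi ->
  normc (fourier xi th) + eps / 64 * th 0 k ^+ 2 <= sumR xi.
Proof.
move=> th_pi; have [a [b [ab fourierE]]] := normc_phase (fourier xi th).
pose f x := xi x * (1 - (a * cos (ang th x) + b * sin (ang th x))).
have f0 x : 0 <= f x by rewrite mulr_ge0// subr_ge0 phase_cos_sin_le1.
have sc := rsummable_cos th xi_summable; have ss := rsummable_sin th xi_summable.
have sab : rsummable (fun x => a * (xi x * cos (ang th x)) + b * (xi x * sin (ang th x))).
  by apply: rsummableD; exact: rsummableZ.
have fE x : f x = xi x - (a * (xi x * cos (ang th x)) + b * (xi x * sin (ang th x))).
  by rewrite /f; ring.
have sf : rsummable f by rewrite (funext fE); exact: rsummableB.
have deficitE : sumR xi - normc (fourier xi th) = sumR f.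
  rewrite (eq_sumR fE) sumRB// sumRD; [|exact: rsummableZ..].
  by rewrite !sumRZ fourierE.
have neq0 : 0 != delta_mx 0 k :> X by apply/eqP => /rowP/(_ k); rewrite !mxE !eqxx.
have := sumR_ge_two_terms f0 sf neq0; rewrite -deficitE /f toR0 dotp0r cos0 sin0 dotp_delta.
rewrite mulr1 mulr0 addr0; set t := th 0 k.
have [xi_0 xi_k] := (proj1 xi_spread, proj2 xi_spread k).
have a1 : a <= 1 by have := sqr_ge0 b; nra.
have t2_le : t ^+ 2 / 32 <= 1 - cos t.
  by apply: oneBcos_ge_sqr; exact: le_trans (norm_coord_le th k) th_pi.
have : eps * (1 - a) <= xi 0 * (1 - a) by rewrite ler_wpM2r// subr_ge0.
have : eps * (1 - (a * cos t + b * sin t)) <= xi (delta_mx 0 k) * (1 - (a * cos t + b * sin t)).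
  by rewrite ler_wpM2r// subr_ge0 phase_cos_sin_le1.
have : eps * (t ^+ 2 / 32) <= eps * (2 * (1 - a) + 2 * (1 - (a * cos t + b * sin t))).
  by rewrite ler_wpM2l// (le_trans t2_le)// oneBcos_le_phase.
lra.
Qed.

Lemma normc_fourier_deficit th : `|th| <= pi ->
  d%:R * normc (fourier xi th) + eps / 64 * dotp th th <= d%:R * sumR xi.
Proof.
move=> th_pi; set r := normc _.
have -> : d%:R * r + eps / 64 * dotp th th = \sum_(k < d) (r + eps / 64 * th 0 k ^+ 2).
  rewrite big_split /= sumr_const card_ord mulr_natl; congr (_ + _).
  by rewrite /dotp mulr_sumr; apply: eq_bigr => k _; rewrite expr2.
apply: (@le_trans _ _ (\sum_(k < d) sumR xi)).
  by apply: ler_sum => k _; exact: normc_fourier_coord_deficit.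
by rewrite sumr_const card_ord mulr_natl.
Qed.

Lemma normc_fourier_le_gauss (M : R) th : (0 < d)%N -> 0 < M -> sumR xi <= M ->
  `|th| <= pi ->
  normc (fourier xi th) <= sumR xi * expR (- (eps / (64 * d%:R * M) * dotp th th)).
Proof.
move=> d0 M0 xM th_pi; have dp : 0 < d%:R :> R by rewrite ltr0n.
have deficit := normc_fourier_deficit th_pi; have s0 := sumR_ge0 xi_ge0.
set q := eps / (64 * d%:R * M) * dotp th th.
have q0 : 0 <= q by rewrite mulr_ge0 ?dotp_ge0// divr_ge0// !mulr_ge0// ltW.
have qE : eps / 64 * dotp th th = d%:R * M * q by rewrite /q; field; rewrite !gt_eqF.
apply: (@le_trans _ _ (sumR xi * (1 - q))); last first.
  by rewrite ler_wpM2l// (le_trans _ (expR_ge1Dx _)).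
rewrite -(ler_pM2l dp) mulrBr mulr1 mulrBr.
have : d%:R * (sumR xi * q) <= d%:R * M * q by rewrite -mulrA ler_pM2l// ler_wpM2r.
lra.
Qed.

End SpreadMeasure.

End LatticeMeasures.

(** * Second order expansions of characteristic functions *)

Section Jets.
Variables (R : realType) (tau : R).
Local Open Scope complex_scope.
Hypothesis tau_ge0 : 0 <= tau.
Implicit Types (t c a b : R) (f g : R[i]).

Definition jet_poly a b : R[i] := (1 - b / 2) +i* a.

Definition jet t c f a b :=
  [/\ normc (f - jet_poly a b) <= c * t ^+ 3, `|a| <= c * t & `|b| <= c * t ^+ 2].

Lemma normc_jet_poly_le t c a b : 0 <= t <= tau -> 0 <= c ->
  `|a| <= c * t -> `|b| <= c * t ^+ 2 ->
  normc (jet_poly a b) <= 1 + c * tau + c * tau ^+ 2.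
Proof.
move=> /andP[t0 tt] c0 a_le b_le; apply: (le_trans (normc_le_ReIm _)) => /=.
have Re_le : `|1 - b / 2| <= 1 + `|b|.
  apply: (le_trans (ler_normB _ _)); rewrite normr1 normrM [`|2^-1|]ger0_norm//.
  by have := normr_ge0 b; lra.
have ct : c * t <= c * tau by rewrite ler_wpM2l.
have ct2 : c * t ^+ 2 <= c * tau ^+ 2 by rewrite ler_wpM2l// lerXn2r ?nnegrE.
lra.
Qed.

Lemma jet_polyM a1 b1 a2 b2 : jet_poly a1 b1 * jet_poly a2 b2 =
  jet_poly (a1 + a2) (b1 + b2 + 2 * a1 * a2) +
  ((b1 * b2 / 4) +i* (- (b1 * a2 + b2 * a1) / 2)).
Proof. by apply/eqP; rewrite eq_complex /=; apply/andP; split; apply/eqP; lra. Qed.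

Lemma jet_polyM_error_le t c1 c2 a1 b1 a2 b2 : 0 <= t <= tau -> 0 <= c1 -> 0 <= c2 ->
  `|a1| <= c1 * t -> `|b1| <= c1 * t ^+ 2 -> `|a2| <= c2 * t -> `|b2| <= c2 * t ^+ 2 ->
  normc ((b1 * b2 / 4) +i* (- (b1 * a2 + b2 * a1) / 2)) <= c1 * c2 * (tau + 2) * t ^+ 3.
Proof.
move=> /andP[t0 tt] c10 c20 a1_le b1_le a2_le b2_le.
apply: (le_trans (normc_le_ReIm _)) => /=.
have bb_le : `|b1 * b2| <= c1 * c2 * (tau * t ^+ 3).
  rewrite normrM (le_trans (ler_pM _ _ b1_le b2_le))//.
  have -> : c1 * t ^+ 2 * (c2 * t ^+ 2) = c1 * c2 * (t * t ^+ 3) by ring.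
  by rewrite ler_wpM2l ?mulr_ge0// ler_wpM2r ?exprn_ge0.
have ba_le : `|b1 * a2| <= c1 * c2 * t ^+ 3.
  rewrite normrM; have -> : c1 * c2 * t ^+ 3 = (c1 * t ^+ 2) * (c2 * t) by ring.
  exact: ler_pM.
have ab_le : `|b2 * a1| <= c1 * c2 * t ^+ 3.
  rewrite normrM; have -> : c1 * c2 * t ^+ 3 = (c2 * t ^+ 2) * (c1 * t) by ring.
  exact: ler_pM.
have Re_le : `|b1 * b2 / 4| <= `|b1 * b2|.
  by rewrite normrM [`|4^-1|]ger0_norm// ler_piMr// invf_le1//; lra.
have Im_le : `|- (b1 * a2 + b2 * a1) / 2| <= `|b1 * a2| + `|b2 * a1|.
  rewrite mulNr normrN normrM [`|2^-1|]ger0_norm//.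
  by have := ler_normD (b1 * a2) (b2 * a1); have := normr_ge0 (b1 * a2 + b2 * a1); lra.
lra.
Qed.

Lemma jet_mul c1 c2 : 0 <= c1 -> 0 <= c2 -> exists2 c, 0 <= c &
  forall t f g a1 b1 a2 b2, 0 <= t <= tau -> jet t c1 f a1 b1 -> jet t c2 g a2 b2 ->
  jet t c (f * g) (a1 + a2) (b1 + b2 + 2 * a1 * a2).
Proof.
move=> c10 c20; pose P c := 1 + c * tau + c * tau ^+ 2.
have P0 c : 0 <= c -> 0 <= P c by move=> c0; rewrite !addr_ge0// ?mulr_ge0 ?sqr_ge0.
pose E := c1 * (P c2 + c2 * tau ^+ 3) + P c1 * c2 + c1 * c2 * (tau + 2).
have E0 : 0 <= E by rewrite !addr_ge0// !mulr_ge0 ?addr_ge0 ?mulr_ge0 ?P0 ?exprn_ge0.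
pose L := c1 + c2 + 2 * c1 * c2; have L0 : 0 <= L by rewrite !addr_ge0 ?mulr_ge0.
exists (E + L) => [|t f g a1 b1 a2 b2 t_tau]; first exact: addr_ge0.
move=> [f_le a1_le b1_le] [g_le a2_le b2_le]; have /andP[t0 tt] := t_tau.
have g_norm : normc g <= P c2 + c2 * tau ^+ 3.
  have -> : g = jet_poly a2 b2 + (g - jet_poly a2 b2) by rewrite addrC subrK.
  apply: (le_trans (normcD_le _ _)); apply: lerD; first exact: normc_jet_poly_le t_tau _ _ _.
  by apply: (le_trans g_le); rewrite ler_wpM2l// lerXn2r ?nnegrE.
split.
- have -> : f * g - jet_poly (a1 + a2) (b1 + b2 + 2 * a1 * a2) =
      (f - jet_poly a1 b1) * g + jet_poly a1 b1 * (g - jet_poly a2 b2) +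
      ((b1 * b2 / 4) +i* (- (b1 * a2 + b2 * a1) / 2)).
    have -> : (f - jet_poly a1 b1) * g + jet_poly a1 b1 * (g - jet_poly a2 b2) =
      f * g - jet_poly a1 b1 * jet_poly a2 b2 by ring.
    by rewrite jet_polyM opprD addrA addrNK.
  apply: (@le_trans _ _ (E * t ^+ 3)); last by rewrite ler_wpM2r ?exprn_ge0// lerDl.
  apply: (le_trans (normcD_le _ _)); rewrite /E [leRHS]mulrDl; apply: lerD; last first.
    exact: jet_polyM_error_le t_tau _ _ _ _ _ _.
  apply: (le_trans (normcD_le _ _)); rewrite !normcM [leRHS]mulrDl; apply: lerD.
    by rewrite [leRHS]mulrAC; apply: ler_pM; rewrite ?normc_ge0.
  rewrite -[leRHS]mulrA; apply: ler_pM; rewrite ?normc_ge0//.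
  exact: normc_jet_poly_le t_tau _ _ _.
- apply: (@le_trans _ _ (L * t)); last by rewrite ler_wpM2r// lerDr.
  apply: (le_trans (ler_normD _ _)); have : 0 <= (2 * c1 * c2) * t by rewrite !mulr_ge0.
  by rewrite /L; lra.
- apply: (@le_trans _ _ (L * t ^+ 2)); last by rewrite ler_wpM2r ?sqr_ge0// lerDr.
  have aa_le : `|2 * a1 * a2| <= 2 * c1 * c2 * t ^+ 2.
    rewrite -!mulrA normrM [`|2|]ger0_norm// ler_pM2l// normrM.
    by have -> : c1 * (c2 * t ^+ 2) = (c1 * t) * (c2 * t) by [ring]; exact: ler_pM.
  apply: (le_trans (ler_normD _ _)); have := ler_normD b1 b2.
  by rewrite /L; lra.
Qed.

Lemma jet_pow c0 n : 0 <= c0 -> exists2 c, 0 <= c &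
  forall t f a b, 0 <= t <= tau -> jet t c0 f a b ->
  jet t c (f ^+ n) (n%:R * a) (n%:R * b + n%:R * (n%:R - 1) * a ^+ 2).
Proof.
move=> c00; elim: n => [|n [c c_ge0 IH]].
  exists 0 => // t f a b _ _; rewrite !mul0r add0r expr0; split; last 2 first.
  - by rewrite normr0 mul0r.
  - by rewrite normr0 mul0r.
  - have -> : jet_poly 0 0 = 1 by rewrite /jet_poly mul0r subr0.
    by rewrite subrr normc0 mul0r.
have [c' c'0 jetM] := jet_mul c_ge0 c00.
exists c' => // t f a b t_tau jf.
have := jetM _ _ _ _ _ _ _ t_tau (IH _ _ _ _ t_tau jf) jf.
rewrite -exprSr; congr jet; rewrite -natr1; ring.
Qed.

Lemma jet_mean1 c t f a b : 0 <= c -> 0 <= t -> jet t c f a b ->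
  jet t c ((1 + f) / 2) (a / 2) (b / 2).
Proof.
move=> c0 t0 [f_le a_le b_le].
have half_le (x y : R) : `|x| <= y -> `|x / 2| <= y.
  by rewrite normrM [`|2^-1|]ger0_norm//; have := normr_ge0 x; lra.
split; [|exact: half_le..].
have -> : (1 + f) / 2 - jet_poly (a / 2) (b / 2) = (f - jet_poly a b) * (2^-1)%:C.
  have -> : (2^-1)%:C = 2^-1 :> R[i] by rewrite fmorphV rmorph_nat.
  apply: (@mulIf _ 2); first by rewrite pnatr_eq0.
  rewrite mulrBl !divfK ?pnatr_eq0// [1 + f]addrC -addrA; congr (_ + _).
  by apply/eqP; rewrite eq_complex /=; apply/andP; split; apply/eqP; lra.
rewrite normcM normc_real ger0_norm//.
by have := normc_ge0 (f - jet_poly a b); lra.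
Qed.

Lemma jet_cis c t y : 0 <= c -> 0 <= t -> `|y| <= c * t ->
  jet t (c + c ^+ 2 + 2 * c ^+ 3) (cis y) y (y ^+ 2).
Proof.
move=> c0 t0 y_le.
have [c2 c3] : 0 <= c ^+ 2 /\ 0 <= c ^+ 3 by rewrite !exprn_ge0.
have y_leX n : `|y| ^+ n <= c ^+ n * t ^+ n by rewrite -exprMn lerXn2r ?nnegrE// mulr_ge0.
split.
- apply: (@le_trans _ _ (2 * c ^+ 3 * t ^+ 3)).
    apply: (le_trans (normc_le_ReIm _)); rewrite /cis /=.
    have := norm_cos_taylor2_le y; have := norm_sinBid_le_cube y; have := y_leX 3%N.
    have -> : cos y - (1 - y ^+ 2 / 2) = cos y - 1 + y ^+ 2 / 2 by lra.
    by have : 0 <= `|y| ^+ 3 by []; lra.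
  by rewrite ler_wpM2r ?exprn_ge0// lerDr addr_ge0.
- by rewrite (le_trans y_le)// ler_wpM2r// -addrA lerDl addr_ge0// mulr_ge0.
- rewrite normrX (le_trans (y_leX 2%N))// ler_wpM2r ?sqr_ge0// addrAC lerDr addr_ge0//.
  by rewrite mulr_ge0.
Qed.

(* For f = 1 + i a - b / 2 + O(t^3), the lazy L-step average (1 + f^L) / 2,
   recentred by its mean L a / 2, has second order part [Q]. *)
Lemma lazy_average_expansion c0 L : 0 <= c0 -> exists2 c, 0 <= c &
  forall t f a b, 0 <= t <= tau -> jet t c0 f a b ->
  let Q := L%:R / 2 * (b - a ^+ 2) + L%:R ^+ 2 / 4 * a ^+ 2 in 0 <= Q ->
  normc ((1 + f ^+ L) / 2 * cis (- (L%:R * a / 2)) - (expR (- (Q / 2)))%:C) <= c * t ^+ 3.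
Proof.
move=> c00; have [c1 c10 jetX] := jet_pow L c00.
pose cy := L%:R * c0; have cy0 : 0 <= cy by rewrite mulr_ge0.
have c20 : 0 <= cy + cy ^+ 2 + 2 * cy ^+ 3 by rewrite !addr_ge0 ?mulr_ge0 ?exprn_ge0 ?mulr_ge0.
have [c3 c30 jetM] := jet_mul c10 c20.
exists (c3 + c3 ^+ 2 * tau) => [|t f a b t_tau jf Q Q0].
  by rewrite addr_ge0// mulr_ge0 ?sqr_ge0.
have /andP[t0 tt] := t_tau.
have j_avg := jet_mean1 c10 t0 (jetX _ _ _ _ t_tau jf).
have y_le : `|- (L%:R * a / 2)| <= cy * t.
  rewrite normrN normrM [`|2^-1|]ger0_norm// normrM [`|L%:R|]ger0_norm// /cy -mulrA -mulrA.
  rewrite ler_wpM2l//; case: jf => _ a_le _; apply: le_trans a_le.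
  by have := normr_ge0 a; lra.
have [] := jetM _ _ _ _ _ _ _ t_tau j_avg (jet_cis cy0 t0 y_le).
have -> : L%:R * a / 2 + - (L%:R * a / 2) = 0 by rewrite subrr.
have -> : (L%:R * b + L%:R * (L%:R - 1) * a ^+ 2) / 2 + (- (L%:R * a / 2)) ^+ 2 +
   2 * (L%:R * a / 2) * (- (L%:R * a / 2)) = Q by rewrite /Q; field.
rewrite (ger0_norm Q0); set z := _ * cis _ => z_le _ Q_le.
have exp_le : `|expR (- (Q / 2)) - (1 - Q / 2)| <= c3 ^+ 2 * tau * t ^+ 3.
  apply: (le_trans (norm_expRN_taylor1_le _)); first by rewrite divr_ge0.
  apply: (@le_trans _ _ ((c3 * t ^+ 2) ^+ 2)).
    by rewrite lerXn2r ?nnegrE ?divr_ge0 ?mulr_ge0 ?sqr_ge0//; lra.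
  have -> : (c3 * t ^+ 2) ^+ 2 = c3 ^+ 2 * t * t ^+ 3 by ring.
  by rewrite ler_wpM2r ?exprn_ge0// ler_wpM2l ?sqr_ge0.
have -> : z - (expR (- (Q / 2)))%:C =
    (z - jet_poly 0 Q) + ((1 - Q / 2)%:C - (expR (- (Q / 2)))%:C) by rewrite addrA subrK.
apply: (le_trans (normcD_le _ _)); rewrite [leRHS]mulrDl; apply: lerD => //.
by rewrite distcC -rmorphB normc_real.
Qed.

End Jets.

(** * Local limit theorem for binomially averaged convolution powers *)

Section ConvolutionPowers.
Variables (R : realType) (d : nat).
Local Open Scope complex_scope.
Local Notation X := 'rV[int]_d.
Implicit Types (f : X -> R) (th v : 'rV[R]_d) (x y : X).

Definition conv_pow (kap nu : X -> R) n : X -> R := iter n (fun f => rconv f nu) kap.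

Definition binom_weight K k : R := 'C(K, k)%:R / 2 ^+ K.

Lemma binom_weight_ge0 K k : 0 <= binom_weight K k.
Proof. by rewrite divr_ge0// exprn_ge0. Qed.

Definition binom_blocks (kap nu : X -> R) L K x : R :=
  \sum_(z : 'I_K.+1 * 'I_L) binom_weight K z.1 * conv_pow kap nu (L * z.1 + z.2) x.

Variables kap nu : X -> R.
Hypotheses (kap_ge0 : forall x, 0 <= kap x) (nu_ge0 : forall x, 0 <= nu x).

Lemma conv_pow_ge0 n x : 0 <= conv_pow kap nu n x.
Proof. by elim: n x => //= n IH x; exact: rconv_ge0. Qed.

Lemma binom_blocks_ge0 L K x : 0 <= binom_blocks kap nu L K x.
Proof. by apply: sumr_ge0 => z _; rewrite mulr_ge0 ?binom_weight_ge0 ?conv_pow_ge0. Qed.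

Hypotheses (kap_summable : rsummable kap) (nu_summable : rsummable nu).

Lemma rsummable_conv_pow n : rsummable (conv_pow kap nu n).
Proof. by elim: n => //= n IH; apply: rsummable_rconv => // x; exact: conv_pow_ge0. Qed.

Lemma rsummable_binom_blocks L K : rsummable (binom_blocks kap nu L K).
Proof. by apply: rsummable_sum => z _; apply: rsummableZ; exact: rsummable_conv_pow. Qed.

Lemma fourier_conv_pow n th :
  fourier (conv_pow kap nu n) th = fourier kap th * fourier nu th ^+ n.
Proof.
elim: n => [|n IH]; first by rewrite expr0 mulr1.
by rewrite /= fourier_rconv ?IH ?exprSr ?mulrA//;
   [exact: conv_pow_ge0 | exact: rsummable_conv_pow].
Qed.

Lemma fourier_binom_blocks L K th : fourier (binom_blocks kap nu L K) th =
  fourier kap th * (\sum_(r < L) fourier nu th ^+ r) * ((1 + fourier nu th ^+ L) / 2) ^+ K.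
Proof.
rewrite /binom_blocks fourier_sum; last by move=> z _; exact: rsummable_conv_pow.
set psi := fourier nu th.
transitivity (fourier kap th * ((\sum_(k < K.+1) (binom_weight K k)%:C * psi ^+ (L * k)) *
   (\sum_(r < L) psi ^+ r))).
  rewrite big_distrlr /= pair_big /= mulr_sumr; apply: eq_bigr => z _.
  by rewrite fourier_conv_pow exprD; ring.
rewrite [X in _ * X]mulrC mulrA; congr (_ * _).
rewrite exprMn exprDn mulr_suml; apply: eq_bigr => k _.
rewrite expr1n mul1r -exprM /binom_weight rmorphM rmorph_nat fmorphV rmorphXn rmorph_nat.
by rewrite exprVn -mulr_natr; ring.
Qed.

End ConvolutionPowers.

Section Covariance.
Variables (R : realType) (d : nat).
Local Notation X := 'rV[int]_d.
Local Notation ang th x := (dotp th (toR R x)).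
Implicit Types (nu : X -> R) (v : 'rV[R]_d).

Definition cov nu : 'M[R]_d := second_moment nu - (mean nu)^T *m mean nu.

(* The covariance per step of the lazy walk which stays put or makes [L] steps of
   [nu], each with probability 1/2. *)
Definition block_cov L nu : 'M[R]_d :=
  (L%:R / 2) *: cov nu + (L%:R ^+ 2 / 4) *: ((mean nu)^T *m mean nu).

Lemma qform_cov nu v : qform (cov nu) v = qform (second_moment nu) v - dotp v (mean nu) ^+ 2.
Proof. by rewrite /cov qform_addmx qform_oppmx qform_outer. Qed.

Lemma qform_block_cov L nu v : qform (block_cov L nu) v =
  L%:R / 2 * (qform (second_moment nu) v - dotp v (mean nu) ^+ 2) +
  L%:R ^+ 2 / 4 * dotp v (mean nu) ^+ 2.
Proof. by rewrite /block_cov qform_addmx !qform_scalemx qform_cov qform_outer. Qed.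

Lemma cov_sym nu : (cov nu)^T = cov nu.
Proof. by rewrite /cov linearB /= trmx_mul trmxK second_moment_sym. Qed.

Lemma block_cov_sym L nu : (block_cov L nu)^T = block_cov L nu.
Proof. by rewrite /block_cov linearD /= !linearZ /= cov_sym trmx_mul trmxK. Qed.

Definition spread_law (del M eps : R) nu :=
  [/\ exp_moment_le del M nu, spread eps nu & sumR nu = 1].

Variables (del M eps : R) (nu : X -> R).
Hypotheses (d_gt0 : (0 < d)%N) (del_gt0 : 0 < del) (eps_gt0 : 0 < eps).
Hypothesis nu_law : spread_law del M eps nu.

Let nu_moment : exp_moment_le del M nu. Proof. by case: nu_law. Qed.

Let dR_gt0 : 0 < d%:R :> R. Proof. by rewrite ltr0n. Qed.

Let square_dev_summands v (a : R) x : (ang v x - a) ^+ 2 * nu x =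
  ang v x ^+ 2 * nu x - 2 * a * (ang v x * nu x) + a ^+ 2 * nu x.
Proof. ring. Qed.

Let rsummable_square_dev v (a : R) : rsummable (fun x => (ang v x - a) ^+ 2 * nu x).
Proof.
have s := exp_moment_rsummable del_gt0 nu_moment.
have s1 : rsummable (fun x => ang v x * nu x) := rsummable_angX del_gt0 nu_moment 1 v.
have s2 := rsummable_angX del_gt0 nu_moment 2 v.
rewrite (funext (square_dev_summands v a)).
by apply: rsummableD; [apply: rsummableB => //; exact: rsummableZ | exact: rsummableZ].
Qed.

Lemma qform_cov_variance v :
  qform (cov nu) v = sumR (fun x => (ang v x - dotp v (mean nu)) ^+ 2 * nu x).
Proof.
have s := exp_moment_rsummable del_gt0 nu_moment.
have s1 : rsummable (fun x => ang v x * nu x) := rsummable_angX del_gt0 nu_moment 1 v.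
have s2 := rsummable_angX del_gt0 nu_moment 2 v.
have meanE := dotp_mean del_gt0 nu_moment v.
rewrite (eq_sumR (square_dev_summands v _)) sumRD; last 2 first.
- by apply: rsummableB => //; exact: rsummableZ.
- exact: rsummableZ.
rewrite sumRB//; last exact: rsummableZ.
rewrite !sumRZ -meanE qform_cov (qform_second_moment del_gt0 nu_moment).
by have [_ _ ->] := nu_law; ring.
Qed.

Lemma qform_cov_ge_coord v k : eps / 2 * v 0 k ^+ 2 <= qform (cov nu) v.
Proof.
rewrite qform_cov_variance; set a := dotp v (mean nu).
have dev_ge0 x : 0 <= (ang v x - a) ^+ 2 * nu x.
  by rewrite mulr_ge0 ?sqr_ge0// (exp_moment_ge0 nu_moment).
have neq0 : 0 != delta_mx 0 k :> X by apply/eqP => /rowP/(_ k); rewrite !mxE !eqxx.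
apply: le_trans (sumR_ge_two_terms dev_ge0 (rsummable_square_dev v a) neq0).
rewrite toR0 dotp0r dotp_delta sub0r sqrrN.
have [_ [nu_0 /(_ k) nu_k] _] := nu_law.
have : a ^+ 2 * eps <= a ^+ 2 * nu 0 by rewrite ler_wpM2l ?sqr_ge0.
have : (v 0 k - a) ^+ 2 * eps <= (v 0 k - a) ^+ 2 * nu (delta_mx 0 k).
  by rewrite ler_wpM2l ?sqr_ge0.
have : 0 <= eps * (v 0 k - 2 * a) ^+ 2 by rewrite mulr_ge0 ?sqr_ge0// ltW.
lra.
Qed.

Lemma qform_cov_ge v : eps / (2 * d%:R) * dotp v v <= qform (cov nu) v.
Proof.
have -> : eps / (2 * d%:R) * dotp v v = (\sum_(k < d) eps / 2 * v 0 k ^+ 2) / d%:R.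
  rewrite -mulr_sumr; have -> : \sum_(k < d) v 0 k ^+ 2 = dotp v v.
    by apply: eq_bigr => k _; rewrite expr2.
  by field; rewrite gt_eqF.
rewrite ler_pdivrMr//; apply: (@le_trans _ _ (\sum_(k < d) qform (cov nu) v)).
  by apply: ler_sum => k _; exact: qform_cov_ge_coord.
by rewrite sumr_const card_ord mulr_natr.
Qed.

Lemma qform_bounded_cov :
  qform_bounded (eps / (2 * d%:R)) ((2 / del) ^+ 2 * M) (cov nu).
Proof.
split; first exact: cov_sym.
move=> v; rewrite qform_cov_ge qform_cov andTb.
have /andP[_] := qform_second_moment_bounds del_gt0 nu_moment v.
by rewrite enorm_sqr -mulrA mulrC; have := sqr_ge0 (dotp v (mean nu)); lra.
Qed.

Lemma qform_bounded_block_cov L : (0 < L)%N -> qform_bounded (eps / (4 * d%:R))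
  (L%:R / 2 * ((2 / del) ^+ 2 * M) + L%:R ^+ 2 / 4 * (M / del) ^+ 2) (block_cov L nu).
Proof.
move=> L0; split; first exact: block_cov_sym.
move=> v; have L1 : 1 <= L%:R :> R by rewrite ler1n.
have /andP[cov_ge cov_le] := proj2 qform_bounded_cov v.
rewrite qform_block_cov -qform_cov; set a := dotp v (mean nu).
set w := qform (cov nu) v in cov_ge cov_le *.
have a2 : 0 <= L%:R ^+ 2 / 4 * a ^+ 2 by rewrite mulr_ge0 ?sqr_ge0// divr_ge0 ?sqr_ge0.
apply/andP; split.
  have -> : eps / (4 * d%:R) * dotp v v = 1 / 2 * (eps / (2 * d%:R) * dotp v v).
    by field; rewrite gt_eqF.
  have w0 : 0 <= w.
    by apply: le_trans cov_ge; rewrite mulr_ge0 ?dotp_ge0// divr_ge0 ?mulr_ge0// ltW.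
  have : 1 / 2 * w <= L%:R / 2 * w by rewrite ler_wpM2r//; lra.
  by lra.
have a_le : a ^+ 2 <= dotp v v * (M / del) ^+ 2.
  rewrite -[a ^+ 2]real_normK ?num_real// -enorm_sqr -exprMn lerXn2r ?nnegrE//.
    by rewrite mulr_ge0 ?enorm_ge0// divr_ge0 ?(exp_moment_bound_ge0 nu_moment)// ltW.
  by rewrite mulrA mulrAC; exact: norm_dotp_mean_le.
rewrite [leRHS]mulrDl; apply: lerD; first by rewrite -[leRHS]mulrA ler_wpM2l ?divr_ge0.
by rewrite -[leRHS]mulrA ler_wpM2l ?divr_ge0 ?sqr_ge0// mulrC.
Qed.

End Covariance.

Section LazyCharacteristicFunction.
Variables (R : realType) (d : nat).
Local Open Scope complex_scope.
Local Notation X := 'rV[int]_d.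
Local Notation ang th x := (dotp th (toR R x)).
Variables (L : nat) (del M eps : R).
Hypotheses (d_gt0 : (0 < d)%N) (L_gt0 : (0 < L)%N) (del_gt0 : 0 < del).
Hypotheses (eps_gt0 : 0 < eps) (M_ge0 : 0 <= M).
Implicit Types (nu kap : X -> R) (th : 'rV[R]_d).

Let radius : R := d%:R * pi.

Let radius_ge0 : 0 <= radius. Proof. by rewrite mulr_ge0 ?pi_ge0. Qed.

Let enorm_le_radius th : `|th| <= pi -> 0 <= enorm th <= radius.
Proof. by move=> th_pi; rewrite enorm_ge0 (le_trans (enorm_le_norm th))// ler_wpM2l. Qed.

Lemma jet_fourier : exists2 c, 0 <= c & forall nu th, exp_moment_le del M nu ->
  sumR nu = 1 ->
  jet (enorm th) c (fourier nu th) (dotp th (mean nu)) (qform (second_moment nu) th).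
Proof.
pose c3 := 2 * (3 / del) ^+ 3 * M; pose c1 := M / del; pose c2 := (2 / del) ^+ 2 * M.
have del0 := ltW del_gt0.
have c30 : 0 <= c3 by rewrite mulr_ge0// mulr_ge0// exprn_ge0// divr_ge0.
have c10 : 0 <= c1 by rewrite divr_ge0.
have c20 : 0 <= c2 by rewrite mulr_ge0 ?sqr_ge0.
exists (c3 + c1 + c2) => [|nu th nu_moment nu1]; first by rewrite !addr_ge0.
have t0 := enorm_ge0 th; split.
- have := fourier_taylor2 del_gt0 nu_moment th; rewrite nu1 => /le_trans; apply.
  by rewrite ler_wpM2r ?exprn_ge0// -addrA lerDl addr_ge0.
- apply: (le_trans (norm_dotp_mean_le del_gt0 nu_moment th)).
  have -> : enorm th / del * M = c1 * enorm th by rewrite /c1; ring.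
  by rewrite ler_wpM2r// addrAC lerDr addr_ge0.
- have /andP[b0 b_le] := qform_second_moment_bounds del_gt0 nu_moment th.
  rewrite ger0_norm//; apply: (le_trans b_le); rewrite -mulrA mulrC.
  by rewrite ler_wpM2r ?sqr_ge0// lerDr addr_ge0.
Qed.

Lemma normc_fourier_gauss : exists2 a : R, 0 < a & forall nu th,
  spread_law del M eps nu -> `|th| <= pi ->
  normc (fourier nu th) <= expR (- (a * enorm th ^+ 2)).
Proof.
have M1 : 0 < M + 1 by rewrite ltr_wpDl.
exists (eps / (64 * d%:R * (M + 1))) => [|nu th [nu_moment nu_spread nu1] th_pi].
  by rewrite divr_gt0 ?mulr_gt0 ?ltr0n.
have := @normc_fourier_le_gauss R d nu eps (exp_moment_ge0 nu_moment)
  (exp_moment_rsummable del_gt0 nu_moment) (ltW eps_gt0) nu_spread (M + 1) th d_gt0 M1.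
by rewrite nu1 mul1r enorm_sqr; apply => //; rewrite lerDr.
Qed.

Lemma normc_fourier_le1 nu th : spread_law del M eps nu -> `|th| <= pi ->
  normc (fourier nu th) <= 1.
Proof.
have [a a0 decay] := normc_fourier_gauss => nu_law th_pi.
apply: (le_trans (decay nu th nu_law th_pi)).
by rewrite -(expR0 R) ler_expR oppr_le0 mulr_ge0 ?sqr_ge0// ltW.
Qed.

Lemma lazy_fourier_decay : exists2 a : R, 0 < a & forall nu th,
  spread_law del M eps nu -> `|th| <= pi ->
  normc ((1 + fourier nu th ^+ L) / 2) <= expR (- (a * enorm th ^+ 2)).
Proof.
have [a a0 decay] := normc_fourier_gauss; pose Y := a * radius ^+ 2.
have Y0 : 0 <= Y by rewrite mulr_ge0 ?sqr_ge0// ltW.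
exists (a / (2 * (1 + Y))) => [|nu th nu_law th_pi].
  by rewrite divr_gt0// mulr_gt0// ltr_pwDl.
have /andP[t0 tt] := enorm_le_radius th_pi; set psi := fourier nu th.
have psi_le := decay nu th nu_law th_pi; have psi_le1 := normc_fourier_le1 nu_law th_pi.
apply: (@le_trans _ _ ((1 + expR (- (a * enorm th ^+ 2))) / 2)).
  have -> : (2^-1 : R[i]) = (2^-1)%:C by rewrite fmorphV rmorph_nat.
  rewrite normcM normc_real ger0_norm// ler_pM2r// (le_trans (normcD_le _ _))//.
  rewrite normc1 lerD2l normcX (le_trans _ psi_le)// -[leRHS]expr1.
  by rewrite ler_wiXn2l ?normc_ge0.
have := @mean1_expRN_le R Y (a * enorm th ^+ 2); rewrite mulr_ge0 ?sqr_ge0 ?(ltW a0)//.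
rewrite /Y ler_pM2l// lerXn2r ?nnegrE// => /(_ isT) /le_trans; apply.
by rewrite ler_expR lerN2 mulrAC.
Qed.

Local Notation recentred nu th :=
  ((1 + fourier nu th ^+ L) / 2 * cis (- (L%:R * dotp th (mean nu) / 2))).
Local Notation gauss_fourier nu th := (expR (- (qform (block_cov L nu) th / 2))).

Lemma recentred_fourier_close : exists2 c, 0 <= c & forall nu th,
  spread_law del M eps nu -> `|th| <= pi ->
  normc (recentred nu th - (gauss_fourier nu th)%:C) <= c * enorm th ^+ 3.
Proof.
have [c0 c00 jet_nu] := jet_fourier.
have [c c_ge0 expansion] := lazy_average_expansion radius_ge0 L c00.
exists c => // nu th nu_law th_pi; have [nu_moment _ nu1] := nu_law.
have Qb := qform_bounded_block_cov d_gt0 del_gt0 eps_gt0 nu_law L_gt0.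
have := expansion _ _ _ _ (enorm_le_radius th_pi) (jet_nu nu th nu_moment nu1).
rewrite -qform_block_cov; apply; have /andP[+ _] := proj2 Qb th.
by apply: le_trans; rewrite mulr_ge0 ?dotp_ge0// divr_ge0 ?mulr_ge0// ltW.
Qed.

Lemma recentred_fourier_pow_close : exists a c : R, [/\ 0 < a, 0 <= c &
  forall nu th K, spread_law del M eps nu -> `|th| <= pi -> (0 < K)%N ->
  normc (recentred nu th ^+ K) <= expR (- (K%:R * a * enorm th ^+ 2)) /\
  normc (recentred nu th ^+ K - (gauss_fourier nu th ^+ K)%:C) <=
    c * (K%:R * enorm th ^+ 3) * expR (- (K%:R * a * enorm th ^+ 2))].
Proof.
have [a1 a10 lazy_decay] := lazy_fourier_decay.
have [c c0 close] := recentred_fourier_close.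
pose aQ := eps / (4 * d%:R); pose a := Num.min a1 (aQ / 2).
have aQ0 : 0 < aQ by rewrite divr_gt0 ?mulr_gt0 ?ltr0n.
have a0 : 0 < a by rewrite lt_min a10 divr_gt0.
exists a, (c * expR (a * radius ^+ 2)); split => // [|nu th K nu_law th_pi K0].
  by rewrite mulr_ge0 ?expR_ge0.
have /andP[t0 tt] := enorm_le_radius th_pi; set t := enorm th.
have t2 : t ^+ 2 <= radius ^+ 2 by rewrite lerXn2r ?nnegrE.
set z := recentred nu th; set w := gauss_fourier nu th.
set rho := expR (- (a * t ^+ 2)); have rho0 : 0 <= rho := expR_ge0 _.
have z_le : normc z <= rho.
  rewrite normcM normc_cis mulr1 (le_trans (lazy_decay nu th nu_law th_pi))//.
  by rewrite ler_expR lerN2 ler_wpM2r ?sqr_ge0// ge_min lexx.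
have w_le : normc w%:C <= rho.
  rewrite normc_real ger0_norm ?expR_ge0// ler_expR lerN2.
  have Qb := qform_bounded_block_cov d_gt0 del_gt0 eps_gt0 nu_law L_gt0.
  have /andP[+ _] := proj2 Qb th; rewrite -enorm_sqr -/t -/aQ => Q_ge.
  apply: (@le_trans _ _ (aQ / 2 * t ^+ 2)); last by lra.
  by rewrite ler_wpM2r ?sqr_ge0// ge_min lexx orbT.
have rhoK : expR (- (K%:R * a * t ^+ 2)) = rho ^+ K.
  by rewrite -expRM_natl; congr expR; ring.
rewrite rhoK; split; first by rewrite normcX lerXn2r ?nnegrE ?normc_ge0.
have rho_pred : rho ^+ K.-1 <= expR (a * radius ^+ 2) * rho ^+ K.
  have -> : rho ^+ K = rho * rho ^+ K.-1 by rewrite -exprS prednK.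
  rewrite mulrA -[leLHS]mul1r ler_wpM2r ?exprn_ge0//.
  have -> : 1 = expR (a * t ^+ 2) * rho by rewrite -expRD subrr expR0.
  by rewrite ler_wpM2r// ler_expR ler_pM2l.
rewrite rmorphXn; apply: (le_trans (normc_exprB_le K z_le w_le)).
apply: (@le_trans _ _ (K%:R * (expR (a * radius ^+ 2) * rho ^+ K) * (c * t ^+ 3))).
  apply: ler_pM => //; rewrite ?normc_ge0// ?mulr_ge0 ?exprn_ge0//; last exact: close.
  by rewrite ler_wpM2l.
by rewrite le_eqVlt; apply/orP; left; apply/eqP; ring.
Qed.

Lemma normc_sum_exprB1_le (z : R[i]) (c : R) : normc z <= 1 -> normc (z - 1) <= c ->
  normc (\sum_(r < L) z ^+ r - L%:R) <= L%:R * (L%:R * c).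
Proof.
move=> z1 zc; have -> : (L%:R : R[i]) = \sum_(r < L) 1 by rewrite sumr_const card_ord.
rewrite -sumrB; apply: (le_trans (normc_sum_le _ _ _)).
have -> : L%:R * (L%:R * c) = \sum_(r < L) (L%:R * c).
  by rewrite sumr_const card_ord -[RHS]mulr_natl.
apply: ler_sum => r _; rewrite -[1](expr1n _ r).
have := @normc_exprB_le R z 1 r 1 z1; rewrite normc1 lexx => /(_ isT) /le_trans; apply.
by rewrite expr1n mulr1; apply: ler_pM; rewrite ?normc_ge0// ler_nat ltnW.
Qed.

Lemma block_prefactor_close : exists2 c, 0 <= c & forall nu kap th,
  spread_law del M eps nu -> exp_moment_le del M kap -> `|th| <= pi ->
  normc (fourier kap th * \sum_(r < L) fourier nu th ^+ r) <= c /\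
  normc (fourier kap th * \sum_(r < L) fourier nu th ^+ r - (sumR kap * L%:R)%:C) <=
    c * enorm th.
Proof.
pose l := 3 / del * M; have l0 : 0 <= l by rewrite mulr_ge0// divr_ge0// ltW.
have LR : 0 <= L%:R :> R by [].
pose c1 := l * L%:R + M * (L%:R * (L%:R * l)).
have c10 : 0 <= c1 by apply: addr_ge0; do ?apply: mulr_ge0 => //.
exists (2 * M * L%:R + c1) => [|nu kap th nu_law kap_moment th_pi].
  by rewrite addr_ge0 ?mulr_ge0.
have [nu_moment _ nu1] := nu_law; have t0 := enorm_ge0 th.
set psi := fourier nu th; set S := \sum_(r < L) psi ^+ r; set k := fourier kap th.
have psi1 : normc psi <= 1 := normc_fourier_le1 nu_law th_pi.
have kap0 := exp_moment_ge0 kap_moment.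
have kap_le := exp_moment_sumR_le del_gt0 kap_moment.
have S_le : normc S <= L%:R.
  apply: (le_trans (normc_sum_le _ _ _)); rewrite -[L in leRHS]card_ord -sum1_card natr_sum.
  by apply: ler_sum => i _; rewrite normcX exprn_ile1 ?normc_ge0.
have S_close : normc (S - L%:R) <= L%:R * (L%:R * (l * enorm th)).
  by apply: normc_sum_exprB1_le => //; have := fourier_lipschitz0 del_gt0 nu_moment th;
     rewrite nu1.
split.
  apply: (@le_trans _ _ (2 * M * L%:R)); last by rewrite lerDl.
  rewrite normcM; apply: ler_pM; rewrite ?normc_ge0//.
  have sk := exp_moment_rsummable del_gt0 kap_moment.
  by rewrite (le_trans (normc_fourier_le th kap0 sk))// ler_pM2l.
apply: (@le_trans _ _ (c1 * enorm th)); last by rewrite ler_wpM2r// lerDr !mulr_ge0.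
have -> : k * S - (sumR kap * L%:R)%:C =
    (k - (sumR kap)%:C) * S + (sumR kap)%:C * (S - L%:R).
  by rewrite rmorphM rmorph_nat; ring.
apply: (le_trans (normcD_le _ _)); rewrite [leRHS]mulrDl; apply: lerD; rewrite normcM.
  rewrite mulrAC; apply: ler_pM; rewrite ?normc_ge0//.
  exact: fourier_lipschitz0.
have -> : M * (L%:R * (L%:R * l)) * enorm th = M * (L%:R * (L%:R * (l * enorm th))) by ring.
apply: ler_pM; rewrite ?normc_ge0// normc_real ger0_norm//.
exact: sumR_ge0.
Qed.

Lemma fourier_binom_blocks_recentred nu kap K th x :
  spread_law del M eps nu -> exp_moment_le del M kap ->
  fourier (binom_blocks kap nu L K) th * cis (- ang th x) =
  fourier kap th * (\sum_(r < L) fourier nu th ^+ r) * recentred nu th ^+ K *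
    cis (- dotp th (toR R x - (K%:R * L%:R / 2) *: mean nu)).
Proof.
move=> [nu_moment _ _] kap_moment; rewrite fourier_binom_blocks; last 4 first.
- exact: exp_moment_ge0 kap_moment.
- exact: exp_moment_ge0 nu_moment.
- exact: exp_moment_rsummable kap_moment.
- exact: exp_moment_rsummable nu_moment.
have -> : ang th x = dotp th (toR R x - (K%:R * L%:R / 2) *: mean nu) +
    (L%:R * dotp th (mean nu) / 2) *+ K.
  by rewrite dotpDr dotpNr dotpZr -mulr_natr; ring.
by rewrite opprD cisD -mulNrn cisMn [in RHS]exprMn; ring.
Qed.

Lemma fourier_binom_blocks_close (r0 : R) : 0 <= r0 -> exists a c : R, [/\ 0 < a, 0 <= c &
  forall nu kap K th x, spread_law del M eps nu -> exp_moment_le del M kap ->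
  (0 < K)%N -> `|toR R x - (K%:R * L%:R / 2) *: mean nu| <= r0 -> `|th| <= pi ->
  normc (fourier (binom_blocks kap nu L K) th * cis (- ang th x) -
         (sumR kap * L%:R * expR (- (K%:R * qform (block_cov L nu) th) / 2))%:C) <=
  c * ((enorm th + K%:R * enorm th ^+ 3) * expR (- (K%:R * a * enorm th ^+ 2)))].
Proof.
move=> r00; have [a [c1 [a0 c10 pow_close]]] := recentred_fourier_pow_close.
have [c2 c20 prefactor] := block_prefactor_close.
pose c3 := c2 * (2 * (d%:R * r0)) + c2; pose c4 := M * L%:R * c1.
have c30 : 0 <= c3 by rewrite addr_ge0 ?mulr_ge0.
have c40 : 0 <= c4 by rewrite !mulr_ge0.
exists a, (c3 + c4); split=> // [|nu kap K th x nu_law kap_moment K0 x_close th_pi].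
  exact: addr_ge0.
rewrite fourier_binom_blocks_recentred//; set A := fourier kap th * _.
set t := enorm th; have t0 : 0 <= t := enorm_ge0 th.
have [A_le A_close] := prefactor nu kap th nu_law kap_moment th_pi.
have [z_le z_close] := pow_close nu th K nu_law th_pi K0; rewrite -/t in z_le z_close.
set z := recentred nu th ^+ K in z_le z_close *.
set rho := expR _ in z_le z_close *; have rho0 : 0 <= rho := expR_ge0 _.
set m := sumR kap * L%:R; set e := cis _; set W := gauss_fourier nu th ^+ K in z_close.
have -> : expR (- (K%:R * qform (block_cov L nu) th) / 2) = W.
  by rewrite /W -expRM_natl; congr expR; ring.
have m_le : `|m| <= M * L%:R.
  rewrite ger0_norm ?mulr_ge0 ?sumR_ge0//; last exact: exp_moment_ge0 kap_moment.
  by rewrite ler_wpM2r//; exact: exp_moment_sumR_le kap_moment.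
have e_close : normc (e - 1) <= 2 * (d%:R * r0) * t.
  apply: (le_trans (normc_cisB1_le _)); rewrite normrN -[leRHS]mulrA ler_pM2l// dotpC.
  by rewrite (le_trans (norm_dotp_le _ _))// ler_wpM2r// ler_wpM2l.
have -> : A * z * e - (m * W)%:C = A * z * (e - 1) + (A - m%:C) * z + m%:C * (z - W%:C).
  by rewrite rmorphM /=; ring.
apply: (@le_trans _ _ (c3 * (t * rho) + c4 * (K%:R * t ^+ 3 * rho))); last first.
  have : 0 <= c3 * (K%:R * t ^+ 3 * rho) by rewrite !mulr_ge0 ?exprn_ge0.
  have : 0 <= c4 * (t * rho) by rewrite !mulr_ge0.
  lra.
apply: (le_trans (normcD_le _ _)); apply: lerD; last first.
  rewrite normcM normc_real /c4 -[leRHS]mulrA ler_pM ?normc_ge0//.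
  by rewrite !mulrA in z_close *.
apply: (le_trans (normcD_le _ _)); rewrite /c3 [leRHS]mulrDl.
rewrite (normcM (A * z)) (normcM A) (normcM (A - m%:C)); apply: lerD.
  have -> : c2 * (2 * (d%:R * r0)) * (t * rho) = c2 * rho * (2 * (d%:R * r0) * t) by ring.
  by apply: ler_pM => //; rewrite ?mulr_ge0 ?normc_ge0//; apply: ler_pM; rewrite ?normc_ge0.
by rewrite mulrA; apply: ler_pM; rewrite ?normc_ge0.
Qed.

End LazyCharacteristicFunction.

Section BinomialLocalLimit.
Variables (R : realType) (d : nat).
Local Notation X := 'rV[int]_d.

Lemma scaled_gauss_absorb (a : R) : 0 < a -> exists2 C : R, 0 <= C & forall K t : R,
  0 < K -> 0 <= t -> (t + K * t ^+ 3) * expR (- (K * a * t ^+ 2)) <=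
    C / Num.sqrt K * expR (- (K * (a / 2) * t ^+ 2)).
Proof.
move=> a0; have [C1 C10 absorb1] := @exprn_gauss_le R 1 a a0.
have [C3 C30 absorb3] := @exprn_gauss_le R 3 a a0.
exists (C1 + C3) => [|K t K0 t0]; first exact: addr_ge0.
have sK : 0 < Num.sqrt K by rewrite sqrtr_gt0.
set s := Num.sqrt K * t; have s0 : 0 <= s by rewrite mulr_ge0// ltW.
have s2 : s ^+ 2 = K * t ^+ 2 by rewrite exprMn sqr_sqrtr// ltW.
have -> : t + K * t ^+ 3 = (s + s ^+ 3) / Num.sqrt K.
  by rewrite [s ^+ 3]exprS s2 /s; field; rewrite gt_eqF.
rewrite mulrAC [leRHS]mulrAC ler_pM2r ?invr_gt0//.
have -> : K * a * t ^+ 2 = a * s ^+ 2 by rewrite s2; ring.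
have -> : K * (a / 2) * t ^+ 2 = a / 2 * s ^+ 2 by rewrite s2; ring.
by rewrite !mulrDl lerD ?absorb3//; have := absorb1 s s0; rewrite expr1.
Qed.

Lemma binom_blocks_local_limit (L : nat) (del M eps r0 : R) :
  (0 < d)%N -> (0 < L)%N -> 0 < del -> 0 < eps -> 0 <= r0 -> 0 <= M ->
  exists2 C : R, 0 <= C & forall (nu kap : X -> R) (K : nat) x,
    spread_law del M eps nu -> exp_moment_le del M kap -> (0 < K)%N ->
    `|toR R x - (K%:R * L%:R / 2) *: mean nu| <= r0 ->
  `|Num.sqrt K%:R ^+ d * binom_blocks kap nu L K x -
     sumR kap * L%:R * (gauss_const (block_cov L nu) / (2 * pi) ^+ d)| <= C / Num.sqrt K%:R.
Proof.
move=> d0 L0 del0 eps0 r00 M0.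
have [a [c [a0 c0 close]]] := fourier_binom_blocks_close d0 L0 del0 eps0 M0 r00.
have [C' C'0 absorb] := scaled_gauss_absorb a0.
pose b := L%:R / 2 * ((2 / del) ^+ 2 * M) + L%:R ^+ 2 / 4 * (M / del) ^+ 2.
pose M1 := M * L%:R + c * C'; have M10 : 0 <= M1 by rewrite addr_ge0 ?mulr_ge0.
have aQ0 : 0 < eps / (4 * d%:R) by rewrite divr_gt0 ?mulr_gt0 ?ltr0n.
have a20 : 0 < a / 2 by rewrite divr_gt0.
have [C C0 limit] := @local_limit R d _ b _ _ aQ0 a20 M10.
exists C => // nu kap K x nu_law kap_moment K0 x_close; have [nu_moment _ _] := nu_law.
have kap0 := exp_moment_ge0 kap_moment; have nu0 := exp_moment_ge0 nu_moment.
apply: limit => [y|||||th th_pi].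
- exact: binom_blocks_ge0.
- by apply: rsummable_binom_blocks => //;
    [exact: exp_moment_rsummable kap_moment | exact: exp_moment_rsummable nu_moment].
- exact: (qform_bounded_block_cov d0 del0 eps0 nu_law L0).
- by rewrite ler1n.
- rewrite ger0_norm ?mulr_ge0 ?sumR_ge0//; apply: (@le_trans _ _ (M * L%:R)).
    by rewrite ler_wpM2r//; exact: exp_moment_sumR_le kap_moment.
  by rewrite lerDl mulr_ge0.
apply: (le_trans (close nu kap K th x nu_law kap_moment K0 x_close th_pi)).
rewrite -enorm_sqr; apply: (@le_trans _ _ (c * (C' / Num.sqrt K%:R *
  expR (- (K%:R * (a / 2) * enorm th ^+ 2))))).
  by rewrite ler_wpM2l// absorb ?enorm_ge0 ?ltr0n.
rewrite !mulrA ler_wpM2r ?expR_ge0// ler_wpM2r ?invr_ge0 ?sqrtr_ge0//.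
by rewrite lerDr mulr_ge0.
Qed.

End BinomialLocalLimit.

(** * Exponential tilting *)

Section Tilting.
Variables (R : realType) (d : nat).
Local Notation X := 'rV[int]_d.
Local Notation ang th x := (dotp th (toR R x)).
Local Notation l1 := (@l1norm R d).
Implicit Types (f g nu : X -> R) (al be w : 'rV[R]_d) (x : X).

Definition tilt al f x : R := expR (ang al x) * f x.

Lemma tilt_ge0 al f x : (forall x, 0 <= f x) -> 0 <= tilt al f x.
Proof. by move=> f0; rewrite mulr_ge0 ?expR_ge0. Qed.

Lemma tilt0 f : tilt 0 f = f.
Proof. by apply/funext => x; rewrite /tilt dotpC dotp0r expR0 mul1r. Qed.

Lemma tilt_change al be f x : tilt be f x = expR (ang (be - al) x) * tilt al f x.
Proof. by rewrite /tilt mulrA -expRD -dotpDl subrK. Qed.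

Lemma exp_moment_le_dominated (del' del M : R) f g : (forall x, 0 <= f x) ->
  (forall x, expR (del' * l1 x) * f x <= expR (del * l1 x) * g x) ->
  exp_moment_le del M g -> exp_moment_le del' M f.
Proof.
move=> f0 fg [g0 sg gM].
have sf : rsummable (fun x => expR (del' * l1 x) * f x).
  by apply: rsummable_le sg => x; rewrite ger0_norm// mulr_ge0 ?expR_ge0.
by split => //; apply: le_trans gM; exact: le_sumR.
Qed.

Lemma exp_moment_le_weaken (del del' M M' : R) f : 0 <= del' <= del -> M <= M' ->
  exp_moment_le del M f -> exp_moment_le del' M' f.
Proof.
move=> /andP[del'0 del'_le] MM' f_moment; have [f0 _ _] := f_moment.
have [_ sf fM] : exp_moment_le del' M f.
  apply: exp_moment_le_dominated f_moment => // x.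
  by rewrite ler_wpM2r// ler_expR ler_wpM2r// l1norm_ge0.
by split => //; exact: le_trans MM'.
Qed.

Section Perturbation.
Variables (del M : R) (f : X -> R) (al be : 'rV[R]_d).
Hypotheses (del_gt0 : 0 < del) (f_moment : exp_moment_le del M (tilt al f)).
Hypothesis al_be_close : `|be - al| <= del / 4.

Let ang_le x : `|ang (be - al) x| <= del / 4 * l1 x.
Proof. by rewrite (le_trans (norm_dotp_le_l1norm _ _))// ler_wpM2r ?l1norm_ge0. Qed.

Lemma exp_moment_le_tilt : exp_moment_le (del / 2) M (tilt be f).
Proof.
have tilt0 x : 0 <= tilt al f x := exp_moment_ge0 f_moment x.
apply: exp_moment_le_dominated f_moment => x; first by rewrite (tilt_change al) mulr_ge0 ?expR_ge0.
rewrite (tilt_change al be) mulrA -expRD ler_wpM2r// ler_expR.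
have := le_trans (ler_norm _) (ang_le x).
by have : 0 <= del * l1 x by [rewrite mulr_ge0 ?l1norm_ge0// ltW]; lra.
Qed.

Lemma sumR_tilt_lipschitz (q : X -> R) (c : R) : 0 <= c ->
  (forall x, `|q x| <= c * expR (del / 2 * l1 x)) ->
  `|sumR (fun x => q x * tilt be f x) - sumR (fun x => q x * tilt al f x)| <=
  `|be - al| * (c * (4 / del) * M).
Proof.
move=> c0 q_le; have d4 : 0 < del / 4 by rewrite divr_gt0.
have f_moment2 : exp_moment_le (del / 2) M (tilt al f).
  by apply: exp_moment_le_weaken (lexx M) f_moment; lra.
have s_be := exp_moment_rsummable_mul exp_moment_le_tilt q_le.
have s_al := exp_moment_rsummable_mul f_moment2 q_le.
rewrite -sumRB//.
rewrite (eq_sumR (g := fun x => q x * (expR (ang (be - al) x) - 1) * tilt al f x)); last first.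
  by move=> x; rewrite (tilt_change al be); ring.
rewrite mulrA; apply: (exp_moment_sumR_mul_le f_moment).
  by rewrite !mulr_ge0// invr_ge0 ltW.
move=> x; rewrite normrM; have l10 := l1norm_ge0 R x.
have exp_split (t : R) : expR (t + t) = expR t * expR t by rewrite expRD.
have exp_le : `|expR (ang (be - al) x) - 1| <=
    `|be - al| * (4 / del) * expR (del / 2 * l1 x).
  apply: (le_trans (norm_expR_sub1_le _)).
  apply: (@le_trans _ _ (`|be - al| * l1 x * expR (del / 4 * l1 x))).
    by apply: ler_pM; rewrite ?expR_ge0 ?norm_dotp_le_l1norm// ler_expR ang_le.
  have -> : del / 2 * l1 x = del / 4 * l1 x + del / 4 * l1 x by lra.
  rewrite exp_split mulrA ler_wpM2r ?expR_ge0// -mulrA ler_wpM2l//.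
  have := @exprn_le_expR R 1 _ _ d4 l10; rewrite !expr1 => /le_trans; apply.
  by rewrite ler_wpM2r ?expR_ge0// invf_div mul1r.
have -> : `|be - al| * (c * (4 / del)) * expR (del * l1 x) =
   (c * expR (del / 2 * l1 x)) * (`|be - al| * (4 / del) * expR (del / 2 * l1 x)).
  have -> : del * l1 x = del / 2 * l1 x + del / 2 * l1 x by lra.
  by rewrite exp_split; ring.
exact: ler_pM.
Qed.

End Perturbation.

Lemma sqr_expR_le (del t : R) w x : 0 < del -> `|w| <= 1 -> `|t| <= del / 4 ->
  `|(t * ang w x) ^+ 2 * expR `|t * ang w x| | <=
  t ^+ 2 * (8 / del) ^+ 2 * expR (del * l1 x).
Proof.
move=> del0 w1 t_le; have d4 : 0 < del / 4 by rewrite divr_gt0.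
have l10 := l1norm_ge0 R x.
have ang_le : `|ang w x| <= l1 x.
  by rewrite (le_trans (norm_dotp_le_l1norm w x))// ler_piMl.
have tang_le : `|t * ang w x| <= del / 4 * l1 x by rewrite normrM; exact: ler_pM.
rewrite ger0_norm; last by rewrite mulr_ge0 ?sqr_ge0 ?expR_ge0.
apply: (@le_trans _ _ (t ^+ 2 * l1 x ^+ 2 * expR (del / 4 * l1 x))).
  apply: ler_pM; rewrite ?sqr_ge0 ?expR_ge0// ?ler_expR//.
  rewrite exprMn ler_wpM2l ?sqr_ge0// -[_ ^+ 2]real_normK ?num_real//.
  by rewrite lerXn2r ?nnegrE.
rewrite -[leLHS]mulrA -[leRHS]mulrA ler_wpM2l ?sqr_ge0//.
apply: (@le_trans _ _ ((2%:R / (del / 4)) ^+ 2 * expR (del / 4 * l1 x) *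
   expR (del / 4 * l1 x))).
  by rewrite ler_wpM2r ?expR_ge0//; exact: exprn_le_expR.
have -> : 2%:R / (del / 4) = 8 / del by field; rewrite gt_eqF.
rewrite -mulrA ler_wpM2l ?sqr_ge0// -expRD ler_expR.
by have : 0 <= del * l1 x by [rewrite mulr_ge0// ltW]; lra.
Qed.

Lemma sumR_tilt_le_taylor2 (del M : R) f al w (t : R) : 0 < del ->
  exp_moment_le del M (tilt al f) -> `|w| <= 1 -> `|t| <= del / 4 ->
  sumR (tilt (al + t *: w) f) <=
  sumR (tilt al f) + t * dotp w (mean (tilt al f)) + t ^+ 2 * ((8 / del) ^+ 2 * M).
Proof.
move=> del0 f_moment w1 t_le; have f0 := exp_moment_ge0 f_moment.
have close : `|al + t *: w - al| <= del / 4.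
  by rewrite addrC addrA addNr add0r normrZ (le_trans _ t_le)// ler_piMr.
have s2 : rsummable (tilt (al + t *: w) f).
  by apply: (@exp_moment_rsummable _ _ (del / 2) M); [lra | exact: exp_moment_le_tilt close].
have s1 := exp_moment_rsummable del0 f_moment.
have sa : rsummable (fun x => ang w x * tilt al f x) := rsummable_angX del0 f_moment 1 w.
pose q x := (t * ang w x) ^+ 2 * expR `|t * ang w x|.
have q_le x : `|q x| <= t ^+ 2 * (8 / del) ^+ 2 * expR (del * l1 x) by exact: sqr_expR_le.
have c0 : 0 <= t ^+ 2 * (8 / del) ^+ 2 by rewrite mulr_ge0 ?sqr_ge0.
have sq := exp_moment_rsummable_mul f_moment q_le.
have qM := exp_moment_sumR_mul_le f_moment c0 q_le.
rewrite (dotp_mean del0 f_moment) -sumRZ -sumRD//; last exact: rsummableZ.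
rewrite mulrA; apply: le_trans (lerD (lexx _) (le_trans (ler_norm _) qM)).
rewrite -sumRD//; last by apply: rsummableD => //; exact: rsummableZ.
apply: le_sumR => //; first by do 2!apply: rsummableD => //; exact: rsummableZ.
move=> x; rewrite (tilt_change al) addrAC subrr add0r dotpZl /q.
by have := ler_wpM2r (f0 x) (expR_le_quadratic (t * ang w x)); lra.
Qed.

Lemma spread_tilt nu (B : R) : (forall x, 0 < nu x) -> exists2 eps : R, 0 < eps &
  forall al, `|al| <= B -> spread eps (tilt al nu).
Proof.
move=> nu0; pose S := (nu 0)^-1 + \sum_k (nu (delta_mx 0 k))^-1.
have inv0 x : 0 < (nu x)^-1 by rewrite invr_gt0.
have sum0 : 0 <= \sum_(k < d) (nu (delta_mx 0 k))^-1 by apply: sumr_ge0 => k _; exact: ltW.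
have S0 : 0 < S by rewrite ltr_pwDl.
have nu_0 : S^-1 <= nu 0 by rewrite -[leRHS]invrK lef_pV2 ?posrE// lerDl.
have nu_k k : S^-1 <= nu (delta_mx 0 k).
  rewrite -[leRHS]invrK lef_pV2 ?posrE// /S (bigD1 k)//= addrCA lerDl.
  by apply: addr_ge0; [exact: ltW | apply: sumr_ge0 => i _; exact: ltW].
exists (expR (- `|B|) * S^-1); first by rewrite mulr_gt0 ?expR_gt0 ?invr_gt0.
move=> al alB; have exp_le1 : expR (- `|B|) <= 1 by rewrite -(expR0 R) ler_expR oppr_le0.
split=> [|k]; rewrite /tilt.
  by rewrite toR0 dotp0r expR0 mul1r; apply: le_trans nu_0; rewrite ler_piMl// invr_ge0 ltW.
apply: ler_pM; rewrite ?expR_ge0 ?invr_ge0 ?(ltW S0)//.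
rewrite ler_expR dotp_delta lerNl (le_trans (ler_norm _))// normrN.
by rewrite (le_trans (norm_coord_le al k))// (le_trans alB)// ler_norm.
Qed.

End Tilting.

(** * The convex set [phi <= 1] *)

Section Sublevel.
Variables (R : realType) (d : nat).
Local Notation X := 'rV[int]_d.
Local Notation ang th x := (dotp th (toR R x)).
Local Notation l1 := (@l1norm R d).
Implicit Types (f : X -> R) (al be : 'rV[R]_d).

Definition mgf_sublevel (nu : X -> R) : set 'rV[R]_d :=
  [set al | rsummable (tilt al nu) /\ sumR (tilt al nu) <= 1].

Definition exp_moments_on_sublevel nu f := forall al, mgf_sublevel nu al ->
  exists2 del : R, 0 < del & rsummable (fun x => expR (del * l1 x) * tilt al f x).

Lemma continuous_dotp (u : 'rV[R]_d) : continuous (dotp u).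
Proof.
apply: (continuous_big add_continuous) => k _ v.
exact: (continuous_comp (@coord_continuous _ _ _ 0 k v) (@mulrl_continuous R (u 0 k) _)).
Qed.

Lemma continuous_tilt nu x : continuous (fun al => tilt al nu x).
Proof.
rewrite (_ : (fun al => tilt al nu x) = fun al => nu x * expR (dotp (toR R x) al)).
  move=> al; apply: (continuous_comp (f := expR \o dotp (toR R x)) _
    (@mulrl_continuous R (nu x) _)).
  exact: (continuous_comp (@continuous_dotp _ al) (@continuous_expR R _)).
by apply/funext => al; rewrite /tilt dotpC mulrC.
Qed.

Variable nu : X -> R.
Hypothesis nu_gt0 : forall x, 0 < nu x.

Let nu_ge0 x : 0 <= nu x := ltW (nu_gt0 x).

Lemma mgf_sublevelP al : mgf_sublevel nu al <->
  forall s : seq X, uniq s -> \sum_(x <- s) tilt al nu x <= 1.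
Proof.
have tilt0 x : 0 <= tilt al nu x by exact: tilt_ge0.
split=> [[s_tilt tilt_le1] s s_uniq|finite_le1].
  apply: le_trans tilt_le1; rewrite -lee_fin ge0_sumRE// -sumEFin fsbig_seq//.
  by apply: esum_ge; exists [set` s] => //; split => //; exact: finite_seq.
have esum_le1 : (\esum_(x in setT) (tilt al nu x)%:E <= 1%:E)%E.
  apply: ge_ereal_sup => /= _ [A [finA _] <-].
  rewrite fsbig_finite//= sumEFin lee_fin; apply: finite_le1.
  exact: finmap.fset_uniq.
have s_tilt : rsummable (tilt al nu).
  by rewrite rsummable_esum//; exact: le_lt_trans esum_le1 (ltry _).
by split => //; rewrite -lee_fin ge0_sumRE.
Qed.

Lemma mgf_sublevel_closed : closed (mgf_sublevel nu).
Proof.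
have -> : mgf_sublevel nu = \bigcap_(s in [set s : seq X | uniq s])
    ((fun al => \sum_(x <- s) tilt al nu x) @^-1` [set t | t <= 1]).
  by apply/seteqP; split => al /mgf_sublevelP.
apply: closed_bigI => s _; apply: preimage_closed; last exact: closed_le.
move=> al _; apply: (continuous_big add_continuous) => x _; exact: continuous_tilt.
Qed.

Lemma mgf_sublevel_bounded : exists2 B : R, 0 <= B &
  forall al, mgf_sublevel nu al -> `|al| <= B.
Proof.
pose L x : R := `|ln (nu x)|; have L0 x : 0 <= L x := normr_ge0 _.
exists (\sum_k (L (delta_mx 0 k) + L (- delta_mx 0 k))).
  by apply: sumr_ge0 => k _; rewrite addr_ge0.
move=> al [s le1]; apply: norm_rV_le => [|k]; first by apply: sumr_ge0 => k _; rewrite addr_ge0.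
have ang_le x : ang al x <= L x.
  have tilt_le1 : tilt al nu x <= 1.
    by apply: le_trans le1; apply: sumR_ge_term => // y; exact: tilt_ge0.
  have : ang al x + ln (nu x) <= 0 by rewrite -ler_expR expR0 expRD lnK ?posrE.
  by have := ler_norm (- ln (nu x)); rewrite normrN -/(L x); lra.
apply: (@le_trans _ _ (L (delta_mx 0 k) + L (- delta_mx 0 k))); last first.
  by rewrite [leRHS](bigD1 k)//= lerDl sumr_ge0// => j _; rewrite addr_ge0.
have := ang_le (delta_mx 0 k); have := ang_le (- delta_mx 0 k).
rewrite toRN dotpNr dotp_delta => neg_le pos_le.
have := L0 (delta_mx 0 k); have := L0 (- delta_mx 0 k).
by rewrite ler_norml; lra.
Qed.

Lemma mgf_sublevel_compact : compact (mgf_sublevel nu).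
Proof.
have [B B0 bounded] := mgf_sublevel_bounded.
apply: (subclosed_compact mgf_sublevel_closed (B := [set v : 'rV[R]_d |
    forall i, `[(- B), B]%classic (v ord0 i)])).
  by apply: (@rV_compact _ _ (fun=> `[(- B), B]%classic)) => i; exact: segment_compact.
move=> al al_sub i /=; rewrite in_itv /= -ler_norml.
exact: le_trans (norm_coord_le al i) (bounded _ al_sub).
Qed.

Lemma sublevel_uniform_exp_moment f : (forall x, 0 <= f x) ->
  exp_moments_on_sublevel nu f -> exists del M : R,
  [/\ 0 < del, 0 < M & forall al, mgf_sublevel nu al -> exp_moment_le del M (tilt al f)].
Proof.
move=> f0 f_moments; have /compact_near_coveringP cover := mgf_sublevel_compact.
have := cover nat \oo (fun n al => exp_moment_le (n.+1%:R^-1) n.+1%:R (tilt al f)) _.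
case=> [al al_sub|N _ uniform]; last first.
  by exists N.+1%:R^-1, N.+1%:R; split => // al; exact: uniform N (leqnn N) _.
have [del del0 s] := f_moments _ al_sub.
pose S := sumR (fun x => expR (del * l1 x) * tilt al f x).
pose n0 := (Num.truncn (Num.max (2 / del) S)).+1.
have : Num.max (2 / del) S <= n0%:R by apply/ltW; exact: truncnS_gt.
rewrite ge_max => /andP[n0_del n0_S]; have d2 : 0 < del / 2 by rewrite divr_gt0.
exists (ball al (del / 2), [set n | (n0 <= n)%N]).
  by split; [exact: nbhsx_ballx | exists n0].
move=> [be n] /= [be_close n0n].
have n0n1 : n0%:R <= n.+1%:R :> R by rewrite ler_nat leqW.
apply: (@exp_moment_le_weaken _ _ n.+1%:R^-1 _ S); [by rewrite lexx invr_ge0 ler0n|lra|].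
apply: (@exp_moment_le_dominated _ _ _ del _ _ (tilt al f)) => [x|x|].
- exact: tilt_ge0.
- rewrite (tilt_change al be) mulrA -expRD ler_wpM2r ?tilt_ge0// ler_expR.
  have be_le : `|be - al| <= del / 2.
    by move: be_close; rewrite -ball_normE /= distrC => /ltW.
  have := le_trans (ler_norm _) (norm_dotp_le_l1norm (be - al) x).
  have : `|be - al| * l1 x <= del / 2 * l1 x by rewrite ler_wpM2r ?l1norm_ge0.
  have : n.+1%:R^-1 * l1 x <= del / 2 * l1 x.
    rewrite ler_wpM2r ?l1norm_ge0//; have -> : del / 2 = (2 / del)^-1 by rewrite invf_div.
    by rewrite lef_pV2 ?posrE ?divr_gt0// ?ltr0n//; lra.
  by move: (_^-1 * l1 x) => a; lra.
- by split => // x; exact: tilt_ge0.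
Qed.

End Sublevel.

(** * Support points of the convex set *)

Section SupportPoint.
Variables (R : realType) (d : nat).
Local Notation X := 'rV[int]_d.
Local Notation ang th x := (dotp th (toR R x)).
Local Notation phi nu al := (sumR (tilt al nu)).
Variables (nu : X -> R) (del M : R) (al : 'rV[R]_d).
Hypotheses (del_gt0 : 0 < del) (nu_moment : exp_moment_le del M (tilt al nu)).
Local Notation m := (mean (tilt al nu)).
Implicit Types (u w be : 'rV[R]_d).

Let tilt_nu_ge0 x : 0 <= tilt al nu x := exp_moment_ge0 nu_moment x.
Let tilt_summable : rsummable (tilt al nu) := exp_moment_rsummable del_gt0 nu_moment.
Let ang_summable w : rsummable (fun x => ang w x * tilt al nu x) :=
  rsummable_angX del_gt0 nu_moment 1 w.

Let convexity_gap be x :=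
  tilt be nu x - (tilt al nu x + ang (be - al) x * tilt al nu x).

Let convexity_gap_ge0 be x : 0 <= convexity_gap be x.
Proof.
rewrite /convexity_gap subr_ge0 (tilt_change al be).
by have := expR_ge1Dx (ang (be - al) x); have := tilt_nu_ge0 x; nra.
Qed.

Let sumR_convexity_gap be : rsummable (tilt be nu) ->
  sumR (convexity_gap be) = phi nu be - (phi nu al + dotp (be - al) m).
Proof.
move=> s_be; rewrite sumRB//; last exact: rsummableD.
by rewrite sumRD// (dotp_mean del_gt0 nu_moment).
Qed.

Lemma mgf_convex be : rsummable (tilt be nu) ->
  phi nu al + dotp (be - al) m <= phi nu be.
Proof.
move=> s_be; rewrite -subr_ge0 -sumR_convexity_gap//.
by apply: sumR_ge0 => x; exact: convexity_gap_ge0.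
Qed.

Lemma mgf_strongly_convex be (B eps : R) k : 1 <= B -> 0 <= eps ->
  rsummable (tilt be nu) -> `|be - al| <= B -> spread eps (tilt al nu) ->
  phi nu al + dotp (be - al) m + eps / (4 * B) * (be - al) 0 k ^+ 2 <= phi nu be.
Proof.
move=> B1 eps0 s_be be_close [_ /(_ k) atom_k].
set e_k : X := delta_mx 0 k; set D := (be - al) 0 k.
have gap_k : eps / (4 * B) * D ^+ 2 <= convexity_gap be e_k.
  rewrite /convexity_gap (tilt_change al be) dotp_delta -/D.
  have := expR_ge_quadratic B1 (le_trans (norm_coord_le (be - al) k) be_close).
  rewrite -/D; move: atom_k; rewrite -/e_k; set e := expR _; set v := tilt al nu _.
  have -> : eps / (4 * B) * D ^+ 2 = eps * (D ^+ 2 / (4 * B)) by ring.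
  have : 0 <= D ^+ 2 / (4 * B) by rewrite divr_ge0 ?sqr_ge0//; lra.
  move: (D ^+ 2 / (4 * B)) => q q0 v_ge exp_ge.
  have : eps * q <= v * q by rewrite ler_wpM2r.
  have : v * (1 + D + q) <= v * e by rewrite ler_wpM2l// (le_trans eps0).
  lra.
have s_gap : rsummable (convexity_gap be) by apply: rsummableB => //; exact: rsummableD.
have := le_trans gap_k (sumR_ge_term e_k (convexity_gap_ge0 be) s_gap).
by rewrite sumR_convexity_gap//; lra.
Qed.

Variable u : 'rV[R]_d.
Hypotheses (u_sphere : sphere u) (al_sub : mgf_sublevel nu al).
Hypothesis al_max : forall be, mgf_sublevel nu be -> dotp u be <= dotp u al.

Let C := (8 / del) ^+ 2 * M.
Let C_ge0 : 0 <= C.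
Proof. by rewrite mulr_ge0 ?sqr_ge0 ?(exp_moment_bound_ge0 nu_moment). Qed.

Lemma mgf_gt1_outward w (t : R) : `|w| <= 1 -> 0 < dotp u w -> 0 < t <= del / 4 ->
  1 < phi nu al + t * dotp w m + t ^+ 2 * C.
Proof.
move=> w1 uw /andP[t0 td].
have t_le : `|t| <= del / 4 by rewrite gtr0_norm.
apply: lt_le_trans (sumR_tilt_le_taylor2 del_gt0 nu_moment w1 t_le).
have close : `|al + t *: w - al| <= del / 4.
  by rewrite addrC addrA addNr add0r normrZ (le_trans _ t_le)// ler_piMr.
have s_w : rsummable (tilt (al + t *: w) nu).
  apply: (@exp_moment_rsummable _ _ (del / 2) M); first by lra.
  exact: exp_moment_le_tilt close.
rewrite ltNge; apply/negP => le1; have := al_max (conj s_w le1); rewrite dotpDr dotpZr.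
by have : 0 < t * dotp u w by [rewrite mulr_gt0]; lra.
Qed.

Lemma mgf_support_eq1 : phi nu al = 1.
Proof.
apply/eqP; rewrite eq_le (proj2 al_sub) /= leNgt; apply/negP => lt1.
pose g := 1 - phi nu al; have g0 : 0 < g by rewrite subr_gt0.
pose K := `|dotp u m| + C + 1.
have K0 : 0 < K by rewrite ltr_wpDl// addr_ge0.
pose t := Num.min (Num.min (del / 4) 1) (g / K).
have t0 : 0 < t by rewrite !lt_min !divr_gt0// ltr01.
have t1 : t <= 1 by rewrite !ge_min lexx orbT.
have td : t <= del / 4 by rewrite !ge_min lexx.
have tg : t * K <= g by rewrite -ler_pdivlMr// !ge_min lexx orbT.
have := @mgf_gt1_outward u t (sphere_norm_le1 u_sphere).
rewrite sphere_dotp// ltr01 t0 td => /(_ isT isT).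
have : t * dotp u m <= t * `|dotp u m| by rewrite ler_pM2l// ler_norm.
have : t ^+ 2 * C <= t * C by rewrite ler_wpM2r// expr2 ler_piMl// ltW.
by move: tg; rewrite /K /g; lra.
Qed.

Lemma dotp_mean_ge0_outward w : 0 < dotp u w -> 0 <= dotp w m.
Proof.
move=> uw; pose r := `|w| + 1; have r0 : 0 < r by rewrite ltr_wpDl.
pose w' := r^-1 *: w.
have w'1 : `|w'| <= 1.
  by rewrite normrZ gtr0_norm ?invr_gt0// mulrC ler_pdivrMr// mul1r lerDl.
have uw' : 0 < dotp u w' by rewrite dotpZr mulr_gt0// invr_gt0.
suff : 0 <= dotp w' m by rewrite dotpZl pmulr_rge0// invr_gt0.
rewrite leNgt; apply/negP => neg.
pose g := - dotp w' m; have g0 : 0 < g by rewrite oppr_gt0.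
pose t := Num.min (del / 4) (g / (C + 1)).
have C1 : 0 < C + 1 by rewrite ltr_wpDl.
have t0 : 0 < t by rewrite lt_min !divr_gt0.
have td : t <= del / 4 by rewrite ge_min lexx.
have tg : t * (C + 1) <= g by rewrite -ler_pdivlMr// ge_min lexx orbT.
have := mgf_gt1_outward w'1 uw'; move=> /(_ t); rewrite t0 td => /(_ isT).
rewrite mgf_support_eq1 -[dotp w' m]opprK -/g expr2.
have : t * (t * (C + 1)) <= t * g by rewrite ler_pM2l.
by have : 0 <= t * t by [rewrite mulr_ge0// ltW]; lra.
Qed.

(* The linear form [m] is nonnegative on the open half-space of [u], so it is a
   multiple of [u]. *)
Lemma mean_support : m = dotp u m *: u.
Proof.
pose lam := dotp u m; pose p := m - lam *: u.
have up : dotp u p = 0 by rewrite dotpDr dotpNr dotpZr sphere_dotp// mulr1 subrr.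
have mE : m = p + lam *: u by rewrite subrK.
suff p0 : p = 0 by rewrite -/lam {1}mE p0 add0r.
apply: dotp_le0_eq0; apply/ler_addgt0Pr => e e0; rewrite add0r.
have l1 : 0 < `|lam| + 1 by rewrite ltr_wpDl.
pose e' := e / (`|lam| + 1); have e'0 : 0 < e' by rewrite divr_gt0.
have := @dotp_mean_ge0_outward (- p + e' *: u).
rewrite dotpDr dotpNr dotpZr up sphere_dotp// oppr0 add0r mulr1 e'0 => /(_ isT).
have -> : dotp (- p + e' *: u) m = - dotp p p + e' * lam.
  rewrite dotpDl dotpNl dotpZl -/lam mE dotpDr dotpZr (dotpC p u) up mulr0 addr0.
  by [].
have : e' * lam <= e.
  have : e' * (`|lam| + 1) = e by rewrite divfK// gt_eqF.
  by have := ler_norm lam; nra.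
by lra.
Qed.

Lemma support_drift_ge (B : R) al0 : (0 < d)%N -> 0 < B ->
  mgf_sublevel nu al0 -> phi nu al0 < 1 -> `|al0 - al| <= B ->
  (1 - phi nu al0) / (d%:R * B) <= dotp u m.
Proof.
move=> d0 B0 al0_sub al0_lt1 close; have dB : 0 < d%:R * B by rewrite mulr_gt0 ?ltr0n.
have := mgf_convex (proj1 al0_sub).
rewrite mgf_support_eq1 mean_support dotpZr [dotp u (_ *: u)]dotpZr sphere_dotp// mulr1.
set lam := dotp u m => gap_le.
have drop_le : 1 - phi nu al0 <= lam * dotp (al - al0) u.
  by rewrite -[al - al0]opprB dotpNl mulrN; lra.
have dotp_le : `|dotp (al - al0) u| <= d%:R * B.
  rewrite (le_trans (norm_dotp_le _ _))// (u_sphere : enorm u = 1) mulr1 ler_wpM2l//.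
  by rewrite distrC.
have dotp_ge0 : 0 <= dotp (al - al0) u.
  by rewrite dotpC dotpDr dotpNr subr_ge0 al_max.
have lam0 : 0 <= lam.
  rewrite leNgt; apply/negP => lam_lt0.
  by have : lam * dotp (al - al0) u <= 0 by [rewrite nmulr_rle0]; lra.
rewrite ler_pdivrMr//; apply: (le_trans drop_le); rewrite ler_wpM2l//.
exact: le_trans (ler_norm _) dotp_le.
Qed.

End SupportPoint.

Section SupportMap.
Variables (R : realType) (d : nat).
Local Notation X := 'rV[int]_d.
Local Notation phi nu al := (sumR (tilt al nu)).
Implicit Types (nu : X -> R) (c : 'rV[R]_d -> 'rV[R]_d) (u v al be : 'rV[R]_d).

Definition support_drift nu c u : R := dotp u (mean (tilt (c u) nu)).

Record support_map nu c (del M eps lam0 lam1 Lc : R) : Prop := SupportMap {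
  support_pos : [/\ 0 < del <= 1, 0 < M, 0 < eps, 0 < lam0 & 0 <= Lc];
  support_sublevel : forall u, sphere u -> mgf_sublevel nu (c u);
  support_law : forall u, sphere u -> spread_law del M eps (tilt (c u) nu);
  support_mean : forall u, sphere u ->
    mean (tilt (c u) nu) = support_drift nu c u *: u;
  support_drift_bounds : forall u, sphere u -> lam0 <= support_drift nu c u <= lam1;
  support_spread : forall u, sphere u -> forall be, `|be - c u| <= 1 ->
    spread eps (tilt be nu);
  support_lipschitz : forall u v, sphere u -> sphere v ->
    `|c u - c v| <= Lc * `|u - v| }.

Lemma support_map_weaken nu c del M eps lam0 lam1 Lc del' M' :
  0 < del' <= del -> M <= M' ->
  support_map nu c del M eps lam0 lam1 Lc -> support_map nu c del' M' eps lam0 lam1 Lc.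
Proof.
move=> /andP[del'0 del'_le] MM'.
case=> -[/andP[_ del1] M0 eps0 lam00 Lc0] sub law meanE drift_le spr lip.
split=> //.
  by rewrite del'0 (le_trans del'_le) // (lt_le_trans M0 MM').
move=> u su; have [c_moment c_spread c1] := law u su; split => //.
by apply: exp_moment_le_weaken MM' c_moment; rewrite (ltW del'0).
Qed.

Lemma support_point_exists nu : (forall x, 0 < nu x) -> mgf_sublevel nu !=set0 ->
  exists c, forall u, mgf_sublevel nu (c u) /\
    forall be, mgf_sublevel nu be -> dotp u be <= dotp u (c u).
Proof.
move=> nu0 sub_neq0.
suff max_at u : exists al, mgf_sublevel nu al /\
    forall be, mgf_sublevel nu be -> dotp u be <= dotp u al.
  by have [c c_max] := boolp.choice max_at; exists c.
have [al al_sub al_max] := compact_EVT_max sub_neq0 (mgf_sublevel_compact nu0)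
  (continuous_subspaceT (@continuous_dotp _ _ u)).
exists al; rewrite inE in al_sub; split => // be be_sub.
by apply: al_max; rewrite inE.
Qed.

Lemma sqr_norm_rV_le v (r : R) : 0 <= r -> (forall k, v 0 k ^+ 2 <= r) -> `|v| ^+ 2 <= r.
Proof.
move=> r0 v_le; have [-> /[!expr0n]//|] := eqVneq `|v| 0.
have : `|v| <= Num.sqrt r.
  apply: norm_rV_le => [|k]; first exact: sqrtr_ge0.
  by rewrite -sqrtr_sqr ler_wsqrtr.
by rewrite -{2}(sqr_sqrtr r0) => ? _; rewrite lerXn2r ?nnegrE ?sqrtr_ge0.
Qed.

(* Strong convexity of [phi] on the segment from [c u] to [c v], combined with the
   maximality of both points. *)
Lemma support_point_lipschitz nu c (del M eps B lam1 : R) u v :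
  (forall u, mgf_sublevel nu (c u) /\
    forall be, mgf_sublevel nu be -> dotp u be <= dotp u (c u)) ->
  0 < del -> 0 < eps -> 1 <= B -> 0 <= lam1 ->
  exp_moment_le del M (tilt (c u) nu) -> spread eps (tilt (c u) nu) ->
  phi nu (c u) = 1 -> mean (tilt (c u) nu) = support_drift nu c u *: u ->
  0 <= support_drift nu c u <= lam1 -> `|c v - c u| <= B ->
  `|c u - c v| <= lam1 * (d%:R * d%:R) / (eps / (4 * B)) * `|u - v|.
Proof.
move=> c_max del0 eps0 B1 lam10 moment spr one meanE /andP[drift0 drift_le] close.
have [u_sub u_max] := c_max u; have [v_sub v_max] := c_max v.
set kap := eps / (4 * B); have kap0 : 0 < kap by rewrite divr_gt0// mulr_gt0//; lra.
set D := c v - c u; have DN : c u - c v = - D by rewrite opprB.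
pose T := lam1 * (d%:R * d%:R) * `|u - v| * `|D|.
have T0 : 0 <= T by rewrite /T !mulr_ge0.
have coord_le k : D 0 k ^+ 2 <= T / kap.
  rewrite ler_pdivlMr// mulrC.
  have := mgf_strongly_convex del0 moment k B1 (ltW eps0) (proj1 v_sub) close spr.
  rewrite one meanE dotpZr -/D -/kap => strong.
  apply: (@le_trans _ _ (support_drift nu c u * dotp u (c u - c v))).
    have -> : dotp u (c u - c v) = - dotp D u by rewrite DN dotpNr dotpC.
    by rewrite mulrN; have := proj2 v_sub; lra.
  have uv_le : dotp u (c u - c v) <= d%:R * `|u - v| * (d%:R * `|D|).
    have : dotp u (c u - c v) <= dotp (u - v) (c u - c v).
      by rewrite dotpDl dotpNl lerDl oppr_ge0 dotpDr dotpNr subr_le0; exact: v_max.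
    move=> /le_trans; apply; apply: (le_trans (ler_norm _)).
    rewrite DN dotpNr normrN (le_trans (norm_dotp_le _ _))//.
    by rewrite ler_wpM2l ?mulr_ge0// enorm_le_norm.
  have -> : T = lam1 * (d%:R * `|u - v| * (d%:R * `|D|)) by rewrite /T; ring.
  by apply: ler_pM => //; rewrite dotpDr dotpNr subr_ge0; exact: u_max.
have := sqr_norm_rV_le (divr_ge0 T0 (ltW kap0)) coord_le; rewrite DN normrN.
have [->|D0] := eqVneq `|D| 0; first by rewrite !mulr_ge0// invr_ge0 ltW.
have Dp : 0 < `|D| by rewrite lt0r D0 normr_ge0.
rewrite expr2 /T; have -> : lam1 * (d%:R * d%:R) * `|u - v| * `|D| / kap =
  lam1 * (d%:R * d%:R) / kap * `|u - v| * `|D| by ring.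
by rewrite ler_pM2r.
Qed.

Lemma sublevel_uniform_bounds nu : (forall x, 0 < nu x) -> exp_moments_on_sublevel nu nu ->
  exists del M eps B : R, [/\ 0 < del <= 1, 0 < M, 0 < eps, 1 <= B & [/\
    forall al, mgf_sublevel nu al -> exp_moment_le del M (tilt al nu),
    forall al be, mgf_sublevel nu al -> mgf_sublevel nu be -> `|be - al| <= B &
    forall al be, mgf_sublevel nu al -> `|be - al| <= 1 -> spread eps (tilt be nu)]].
Proof.
move=> nu0 nu_moments.
have [del [M [del0 M0 moment]]] :=
  sublevel_uniform_exp_moment nu0 (fun x => ltW (nu0 x)) nu_moments.
have [B B0 bounded] := mgf_sublevel_bounded nu0.
have [eps eps0 spread_near] := spread_tilt (B + 1) nu0.
exists (Num.min del 1), M, eps, (2 * B + 1); split=> //; first 2 last.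
- split=> [al al_sub|al be al_sub be_sub|al be al_sub be_close].
  + apply: exp_moment_le_weaken (lexx M) (moment _ al_sub).
    by rewrite ge_min lexx le_min ler01 (ltW del0).
  + apply: (le_trans (ler_normB _ _)).
    by have := bounded _ al_sub; have := bounded _ be_sub; lra.
  + apply: spread_near; rewrite -(subrK al be).
    by rewrite (le_trans (ler_normD _ _))// addrC lerD// bounded.
- by rewrite lt_min del0 ltr01 ge_min lexx orbT.
- by lra.
Qed.

Lemma support_map_exists nu al0 : (0 < d)%N -> (forall x, 0 < nu x) ->
  exp_moments_on_sublevel nu nu -> mgf_sublevel nu al0 -> phi nu al0 < 1 ->
  exists c del M eps lam0 lam1 Lc, support_map nu c del M eps lam0 lam1 Lc.
Proof.
move=> d0 nu0 nu_moments al0_sub al0_lt1.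
have [c c_max] := support_point_exists nu0 (ex_intro _ al0 al0_sub).
have [del [M [eps [B [del01 M0 eps0 B1 [moment close spr]]]]]] :=
  sublevel_uniform_bounds nu0 nu_moments.
have /andP[del0 _] := del01; have Bp : 0 < B by lra.
have moment_c u := moment _ (proj1 (c_max u)).
have spr_c u : spread eps (tilt (c u) nu).
  by apply: (spr (c u)); [case: (c_max u) | rewrite subrr normr0].
have one u : sphere u -> phi nu (c u) = 1.
  by move=> su; have [? ?] := c_max u; exact: (mgf_support_eq1 del0 (moment_c u) su).
have meanE u : sphere u -> mean (tilt (c u) nu) = support_drift nu c u *: u.
  by move=> su; have [? ?] := c_max u; exact: (mean_support del0 (moment_c u) su).
pose lam0 := (1 - phi nu al0) / (d%:R * B); pose lam1 := M / del.
have lam00 : 0 < lam0 by rewrite divr_gt0 ?subr_gt0 ?mulr_gt0 ?ltr0n.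
have lam10 : 0 < lam1 by rewrite divr_gt0.
have drift_le u : sphere u -> lam0 <= support_drift nu c u <= lam1.
  move=> su; have [cu_sub cu_max] := c_max u; apply/andP; split.
    by apply: (support_drift_ge del0 (moment_c u) su) => //; exact: close.
  apply: (le_trans (ler_norm _)); apply: (le_trans (norm_dotp_mean_le del0 (moment_c u) u)).
  by rewrite (su : enorm u = 1) mul1r mulrC.
have kap0 : 0 < eps / (4 * B) by rewrite divr_gt0 ?mulr_gt0.
exists c, del, M, eps, lam0, lam1, (lam1 * (d%:R * d%:R) / (eps / (4 * B))); split => //.
- by split=> //; rewrite mulr_ge0 ?invr_ge0 ?(ltW kap0)// mulr_ge0 ?(ltW lam10).
- by move=> u su; case: (c_max u).
- by move=> u su; split; [exact: moment_c | exact: spr_c | exact: one].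
- by move=> u su be; apply: spr; case: (c_max u).
move=> u v su sv; have /andP[lam0_le lam_le1] := drift_le u su.
have [cu_sub _] := c_max u; have [cv_sub _] := c_max v.
apply: (support_point_lipschitz c_max del0 eps0 B1 (ltW lam10) (moment_c u)) => //.
- exact: one.
- exact: meanE.
- by rewrite (le_trans (ltW lam00)).
- exact: close.
Qed.

End SupportMap.

(** * Binomial weights *)

Section BinomialWeights.
Variable R : realType.
Implicit Types k j l : nat.
Local Notation p k := (binom_weight R k.*2 k).

Lemma leq_bin_central k j : ('C(k.*2, k + j) <= 'C(k.*2, k))%N.
Proof.
elim: j => [|j IH]; first by rewrite addn0.
apply: leq_trans IH; rewrite addnS -(leq_pmul2l (ltn0Sn (k + j))) mul_bin_left.
by rewrite leq_mul2r; apply/orP; right; rewrite -addnn; lia.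
Qed.

Lemma bin_central_ratio k j : (j <= k)%N ->
  (k%:R + j%:R + 1) * 'C(k.*2, k + j.+1)%:R = (k%:R - j%:R) * 'C(k.*2, k + j)%:R :> R.
Proof.
move=> jk; have := mul_bin_left k.*2 (k + j).
have -> : (k.*2 - (k + j) = k - j)%N by rewrite -addnn; lia.
move=> /(congr1 (fun n : nat => n%:R : R)); rewrite !natrM natrB// addnS => <-.
by rewrite -natr1 natrD.
Qed.

Lemma bin_central_ge k j : (0 < k)%N ->
  (1 - j%:R ^+ 2 / k%:R) * 'C(k.*2, k)%:R <= 'C(k.*2, k + j)%:R :> R.
Proof.
move=> k_gt0; have k0 : 0 < k%:R :> R by rewrite ltr0n.
have C0 : 0 < 'C(k.*2, k)%:R :> R by rewrite ltr0n bin_gt0 -addnn leq_addr.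
elim: j => [|j IH]; first by rewrite addn0 expr0n mul0r subr0 mul1r.
have [kj|jk2] := leP k%:R (j.+1%:R ^+ 2 : R).
  apply: le_trans (ler0n _ _); rewrite pmulr_lle0// subr_le0.
  by rewrite ler_pdivlMr// mul1r.
have jk : (j < k)%N.
  move: jk2; rewrite -natrX ltr_nat; apply: leq_trans.
  by rewrite leqW// -[leqLHS]muln1 leq_mul.
have jkR : j%:R < k%:R :> R by rewrite ltr_nat.
have kj1 : 0 < k%:R + j%:R + 1 :> R by have : 0 <= j%:R :> R by []; lra.
rewrite -(ler_pM2l kj1) (bin_central_ratio (ltnW jk)).
apply: le_trans (ler_wpM2l _ IH); last by rewrite subr_ge0 ltW.
rewrite !mulrA ler_pM2r// -subr_ge0 -natr1.
rewrite (_ : _ - _ = (j%:R ^+ 3 + (j%:R + 1) ^+ 3) / k%:R); last by field; rewrite gt_eqF.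
by rewrite divr_ge0// addr_ge0// exprn_ge0// addr_ge0.
Qed.

Lemma binom_weight_central_bounds k l : (0 < k)%N ->
  (1 - (l%:R - k%:R) ^+ 2 / k%:R) * p k <= binom_weight R k.*2 l <= p k.
Proof.
move=> k_gt0; have pow_ge0 : 0 <= (2 ^+ k.*2)^-1 :> R by rewrite invr_ge0 exprn_ge0.
apply/andP; split; rewrite /binom_weight ?mulrA ler_wpM2r//.
  have [kl|lk] := leqP k l.
    by have := bin_central_ge (l - k) k_gt0; rewrite subnKC// natrB.
  have := bin_central_ge (k - l) k_gt0.
  have -> : (k + (k - l) = k.*2 - l)%N by rewrite -addnn; lia.
  rewrite bin_sub; last by rewrite -addnn; lia.
  by rewrite natrB ?(ltnW lk)// -(sqrrN (k%:R - l%:R)) opprB.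
rewrite ler_nat; have [kl|lk] := leqP k l.
  by rewrite -(subnKC kl); exact: leq_bin_central.
rewrite -bin_sub; last by rewrite -addnn; lia.
have -> : (k.*2 - l = k + (k - l))%N by rewrite -addnn; lia.
exact: leq_bin_central.
Qed.

Lemma binom_weight_central_gt0 k : 0 < p k.
Proof. by rewrite divr_gt0 ?exprn_gt0// ltr0n bin_gt0 -addnn leq_addr. Qed.

Lemma binom_weight_centralS k : p k.+1 * (2 * k%:R + 2) = p k * (2 * k%:R + 1).
Proof.
have : (k.+1 * 'C(k.+1.*2, k.+1) = 2 * k.*2.+1 * 'C(k.*2, k))%N.
  have -> : (k.+1 * 'C(k.+1.*2, k.+1) = k.+1.*2 * 'C(k.*2.+1, k))%N.
    by rewrite -mul_bin_diag doubleS.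
  rewrite -[k.+1.*2]mul2n -!mulnA; congr (2 * _)%N.
  by rewrite [RHS]mul_bin_down; congr (_ * _)%N; rewrite -addnn; lia.
move/(congr1 (fun n : nat => n%:R : R)); rewrite !natrM.
rewrite -[in k.+1%:R](natr1 k) -(natr1 k.*2) -[in k.*2%:R]mul2n natrM.
rewrite /binom_weight doubleS; move: ('C(_, _)%:R) ('C(_, _)%:R) => B B' recurrence.
have -> : 2 ^+ k.*2.+2 = 4 * 2 ^+ k.*2 :> R by rewrite !exprS; ring.
have -> : B' / (4 * 2 ^+ k.*2) * (2 * k%:R + 2) = ((k%:R + 1) * B') / (2 * 2 ^+ k.*2).
  by field; rewrite expf_neq0.
by rewrite recurrence; field; rewrite expf_neq0.
Qed.

Lemma odd_sqr_binom_weight_central_le1 k : (2 * k%:R + 1) * p k ^+ 2 <= 1.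
Proof.
elim: k => [|k IH].
  by rewrite /binom_weight bin0 expr0 divr1 expr1n mulr0 add0r mulr1.
have k0 : 0 <= k%:R :> R by [].
apply: le_trans IH.
have pos : 0 < (2 * k%:R + 2) ^+ 2 :> R by rewrite exprn_gt0//; lra.
rewrite -(ler_pM2r pos) -[leLHS]mulrA -[in leLHS]exprMn binom_weight_centralS.
rewrite (exprMn _ (p k)) -natr1; have := sqr_ge0 (p k); move: (p k ^+ 2) => z z0.
rewrite -subr_ge0 (_ : _ - _ = z * (2 * k%:R + 1)); last by ring.
by rewrite mulr_ge0//; lra.
Qed.

Let scaled k : R := Num.sqrt k.*2%:R * p k.

Let scaled_ge0 k : 0 <= scaled k.
Proof. by rewrite mulr_ge0 ?sqrtr_ge0// ltW ?binom_weight_central_gt0. Qed.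

Let sqr_scaled k : scaled k ^+ 2 = 2 * k%:R * p k ^+ 2.
Proof. by rewrite exprMn sqr_sqrtr// -mul2n natrM. Qed.

Let scaled_nondecreasing : nondecreasing_seq scaled.
Proof.
apply/nondecreasing_seqP => k.
rewrite -(ler_pXn2r (n := 2)) ?nnegrE// !sqr_scaled -natr1.
have k0 : 0 <= k%:R :> R by [].
have pos : 0 < (2 * k%:R + 2) ^+ 2 :> R by rewrite exprn_gt0//; lra.
rewrite -(ler_pM2r pos) -[leRHS]mulrA -[in leRHS]exprMn binom_weight_centralS.
rewrite (exprMn _ (p k)); have := sqr_ge0 (p k); move: (p k ^+ 2) => z z0.
rewrite -subr_ge0 (_ : _ - _ = z * (2 * k%:R + 2)); last by ring.
by rewrite mulr_ge0//; lra.
Qed.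

Let scaled_le1 k : scaled k <= 1.
Proof.
rewrite -(ler_pXn2r (n := 2)) ?nnegrE// sqr_scaled expr1n.
by apply: le_trans (odd_sqr_binom_weight_central_le1 k); rewrite ler_wpM2r ?sqr_ge0// lerDl.
Qed.

(* The limit is [sqrt (2 / pi)] by Wallis' formula, but only its positivity matters. *)
Lemma sqrt_binom_weight_central_cvg : exists2 w : R, 0 < w &
  Num.sqrt k.*2%:R * p k @[k --> \oo] --> w.
Proof.
have bounded : has_ubound (range scaled) by exists 1 => _ [k _ <-].
have scaled_cvg := nondecreasing_is_cvgn scaled_nondecreasing bounded.
exists (limn scaled) => //.
apply: (@lt_le_trans _ _ (scaled 1)); last exact: nondecreasing_cvgn_le.
by rewrite mulr_gt0 ?sqrtr_gt0// binom_weight_central_gt0.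
Qed.

(* With [T] between [L * k] and [L * k.+1], the weight is flat at times [n] within
   [sqrt T] of [T] when [L] is large and [T] much larger. *)
Lemma binom_weight_block_flat (L k n : nat) (T : R) : (0 < L)%N -> (0 < k)%N ->
  1 <= T -> k%:R * L%:R <= T < (k%:R + 1) * L%:R ->
  0 <= 1 - binom_weight R k.*2 (n %/ L)%N / p k <=
    4 * (L%:R^-1 + L%:R / T) * (1 + (n%:R - T) ^+ 2 / T).
Proof.
move=> L_gt0 k_gt0 T1 /andP[kT Tk].
have L0 : 0 < L%:R :> R by rewrite ltr0n.
have T0 : 0 < T by lra.
have k0 : 0 < k%:R :> R by rewrite ltr0n.
have p0 := binom_weight_central_gt0 k.
have /andP[weight_ge weight_le] := binom_weight_central_bounds (n %/ L) k_gt0.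
rewrite subr_ge0 ler_pdivrMr// mul1r weight_le /=.
set l := (n %/ L)%N in weight_ge *; set s := (n%:R - T) / L%:R.
have l_le : l%:R * L%:R <= n%:R :> R by rewrite -natrM ler_nat leq_divM.
have l_ge : n%:R <= (l%:R + 1) * L%:R :> R.
  by rewrite natr1 -natrM ler_nat ltnW// ltn_ceil.
apply: (@le_trans _ _ ((l%:R - k%:R) ^+ 2 / k%:R)).
  by rewrite lerBlDr -lerBlDl ler_pdivlMr.
have sL : s * L%:R = n%:R - T by rewrite divfK// gt_eqF.
have dev_le : `|l%:R - k%:R| <= `|s| + 1.
  have sN : - (`|s| * L%:R) <= s * L%:R by rewrite -mulNr ler_pM2r// lerNl -normrN ler_norm.
  have sP : s * L%:R <= `|s| * L%:R by rewrite ler_pM2r// ler_norm.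
  by rewrite ler_norml; apply/andP; split; rewrite -(ler_pM2r L0); lra.
have sqr_dev_le : (l%:R - k%:R) ^+ 2 <= 2 * s ^+ 2 + 2.
  rewrite -[leLHS]real_normK ?num_real// -[s ^+ 2]real_normK ?num_real//.
  apply: (@le_trans _ _ ((`|s| + 1) ^+ 2)); first by rewrite lerXn2r ?nnegrE ?addr_ge0.
  by have := sqr_ge0 (`|s| - 1); rewrite !expr2; lra.
have k_inv : k%:R^-1 <= 2 * L%:R / T.
  rewrite -[leLHS]mul1r ler_pdivrMr// mulrAC ler_pdivlMr// mul1r.
  have : 1 * L%:R <= k%:R * L%:R :> R by rewrite ler_pM2r// ler1n.
  by lra.
apply: (@le_trans _ _ ((2 * s ^+ 2 + 2) * (2 * L%:R / T))).
  by apply: ler_pM; rewrite ?sqr_ge0 ?invr_ge0// ltW.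
have z0 : 0 <= (n%:R - T) ^+ 2 / T by rewrite divr_ge0 ?sqr_ge0// ltW.
have -> : (2 * s ^+ 2 + 2) * (2 * L%:R / T) =
    4 * (L%:R^-1 * ((n%:R - T) ^+ 2 / T) + L%:R / T).
  by rewrite /s; field; rewrite !gt_eqF.
rewrite -mulrA ler_pM2l//.
have iL0 : 0 <= L%:R^-1 :> R by rewrite invr_ge0 ltW.
have LT0 : 0 <= L%:R / T by rewrite divr_ge0// ltW.
by have := mulr_ge0 LT0 z0; lra.
Qed.

End BinomialWeights.

(** * Gaussian sums in time *)

Section TimeSums.
Variable R : realType.

Lemma sum_gauss_le (a : R) : 0 < a -> exists2 C : R, 0 <= C & forall (T : R) (N : nat), 1 <= T ->
  \sum_(n < N) expR (- (a * ((n%:R - T) ^+ 2 / T))) <= C * Num.sqrt T.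
Proof.
move=> a0; exists (Num.sqrt (2 * pi) / Num.sqrt (2 * a) + 2) => [|T N T1].
  by rewrite addr_ge0// divr_ge0// sqrtr_ge0.
have T0 : 0 < T by lra.
have sT0 : 0 < Num.sqrt T by rewrite sqrtr_gt0.
have sT1 : 1 <= Num.sqrt T by rewrite -[leLHS]sqrtr1 ler_wsqrtr.
pose h := (Num.sqrt T)^-1; have h0 : 0 < h by rewrite invr_gt0.
pose f (k : int) := h * expR (- (2 * a * (h * k%:~R + - Num.sqrt T) ^+ 2) / 2).
have f0 k : 0 <= f k by rewrite mulr_ge0 ?expR_ge0 ?ltW.
have fE n : expR (- (a * ((n%:R - T) ^+ 2 / T))) = f n%:Z * Num.sqrt T.
  rewrite /f [RHS]mulrAC [h * Num.sqrt T]mulVf ?gt_eqF// mul1r; congr expR.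
  have -> : h * n%:Z%:~R + - Num.sqrt T = (n%:R - T) / Num.sqrt T.
    rewrite mulrBl; congr (_ - _); first by rewrite mulrC.
    by rewrite -{2}[T]sqr_sqrtr ?(ltW T0)// expr2 mulfK ?gt_eqF.
  by rewrite expr_div_n sqr_sqrtr ?ltW//; lra.
rewrite (eq_bigr _ (fun (n : 'I_N) _ => fE n)) -mulr_suml ler_wpM2r ?sqrtr_ge0//.
rewrite -lee_fin -sumEFin.
have [|_ sum_le] := andP (@gauss_int_sum_bounds_scaled R (2 * a) h (- Num.sqrt T) _ h0).
  by rewrite mulr_gt0.
apply: (le_trans (esum_nat_ge N (a := fun n => (f n%:Z)%:E) _)) => [n|].
  by rewrite lee_fin.
apply: le_trans (le_trans _ sum_le) _; last first.
  by rewrite lee_fin lerD2l ler_piMr// invf_le1.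
rewrite esum_int; last by move=> k; rewrite lee_fin; exact: f0.
by apply: leeDl; apply: esum_ge0 => k _; rewrite lee_fin; exact: f0.
Qed.

Variable a : R.
Hypothesis a_gt0 : 0 < a.

(* Beyond time [2 T] the exponent dominates both [n - T] and [n]. *)
Lemma quadratic_gauss_term_le : exists C : R, exists2 r : R, 0 <= C /\ 0 < r < 1 &
  forall (T : R) (n : nat), 1 <= T ->
  (1 + (n%:R - T) ^+ 2 / T) * expR (- (a * ((n%:R - T) ^+ 2 / (T + n%:R)))) <=
  C * expR (- (a / 6 * ((n%:R - T) ^+ 2 / T))) + C * r ^+ n.
Proof.
have a6 : 0 < a / 6 by rewrite divr_gt0.
have [C1 C10 absorb1] := exprn_expRN_bounded 1 a6.
have [C2 C20 absorb2] := exprn_expRN_bounded 2 a6.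
pose r := expR (- (a / 12)); have r0 : 0 <= r := expR_ge0 _.
exists (1 + C1 + C2), r => [|T n T1].
  by rewrite !addr_ge0// expR_gt0 -(expR0 R) ltr_expR; split => //; lra.
have T0 : 0 < T by lra.
have n0 : 0 <= n%:R :> R by [].
have Tn : 0 < T + n%:R by lra.
set s := n%:R - T; set z := s ^+ 2; have z0 : 0 <= z by exact: sqr_ge0.
have zT0 : 0 <= z / T by rewrite divr_ge0// ltW.
have split_factor (q t e : R) (C : R) : 0 <= q -> 0 <= t -> 0 <= e ->
    q * expR (- (a / 6 * t)) <= C -> (1 + q) * (expR (- (a / 6 * t)) * e) <= (1 + C) * e.
  move=> q0 t0 e0 qC; rewrite mulrA ler_wpM2r// mulrDl mul1r lerD//.
  by rewrite -[leRHS](expR0 R) ler_expR oppr_le0 mulr_ge0// ltW.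
have [near|far] := leP n%:R (2 * T).
  apply: ler_wpDr; first by rewrite mulr_ge0 ?exprn_ge0 ?addr_ge0.
  have exponent_le : - (a * (z / (T + n%:R))) <= - (a / 6 * (z / T)) + - (a / 6 * (z / T)).
    rewrite -opprD lerN2 -mulrDl (_ : a / 6 + a / 6 = a / 3); last by lra.
    rewrite -mulrA ler_pM2l// mulrCA -invfM ler_wpM2l// lef_pV2 ?posrE ?mulr_gt0//; lra.
  apply: (@le_trans _ _ ((1 + z / T) * (expR (- (a / 6 * (z / T))) * expR (- (a / 6 * (z / T)))))).
    by rewrite ler_wpM2l ?addr_ge0// -expRD ler_expR.
  apply: le_trans (split_factor _ _ _ C1 zT0 zT0 (expR_ge0 _) _) _.
    by have := absorb1 _ zT0; rewrite expr1.
  by rewrite ler_wpM2r ?expR_ge0// lerDl.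
apply: ler_wpDl; first by rewrite mulr_ge0 ?expR_ge0 ?addr_ge0.
have s0 : 0 <= s by rewrite /s; lra.
have exponent_le : - (a * (z / (T + n%:R))) <= - (a / 6 * s) + - (a / 12 * n%:R).
  have : s / 3 <= z / (T + n%:R).
    by rewrite ler_pdivlMr// /z expr2 -mulrA ler_wpM2l// /s; lra.
  have : n%:R / 4 <= s / 2 by rewrite /s; lra.
  rewrite -(ler_pM2l a_gt0) -(ler_pM2l a_gt0 (s / 3)); lra.
apply: (@le_trans _ _ ((1 + z) * (expR (- (a / 6 * s)) * r ^+ n))).
  apply: ler_pM; rewrite ?addr_ge0 ?expR_ge0 ?lerD2l//.
    by rewrite ler_pdivrMr// ler_peMr.
  by rewrite /r -expRM_natr -expRD ler_expR mulNr.
apply: le_trans (split_factor _ _ _ C2 z0 s0 (exprn_ge0 _ r0) (absorb2 _ s0)) _.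
by rewrite ler_wpM2r ?exprn_ge0// addrAC lerDl.
Qed.

Lemma sum_quadratic_gauss_le : exists2 C : R, 0 <= C & forall (T : R) (N : nat), 1 <= T ->
  \sum_(n < N) (1 + (n%:R - T) ^+ 2 / T) * expR (- (a * ((n%:R - T) ^+ 2 / (T + n%:R)))) <=
  C * Num.sqrt T.
Proof.
have [C [r [C0 /andP[r0 r1]] term_le]] := quadratic_gauss_term_le.
have [Cg Cg0 gauss_le] := sum_gauss_le (divr_gt0 a_gt0 (ltr0n R 6)).
exists (C * Cg + C * (1 - r)^-1) => [|T N T1].
  by rewrite addr_ge0 ?mulr_ge0 ?invr_ge0 ?subr_ge0// ltW.
have sT1 : 1 <= Num.sqrt T by rewrite -[leLHS]sqrtr1 ler_wsqrtr.
apply: (le_trans (ler_sum _ (fun (n : 'I_N) _ => term_le T n T1))).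
rewrite big_split/= mulrDl; apply: lerD; first by rewrite -mulr_sumr -mulrA ler_wpM2l// gauss_le.
have := geometric_le_lim N C0 r0 (_ : `|r| < 1); rewrite gtr0_norm// => /(_ r1).
rewrite /series /= big_mkord => /le_trans; apply.
by rewrite ler_peMr// mulr_ge0// invr_ge0 subr_ge0 ltW.
Qed.

End TimeSums.

(** * Tails of the convolution powers *)

Section RealEstimates.
Variable R : realType.
Implicit Types (T a : R) (n : nat).

(* At [n = 0] there is no local decay, hence the [maxn]. *)
Lemma local_scale_gauss_le (d : nat) a : 0 < a -> exists2 C : R, 0 <= C &
  forall T n, 1 <= T ->
  (Num.sqrt (maxn 1 n)%:R ^+ d)^-1 * expR (- (a * ((n%:R - T) ^+ 2 / (T + n%:R)))) <=
  C / Num.sqrt T ^+ d * expR (- (a / 2 * ((n%:R - T) ^+ 2 / (T + n%:R)))).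
Proof.
move=> a0; have a12 : 0 < a / 12 by rewrite divr_gt0.
have [C C0 absorb] := exprn_expRN_bounded d a12.
exists (Num.sqrt 2 ^+ d + C) => [|T n T1]; first by rewrite addr_ge0 ?exprn_ge0 ?sqrtr_ge0.
have T0 : 0 < T by lra.
have n0 : 0 <= n%:R :> R by [].
have sT0 : 0 < Num.sqrt T by rewrite sqrtr_gt0.
set y := (n%:R - T) ^+ 2 / (T + n%:R).
have y0 : 0 <= y by rewrite divr_ge0 ?sqr_ge0// addr_ge0// ltW.
set r := _^-1; have r0 : 0 <= r by rewrite invr_ge0 exprn_ge0 ?sqrtr_ge0.
have -> : - (a * y) = - (a / 2 * y) + - (a / 2 * y) by lra.
rewrite expRD mulrA ler_wpM2r ?expR_ge0// ler_pdivlMr ?exprn_gt0//.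
have e_le1 : expR (- (a / 2 * y)) <= 1.
  by rewrite -[leRHS](expR0 R) ler_expR oppr_le0 mulr_ge0// divr_ge0// ltW.
have [late|early] := leP T (2 * n%:R).
  apply: ler_wpDr => //; apply: (@le_trans _ _ (r * 1 * Num.sqrt T ^+ d)).
    by rewrite ler_wpM2r ?exprn_ge0 ?sqrtr_ge0// ler_wpM2l.
  have n_gt0 : (0 < n)%N by rewrite -(ltr0n R); lra.
  rewrite mulr1 /r (maxn_idPr n_gt0) mulrC ler_pdivrMr ?exprn_gt0 ?sqrtr_gt0 ?ltr0n//.
  rewrite -exprMn lerXn2r ?nnegrE ?mulr_ge0 ?sqrtr_ge0//.
  by rewrite -sqrtrM// ler_wsqrtr.
apply: ler_wpDl; first by rewrite exprn_ge0// sqrtr_ge0.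
have r1 : r <= 1.
  have max1 : 1 <= (maxn 1 n)%:R :> R by rewrite ler1n leq_maxl.
  rewrite invf_le1 ?exprn_gt0 ?sqrtr_gt0 ?(lt_le_trans ltr01 max1)//.
  by rewrite exprn_ege1// -[leLHS]sqrtr1 ler_wsqrtr.
have yT : T / 6 <= y.
  rewrite /y ler_pdivlMr//; last by lra.
  have : 0 <= (T - 2 * n%:R) * (5 * T - 5 * n%:R) by rewrite mulr_ge0//; lra.
  have : 0 <= n%:R * T by rewrite mulr_ge0// ltW.
  nra.
apply: (@le_trans _ _ (expR (- (a / 12 * T)) * T ^+ d)); last by rewrite mulrC absorb// ltW.
apply: ler_pM; rewrite ?mulr_ge0 ?expR_ge0 ?exprn_ge0 ?sqrtr_ge0//.
  rewrite -[leRHS]mul1r; apply: ler_pM => //; rewrite ?expR_ge0// ler_expR lerN2.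
  have : a / 2 * (T / 6) <= a / 2 * y by rewrite ler_wpM2l// divr_ge0// ltW.
  lra.
rewrite lerXn2r ?nnegrE ?sqrtr_ge0 ?(ltW T0)//.
rewrite -[leRHS]sqr_sqrtr ?(ltW T0)// expr2 ler_peMr ?sqrtr_ge0//.
by rewrite -[leLHS]sqrtr1 ler_wsqrtr.
Qed.

Lemma tilted_exponent_le (eta lam0 lam C T t : R) n : 0 <= eta -> 0 <= C -> 0 < T ->
  lam0 <= lam -> eta * C <= lam0 / 2 ->
  t = eta * (T - n%:R) / (T + n%:R) ->
  (t * lam + t ^+ 2 * C) * n%:R - t * (lam * T) <=
  - (eta * lam0 / 2 * ((n%:R - T) ^+ 2 / (T + n%:R))).
Proof.
move=> eta0 C0 T0 lam0_le etaC tE; have n0 : 0 <= n%:R :> R by [].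
have Tn : 0 < T + n%:R by lra.
set y := (n%:R - T) ^+ 2 / (T + n%:R).
have y0 : 0 <= y by rewrite divr_ge0 ?sqr_ge0// ltW.
have -> : (t * lam + t ^+ 2 * C) * n%:R - t * (lam * T) =
    - (eta * y * (lam - eta * C * (n%:R / (T + n%:R)))).
  by rewrite tE /y; field; rewrite gt_eqF.
have ratio1 : n%:R / (T + n%:R) <= 1 by rewrite ler_pdivrMr// mul1r; lra.
have : eta * C * (n%:R / (T + n%:R)) <= lam0 / 2.
  by apply: le_trans etaC; rewrite ler_piMr// mulr_ge0.
move: (eta * C * _) => z z_le.
rewrite lerN2 (_ : eta * lam0 / 2 * y = eta * y * (lam0 / 2)); last by ring.
by apply: ler_wpM2l; [rewrite mulr_ge0 | lra].
Qed.

End RealEstimates.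

Section ConvPowBound.
Variables (R : realType) (d : nat).
Local Notation X := 'rV[int]_d.
Local Notation ang th x := (dotp th (toR R x)).

Lemma tilt_rconv al (f h : X -> R) :
  tilt al (rconv f h) = rconv (tilt al f) (tilt al h).
Proof.
apply/funext => x; rewrite /tilt /rconv -sumRZ; apply: eq_sumR => y.
have -> : expR (ang al x) = expR (ang al y) * expR (ang al (x - y)).
  by rewrite -expRD -dotpDr -toRD addrC subrK.
by rewrite !mulrA; congr (_ * _); rewrite mulrAC.
Qed.

Lemma tilt_conv_pow al (kap nu : X -> R) n :
  tilt al (conv_pow kap nu n) = conv_pow (tilt al kap) (tilt al nu) n.
Proof. by elim: n => //= n <-; exact: tilt_rconv. Qed.

Lemma conv_pow_le (eps M : R) : (0 < d)%N -> 0 < eps -> 0 < M -> exists2 B : R, 0 <= B &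
  forall (kap nu : X -> R) n x, (forall y, 0 <= kap y) -> (forall y, 0 <= nu y) ->
  rsummable kap -> rsummable nu -> sumR kap <= M -> sumR nu <= M -> spread eps nu ->
  conv_pow kap nu n x <= B * sumR nu ^+ n / Num.sqrt (maxn 1 n)%:R ^+ d.
Proof.
move=> d0 eps0 M0; pose q := eps / (64 * d%:R * M).
have q0 : 0 < q by rewrite divr_gt0// !mulr_gt0// ltr0n.
have [C C0 bound] := le_of_fourier_gauss_bound R d.
have Cq0 : 0 <= C * (2 * M) / Num.sqrt q ^+ d.
  by rewrite divr_ge0 ?mulr_ge0 ?exprn_ge0 ?sqrtr_ge0// ltW.
exists (M + C * (2 * M) / Num.sqrt q ^+ d) => [|kap nu n x kap0 nu0 s_kap s_nu kapM nuM nu_spread].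
  by rewrite addr_ge0// ltW.
case: n => [|n].
  rewrite maxn0 sqrtr1 expr1n expr0 mulr1 divr1; apply: ler_wpDr => //.
  by apply: le_trans kapM; exact: sumR_ge_term.
rewrite (maxn_idPr (ltn0Sn n)).
have phi0 : 0 <= sumR nu by exact: sumR_ge0.
have fourier_le th : `|th| <= pi -> normc (fourier (conv_pow kap nu n.+1) th) <=
    2 * M * sumR nu ^+ n.+1 * expR (- (q * n.+1%:R * dotp th th)).
  move=> th_pi; rewrite fourier_conv_pow// normcM -[leRHS]mulrA.
  apply: ler_pM; rewrite ?normc_ge0//.
    by apply: (le_trans (normc_fourier_le _ kap0 s_kap)); rewrite ler_pM2l.
  have -> : sumR nu ^+ n.+1 * expR (- (q * n.+1%:R * dotp th th)) =
      (sumR nu * expR (- (q * dotp th th))) ^+ n.+1.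
    by rewrite exprMn -expRM_natr; congr (_ * expR _); ring.
  rewrite normcX lerXn2r ?nnegrE ?normc_ge0 ?mulr_ge0 ?expR_ge0//.
  by apply: normc_fourier_le_gauss => //; exact: ltW.
have mass0 : 0 <= 2 * M * sumR nu ^+ n.+1 by rewrite !mulr_ge0 ?exprn_ge0// ltW.
have conv0 := conv_pow_ge0 kap0 nu0 n.+1.
have s_conv := rsummable_conv_pow kap0 nu0 s_kap s_nu n.+1.
apply: (le_trans (bound _ _ _ conv0 s_conv mass0 (mulr_gt0 q0 (ltr0Sn R n)) fourier_le x)).
rewrite sqrtrM ?(ltW q0)// exprMn invfM.
rewrite (_ : C * _ * _ = C * (2 * M) / Num.sqrt q ^+ d * sumR nu ^+ n.+1 /
  Num.sqrt n.+1%:R ^+ d); last by ring.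
rewrite ler_wpM2r ?invr_ge0 ?exprn_ge0 ?sqrtr_ge0// ler_wpM2r ?exprn_ge0//.
by rewrite lerDr ltW.
Qed.

Lemma sum_blocks (L K N : nat) (w F : nat -> R) : (0 < L)%N ->
  (forall k, (K < k)%N -> w k = 0) -> (L * K.+1 <= N)%N ->
  \sum_(n < N) w (n %/ L)%N * F n = \sum_(z : 'I_K.+1 * 'I_L) w z.1 * F (L * z.1 + z.2)%N.
Proof.
move=> L0 w0 LN; rewrite -(pair_bigA _ (fun (i : 'I_K.+1) (j : 'I_L) => w i * F (L * i + j)%N))/=.
rewrite -(big_mkord xpredT (fun n => w (n %/ L)%N * F n)).
rewrite (@big_cat_nat _ _ _ (L * K.+1)%N)//= [X in _ + X]big_nat.
rewrite [X in _ + X]big1 => [|n /andP[n_ge _]].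
  rewrite addr0 mulnC big_nat_mul big_mkord; apply: eq_bigr => i _.
  rewrite -{1}[(i * L)%N]add0n big_addn mulSn addnK big_mkord; apply: eq_bigr => j _.
  by rewrite [(L * i)%N]mulnC [(j + _)%N]addnC divnMDl// (divn_small (ltn_ord j)) addn0.
by rewrite w0 ?mul0r// leq_divRL// mulnC.
Qed.

End ConvPowBound.

Section RayTails.
Variables (R : realType) (d : nat).
Local Notation X := 'rV[int]_d.
Local Notation ang th x := (dotp th (toR R x)).
Variables (nu kap : X -> R) (c : 'rV[R]_d -> 'rV[R]_d) (del M eps lam0 lam1 Lc : R).
Hypotheses (d_gt0 : (0 < d)%N) (nu_gt0 : forall x, 0 < nu x).
Hypothesis kap_ge0 : forall x, 0 <= kap x.
Hypothesis supp : support_map nu c del M eps lam0 lam1 Lc.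
Hypothesis kap_moment : forall u, sphere u -> exp_moment_le del M (tilt (c u) kap).
Local Notation lam u := (support_drift nu c u).
Implicit Types (u : 'rV[R]_d) (x : X).

Let del_gt0 : 0 < del. Proof. by case: supp => -[/andP[]]. Qed.

Let nu_moment u : sphere u -> exp_moment_le del M (tilt (c u) nu).
Proof. by move=> su; case: (support_law supp su). Qed.

Lemma conv_pow_tilt_near_le (eta : R) : 0 <= eta <= del / 4 -> exists2 B : R, 0 <= B &
  forall u x (t : R) n, sphere u -> `|t| <= eta ->
  conv_pow (tilt (c u + t *: u) kap) (tilt (c u + t *: u) nu) n x <=
  B * expR (t * lam u + t ^+ 2 * ((8 / del) ^+ 2 * M)) ^+ n / Num.sqrt (maxn 1 n)%:R ^+ d.
Proof.
case/andP=> eta0 eta_del; have [/andP[_ del1] M0 eps0 _ _] := support_pos supp.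
have [B B0 bound] := conv_pow_le d_gt0 eps0 M0.
exists B => // u x t n su t_eta; set be := c u + t *: u.
have be_close : `|be - c u| <= del / 4.
  rewrite /be addrC addrA addNr add0r normrZ (le_trans _ (le_trans t_eta eta_del))//.
  by rewrite ler_piMr// sphere_norm_le1.
have kap_be := exp_moment_le_tilt del_gt0 (kap_moment su) be_close.
have nu_be := exp_moment_le_tilt del_gt0 (nu_moment su) be_close.
have del2 : 0 < del / 2 by rewrite divr_gt0.
have be_spread : spread eps (tilt be nu).
  by apply: (support_spread supp su); apply: (le_trans be_close); have := del_gt0; lra.
have mass_le : sumR (tilt be nu) <= expR (t * lam u + t ^+ 2 * ((8 / del) ^+ 2 * M)).
  have := sumR_tilt_le_taylor2 del_gt0 (nu_moment su) (sphere_norm_le1 su)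
    (le_trans t_eta eta_del).
  have [_ _ ->] := support_law supp su => /le_trans; apply.
  by rewrite -addrA; exact: expR_ge1Dx.
apply: (le_trans (bound _ _ n x (exp_moment_ge0 kap_be) (exp_moment_ge0 nu_be)
  (exp_moment_rsummable del2 kap_be) (exp_moment_rsummable del2 nu_be)
  (exp_moment_sumR_le del2 kap_be) (exp_moment_sumR_le del2 nu_be) be_spread)).
rewrite ler_wpM2r ?invr_ge0 ?exprn_ge0 ?sqrtr_ge0// ler_wpM2l//.
by rewrite lerXn2r ?nnegrE ?expR_ge0// sumR_ge0//; exact: exp_moment_ge0 nu_be.
Qed.

(* Tilting further along the ray by an amount proportional to [(T - n) / (T + n)]
   is what produces the Gaussian factor. *)
Lemma conv_pow_ray_le : exists C a : R, [/\ 0 <= C, 0 < a &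
  forall u x (T : R) n, sphere u -> toR R x = (lam u * T) *: u -> 1 <= T ->
  tilt (c u) (conv_pow kap nu n) x <=
  C / Num.sqrt T ^+ d * expR (- (a * ((n%:R - T) ^+ 2 / (T + n%:R))))].
Proof.
have [/andP[_ del1] M0 eps0 lam00 _] := support_pos supp.
pose C2 := (8 / del) ^+ 2 * M; have C20 : 0 <= C2 by rewrite mulr_ge0 ?sqr_ge0// ltW.
pose eta := Num.min (del / 4) (lam0 / (2 * (C2 + 1))).
have eta0 : 0 < eta by rewrite lt_min !divr_gt0//= mulr_gt0//; lra.
have eta_del : eta <= del / 4 by rewrite ge_min lexx.
have etaC : eta * C2 <= lam0 / 2.
  apply: (@le_trans _ _ (lam0 / (2 * (C2 + 1)) * (C2 + 1))).
    by apply: ler_pM => //; rewrite ?(ltW eta0) ?ge_min ?lexx ?orbT//; lra.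
  by rewrite invfM mulrA divfK// gt_eqF//; lra.
pose a := eta * lam0 / 2; have a0 : 0 < a by rewrite divr_gt0// mulr_gt0.
have [B B0 near_le] : exists2 B : R, 0 <= B & _ :=
  conv_pow_tilt_near_le (introT andP (conj (ltW eta0) eta_del)).
have [C C0 scale_le] := local_scale_gauss_le d a0.
exists (B * C), (a / 2); split; [exact: mulr_ge0 | by rewrite divr_gt0|].
move=> u x T n su xu T1; have T0 : 0 < T by lra.
have n0 : 0 <= n%:R :> R by [].
have Tn : 0 < T + n%:R by lra.
have /andP[lam_ge _] := support_drift_bounds supp su.
pose t := eta * (T - n%:R) / (T + n%:R).
have t_eta : `|t| <= eta.
  rewrite /t -mulrA normrM (gtr0_norm eta0) ler_piMr ?(ltW eta0)//.
  rewrite normrM normfV (gtr0_norm Tn) ler_pdivrMr// mul1r ler_norml; lra.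
have ux : ang u x = lam u * T by rewrite xu dotpZr sphere_dotp// mulr1.
rewrite (tilt_change (c u + t *: u)) opprD addrA subrr add0r dotpNl dotpZl ux tilt_conv_pow.
apply: (le_trans (ler_wpM2l (expR_ge0 _) (near_le u x t n su t_eta))).
set q := t * lam u + t ^+ 2 * C2; set S := Num.sqrt (maxn 1 n)%:R ^+ d.
have -> : expR (- (t * (lam u * T))) * (B * expR q ^+ n / S) =
    B * (S^-1 * expR (q * n%:R - t * (lam u * T))).
  by rewrite (expRD (q * n%:R)) expRM_natr; ring.
rewrite -[leRHS]mulrA -[leRHS]mulrA ler_wpM2l// mulrA; apply: le_trans (scale_le T n T1).
rewrite ler_wpM2l ?invr_ge0 ?exprn_ge0 ?sqrtr_ge0// ler_expR.
exact: (tilted_exponent_le (ltW eta0) C20 T0 lam_ge etaC).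
Qed.

Lemma binom_blocks_compare : exists2 C : R, 0 <= C &
  forall (L k N : nat) u x (T : R), (0 < L)%N -> sphere u ->
  toR R x = (lam u * T) *: u -> 1 <= T -> L%:R <= T ->
  k%:R <= T / L%:R < k.+1%:R -> (L * k.*2.+1 <= N)%N ->
  0 <= \sum_(n < N) tilt (c u) (conv_pow kap nu n) x -
       binom_blocks (tilt (c u) kap) (tilt (c u) nu) L k.*2 x / binom_weight R k.*2 k <=
  C * (Num.sqrt T / Num.sqrt T ^+ d) * (L%:R^-1 + L%:R / T).
Proof.
have [C [a [C0 a0 ray_le]]] := conv_pow_ray_le.
have [Cs Cs0 sum_le] := sum_quadratic_gauss_le a0.
exists (4 * C * Cs) => [|L k N u x T L_gt0 su xu T1 LT /andP[kT Tk] LN].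
  by rewrite !mulr_ge0.
have T0 : 0 < T by lra.
have L0 : 0 < L%:R :> R by rewrite ltr0n.
have k_gt0 : (0 < k)%N.
  case: (k) Tk => // Tk; have : 1 <= T / L%:R by rewrite ler_pdivlMr// mul1r.
  by rewrite leNgt Tk.
have T_block : k%:R * L%:R <= T < (k%:R + 1) * L%:R.
  by rewrite -ler_pdivlMr// -ltr_pdivrMr// natr1 kT.
set b := binom_weight R k.*2 k; pose F n := tilt (c u) (conv_pow kap nu n) x.
have F0 n : 0 <= F n.
  by apply: tilt_ge0 => y; apply: conv_pow_ge0 => // z; exact: ltW.
pose w n := binom_weight R k.*2 (n %/ L)%N / b.
have -> : binom_blocks (tilt (c u) kap) (tilt (c u) nu) L k.*2 x / b = \sum_(n < N) w n * F n.
  rewrite (sum_blocks (w := fun l => binom_weight R k.*2 l / b) F L_gt0 _ LN); last first.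
    by move=> l kl; rewrite /binom_weight bin_small// mul0r mul0r.
  by rewrite /binom_blocks mulr_suml; apply: eq_bigr => z _; rewrite /F tilt_conv_pow mulrAC.
rewrite -[X in X - _]/(\sum_(n < N) F n) -sumrB.
have flat n : 0 <= 1 - w n <= 4 * (L%:R^-1 + L%:R / T) * (1 + (n%:R - T) ^+ 2 / T).
  exact: binom_weight_block_flat.
have FwF n : F n - w n * F n = (1 - w n) * F n by rewrite mulrBl mul1r.
rewrite (eq_bigr _ (fun (n : 'I_N) _ => FwF n)); apply/andP; split.
  by apply: sumr_ge0 => n _; rewrite mulr_ge0//; case/andP: (flat n).
have scale0 : 0 <= C / Num.sqrt T ^+ d by rewrite divr_ge0// exprn_ge0// sqrtr_ge0.
have flat0 : 0 <= 4 * (L%:R^-1 + L%:R / T).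
  by rewrite mulr_ge0// addr_ge0 ?invr_ge0 ?divr_ge0// ltW.
apply: (@le_trans _ _ (4 * (L%:R^-1 + L%:R / T) * (C / Num.sqrt T ^+ d) * (Cs * Num.sqrt T))).
  apply: le_trans (ler_wpM2l _ (sum_le T N T1)); last by rewrite mulr_ge0.
  rewrite mulr_sumr; apply: ler_sum => n _; have /andP[w_le w_ge] := flat n.
  apply: (le_trans (ler_pM w_le (F0 n) w_ge (ray_le _ _ _ n su xu T1))).
  by rewrite le_eqVlt; apply/orP; left; apply/eqP; ring.
by rewrite le_eqVlt; apply/orP; left; apply/eqP; ring.
Qed.

End RayTails.

(** * Continuity on the sphere *)

Section SphereContinuity.
Variable R : realType.

Lemma within_continuous_lipschitz (V W : normedModType R) (A : set V) (f : V -> W) (rho K : R) :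
  0 < rho -> 0 <= K ->
  (forall u v, A u -> A v -> `|u - v| <= rho -> `|f u - f v| <= K * `|u - v|) ->
  {within A, continuous f}.
Proof.
move=> rho0 K0 f_lipschitz; apply/subspace_continuousP => u Au.
apply/cvgrPdist_le => e e0; have K1 : 0 < K + 1 by lra.
have r0 : 0 < Num.min rho (e / (K + 1)) by rewrite lt_min rho0 divr_gt0.
apply: filterS (nbhsx_ballx u _ r0) => v + Av.
rewrite -ball_normE /= lt_min => /andP[/ltW uv_rho uv_e].
apply: (le_trans (f_lipschitz u v Au Av uv_rho)).
by move: uv_e; rewrite ltr_pdivlMr//; have := normr_ge0 (u - v); nra.
Qed.

Lemma continuous_det (T : topologicalType) n (F : T -> 'M[R]_n) :
  (forall i j, continuous (fun t => F t i j)) -> continuous (fun t => \det (F t)).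
Proof.
move=> F_cont; apply: (continuous_big add_continuous) => s _ t.
apply: cvgM; first exact: cvg_cst.
by apply: (continuous_big mul_continuous) => i _; exact: F_cont.
Qed.

Variable d : nat.
Implicit Types u v : 'rV[R]_d.

Lemma sphere_compact : compact (@sphere R d).
Proof.
have sphere_closed : closed (@sphere R d).
  have -> : @sphere R d = (fun v => dotp v v) @^-1` [set 1].
    apply/seteqP; split => u /=; first exact: sphere_dotp.
    by rewrite -enorm_sqr => /eqP; rewrite sqrp_eq1 ?enorm_ge0// => /eqP.
  apply: preimage_closed; last exact: closed_eq.
  move=> v _; apply: (continuous_big add_continuous) => k _ w.
  exact: (continuous_comp (@coord_continuous _ _ _ 0 k w) (@exprn_continuous R 2 _)).
apply: (subclosed_compact sphere_closed (B := [set v : 'rV[R]_d |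
    forall i, `[(-1 : R), 1]%classic (v ord0 i)])).
  by apply: (@rV_compact _ _ (fun=> `[(-1 : R), 1]%classic)) => i; exact: segment_compact.
move=> u su i /=; rewrite in_itv /= -ler_norml.
exact: le_trans (norm_coord_le u i) (sphere_norm_le1 su).
Qed.

Lemma sphere_continuous_bounds (f : 'rV[R]_d -> R) : (0 < d)%N ->
  {within @sphere R d, continuous f} -> (forall u, sphere u -> 0 < f u) ->
  exists C1 C2 : R, [/\ 0 < C1, 0 < C2 & forall u, sphere u -> C1 <= f u <= C2].
Proof.
move=> d0 f_cont f0.
have [a aS amin] := @compact_EVT_min _ R f _ (sphere_neq0 R d0) sphere_compact f_cont.
have [b bS bmax] := @compact_EVT_max _ R f _ (sphere_neq0 R d0) sphere_compact f_cont.
rewrite !inE in aS bS.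
exists (f a), (f b); split; [exact: f0 | exact: f0 |] => u su.
by rewrite amin ?bmax ?inE.
Qed.

End SphereContinuity.

(** * The Green kernel of a walk along its drift *)

Section TimeBlocks.
Variable R : realType.
Local Notation b k := (Num.sqrt k.*2%:R * binom_weight R k.*2 k).

Lemma block_index_bounds (L k : nat) (T : R) : (0 < L)%N -> (0 < k)%N ->
  k%:R <= T / L%:R < k.+1%:R ->
  L%:R / 2 <= T / k.*2%:R <= L%:R / 2 * (1 + 2 * harmonic k).
Proof.
move=> L_gt0 k_gt0 /andP[]; have L0 : 0 < L%:R :> R by rewrite ltr0n.
have k1 : 1 <= k%:R :> R by rewrite ler1n.
have kkE : k.*2%:R = 2 * k%:R :> R by rewrite -mul2n natrM.
rewrite ler_pdivlMr// ltr_pdivrMr// /harmonic /= -natr1 kkE => kT Tk; apply/andP; split.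
  by rewrite ler_pdivlMr; lra.
rewrite ler_pdivrMr; last by lra.
have -> : L%:R / 2 * (1 + 2 * (k%:R + 1)^-1) * (2 * k%:R) =
    L%:R * (k%:R + 2 * (k%:R / (k%:R + 1))) :> R by field; lra.
have : 1 <= 2 * (k%:R / (k%:R + 1)) :> R by rewrite mulrA ler_pdivlMr; lra.
by nra.
Qed.

Lemma block_count_cvg (w : R) (n L : nat) (e : R) : 0 < w -> b k @[k --> \oo] --> w ->
  (0 < L)%N -> 0 < e ->
  \forall k \near \oo, forall T : R, k%:R <= T / L%:R < k.+1%:R ->
  `|Num.sqrt T ^+ n / Num.sqrt k.*2%:R ^+ n / b k - Num.sqrt (L%:R / 2) ^+ n / w| <= e.
Proof.
move=> w0 b_cvg L_gt0 e0; have L20 : 0 <= L%:R / 2 :> R by rewrite divr_ge0.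
have bV_cvg : (b k)^-1 @[k --> \oo] --> w^-1 by apply: cvgV => //; rewrite gt_eqF.
pose upper k := Num.sqrt (L%:R / 2 * (1 + 2 * harmonic k)) ^+ n / b k.
have lower_cvg : Num.sqrt (L%:R / 2) ^+ n / b k @[k --> \oo] --> Num.sqrt (L%:R / 2) ^+ n / w.
  by apply: cvgM bV_cvg; exact: cvg_cst.
have upper_cvg : upper k @[k --> \oo] --> Num.sqrt (L%:R / 2) ^+ n / w.
  apply: cvgM bV_cvg.
  have sqrt_cvg :
      Num.sqrt (L%:R / 2 * (1 + 2 * harmonic k)) @[k --> \oo] --> Num.sqrt (L%:R / 2 : R).
    apply: continuous_cvg; first exact: sqrt_continuous.
    rewrite -[X in _ --> X]mulr1; apply: cvgM; first exact: cvg_cst.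
    rewrite -[X in _ --> X]addr0; apply: cvgD; first exact: cvg_cst.
    by rewrite -[X in _ --> X](mulr0 2); apply: cvgM cvg_harmonic; exact: cvg_cst.
  exact: (cvg_comp _ _ sqrt_cvg (@exprn_continuous R n _)).
have /cvgrPdist_le/(_ e e0) lower_close := lower_cvg.
have /cvgrPdist_le/(_ e e0) upper_close := upper_cvg.
near=> k => T kT; have k_gt0 : (0 < k)%N by near: k; exact: nbhs_infty_gt.
have kk0 : 0 < k.*2%:R :> R by rewrite ltr0n double_gt0.
have b0 : 0 <= (b k)^-1 by rewrite invr_ge0 mulr_ge0 ?sqrtr_ge0 ?binom_weight_ge0.
have /andP[T_ge T_le] := block_index_bounds L_gt0 k_gt0 kT.
have T0 : 0 <= T by rewrite -(pmulr_lge0 _ (x := k.*2%:R^-1)) ?invr_gt0// (le_trans L20).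
have -> : Num.sqrt T ^+ n / Num.sqrt k.*2%:R ^+ n = Num.sqrt (T / k.*2%:R) ^+ n.
  by rewrite sqrtrM// exprMn sqrtrV ?(ltW kk0)// exprVn.
have between h h' : h <= h' -> Num.sqrt h ^+ n / b k <= Num.sqrt h' ^+ n / b k.
  move=> hh'; rewrite ler_wpM2r// lerXn2r ?nnegrE ?sqrtr_ge0//.
  by rewrite ler_wsqrtr.
have := between _ _ T_ge; have := between _ _ T_le.
have : `|Num.sqrt (L%:R / 2) ^+ n / w - Num.sqrt (L%:R / 2) ^+ n / b k| <= e by near: k.
have : `|Num.sqrt (L%:R / 2) ^+ n / w - upper k| <= e by near: k.
rewrite /upper !ler_norml; lra.
Unshelve. all: by end_near. Qed.

Lemma block_index_exists (L : nat) (P : set nat) : (0 < L)%N -> (\forall k \near \oo, P k) ->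
  exists2 T0 : R, 0 < T0 & forall T, T0 <= T -> exists k : nat,
  [/\ 1 <= T, L%:R <= T, L%:R / T <= L%:R^-1, k%:R <= T / L%:R < k.+1%:R & P k].
Proof.
move=> L_gt0 [k0 _ P_k]; have L1 : 1 <= L%:R :> R by rewrite ler1n.
have L0 : 0 < L%:R :> R by lra.
have k0_ge0 : 0 <= k0%:R :> R by [].
exists (L%:R ^+ 2 + L%:R * k0%:R) => [|T T0T].
  by rewrite ltr_pwDl ?exprn_gt0// mulr_ge0// ltW.
have Lk0 : 0 <= L%:R * k0%:R :> R by rewrite mulr_ge0// ltW.
have L2T : L%:R ^+ 2 <= T by lra.
have LL : L%:R <= L%:R ^+ 2 :> R by rewrite expr2 ler_peMr// ltW.
have Tp : 0 < T by lra.
have kT : (Num.truncn (T / L%:R))%:R <= T / L%:R < (Num.truncn (T / L%:R)).+1%:R.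
  by apply: Num.Theory.truncn_itv; rewrite divr_ge0// ltW.
exists (Num.truncn (T / L%:R)); move: (Num.truncn _) kT => k kT; split => //; try lra.
  by rewrite ler_pdivrMr// -ler_pdivrMl ?invr_gt0// invrK -expr2.
apply: P_k; rewrite /= -ltnS -(ltr_nat R); apply: le_lt_trans (proj2 (andP kT)).
by rewrite ler_pdivlMr// mulrC; have := sqr_ge0 (L%:R : R); lra.
Qed.

End TimeBlocks.

Section BlockCovariance.
Variables (R : realType) (d : nat) (nu : 'rV[int]_d -> R).

Lemma det_block_cov (L : nat) : (0 < L)%N -> cov nu \in unitmx ->
  \det (block_cov L nu) = (L%:R / 2) ^+ d.+1 *
    (\det (bordered_mx (cov nu) (mean nu)) + 2 * \det (cov nu) / L%:R).
Proof.
move=> L_gt0 cov_unit; have L0 : 0 < L%:R :> R by rewrite ltr0n.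
have -> : block_cov L nu =
    (L%:R / 2) *: (cov nu + (L%:R / 2) *: ((mean nu)^T *m mean nu)).
  by rewrite [RHS]scalerDr scalerA; congr (_ + _ *: _); field.
by rewrite detZ det_add_rank1// exprS; field; rewrite gt_eqF.
Qed.

End BlockCovariance.

Definition ray_asymptotics (R : realType) d (c : 'rV[R]_d -> 'rV[R]_d)
    (F : nat -> 'rV[int]_d -> R) (chi : 'rV[R]_d -> R) : Prop :=
  forall e : R, 0 < e -> exists2 r0 : R, 0 < r0 &
  forall u x (r : R), sphere u -> toR R x = r *: u -> r0 <= r ->
  \forall N \near \oo,
    `|Num.sqrt r ^+ d.-1 * (\sum_(n < N) tilt (c u) (F n) x) - chi u| <= e.

Section WalkAsymptotics.
Variables (R : realType) (d : nat).
Local Notation X := 'rV[int]_d.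
Variables (nu kap : X -> R) (c : 'rV[R]_d -> 'rV[R]_d) (del M eps lam0 lam1 Lc : R).
Hypotheses (d_gt0 : (0 < d)%N) (nu_gt0 : forall x, 0 < nu x) (kap_gt0 : forall x, 0 < kap x).
Hypothesis supp : support_map nu c del M eps lam0 lam1 Lc.
Hypothesis kap_moment : forall u, sphere u -> exp_moment_le del M (tilt (c u) kap).
Local Notation lam u := (support_drift nu c u).
Local Notation mass u := (sumR (tilt (c u) kap)).
Local Notation m u := (mean (tilt (c u) nu)).
Local Notation S u := (cov (tilt (c u) nu)).
Implicit Types (f q : X -> R) (u v : 'rV[R]_d) (x : X).

Let kap_ge0 x : 0 <= kap x := ltW (kap_gt0 x).

Let del_gt0 : 0 < del. Proof. by case: supp => -[/andP[]]. Qed.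

Let del2_gt0 : 0 < del / 2. Proof. by rewrite divr_gt0. Qed.

Let M_gt0 : 0 < M. Proof. by case: supp => -[]. Qed.

Let nu_moment u : sphere u -> exp_moment_le del M (tilt (c u) nu).
Proof. by move=> su; case: (support_law supp su). Qed.

Let lam_gt0 u : sphere u -> 0 < lam u.
Proof.
move=> su; have [_ _ _ lam00 _] := support_pos supp.
by have /andP[+ _] := support_drift_bounds supp su; exact: lt_le_trans.
Qed.

Lemma within_continuous_sumR_tilt f q (cq : R) :
  (forall u, sphere u -> exp_moment_le del M (tilt (c u) f)) ->
  0 <= cq -> (forall x, `|q x| <= cq * expR (del / 2 * l1norm R x)) ->
  {within @sphere R d, continuous (fun u => sumR (fun x => q x * tilt (c u) f x))}.
Proof.
move=> f_moment cq0 q_le; have [_ _ _ _ Lc0] := support_pos supp.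
have Lc1 : 0 < Lc + 1 by lra.
have K0 : 0 <= cq * (4 / del) * M by rewrite !mulr_ge0 ?invr_ge0// ltW.
apply: (@within_continuous_lipschitz _ _ _ _ _ (del / 4 / (Lc + 1)) (Lc * (cq * (4 / del) * M))).
- by rewrite !divr_gt0.
- exact: mulr_ge0.
move=> u v su sv; rewrite ler_pdivlMr// => uv_le.
have c_le := support_lipschitz supp su sv.
have c_close : `|c u - c v| <= del / 4 by have := normr_ge0 (u - v); lra.
apply: (le_trans (sumR_tilt_lipschitz del_gt0 (f_moment v sv) c_close cq0 q_le)).
by rewrite [leRHS]mulrAC ler_wpM2r.
Qed.

Lemma within_continuous_mass : {within @sphere R d, continuous (fun u => mass u)}.
Proof.
have -> : (fun u => mass u) = (fun u => sumR (fun x => 1 * tilt (c u) kap x)).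
  by apply/funext => u; rewrite sumRZ mul1r.
apply: (within_continuous_sumR_tilt kap_moment ler01) => x; rewrite normr1 mul1r.
by rewrite -[leLHS](expR0 R) ler_expR mulr_ge0 ?l1norm_ge0// ltW.
Qed.

Lemma within_continuous_mean k : {within @sphere R d, continuous (fun u => m u 0 k)}.
Proof.
have -> : (fun u => m u 0 k) = (fun u => sumR (fun x : X => (x 0 k)%:~R * tilt (c u) nu x)).
  by apply/funext => u; rewrite mxE.
apply: (within_continuous_sumR_tilt (cq := 1 / (del / 2)) nu_moment).
  by rewrite divr_ge0// ltW.
move=> x; apply: (le_trans (norm_coord_le_l1norm _ _ _)).
by have := exprn_le_expR 1 del2_gt0 (l1norm_ge0 R x); rewrite !expr1.
Qed.

Lemma within_continuous_cov i j : {within @sphere R d, continuous (fun u => S u i j)}.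
Proof.
pose s u := sumR (fun x : X => (x 0 i)%:~R * (x 0 j)%:~R * tilt (c u) nu x).
have s_cont : {within @sphere R d, continuous s}.
  apply: (within_continuous_sumR_tilt (cq := (2 / (del / 2)) ^+ 2) nu_moment).
    exact: sqr_ge0.
  move=> x; apply: le_trans (exprn_le_expR 2 del2_gt0 (l1norm_ge0 R x)).
  by rewrite normrM expr2; apply: ler_pM => //; exact: norm_coord_le_l1norm.
have -> : (fun u => S u i j) = (fun u => s u - m u 0 i * m u 0 j).
  apply/funext => u; rewrite /cov mxE [X in X + _]mxE [X in _ + X]mxE [X in - X]mxE.
  by rewrite big_ord1 [X in X * _]mxE.
move=> u; apply: cvgB; first exact: s_cont.
by apply: cvgM; exact: within_continuous_mean.
Qed.

Lemma within_continuous_det_cov : {within @sphere R d, continuous (fun u => \det (S u))}.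
Proof. by apply: continuous_det => i j; exact: within_continuous_cov. Qed.

Lemma within_continuous_det_bordered :
  {within @sphere R d, continuous (fun u => \det (bordered_mx (S u) (m u)))}.
Proof.
apply: continuous_det => i j.
case: (split_ordP i) => i' ->; case: (split_ordP j) => j' ->.
- rewrite (_ : (fun u => _) = cst 0); first exact: cst_continuous.
  by apply/funext => u; rewrite block_mxEul mxE.
- rewrite (_ : (fun u => _) = fun u => - m u 0 j').
    by move=> u; apply: cvgN; exact: within_continuous_mean.
  by apply/funext => u; rewrite block_mxEur mxE ord1.
- rewrite (_ : (fun u => _) = fun u => m u 0 i'); first exact: within_continuous_mean.
  by apply/funext => u; rewrite block_mxEdl mxE ord1.
- rewrite (_ : (fun u => _) = fun u => S u i' j'); first exact: within_continuous_cov.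
  by apply/funext => u; rewrite block_mxEdr.
Qed.

Lemma within_continuous_drift : {within @sphere R d, continuous (support_drift nu c)}.
Proof.
apply: (continuous_big add_continuous) => k _ u; apply: cvgM.
  exact: (continuous_subspaceT (@coord_continuous _ _ _ 0 k)).
exact: within_continuous_mean.
Qed.

Lemma qform_bounded_support_cov u : sphere u ->
  0 < eps / (2 * d%:R) /\ qform_bounded (eps / (2 * d%:R)) ((2 / del) ^+ 2 * M) (S u).
Proof.
move=> su; have [_ _ eps0 _ _] := support_pos supp.
by split; [rewrite divr_gt0 ?mulr_gt0 ?ltr0n |
  exact: (qform_bounded_cov d_gt0 del_gt0 eps0 (support_law supp su))].
Qed.

Lemma det_support_cov_gt0 u : sphere u -> 0 < \det (S u).
Proof.
move=> su; have [a0 bounded] := qform_bounded_support_cov su.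
exact: qform_bounded_det_gt0 bounded.
Qed.

Lemma det_bordered_support_gt0 u : sphere u -> 0 < \det (bordered_mx (S u) (m u)).
Proof.
move=> su; have [a0 bounded] := qform_bounded_support_cov su.
apply: (det_bordered_mx_gt0 a0 bounded); rewrite (support_mean supp su) scaler_eq0 negb_or.
rewrite gt_eqF ?lam_gt0//=; apply/eqP => u0.
by move: (sphere_dotp su); rewrite u0 dotp0r => /esym/eqP; rewrite oner_eq0.
Qed.

Section RayDensity.
Variable w : R.
Hypotheses (w_gt0 : 0 < w)
  (w_cvg : Num.sqrt k.*2%:R * binom_weight R k.*2 k @[k --> \oo] --> w).

Let gauss_factor : R := 2 * (Num.sqrt (2 * pi) ^+ d / (2 * pi) ^+ d) / w.

Let block_ratio L : R := Num.sqrt (L%:R / 2) ^+ d.-1 / w.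

Let block_density L u : R :=
  mass u * L%:R * (gauss_const (block_cov L (tilt (c u) nu)) / (2 * pi) ^+ d).

Definition ray_density u : R :=
  mass u * gauss_factor / Num.sqrt (\det (bordered_mx (S u) (m u))).

Let gauss_factor_gt0 : 0 < gauss_factor.
Proof. by rewrite divr_gt0// mulr_gt0// divr_gt0 ?exprn_gt0 ?sqrtr_gt0 ?mulr_gt0 ?pi_gt0. Qed.

Let block_ratio_gt0 L : (0 < L)%N -> 0 < block_ratio L.
Proof. by move=> L0; rewrite divr_gt0// exprn_gt0// sqrtr_gt0 divr_gt0 ?ltr0n. Qed.

Let mass_gt0 u : sphere u -> 0 < mass u.
Proof.
move=> su; have s := exp_moment_rsummable del_gt0 (kap_moment su).
apply: lt_le_trans (@sumR_ge_term _ _ _ 0 _ s); first by rewrite mulr_gt0 ?expR_gt0.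
by move=> x; exact: tilt_ge0.
Qed.

Let mass_le u : sphere u -> mass u <= M.
Proof. by move=> su; exact: (exp_moment_sumR_le del_gt0 (kap_moment su)). Qed.

Lemma within_continuous_ray_density : {within @sphere R d, continuous ray_density}.
Proof.
apply/subspace_continuousP => u su.
apply: cvgM.
  apply: cvgM; last exact: cvg_cst.
  exact: (subspace_continuousP _ _).1 within_continuous_mass u su.
apply: cvgV; first by rewrite gt_eqF// sqrtr_gt0 det_bordered_support_gt0.
apply: continuous_cvg; first exact: sqrt_continuous.
exact: (subspace_continuousP _ _).1 within_continuous_det_bordered u su.
Qed.

Lemma ray_density_gt0 u : sphere u -> 0 < ray_density u.
Proof.
by move=> su; rewrite divr_gt0 ?sqrtr_gt0 ?det_bordered_support_gt0// mulr_gt0// mass_gt0.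
Qed.

Lemma block_densityE (L : nat) u : (0 < L)%N -> sphere u ->
  block_ratio L * block_density L u = mass u * gauss_factor /
    Num.sqrt (\det (bordered_mx (S u) (m u)) + 2 * \det (S u) / L%:R).
Proof.
move=> L_gt0 su; have L0 : 0 < L%:R :> R by rewrite ltr0n.
have det0 := det_support_cov_gt0 su.
set D := \det (bordered_mx (S u) (m u)) + 2 * \det (S u) / L%:R.
have D0 : 0 < Num.sqrt D.
  by rewrite sqrtr_gt0 addr_gt0 ?det_bordered_support_gt0// divr_gt0// mulr_gt0.
rewrite /block_ratio /block_density /gauss_factor /gauss_const det_block_cov//; last first.
  by rewrite unitmxE unitfE gt_eqF.
rewrite [Num.sqrt (_ ^+ d.+1 * _)]sqrtrM ?exprn_ge0 ?divr_ge0// sqrtrX ?divr_ge0//.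
set h := Num.sqrt (L%:R / 2); have h0 : 0 < h by rewrite sqrtr_gt0 divr_gt0.
have LE : L%:R = 2 * (h * h) by rewrite -expr2 sqr_sqrtr ?divr_ge0//; field.
have -> : h ^+ d.+1 = h * h * h ^+ d.-1 by rewrite exprS -{1}(prednK d_gt0) exprS mulrA.
have pow_h : 0 < h ^+ d.-1 by rewrite exprn_gt0.
have pow_pi : 0 < (2 * pi) ^+ d :> R by rewrite exprn_gt0// mulr_gt0// pi_gt0.
by rewrite -/D LE; field; rewrite !gt_eqF.
Qed.

(* [block_ratio L * block_density L] is the density obtained from blocks of length [L];
   its error comes from the variance of the block lengths, hence the rate [1 / L]. *)
Lemma block_density_close : exists2 C : R, 0 <= C & forall (L : nat) u, (0 < L)%N ->
  sphere u -> `|block_ratio L * block_density L u - ray_density u| <= C / L%:R.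
Proof.
have [E0 [E1 [E0_gt0 _ det_ge]]] := sphere_continuous_bounds d_gt0
  within_continuous_det_bordered det_bordered_support_gt0.
have [D0 [D1 [_ D1_gt0 cov_le]]] := sphere_continuous_bounds d_gt0
  within_continuous_det_cov det_support_cov_gt0.
pose P := M * gauss_factor; have P0 : 0 <= P by rewrite mulr_ge0// ltW.
have E0' : 0 < E0 * Num.sqrt E0 by rewrite mulr_gt0 ?sqrtr_gt0.
exists (P * (2 * D1) / (E0 * Num.sqrt E0)) => [|L u L_gt0 su].
  by rewrite divr_ge0 ?(ltW E0')// mulr_ge0// mulr_ge0// ltW.
have L0 : 0 < L%:R :> R by rewrite ltr0n.
have /andP[E0_le _] := det_ge u su; have /andP[_ D1_ge] := cov_le u su.
have z0 : 0 <= 2 * \det (S u) / L%:R.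
  by rewrite !mulr_ge0 ?invr_ge0 ?(ltW L0)// ltW ?det_support_cov_gt0.
rewrite block_densityE// /ray_density -mulrBr normrM ger0_norm; last first.
  by rewrite mulr_ge0// ltW ?mass_gt0.
have -> : P * (2 * D1) / (E0 * Num.sqrt E0) / L%:R =
  P * (2 * D1 / L%:R / (E0 * Num.sqrt E0)) by ring.
apply: ler_pM => //; first by rewrite mulr_ge0 ?(ltW (mass_gt0 su))// ltW.
  by rewrite ler_pM2r// mass_le.
apply: (le_trans (norm_invsqrtD_le E0_gt0 E0_le z0)).
by rewrite ler_wpM2r ?invr_ge0 ?(ltW E0')// ler_wpM2r ?invr_ge0 ?(ltW L0)// ler_pM2l.
Qed.

Lemma block_density_bounded (L : nat) : (0 < L)%N -> exists2 B : R, 0 <= B &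
  forall u, sphere u -> 0 <= block_density L u <= B.
Proof.
move=> L_gt0; have ratio0 := block_ratio_gt0 L_gt0.
have [C C0 close] := block_density_close.
have [B' [B [_ B0 density_le]]] := sphere_continuous_bounds d_gt0
  within_continuous_ray_density ray_density_gt0.
have CL : 0 <= C / L%:R by rewrite divr_ge0.
exists ((B + C / L%:R) / block_ratio L) => [|u su].
  by rewrite divr_ge0 ?addr_ge0// ltW.
have := ler_norm (block_ratio L * block_density L u - ray_density u).
have := close L u L_gt0 su; have /andP[_ ray_le] := density_le u su => dev_le dev_ge.
rewrite ler_pdivlMr// -(pmulr_rge0 (block_density L u) ratio0) [_ * block_ratio L]mulrC.
apply/andP; split; last by lra.
rewrite block_densityE//.
by rewrite mulr_ge0 ?invr_ge0 ?sqrtr_ge0// mulr_ge0 ?(ltW (mass_gt0 su)) ?(ltW gauss_factor_gt0).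
Qed.

Lemma binom_blocks_ray_limit (L : nat) : (0 < L)%N -> exists2 C : R, 0 <= C &
  forall u x (T : R) (k : nat), sphere u -> toR R x = (lam u * T) *: u -> (0 < k)%N ->
  k%:R <= T / L%:R < k.+1%:R ->
  `|Num.sqrt k.*2%:R ^+ d * binom_blocks (tilt (c u) kap) (tilt (c u) nu) L k.*2 x -
     block_density L u| <= C / Num.sqrt k.*2%:R.
Proof.
move=> L_gt0; have L0 : 0 < L%:R :> R by rewrite ltr0n.
have [_ _ eps0 lam00 _] := support_pos supp.
have lam10 : 0 <= `|lam1| by [].
have [C C0 limit] := binom_blocks_local_limit d_gt0 L_gt0 del_gt0 eps0
  (mulr_ge0 lam10 (ltW L0)) (ltW M_gt0).
exists C => // u x T k su xu k_gt0 /andP[kT Tk].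
apply: (limit _ _ _ _ (support_law supp su) (kap_moment su)); first by rewrite double_gt0.
have T_ge : 0 <= T - k%:R * L%:R by rewrite subr_ge0 -ler_pdivlMr.
have T_le : T - k%:R * L%:R <= L%:R.
  by move: Tk; rewrite -natr1 ltr_pdivrMr// mulrDl mul1r lerBlDl => /ltW.
have -> : toR R x - (k.*2%:R * L%:R / 2) *: m u = (lam u * (T - k%:R * L%:R)) *: u.
  rewrite xu (support_mean supp su) scalerA -scalerBl -mul2n natrM; congr (_ *: _).
  by field.
have lam_ge0 := ltW (lam_gt0 su).
have /andP[_ lam_le] := support_drift_bounds supp su.
rewrite normrZ ger0_norm ?mulr_ge0// -[leRHS]mulr1.
apply: ler_pM; rewrite ?mulr_ge0 ?sphere_norm_le1//; apply: ler_pM => //.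
exact: le_trans lam_le (ler_norm _).
Qed.

Lemma binom_blocks_ray_cvg (L : nat) (e : R) : (0 < L)%N -> 0 < e ->
  \forall k \near \oo, forall u x (T : R), sphere u -> toR R x = (lam u * T) *: u ->
  k%:R <= T / L%:R < k.+1%:R ->
  `|Num.sqrt T ^+ d.-1 * (binom_blocks (tilt (c u) kap) (tilt (c u) nu) L k.*2 x /
      binom_weight R k.*2 k) - block_ratio L * block_density L u| <= e.
Proof.
move=> L_gt0 e0; have ratio0 := block_ratio_gt0 L_gt0.
have [B B0 density_le] := block_density_bounded L_gt0.
have [C C0 limit] := binom_blocks_ray_limit L_gt0.
have BC0 : 0 < B + C + 1 by lra.
have e1 : 0 < e / 2 / (B + C + 1) by rewrite !divr_gt0.
have ratio_close := block_count_cvg d.-1 w_gt0 w_cvg L_gt0 e1.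
pose a := block_ratio L * C / (e / 2); have e2 : 0 < e / 2 by rewrite divr_gt0.
near=> k => u x T su xu kT.
have k_gt0 : (0 < k)%N by near: k; exact: nbhs_infty_gt.
set s := Num.sqrt (k.*2%:R : R); have s1 : 1 <= s.
  by rewrite -[leLHS]sqrtr1 ler_wsqrtr// ler1n double_gt0.
have s0 : 0 < s by lra.
set p := binom_weight R k.*2 k; have p0 : 0 < p := binom_weight_central_gt0 _ k.
set V := s ^+ d * binom_blocks (tilt (c u) kap) (tilt (c u) nu) L k.*2 x.
pose r := Num.sqrt T ^+ d.-1 / s ^+ d.-1 / (s * p).
have -> : Num.sqrt T ^+ d.-1 * (binom_blocks (tilt (c u) kap) (tilt (c u) nu) L k.*2 x / p) = r * V.
  have -> : V = s * s ^+ d.-1 * binom_blocks (tilt (c u) kap) (tilt (c u) nu) L k.*2 x.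
    by rewrite -exprS prednK.
  by rewrite /r; field; rewrite !gt_eqF// exprn_gt0.
have V_close : `|V - block_density L u| <= C / s := limit u x T k su xu k_gt0 kT.
have r_close : `|r - block_ratio L| <= e / 2 / (B + C + 1).
  by apply: (near ratio_close k).
have s_large : block_ratio L * C <= e / 2 * s.
  rewrite [leRHS]mulrC -ler_pdivrMr// -/a (le_trans (ler_norm a))// -sqrtr_sqr ler_wsqrtr//.
  apply: (@le_trans _ _ k%:R); first by near: k; exact: nbhs_infty_ger.
  by rewrite ler_nat -addnn leq_addr.
have V_le : `|V| <= B + C.
  have : `|V - block_density L u| <= C by rewrite (le_trans V_close)// ler_pdivrMr// ler_peMr.
  have := ler_normD (V - block_density L u) (block_density L u); rewrite subrK.
  by have /andP[d0 dB] := density_le u su; rewrite (ger0_norm d0); lra.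
have -> : r * V - block_ratio L * block_density L u =
  (r - block_ratio L) * V + block_ratio L * (V - block_density L u) by ring.
rewrite (splitr e) (le_trans (ler_normD _ _))// (normrM (r - _)) (normrM (block_ratio L)).
rewrite (gtr0_norm ratio0) lerD//.
  apply: (@le_trans _ _ (e / 2 / (B + C + 1) * (B + C + 1))); last by rewrite divfK ?gt_eqF.
  by apply: ler_pM => //; lra.
apply: (@le_trans _ _ (block_ratio L * (C / s))); first by rewrite ler_pM2l.
by rewrite mulrA ler_pdivrMr.
Unshelve. all: by end_near. Qed.

Lemma walk_time_scale_asymptotics (e : R) : 0 < e -> exists2 T0 : R, 0 < T0 &
  forall u x (T : R), sphere u -> toR R x = (lam u * T) *: u -> T0 <= T ->
  \forall N \near \oo,
    `|Num.sqrt T ^+ d.-1 * (\sum_(n < N) tilt (c u) (conv_pow kap nu n) x) - ray_density u| <= e.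
Proof.
move=> e0; have [Cs Cs0 compare] := binom_blocks_compare d_gt0 nu_gt0 kap_ge0 supp kap_moment.
have [Cd Cd0 close] := block_density_close.
have e2 : 0 < e / 2 by rewrite divr_gt0.
pose L := (Num.truncn ((2 * Cs + Cd) / (e / 2))).+1; have L_gt0 : (0 < L)%N by [].
have L0 : 0 < L%:R :> R by rewrite ltr0n.
have L_large : (2 * Cs + Cd) / L%:R <= e / 2.
  rewrite ler_pdivrMr// [leRHS]mulrC -ler_pdivrMr//; apply/ltW; exact: truncnS_gt.
have [T0 T00 block] := block_index_exists R L_gt0 (binom_blocks_ray_cvg L_gt0 e2).
exists T0 => // u x T su xu /block[k [T1 LT LT_le kT blocks_close]].
have {}blocks_close := blocks_close u x T su xu kT.
exists (L * k.*2.+1)%N => // N LN.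
have sT0 : 0 < Num.sqrt T by rewrite sqrtr_gt0; lra.
have /andP[diff_ge diff_le] := compare L k N u x T L_gt0 su xu T1 LT kT LN.
set G := \sum_(n < N) _ in diff_ge diff_le *.
set W := binom_blocks _ _ _ _ _ / _ in diff_ge diff_le blocks_close.
have G_close : `|Num.sqrt T ^+ d.-1 * G - Num.sqrt T ^+ d.-1 * W| <= 2 * Cs / L%:R.
  rewrite -mulrBr normrM !ger0_norm ?exprn_ge0 ?sqrtr_ge0//.
  have -> : 2 * Cs / L%:R = Cs * (L%:R^-1 + L%:R^-1) by ring.
  apply: (@le_trans _ _ (Cs * (L%:R^-1 + L%:R / T))); last by rewrite ler_wpM2l// lerD2l.
  have -> : Cs * (L%:R^-1 + L%:R / T) = Num.sqrt T ^+ d.-1 *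
      (Cs * (Num.sqrt T / Num.sqrt T ^+ d) * (L%:R^-1 + L%:R / T)).
    have -> : Num.sqrt T ^+ d = Num.sqrt T * Num.sqrt T ^+ d.-1 by rewrite -exprS prednK.
    by field; rewrite !gt_eqF ?exprn_gt0//; lra.
  by rewrite ler_wpM2l// exprn_ge0// ltW.
apply: (le_trans (ler_distD (block_ratio L * block_density L u) _ _)).
have := close L u L_gt0 su.
have := le_trans (ler_distD (Num.sqrt T ^+ d.-1 * W) _ _) (lerD G_close blocks_close).
by move: L_large; rewrite mulrDl; lra.
Qed.

End RayDensity.

Theorem walk_ray_asymptotics : exists chi : 'rV[R]_d -> R,
  [/\ {within @sphere R d, continuous chi}, forall u, sphere u -> 0 < chi u &
      ray_asymptotics c (conv_pow kap nu) chi].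
Proof.
have [w w0 w_cvg] := sqrt_binom_weight_central_cvg R.
exists (fun u => Num.sqrt (lam u) ^+ d.-1 * ray_density w u); split.
- apply/subspace_continuousP => u su; apply: cvgM; last first.
    exact: (subspace_continuousP _ _).1 (@within_continuous_ray_density w) u su.
  have drift_cvg := (subspace_continuousP _ _).1 within_continuous_drift u su.
  have sqrt_drift_cvg := cvg_comp _ _ drift_cvg (@sqrt_continuous R _).
  exact: (cvg_comp _ _ sqrt_drift_cvg (@exprn_continuous R d.-1 _)).
- by move=> u su; rewrite mulr_gt0 ?exprn_gt0 ?sqrtr_gt0 ?lam_gt0// ray_density_gt0.
move=> e e0; have [v sv] := sphere_neq0 R d_gt0.
have lam1_gt0 : 0 < lam1.
  by have /andP[_] := support_drift_bounds supp sv; exact: lt_le_trans (lam_gt0 sv).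
pose K := Num.sqrt lam1 ^+ d.-1; have K0 : 0 < K by rewrite exprn_gt0// sqrtr_gt0.
have [T0 T00 asymptotics] := walk_time_scale_asymptotics w0 w_cvg (divr_gt0 e0 K0).
exists (lam1 * T0) => [|u x r su xr r_ge]; first exact: mulr_gt0.
have l0 := lam_gt0 su; have /andP[_ lam_le] := support_drift_bounds supp su.
have rE : r = lam u * (r / lam u) by rewrite mulrC divfK// gt_eqF.
have T_ge : T0 <= r / lam u.
  by rewrite ler_pdivlMr// mulrC; apply: le_trans r_ge; rewrite ler_wpM2r// ltW.
have [N0 _ close] := asymptotics u x (r / lam u) su (etrans xr (congr1 (fun t => t *: u) rE)) T_ge.
exists N0 => // N /close close_N /=.
rewrite rE sqrtrM ?(ltW l0)// exprMn -mulrA -mulrBr normrM ger0_norm ?exprn_ge0 ?sqrtr_ge0//.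
have -> : e = K * (e / K) by rewrite mulrC divfK// gt_eqF.
apply: ler_pM => //; rewrite ?exprn_ge0 ?sqrtr_ge0//.
by rewrite lerXn2r ?nnegrE ?sqrtr_ge0// ler_wsqrtr.
Qed.

End WalkAsymptotics.

(** * Nonnegative kernels *)

Section Kernels.
Variable R : realType.
Local Open Scope ereal_scope.
Implicit Types S T U V : choiceType.

Definition kernel_ge0 S T (A : S -> T -> \bar R) : Prop := forall s t, 0 <= A s t.

Definition kcomp S T U (A : S -> T -> \bar R) (B : T -> U -> \bar R) s u : \bar R :=
  \esum_(t in [set: T]) (A s t * B t u).

Definition kadd S T (A B : S -> T -> \bar R) s t : \bar R := A s t + B s t.

Definition kscale S T (c : \bar R) (A : S -> T -> \bar R) s t : \bar R := c * A s t.

Definition kdelta S (s t : S) : \bar R := (if s == t then 1%R else 0%R)%:E.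

Fixpoint kpow S (Q : S -> S -> \bar R) n : S -> S -> \bar R :=
  if n is n'.+1 then kcomp (kpow Q n') Q else @kdelta S.

Definition kstar S (Q : S -> S -> \bar R) s t : \bar R := \esum_(n in [set: nat]) kpow Q n s t.

Lemma kcomp_ge0 S T U (A : S -> T -> \bar R) (B : T -> U -> \bar R) :
  kernel_ge0 A -> kernel_ge0 B -> kernel_ge0 (kcomp A B).
Proof. by move=> A0 B0 s u; apply: esum_ge0 => t _; rewrite mule_ge0. Qed.

Lemma kadd_ge0 S T (A B : S -> T -> \bar R) :
  kernel_ge0 A -> kernel_ge0 B -> kernel_ge0 (kadd A B).
Proof. by move=> A0 B0 s t; exact: adde_ge0. Qed.

Lemma kscale_ge0 S T (c : \bar R) (A : S -> T -> \bar R) :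
  0 <= c -> kernel_ge0 A -> kernel_ge0 (kscale c A).
Proof. by move=> c0 A0 s t; exact: mule_ge0. Qed.

Lemma kdelta_ge0 S : kernel_ge0 (@kdelta S).
Proof. by move=> s t; rewrite /kdelta lee_fin; case: ifP. Qed.

Hint Resolve kcomp_ge0 kadd_ge0 kdelta_ge0 : core.

Lemma kcompA S T U V (A : S -> T -> \bar R) (B : T -> U -> \bar R) (C : U -> V -> \bar R) :
  kernel_ge0 A -> kernel_ge0 B -> kernel_ge0 C -> kcomp (kcomp A B) C = kcomp A (kcomp B C).
Proof.
move=> A0 B0 C0; apply/funext => s; apply/funext => v; rewrite /kcomp.
transitivity (\esum_(u in [set: U]) \esum_(t in [set: T]) (A s t * B t u * C u v)).
  by apply: eq_esum => u _; rewrite -esumZr// => t; rewrite mule_ge0.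
rewrite exchange_esum; last by move=> x y; rewrite !mule_ge0.
apply: eq_esum => t _; rewrite -esumZl//; last by move=> u; rewrite mule_ge0.
by apply: eq_esum => u _; rewrite muleA.
Qed.

Lemma le_kcomp S T U (A A' : S -> T -> \bar R) (B B' : T -> U -> \bar R) s u :
  kernel_ge0 A -> kernel_ge0 B -> (forall t, A s t <= A' s t) -> (forall t, B t u <= B' t u) ->
  kcomp A B s u <= kcomp A' B' s u.
Proof. by move=> A0 B0 AA' BB'; apply: le_esum => t _; apply: lee_pmul. Qed.

Lemma kcompDl S T U (A A' : S -> T -> \bar R) (B : T -> U -> \bar R) :
  kernel_ge0 A -> kernel_ge0 A' -> kernel_ge0 B ->
  kcomp (kadd A A') B = kadd (kcomp A B) (kcomp A' B).
Proof.
move=> A0 A'0 B0; apply/funext => s; apply/funext => u.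
rewrite /kadd /kcomp -esumD; try by move=> t _; rewrite mule_ge0.
by apply: eq_esum => t _; rewrite ge0_muleDl.
Qed.

Lemma kcompDr S T U (A : S -> T -> \bar R) (B B' : T -> U -> \bar R) :
  kernel_ge0 A -> kernel_ge0 B -> kernel_ge0 B' ->
  kcomp A (kadd B B') = kadd (kcomp A B) (kcomp A B').
Proof.
move=> A0 B0 B'0; apply/funext => s; apply/funext => u.
rewrite /kadd /kcomp -esumD; try by move=> t _; rewrite mule_ge0.
by apply: eq_esum => t _; rewrite ge0_muleDr.
Qed.

Lemma kcompZr S T U (A : S -> T -> \bar R) (B : T -> U -> \bar R) (c : \bar R) :
  kernel_ge0 A -> kernel_ge0 B -> 0 <= c -> kcomp A (kscale c B) = kscale c (kcomp A B).
Proof.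
move=> A0 B0 c0; apply/funext => s; apply/funext => u.
rewrite /kscale /kcomp -esumZl//; last by move=> t; rewrite mule_ge0.
by apply: eq_esum => t _; rewrite muleCA.
Qed.

Lemma kcomp_ge_term S T U (A : S -> T -> \bar R) (B : T -> U -> \bar R) s t u :
  kernel_ge0 A -> kernel_ge0 B -> A s t * B t u <= kcomp A B s u.
Proof.
by move=> A0 B0; apply: (@esum_ge_term _ _ (fun t => A s t * B t u)) => y; rewrite mule_ge0.
Qed.

Lemma kcomp_gt0 S T U (A : S -> T -> \bar R) (B : T -> U -> \bar R) s u :
  kernel_ge0 A -> kernel_ge0 B ->
  0 < kcomp A B s u <-> exists2 t, 0 < A s t & 0 < B t u.
Proof.
move=> A0 B0; split=> [|[t At Bt]]; last first.
  by apply: lt_le_trans (kcomp_ge_term s t u A0 B0); exact: mule_gt0.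
apply: contraPP => none; rewrite /kcomp esum1 ?ltxx// => t _.
have [->|At] := eqVneq (A s t) 0; first by rewrite mul0e.
have [->|Bt] := eqVneq (B t u) 0; first by rewrite mule0.
by exfalso; apply: none; exists t; rewrite lt_neqAle eq_sym ?At ?Bt ?A0 ?B0.
Qed.

Lemma kcomp_deltal S T (A : S -> T -> \bar R) : kernel_ge0 A -> kcomp (@kdelta S) A = A.
Proof.
move=> A0; apply/funext => s; apply/funext => t; rewrite /kcomp.
rewrite (@esum_single _ _ (fun x => kdelta s x * A x t) s).
- by rewrite /kdelta eqxx mul1e.
- by move=> x xs; rewrite /kdelta eq_sym (negPf xs) mul0e.
- by rewrite mule_ge0// kdelta_ge0.
Qed.

Lemma kcomp_deltar S T (A : S -> T -> \bar R) : kernel_ge0 A -> kcomp A (@kdelta T) = A.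
Proof.
move=> A0; apply/funext => s; apply/funext => t; rewrite /kcomp.
rewrite (@esum_single _ _ (fun x => A s x * kdelta x t) t).
- by rewrite /kdelta eqxx mule1.
- by move=> x xs; rewrite /kdelta (negPf xs) mule0.
- by rewrite mule_ge0// kdelta_ge0.
Qed.

Section Star.
Variables (S : choiceType) (Q : S -> S -> \bar R).
Hypothesis Q_ge0 : kernel_ge0 Q.

Lemma kpow_ge0 n : kernel_ge0 (kpow Q n).
Proof. by elim: n => [|n IH]; [exact: kdelta_ge0 | exact: kcomp_ge0]. Qed.

Hint Resolve kpow_ge0 : core.

Lemma kpowD m n : kpow Q (m + n) = kcomp (kpow Q m) (kpow Q n).
Proof.
elim: n => [|n IH]; first by rewrite addn0 kcomp_deltar.
by rewrite addnS /= IH kcompA.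
Qed.

Lemma kpow1 : kpow Q 1 = Q.
Proof. exact: kcomp_deltal. Qed.

Lemma kpowSl n : kpow Q n.+1 = kcomp Q (kpow Q n).
Proof. by rewrite -(add1n n) kpowD kpow1. Qed.

Lemma kstar_ge0 : kernel_ge0 (kstar Q).
Proof. by move=> s t; apply: esum_ge0 => n _; exact: kpow_ge0. Qed.

Hint Resolve kstar_ge0 : core.

Lemma kpow_le_star n s t : kpow Q n s t <= kstar Q s t.
Proof. by apply: (@esum_ge_term _ _ (fun n => kpow Q n s t)) => k; exact: kpow_ge0. Qed.

Lemma kcomp_starl T (B : S -> T -> \bar R) s t : kernel_ge0 B ->
  kcomp (kstar Q) B s t = \esum_(n in [set: nat]) kcomp (kpow Q n) B s t.
Proof.
move=> B0; rewrite /kcomp -exchange_esum.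
  by apply: eq_esum => u _; rewrite -esumZr// => n; exact: kpow_ge0.
by move=> u n; rewrite mule_ge0//; exact: kpow_ge0.
Qed.

Lemma kcomp_starr T (B : T -> S -> \bar R) s t : kernel_ge0 B ->
  kcomp B (kstar Q) s t = \esum_(n in [set: nat]) kcomp B (kpow Q n) s t.
Proof.
move=> B0; rewrite /kcomp -exchange_esum.
  by apply: eq_esum => u _; rewrite -esumZl// => n; exact: kpow_ge0.
by move=> u n; rewrite mule_ge0//; exact: kpow_ge0.
Qed.

Lemma kstar_rec : kstar Q = kadd (@kdelta S) (kcomp Q (kstar Q)).
Proof.
apply/funext => s; apply/funext => t.
rewrite /kadd kcomp_starr// {1}/kstar esum_nat_recl; last by move=> n; exact: kpow_ge0.
by congr (_ + _); apply: eq_esum => n _; rewrite kpowSl.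
Qed.

Lemma kcomp_star_rec T (B : S -> T -> \bar R) : kernel_ge0 B ->
  kcomp (kstar Q) B = kadd B (kcomp Q (kcomp (kstar Q) B)).
Proof. by move=> B0; rewrite {1}kstar_rec kcompDl ?kcomp_deltal ?kcompA//; exact: kcomp_ge0. Qed.

Lemma kcomp_star_least T (B X : S -> T -> \bar R) : kernel_ge0 B -> kernel_ge0 X ->
  (forall s t, B s t + kcomp Q X s t <= X s t) -> forall s t, kcomp (kstar Q) B s t <= X s t.
Proof.
move=> B0 X0 superX s t; rewrite kcomp_starl//.
have QB0 n : kernel_ge0 (kcomp (kpow Q n) B) by exact: kcomp_ge0.
pose partial n s t := \sum_(k < n) kcomp (kpow Q k) B s t.
have partial0 n : kernel_ge0 (partial n) by move=> x y; apply: sume_ge0 => k _; exact: QB0.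
have partial_recr n : partial n.+1 = kadd (partial n) (kcomp (kpow Q n) B).
  by apply/funext => x; apply/funext => y; rewrite /partial big_ord_recr.
have partial_recl n : partial n.+1 = kadd B (kcomp Q (partial n)).
  elim: n => [|n IH].
    rewrite partial_recr kcomp_deltal//; apply/funext => x; apply/funext => y.
    rewrite /kadd /partial big_ord0 add0e /kcomp esum1 ?adde0// => u _.
    by rewrite big_ord0 mule0.
  rewrite partial_recr {1}IH [in RHS]partial_recr kcompDr// kpowSl kcompA//.
  by apply/funext => x; apply/funext => y; rewrite /kadd addeA.
apply: esum_nat_le => [n|n]; first exact: QB0.
elim: n s t => [|n IH] s t; first by rewrite big_ord0.
rewrite -/(partial n.+1 s t) partial_recl; apply: le_trans (superX s t).
by apply: leeD => //; apply: le_kcomp => // u; exact: IH.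
Qed.

Lemma kstar_least (X : S -> S -> \bar R) : kernel_ge0 X ->
  (forall s t, kdelta s t + kcomp Q X s t <= X s t) -> forall s t, kstar Q s t <= X s t.
Proof.
by move=> X0 superX s t; rewrite -[kstar Q]kcomp_deltar//; exact: kcomp_star_least.
Qed.

Lemma kcomp_pow_star_le n s t : kcomp (kpow Q n) (kstar Q) s t <= kstar Q s t.
Proof.
rewrite kcomp_starr//.
apply: le_trans (esum_nat_addr_le n (a := fun m => kpow Q m s t) (fun m => kpow_ge0 m s t)).
by apply: le_esum => m _; rewrite -kpowD addnC.
Qed.

Lemma kcomp_star_pow_le n s t : kcomp (kstar Q) (kpow Q n) s t <= kstar Q s t.
Proof.
rewrite kcomp_starl//.
apply: le_trans (esum_nat_addr_le n (a := fun m => kpow Q m s t) (fun m => kpow_ge0 m s t)).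
by apply: le_esum => m _; rewrite -kpowD.
Qed.

End Star.

(* A [Q]-path is decomposed at its [Q2]-steps. *)
Lemma kstar_split S (Q1 Q2 : S -> S -> \bar R) : kernel_ge0 Q1 -> kernel_ge0 Q2 ->
  kstar (kadd Q1 Q2) = kcomp (kstar (kcomp (kstar Q1) Q2)) (kstar Q1).
Proof.
move=> Q1_ge0 Q2_ge0; set Q := kadd Q1 Q2; set H := kstar Q1; set A := kcomp H Q2.
have Q0 : kernel_ge0 Q by exact: kadd_ge0.
have H0 : kernel_ge0 H by exact: kstar_ge0.
have A0 : kernel_ge0 A by exact: kcomp_ge0.
have sQ0 : kernel_ge0 (kstar Q) by exact: kstar_ge0.
have sA0 : kernel_ge0 (kstar A) by exact: kstar_ge0.
set Y := kcomp (kstar A) H; have Y0 : kernel_ge0 Y by exact: kcomp_ge0.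
have d0 := @kdelta_ge0 S.
have QE B : kernel_ge0 B -> kcomp Q B = kadd (kcomp Q1 B) (kcomp Q2 B).
  by move=> B0; rewrite /Q kcompDl.
have Y_rec : Y = kadd (kadd (@kdelta S) (kcomp Q2 Y)) (kcomp Q1 Y).
  have YE : Y = kcomp H (kadd (@kdelta S) (kcomp Q2 Y)).
    by rewrite kcompDr//; [rewrite kcomp_deltar// -kcompA// /Y -kcomp_star_rec | exact: kcomp_ge0].
  by rewrite {1 3}YE [LHS]kcomp_star_rec// ; exact: kadd_ge0 d0 (kcomp_ge0 _ _).
apply/funext => s; apply/funext => t; apply/eqP; rewrite eq_le; apply/andP; split.
  apply: kstar_least => // {}s {}t.
  by rewrite QE// [leRHS](congr1 (fun K => K s t) Y_rec) /kadd addeA addeAC.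
apply: kcomp_star_least => // {}s {}t.
have -> : H s t + kcomp A (kstar Q) s t = kcomp H (kadd (@kdelta S) (kcomp Q2 (kstar Q))) s t.
  by rewrite kcompDr// ?kcomp_deltar ?kcompA//; exact: kcomp_ge0.
apply: kcomp_star_least => // [|x y]; first by apply: kadd_ge0 => //; exact: kcomp_ge0.
by rewrite [leRHS](congr1 (fun K => K x y) (kstar_rec Q0)) QE// /kadd addeAC addeA.
Qed.

End Kernels.

(** * Regeneration at a fixed type *)

Section TranslationInvariance.
Variables (R : realType) (d p : nat).
Local Notation X := 'rV[int]_d.
Local Notation S := (state d p).
Local Open Scope ereal_scope.
Implicit Types (K J : S -> S -> \bar R) (z : X).

Definition translation_invariant K : Prop :=
  forall z (s t : S), K (s.1 + z, s.2)%R (t.1 + z, t.2)%R = K s t.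

Lemma translate_bij z : bijective (fun u : S => (u.1 + z, u.2)%R : S).
Proof.
exists (fun u : S => (u.1 - z, u.2)%R : S) => [[x i]|[x i]] /=; first by rewrite addrK.
by rewrite subrK.
Qed.

Lemma translation_invariant_comp K J :
  translation_invariant K -> translation_invariant J -> translation_invariant (kcomp K J).
Proof.
move=> K_inv J_inv z s t; rewrite /kcomp (reindex_esum_bij _ (translate_bij z)).
by apply: eq_esum => u _; rewrite K_inv J_inv.
Qed.

Lemma translation_invariant_pow K n :
  translation_invariant K -> translation_invariant (kpow K n).
Proof.
move=> K_inv; elim: n => [|n IH]; last exact: translation_invariant_comp.
move=> z [x i] [y j]; rewrite /= /kdelta /=; congr (if _ then _ else _)%:E.
by rewrite !xpair_eqE (inj_eq (addIr z)).
Qed.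

Lemma translation_invariant_star K :
  translation_invariant K -> translation_invariant (kstar K).
Proof. by move=> K_inv z s t; apply: eq_esum => n _; exact: translation_invariant_pow. Qed.

Lemma translation_invariant_at0 K x i t : translation_invariant K ->
  K (x, i) t = K (0%R, i) (t.1 - x, t.2)%R.
Proof. by move=> K_inv; rewrite -[RHS](K_inv x) /= add0r subrK; case: t. Qed.

Lemma kcomp_unit (K : S -> S -> \bar R) (W : S -> unit -> \bar R) s :
  kernel_ge0 K -> kernel_ge0 W ->
  kcomp K W s tt = \sum_(k < p) \esum_(x in [set: X]) (K s (x, k) * W (x, k) tt).
Proof.
move=> K0 W0; rewrite /kcomp (@esum_prod R _ _ (fun t : S => K s t * W t tt)); last first.
  by move=> z; rewrite mule_ge0.
by rewrite exchange_esum ?esum_finType// => *; rewrite ?esum_ge0// => *; rewrite mule_ge0.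
Qed.

End TranslationInvariance.

Section ExponentialWeights.
Variables (R : realType) (d p : nat).
Local Notation X := 'rV[int]_d.
Local Notation S := (state d p).
Local Notation ang th x := (dotp th (toR R x)).
Local Notation l1 := (@l1norm R d).
Local Open Scope ereal_scope.
Implicit Types (K J : S -> S -> \bar R) (g : 'I_p -> R) (al : 'rV[R]_d) (del : R).

Definition exp_weight al del g (s : S) (_ : unit) : \bar R :=
  (expR (ang al s.1 + del * l1 s.1) * g s.2)%:E.

Local Notation weight1 al del := (exp_weight al del (fun=> 1%R)).

Definition exp_finite al del K : Prop :=
  forall i, kcomp K (weight1 al del) ((0%R, i) : S) tt < +oo.

Lemma exp_weight_ge0 al del g : (forall i, 0 <= g i)%R -> kernel_ge0 (exp_weight al del g).
Proof. by move=> g0 s t; rewrite lee_fin mulr_ge0 ?expR_ge0. Qed.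

Lemma weight1_ge0 al del : kernel_ge0 (weight1 al del).
Proof. exact: exp_weight_ge0. Qed.

Lemma exp_weight0 al g x i : exp_weight al 0 g (x, i) tt = (expR (ang al x) * g i)%:E.
Proof. by rewrite /exp_weight /= mul0r addr0. Qed.

Lemma exp_weight_origin al g i : exp_weight al 0 g (0%R, i) tt = (g i)%:E.
Proof. by rewrite exp_weight0 toR0 dotp0r expR0 mul1r. Qed.

Lemma kcomp_exp_weight_le al del K g x i : (0 <= del)%R ->
  translation_invariant K -> kernel_ge0 K -> (forall i, 0 <= g i)%R ->
  kcomp K (exp_weight al del g) (x, i) tt <=
  (expR (ang al x + del * l1 x))%:E * kcomp K (exp_weight al del g) (0%R, i) tt.
Proof.
move=> del0 K_inv K0 g0; rewrite /kcomp -esumZl; last 2 first.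
- by move=> u; rewrite mule_ge0// exp_weight_ge0.
- by rewrite lee_fin expR_ge0.
rewrite (reindex_esum_bij _ (@translate_bij d p x)); apply: le_esum => u _.
rewrite -{1}(add0r x) (K_inv x (0%R, i) u) muleCA; apply: lee_wpmul2l => //.
rewrite /exp_weight -EFinM lee_fin mulrA ler_wpM2r// -expRD ler_expR /= toRD dotpDr.
have : (del * l1 (u.1 + x) <= del * (l1 u.1 + l1 x))%R by rewrite ler_wpM2l// l1normD.
lra.
Qed.

Lemma kcomp_exp_weight0 al K g : translation_invariant K -> kernel_ge0 K ->
  (forall i, 0 <= g i)%R -> forall x i,
  kcomp K (exp_weight al 0 g) (x, i) tt =
  (expR (ang al x))%:E * kcomp K (exp_weight al 0 g) (0%R, i) tt.
Proof.
move=> K_inv K0 g0 x i; rewrite /kcomp -esumZl; last 2 first.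
- by move=> u; rewrite mule_ge0// exp_weight_ge0.
- by rewrite lee_fin expR_ge0.
rewrite (reindex_esum_bij _ (@translate_bij d p x)); apply: eq_esum => -[y k] _ /=.
have := K_inv x (0%R, i) (y, k); rewrite /= add0r => ->; rewrite muleCA; congr (_ * _).
by rewrite !exp_weight0 -EFinM mulrA -expRD toRD dotpDr addrC.
Qed.

Lemma fine_sum_ge (f : 'I_p -> \bar R) i : (forall i, 0 <= f i) -> (forall i, f i < +oo) ->
  f i <= (\sum_(k < p) fine (f k))%R%:E.
Proof.
move=> f0 f_fin; have fin k : f k \is a fin_num by rewrite ge0_fin_numE.
rewrite -(fineK (fin i)) lee_fin (bigD1 i)//= lerDl.
by apply: sumr_ge0 => k _; exact: fine_ge0.
Qed.

Lemma exp_finite_bounded al del K : kernel_ge0 K -> exp_finite al del K ->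
  exists2 M : R, (0 <= M)%R & forall i, kcomp K (weight1 al del) ((0%R, i) : S) tt <= M%:E.
Proof.
move=> K0 fin; have pos i := kcomp_ge0 K0 (weight1_ge0 al del) ((0%R, i) : S) tt.
exists (\sum_(k < p) fine (kcomp K (weight1 al del) ((0%R, k) : S) tt))%R.
  by apply: sumr_ge0 => k _; exact: fine_ge0.
by move=> i; exact: (fine_sum_ge i pos fin).
Qed.

Lemma exp_finite_comp al del K J : (0 <= del)%R ->
  translation_invariant J -> kernel_ge0 K -> kernel_ge0 J ->
  exp_finite al del K -> exp_finite al del J -> exp_finite al del (kcomp K J).
Proof.
move=> del0 J_inv K0 J0 K_fin /(exp_finite_bounded J0)[N N0 J_le] i.
have w0 := weight1_ge0 al del; have N0' : 0 <= N%:E by rewrite lee_fin.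
rewrite kcompA//; apply: (@le_lt_trans _ _ (kcomp K (kscale N%:E (weight1 al del)) (0%R, i) tt)).
  apply: le_kcomp => // [|[x k]]; first exact: kcomp_ge0.
  apply: (le_trans (kcomp_exp_weight_le al x k del0 J_inv J0 (fun=> ler01))).
  rewrite /kscale muleC; apply: lee_pmul => //; first exact: kcomp_ge0.
  by rewrite /exp_weight /= mulr1.
by rewrite kcompZr// /kscale; apply: lte_mul_pinfty.
Qed.

Lemma exp_finite_rsummable al del K i j : kernel_ge0 K ->
  (forall x : X, K (0%R, i) (x, j) < +oo) -> exp_finite al del K ->
  rsummable (fun x => (expR (del * l1 x) * tilt al (fun x => fine (K (0%R, i) (x, j))) x)%R).
Proof.
move=> K0 K_fin /(_ i) fin; have w0 := weight1_ge0 al del.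
rewrite rsummable_esum; last first.
  by move=> x; rewrite mulr_ge0 ?expR_ge0// tilt_ge0// => y; exact: fine_ge0.
apply: le_lt_trans fin; rewrite kcomp_unit// (bigD1 j)//=; apply: le_trans (leeDl _ _); last first.
  by apply: sume_ge0 => k _; apply: esum_ge0 => x _; rewrite mule_ge0.
apply: le_esum => x _; rewrite -[K _ _]fineK ?ge0_fin_numE//.
by rewrite /exp_weight /tilt -EFinM lee_fin /= expRD mulr1
  mulrA [leRHS]mulrC [X in (X * _ <= _)%R]mulrC.
Qed.

Lemma expR_small_order_le (del n : R) : (0 <= del <= 1)%R -> (0 <= n)%R ->
  (expR (del * n) <= 1 + del * expR (2 * n))%R.
Proof.
move=> /andP[del0 del1] n0; have dn : (0 <= del * n)%R by exact: mulr_ge0.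
have := norm_expR_sub1_le (del * n); rewrite (ger0_norm dn) => exp_le.
have : (del * n * expR (del * n) <= del * expR (2 * n))%R.
  rewrite -mulrA ler_wpM2l//.
  have -> : expR (2 * n) = (expR n * expR n)%R by rewrite -expRD; congr expR; ring.
  apply: ler_pM; rewrite ?expR_ge0// ?ler_expR ?ler_piMl//.
  by have := expR_ge1Dx n; lra.
by have := le_trans (ler_norm _) exp_le; lra.
Qed.

Lemma kcomp_exp_weight_perturb al del K g i : (0 <= del <= 1)%R -> kernel_ge0 K ->
  (forall i, 0 <= g i)%R ->
  kcomp K (exp_weight al del g) ((0%R, i) : S) tt <=
  kcomp K (exp_weight al 0 g) ((0%R, i) : S) tt +
    del%:E * kcomp K (exp_weight al 2 g) ((0%R, i) : S) tt.
Proof.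
move=> del01 K0 g0; have /andP[del0 _] := del01; have w0 a := exp_weight_ge0 al a g0.
have del0' : 0 <= del%:E by rewrite lee_fin.
rewrite -/(kscale _ _ _ _) -kcompZr// -/(kadd _ _ _ _) -kcompDr//; last exact: kscale_ge0.
apply: le_kcomp => // -[x k].
rewrite /kadd /kscale exp_weight0 /exp_weight /= -EFinM -EFinD lee_fin mulrA -mulrDl ler_wpM2r//.
rewrite !expRD mulrCA -{2}[expR (ang al x)]mulr1 -mulrDr ler_wpM2l ?expR_ge0//.
exact: expR_small_order_le (l1norm_ge0 R x).
Qed.

End ExponentialWeights.

Section StarMoments.
Variables (R : realType) (d p : nat).
Local Notation X := 'rV[int]_d.
Local Notation S := (state d p).
Local Open Scope ereal_scope.
Variables (al : 'rV[R]_d) (Q : S -> S -> \bar R).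
Hypotheses (Q_ge0 : kernel_ge0 Q) (Q_inv : translation_invariant Q).
Hypothesis star_finite : exp_finite al 0 (kstar Q).
Hypothesis Q_finite : forall (g : 'I_p -> R) i, (forall k, 0 <= g k)%R ->
  kcomp Q (exp_weight al 2 g) ((0%R, i) : S) tt < +oo.

Let G i := fine (kcomp (kstar Q) (exp_weight al 0 (fun=> 1%R)) ((0%R, i) : S) tt).

Let G_ge0 i : (0 <= G i)%R.
Proof.
apply: fine_ge0; apply: kcomp_ge0; first exact: kstar_ge0.
exact: weight1_ge0.
Qed.

Let GE i : kcomp (kstar Q) (exp_weight al 0 (fun=> 1%R)) ((0%R, i) : S) tt = (G i)%:E.
Proof.
rewrite fineK// ge0_fin_numE; first exact: star_finite.
by apply: kcomp_ge0; [exact: kstar_ge0 | exact: weight1_ge0].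
Qed.

Let G_harmonic i : 1 + kcomp Q (exp_weight al 0 G) ((0%R, i) : S) tt = (G i)%:E.
Proof.
have w0 := @weight1_ge0 R d p al 0.
rewrite -GE kcomp_star_rec// /kadd exp_weight_origin; congr (_ + _).
congr (kcomp Q _ _ tt); apply/funext => -[x k]; apply/funext => -[].
rewrite kcomp_exp_weight0//; [|exact: translation_invariant_star|exact: kstar_ge0].
by rewrite GE exp_weight0.
Qed.

Let G_superharmonic : exists2 del : R, (0 < del)%R &
  forall i, (2^-1)%:E + kcomp Q (exp_weight al del G) ((0%R, i) : S) tt <= (G i)%:E.
Proof.
pose r i := kcomp Q (exp_weight al 2 G) ((0%R, i) : S) tt.
have r0 i : 0 <= r i by apply: kcomp_ge0 => //; exact: exp_weight_ge0.
pose B := (\sum_(k < p) fine (r k))%R.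
have B0 : (0 <= B)%R by apply: sumr_ge0 => k _; exact: fine_ge0.
have r_le i : r i <= B%:E by apply: fine_sum_ge => // k; exact: Q_finite.
pose del := Num.min 1%R (2 * (B + 1))^-1%R.
have B1 : (0 < 2 * (B + 1))%R by lra.
have del0 : (0 < del)%R by rewrite lt_min ltr01 invr_gt0.
have del1 : (del <= 1)%R by rewrite ge_min lexx.
have delB : (del * B <= 2^-1)%R.
  have : (del * (2 * (B + 1)) <= 1)%R.
    by rewrite -ler_pdivlMr// div1r ge_min lexx orbT.
  by lra.
exists del => // i; rewrite -G_harmonic.
have del01 : (0 <= del <= 1)%R by rewrite (ltW del0).
apply: (le_trans (leeD2l _ (kcomp_exp_weight_perturb al i del01 Q_ge0 G_ge0))).
have delr : del%:E * r i <= (2^-1)%:E.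
  apply: (@le_trans _ _ (del%:E * B%:E)); last by rewrite -EFinM lee_fin.
  by apply: lee_wpmul2l => //; rewrite lee_fin ltW.
apply: (le_trans (leeD2l _ (leeD2l _ delr))).
rewrite addeCA addeC -EFinD; apply: leeD2r; rewrite lee_fin; lra.
Qed.

Lemma exp_finite_star : exists2 del : R, (0 < del)%R & exp_finite al del (kstar Q).
Proof.
have [del del0 superG] := G_superharmonic; exists del => // i.
have w0 := @weight1_ge0 R d p al del; have H0 := kstar_ge0 Q_ge0.
have half0 : 0 <= (2^-1 : R)%:E by rewrite lee_fin invr_ge0.
have wG0 : kernel_ge0 (exp_weight al del G) by exact: exp_weight_ge0.
have star_le (s : S) t : kcomp (kstar Q) (kscale (2^-1)%:E (exp_weight al del (fun=> 1%R))) s t <=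
    exp_weight al del G s t.
  apply: kcomp_star_least => //; first exact: kscale_ge0.
  move=> {}s {}t; case: s => x k; case: t.
  apply: le_trans (leeD2l _ (kcomp_exp_weight_le al x k (ltW del0) Q_inv Q_ge0 G_ge0)) _.
  rewrite /kscale /exp_weight /= mulr1 [X in X + _]muleC -ge0_muleDr//; last exact: kcomp_ge0.
  by rewrite EFinM; apply: lee_wpmul2l; rewrite ?lee_fin ?expR_ge0//; exact: superG.
have := star_le (0%R, i) tt; rewrite kcompZr// /kscale.
move: (kcomp _ _ _ _) => v half_le.
rewrite -[v]mul1e -(divff (_ : 2 != 0 :> R)%R)// EFinM -muleA.
by apply: lte_mul_pinfty => //; apply: (le_lt_trans half_le); rewrite ltry.
Qed.

End StarMoments.

Section Regeneration.
Variables (R : realType) (d p : nat) (mu : jump R d p) (i0 : 'I_p).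
Local Notation X := 'rV[int]_d.
Local Notation S := (state d p).
Local Notation ang th x := (dotp th (toR R x)).
Local Notation weight1 al del := (exp_weight al del (fun=> 1%R)).
Local Open Scope ereal_scope.
Hypothesis mu_ge0 : forall i j x, (0 <= mu i j x)%R.

Definition step_kernel (s t : S) : \bar R := (P1 mu s t)%:E.

(* Steps landing in type [i0] are marked with probability 1/2, so that both the
   marked and the unmarked walk still see every path. *)
Definition marked_step (s t : S) : \bar R := (if t.2 == i0 then P1 mu s t / 2 else 0)%:E.

Definition unmarked_step (s t : S) : \bar R :=
  (if t.2 == i0 then P1 mu s t / 2 else P1 mu s t)%:E.

Definition unmarked_green := kstar unmarked_step.

Definition regen_kernel := kcomp unmarked_green marked_step.

Lemma step_kernel_ge0 : kernel_ge0 step_kernel.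
Proof. by move=> s t; rewrite lee_fin; exact: mu_ge0. Qed.

Lemma unmarked_step_ge0 : kernel_ge0 unmarked_step.
Proof. by move=> s t; rewrite lee_fin; case: ifP => _; rewrite ?divr_ge0 ?mu_ge0. Qed.

Lemma marked_step_ge0 : kernel_ge0 marked_step.
Proof. by move=> s t; rewrite lee_fin; case: ifP => _; rewrite ?divr_ge0 ?mu_ge0. Qed.

Lemma unmarked_green_ge0 : kernel_ge0 unmarked_green.
Proof. exact: kstar_ge0 unmarked_step_ge0. Qed.

Lemma regen_kernel_ge0 : kernel_ge0 regen_kernel.
Proof. exact: kcomp_ge0 unmarked_green_ge0 marked_step_ge0. Qed.

Hint Resolve step_kernel_ge0 unmarked_step_ge0 marked_step_ge0 : core.
Hint Resolve unmarked_green_ge0 regen_kernel_ge0 : core.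

Lemma Pn_kpow n : Pn mu n = kpow step_kernel n.
Proof. by elim: n => //= n ->. Qed.

Lemma green_kstar : green mu = kstar step_kernel.
Proof.
by apply/funext => s; apply/funext => t; apply: eq_esum => n _; rewrite Pn_kpow.
Qed.

Lemma step_kernelE : step_kernel = kadd unmarked_step marked_step.
Proof.
apply/funext => s; apply/funext => t; rewrite /kadd /step_kernel /unmarked_step /marked_step.
by rewrite -EFinD; congr _%:E; case: ifP => _; lra.
Qed.

Lemma unmarked_step_le s t : unmarked_step s t <= step_kernel s t.
Proof. by rewrite step_kernelE leeDl. Qed.

Lemma marked_step_le s t : marked_step s t <= step_kernel s t.
Proof. by rewrite step_kernelE leeDr. Qed.

Lemma green_regen : green mu = kcomp (kstar regen_kernel) unmarked_green.
Proof. by rewrite green_kstar step_kernelE kstar_split. Qed.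

Let P1_translation z (s t : S) : P1 mu (s.1 + z, s.2)%R (t.1 + z, t.2)%R = P1 mu s t.
Proof. by rewrite /P1 /= opprD addrACA subrr addr0. Qed.

Lemma translation_invariant_step : translation_invariant step_kernel.
Proof. by move=> z s t; rewrite /step_kernel P1_translation. Qed.

Lemma translation_invariant_unmarked : translation_invariant unmarked_step.
Proof. by move=> z s t; rewrite /unmarked_step P1_translation. Qed.

Lemma translation_invariant_marked : translation_invariant marked_step.
Proof. by move=> z s t; rewrite /marked_step P1_translation. Qed.

Lemma translation_invariant_unmarked_green : translation_invariant unmarked_green.
Proof. exact: translation_invariant_star translation_invariant_unmarked. Qed.

Lemma translation_invariant_regen : translation_invariant regen_kernel.
Proof.
exact: translation_invariant_comp translation_invariant_unmarked_green translation_invariant_marked.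
Qed.

Section Irreducibility.
Hypotheses (d_gt0 : (0 < d)%N) (irr : irreducible mu).

Lemma irreducible_positive_time (s t : S) : exists n, 0 < kpow step_kernel n.+1 s t.
Proof.
pose u : S := (s.1 + delta_mx 0 (Ordinal d_gt0), s.2)%R.
have [m su] := irr s u; have [n ut] := irr u t; rewrite !Pn_kpow in su ut.
case: m su => [|m] su.
  move: su; rewrite /= /kdelta; case: eqP => [s_eq|_]; last by rewrite ltxx.
  have := congr1 fst s_eq; rewrite /u /= -{1}[s.1]addr0 => /addrI/rowP/(_ (Ordinal d_gt0)).
  by rewrite !mxE !eqxx.
exists (m + n)%N; rewrite -addSn kpowD// kcomp_gt0; [by exists u|exact: kpow_ge0..].
Qed.

Lemma unmarked_step_gt0 s t : 0 < step_kernel s t -> 0 < unmarked_step s t.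
Proof. by rewrite !lte_fin; case: ifP => // _ st; rewrite divr_gt0. Qed.

Lemma kpow_unmarked_gt0 n s t : 0 < kpow step_kernel n s t -> 0 < kpow unmarked_step n s t.
Proof.
elim: n t => [//|n IH] t /kcomp_gt0[|//|u su ut]; first exact: kpow_ge0.
by apply/kcomp_gt0 => //; [exact: kpow_ge0 | exists u; [exact: IH | exact: unmarked_step_gt0]].
Qed.

Lemma marked_path_exists s (x : X) :
  exists n, 0 < kcomp (kpow unmarked_step n) marked_step s (x, i0).
Proof.
have [n /kcomp_gt0[|//|u su ut]] := irreducible_positive_time s (x, i0).
  exact: kpow_ge0.
exists n; apply/kcomp_gt0 => //; first exact: kpow_ge0.
exists u; first exact: kpow_unmarked_gt0.
by move: ut; rewrite !lte_fin /= eqxx => ut; rewrite divr_gt0.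
Qed.

Lemma unmarked_green_gt0 s t : 0 < unmarked_green s t.
Proof.
have [n path] := irreducible_positive_time s t.
by apply: lt_le_trans (kpow_le_star unmarked_step_ge0 n.+1 s t); exact: kpow_unmarked_gt0.
Qed.

Lemma regen_kernel_gt0 s (x : X) : 0 < regen_kernel s (x, i0).
Proof.
have [n path] := marked_path_exists s x; apply: (lt_le_trans path).
by apply: le_kcomp => // [|t]; [exact: kpow_ge0 | exact: kpow_le_star].
Qed.

Lemma exists_fin_le (a : \bar R) : 0 < a -> exists2 r : R, (0 < r)%R & r%:E <= a.
Proof.
case: a => [r| |]//; first by rewrite lte_fin => r0; exists r.
by move=> _; exists 1%R => //; rewrite leey.
Qed.

(* An unmarked excursion from [i] to [j] extends, at a bounded cost, to a regeneration. *)
Lemma unmarked_green_le_regen i j : exists2 r : R, (0 < r)%R &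
  forall x : X, r%:E * unmarked_green (0%R, i) (x, j) <= regen_kernel (0%R, i0) (x, i0).
Proof.
have [m /kpow_unmarked_gt0/exists_fin_le[r1 r10 r1_le]] :=
  irreducible_positive_time (0%R, i0) (0%R, i).
have [n /exists_fin_le[r2 r20 r2_le]] := marked_path_exists (0%R, j) 0.
exists (r1 * r2)%R => [|x]; first by rewrite mulr_gt0.
have U0 k : kernel_ge0 (kpow unmarked_step k) by exact: kpow_ge0.
pose entry := kcomp (kpow unmarked_step m.+1) unmarked_green.
pose exit := kcomp (kpow unmarked_step n) marked_step.
have entry0 : kernel_ge0 entry by exact: kcomp_ge0.
have exit0 : kernel_ge0 exit by exact: kcomp_ge0.
have through : kcomp entry exit (0%R, i0) (x, i0) <= regen_kernel (0%R, i0) (x, i0).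
  rewrite -kcompA//; apply: le_kcomp => // [|t]; first exact: kcomp_ge0.
  apply: le_trans (kcomp_star_pow_le unmarked_step_ge0 n (0%R, i0) t).
  by apply: le_kcomp => // u; exact: kcomp_pow_star_le.
apply: le_trans through; apply: le_trans (kcomp_ge_term _ (x, j) _ entry0 exit0).
rewrite EFinM muleAC; apply: lee_pmul; rewrite ?mule_ge0 ?lee_fin ?(ltW r10) ?(ltW r20)//.
  apply: le_trans (kcomp_ge_term _ (0%R, i) _ (U0 _) unmarked_green_ge0).
  by apply: lee_pmul => //; rewrite lee_fin ltW.
rewrite (translation_invariant_at0 x j (x, i0)) /= ?subrr//.
apply: translation_invariant_comp translation_invariant_marked.
exact: translation_invariant_pow translation_invariant_unmarked.
Qed.

Section Moments.
Hypothesis mu_moments : finite_exp_moments mu.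

Lemma jump_tilted_moment_lty al (a : R) i k : (0 <= a)%R ->
  \esum_(x in [set: X]) (expR (ang al x + a * l1norm R x) * mu i k x)%:E < +oo.
Proof.
move=> a0; pose b := ((enorm al + a) * d%:R + 1)%R.
have ea0 : (0 <= enorm al + a)%R by rewrite addr_ge0 ?enorm_ge0.
have b0 : (0 < b)%R by rewrite ltr_wpDl// mulr_ge0.
apply: le_lt_trans (mu_moments i k b0); apply: le_esum => x _.
rewrite lee_fin ler_wpM2r// ler_expR /b.
apply: (@le_trans _ _ ((enorm al + a) * l1norm R x)%R).
  by rewrite mulrDl lerD2r (le_trans (ler_norm _))// norm_dotp_le_enorm_l1norm.
apply: (@le_trans _ _ ((enorm al + a) * (d%:R * enorm (toR R x)))%R).
  by rewrite ler_wpM2l ?l1norm_le_enorm.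
by rewrite [leRHS]mulrDl mul1r -mulrA lerDl enorm_ge0.
Qed.

Lemma kcomp_step_weight_lty al (a : R) (K : S -> S -> \bar R) (g : 'I_p -> R) i : (0 <= a)%R ->
  kernel_ge0 K -> (forall s t, K s t <= step_kernel s t) -> (forall k, 0 <= g k)%R ->
  kcomp K (exp_weight al a g) ((0%R, i) : S) tt < +oo.
Proof.
move=> a0 K0 K_le g0; have w0 := exp_weight_ge0 al a g0.
rewrite kcomp_unit//; apply: lte_sum_pinfty => k _.
apply: (@le_lt_trans _ _ ((g k)%:E *
    \esum_(x in [set: X]) (expR (ang al x + a * l1norm R x) * mu i k x)%:E)).
  rewrite -esumZl; last 2 first.
  - by move=> x; rewrite lee_fin mulr_ge0 ?expR_ge0.
  - by rewrite lee_fin.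
  apply: le_esum => x _; apply: (le_trans (lee_wpmul2r (w0 _ _) (K_le _ _))).
  rewrite /step_kernel /exp_weight /P1 /= subr0 -!EFinM lee_fin.
  by rewrite mulrC -mulrA mulrCA.
by apply: lte_mul_pinfty; rewrite ?lee_fin//; exact: jump_tilted_moment_lty.
Qed.

Variable al : 'rV[R]_d.
Hypothesis regen_finite :
  \esum_(x in [set: X]) (regen_kernel (0%R, i0) (x, i0) * (expR (ang al x))%:E) < +oo.

Lemma exp_finite_unmarked_green0 : exp_finite al 0 unmarked_green.
Proof.
move=> i; rewrite kcomp_unit//; last exact: weight1_ge0.
apply: lte_sum_pinfty => j _; have [r r0 r_le] := unmarked_green_le_regen i j.
apply: (@le_lt_trans _ _ ((r^-1)%:E *
    \esum_(x in [set: X]) (regen_kernel (0%R, i0) (x, i0) * (expR (ang al x))%:E))); last first.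
  by apply: lte_mul_pinfty => //; rewrite lee_fin invr_ge0 ltW.
rewrite -esumZl; last 2 first.
- by move=> x; rewrite mule_ge0// lee_fin expR_ge0.
- by rewrite lee_fin invr_ge0 ltW.
apply: le_esum => x _; rewrite exp_weight0 mulr1 muleA.
apply: lee_wpmul2r; first by rewrite lee_fin expR_ge0.
have -> : unmarked_green (0%R, i) (x, j) = (r^-1)%:E * (r%:E * unmarked_green (0%R, i) (x, j)).
  by rewrite muleA -EFinM mulVf ?gt_eqF// mul1e.
by apply: lee_wpmul2l; rewrite ?lee_fin ?invr_ge0 ?(ltW r0).
Qed.

Lemma exp_finite_regen : exists2 del : R, (0 < del)%R &
  [/\ exp_finite al del unmarked_green, exp_finite al del regen_kernel &
      exp_finite al del (kcomp regen_kernel unmarked_green)].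
Proof.
have [del del0 green_fin] : exists2 del : R, (0 < del)%R & exp_finite al del unmarked_green.
  apply: (exp_finite_star unmarked_step_ge0 translation_invariant_unmarked
    exp_finite_unmarked_green0) => g i g0.
  by apply: kcomp_step_weight_lty => //; exact: unmarked_step_le.
have dl := ltW del0; exists del => //.
have regen_fin : exp_finite al del regen_kernel.
  apply: exp_finite_comp => //; first exact: translation_invariant_marked.
  by move=> i; apply: kcomp_step_weight_lty => //; exact: marked_step_le.
by split => //; apply: exp_finite_comp => //; exact: translation_invariant_unmarked_green.
Qed.

End Moments.
End Irreducibility.

Lemma regen_kernel_eq0 s (t : S) : t.2 != i0 -> regen_kernel s t = 0.
Proof.
move=> ti; rewrite /regen_kernel /kcomp esum1// => u _.
by rewrite /marked_step (negPf ti) mule0.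
Qed.

Lemma kpow_regen_eq0 n s (t : S) : t.2 != i0 -> kpow regen_kernel n.+1 s t = 0.
Proof. by move=> ti; rewrite /= /kcomp esum1// => u _; rewrite regen_kernel_eq0 ?mule0. Qed.

Lemma esum_type (F : S -> \bar R) : (forall u, 0 <= F u) -> (forall u : S, u.2 != i0 -> F u = 0) ->
  \esum_(u in [set: S]) F u = \esum_(y in [set: X]) F (y, i0).
Proof.
move=> F0 Fz; rewrite (@esum_prod R _ _ F)//; apply: eq_esum => y _.
by rewrite (@esum_single R _ (fun k => F (y, k)) i0)// => k ki; exact: Fz.
Qed.

Section Contraction.
Variables (al : 'rV[R]_d) (h : 'I_p -> R) (eta : R).
Hypotheses (h_gt0 : forall i, (0 < h i)%R) (eta_gt0 : (0 < eta)%R).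
Hypothesis contraction : forall i,
  eta%:E + kcomp step_kernel (exp_weight al 0 h) ((0%R, i) : S) tt <= (h i)%:E.

Let h_ge0 i : (0 <= h i)%R := ltW (h_gt0 i).
Let w0 : kernel_ge0 (exp_weight al 0 h) := exp_weight_ge0 al 0 h_ge0.
Let one0 : kernel_ge0 (weight1 al 0 : S -> _) := @weight1_ge0 R d p al 0.
Let eta_ge0 : 0 <= eta%:E. Proof. by rewrite lee_fin ltW. Qed.

Lemma regen_contraction (s : S) : kcomp regen_kernel (exp_weight al 0 h) s tt +
  eta%:E * kcomp unmarked_green (weight1 al 0) s tt <= exp_weight al 0 h s tt.
Proof.
have one_eta0 : kernel_ge0 (kscale eta%:E (weight1 al 0) : S -> _) by exact: kscale_ge0.
have marked0 : kernel_ge0 (kcomp marked_step (exp_weight al 0 h)) by exact: kcomp_ge0.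
rewrite -/(kscale _ _ _ _) -kcompZr// /regen_kernel kcompA// -/(kadd _ _ _ _) -kcompDr//.
apply: kcomp_star_least => // [|[x i] []]; first exact: kadd_ge0.
rewrite /kadd addeAC addeC [X in _ + X]addeC -[kcomp unmarked_step _ _ _ + _]/(kadd _ _ _ _).
rewrite -kcompDl// -step_kernelE.
rewrite kcomp_exp_weight0//; last exact: translation_invariant_step.
rewrite /kscale !exp_weight0 mulr1 [X in X + _]muleC -ge0_muleDr//; last exact: kcomp_ge0.
by rewrite EFinM; apply: lee_wpmul2l; rewrite ?lee_fin ?expR_ge0.
Qed.

Lemma kpow_regen_superharmonic n s :
  kcomp (kpow regen_kernel n) (exp_weight al 0 h) s tt <= exp_weight al 0 h s tt.
Proof.
have pow0 k := kpow_ge0 regen_kernel_ge0 k.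
elim: n => [|n IH]; first by rewrite kcomp_deltal.
apply: le_trans IH; rewrite /= kcompA//.
apply: le_kcomp => // [|t]; first exact: kcomp_ge0.
apply: le_trans (regen_contraction t); rewrite leeDl// mule_ge0//.
exact: kcomp_ge0.
Qed.

Lemma kpow_regen_lty n s t : kpow regen_kernel n s t < +oo.
Proof.
have : kpow regen_kernel n s t * exp_weight al 0 h t tt <= exp_weight al 0 h s tt.
  apply: le_trans (kpow_regen_superharmonic n s).
  by apply: kcomp_ge_term => //; exact: kpow_ge0.
rewrite ltey; apply: contraTneq => ->.
by rewrite gt0_mulye ?leye_eq// lte_fin mulr_gt0 ?expR_gt0.
Qed.

Lemma kpow_regen_unmarked_lty n s t : kcomp (kpow regen_kernel n) unmarked_green s t < +oo.
Proof.
have pow0 := kpow_ge0 regen_kernel_ge0 n.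
have one_gt0 : 0 < exp_weight al 0 (fun=> 1%R) t tt by rewrite lte_fin mulr_gt0 ?expR_gt0.
have : eta%:E * (kcomp (kpow regen_kernel n) unmarked_green s t * exp_weight al 0 (fun=> 1%R) t tt)
    <= exp_weight al 0 h s tt.
  apply: (@le_trans _ _ (eta%:E *
      kcomp (kcomp (kpow regen_kernel n) unmarked_green) (weight1 al 0) s tt)).
    by apply: lee_wpmul2l => //; apply: kcomp_ge_term => //; exact: kcomp_ge0.
  rewrite kcompA// -/(kscale _ _ _ _) -kcompZr//; last exact: kcomp_ge0.
  apply: le_trans (kpow_regen_superharmonic n s); apply: le_kcomp => // [|u].
    by apply: kscale_ge0 => //; exact: kcomp_ge0.
  by apply: le_trans (regen_contraction u); rewrite leeDr//; exact: kcomp_ge0.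
rewrite ltey; apply: contraTneq => ->.
by rewrite gt0_mulye// gt0_muley ?leye_eq// lte_fin.
Qed.

Lemma regen_mass_lt1 : (h i0)%:E *
    (\esum_(x in [set: X]) (regen_kernel (0%R, i0) (x, i0) * (expR (ang al x))%:E)) + eta%:E <=
  (h i0)%:E.
Proof.
have := regen_contraction (0%R, i0); rewrite exp_weight_origin; apply: le_trans; apply: leeD.
  rewrite /kcomp (@esum_type (fun t => regen_kernel (0%R, i0) t * exp_weight al 0 h t tt));
    last 2 first.
  - by move=> u; rewrite mule_ge0.
  - by move=> u ui; rewrite regen_kernel_eq0 ?mul0e.
  rewrite -esumZl; last 2 first.
  - by move=> x; rewrite mule_ge0 ?lee_fin ?expR_ge0.
  - by rewrite lee_fin.
  by apply: le_esum => x _; rewrite muleCA exp_weight0 -EFinM mulrC.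
rewrite -[leLHS]mule1; apply: lee_wpmul2l => //.
rewrite kcomp_star_rec// /kadd exp_weight_origin leeDl//.
by apply: kcomp_ge0 => //; exact: kcomp_ge0.
Qed.

End Contraction.

Section RegenerationWalk.
Hypothesis kpow_lty : forall n s t, kpow regen_kernel n s t < +oo.
Hypothesis green_lty : forall n s t, kcomp (kpow regen_kernel n) unmarked_green s t < +oo.

Definition regen_law (x : X) : R := fine (regen_kernel (0%R, i0) (x, i0)).

Definition excursion_law (i j : 'I_p) (x : X) : R := fine (unmarked_green (0%R, i) (x, j)).

Definition start_law (i j : 'I_p) (x : X) : R :=
  fine (kcomp regen_kernel unmarked_green (0%R, i) (x, j)).

Lemma regen_lawE x : (regen_law x)%:E = regen_kernel (0%R, i0) (x, i0).
Proof. by rewrite fineK// ge0_fin_numE// -[regen_kernel]kpow1. Qed.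

Lemma excursion_lawE i j x : (excursion_law i j x)%:E = unmarked_green (0%R, i) (x, j).
Proof.
by rewrite fineK// ge0_fin_numE//; have := green_lty 0 (0%R, i) (x, j); rewrite kcomp_deltal.
Qed.

Lemma start_lawE i j x :
  (start_law i j x)%:E = kcomp regen_kernel unmarked_green (0%R, i) (x, j).
Proof.
rewrite fineK// ge0_fin_numE; last exact: kcomp_ge0.
by have := green_lty 1 (0%R, i) (x, j); rewrite kpow1.
Qed.

Lemma esum_conv_swap (a b c : X -> \bar R) x : (forall y, 0 <= a y) -> (forall y, 0 <= b y) ->
  (forall y, 0 <= c y) ->
  \esum_(y in [set: X]) ((\esum_(z in [set: X]) (a z * b (y - z)%R)) * c (x - y)%R) =
  \esum_(y in [set: X]) ((\esum_(z in [set: X]) (a z * c (y - z)%R)) * b (x - y)%R).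
Proof.
move=> a0 b0 c0.
transitivity (\esum_(z in [set: X]) \esum_(y in [set: X]) (a z * b (y - z)%R * c (x - y)%R)).
  rewrite exchange_esum; last by move=> z y; rewrite !mule_ge0.
  by apply: eq_esum => y _; rewrite -esumZr// => z; rewrite mule_ge0.
transitivity (\esum_(z in [set: X]) \esum_(y in [set: X]) (a z * c (y - z)%R * b (x - y)%R)).
  apply: eq_esum => z _; rewrite (esum_subl (x + z)%R); apply: eq_esum => y _.
  have -> : (x + z - y - z = x - y)%R by rewrite addrAC addrK.
  have -> : (x - (x + z - y) = y - z)%R by rewrite !opprD opprK addrA addrA subrr add0r addrC.
  by rewrite -!muleA; congr (_ * _); rewrite muleC.
rewrite exchange_esum; last by move=> z y; rewrite !mule_ge0.
by apply: eq_esum => y _; rewrite -esumZr// => z; rewrite mule_ge0.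
Qed.

Lemma kcomp_kpow_regenE n (K : S -> S -> \bar R) i x j : kernel_ge0 K ->
  translation_invariant K -> kcomp (kpow regen_kernel n.+1) K (0%R, i) (x, j) =
  \esum_(y in [set: X]) (kpow regen_kernel n.+1 (0%R, i) (y, i0) * K (0%R, i0) ((x - y)%R, j)).
Proof.
move=> K0 K_inv; have pow0 := kpow_ge0 regen_kernel_ge0 n.+1.
rewrite /kcomp (@esum_type (fun u => kpow regen_kernel n.+1 (0%R, i) u * K u (x, j))).
- by apply: eq_esum => y _; rewrite (translation_invariant_at0 _ _ _ K_inv).
- by move=> u; rewrite mule_ge0.
- by move=> u ui; rewrite kpow_regen_eq0 ?mul0e.
Qed.

(* Commuting the convolutions moves the unmarked part behind the regeneration steps. *)
Lemma conv_pow_regenE i j n x : (conv_pow (start_law i j) regen_law n x)%:E =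
  kcomp (kpow regen_kernel n.+1) unmarked_green (0%R, i) (x, j).
Proof.
elim: n x => [|n IH] x; first by rewrite kpow1// -start_lawE.
have pow0 := kpow_ge0 regen_kernel_ge0 n.+1.
have conv0 y : (0 <= conv_pow (start_law i j) regen_law n y)%R.
  by rewrite -lee_fin IH; exact: kcomp_ge0.
have sum_eq : \esum_(y in [set: X])
      (conv_pow (start_law i j) regen_law n y * regen_law (x - y))%R%:E =
    kcomp (kpow regen_kernel n.+2) unmarked_green (0%R, i) (x, j).
  transitivity (\esum_(y in [set: X]) ((\esum_(z in [set: X])
      (kpow regen_kernel n.+1 (0%R, i) (z, i0) * unmarked_green (0%R, i0) ((y - z)%R, j))) *
      regen_kernel (0%R, i0) ((x - y)%R, i0))).
    apply: eq_esum => y _; rewrite EFinM IH regen_lawE kcomp_kpow_regenE//.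
    exact: translation_invariant_unmarked_green.
  rewrite (esum_conv_swap (a := fun z => kpow regen_kernel n.+1 (0%R, i) (z, i0))
    (b := fun z => unmarked_green (0%R, i0) (z, j))
    (c := fun z => regen_kernel (0%R, i0) (z, i0)))//.
  rewrite kcomp_kpow_regenE//; last exact: translation_invariant_unmarked_green.
  apply: eq_esum => y _; congr (_ * _).
  by rewrite -kcomp_kpow_regenE//; exact: translation_invariant_regen.
rewrite /conv_pow iterS -/(conv_pow _ _ n) /rconv ge0_sumRE.
- exact: sum_eq.
- by move=> y; rewrite mulr_ge0// fine_ge0.
by rewrite rsummable_esum ?sum_eq// => y; rewrite mulr_ge0// fine_ge0.
Qed.

Lemma green_regen_walk i j x : green mu (0%R, i) (x, j) =
  (excursion_law i j x)%:E +
  \esum_(n in [set: nat]) (conv_pow (start_law i j) regen_law n x)%:E.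
Proof.
rewrite green_regen kcomp_starl// esum_nat_recl; last first.
  by move=> n; apply: kcomp_ge0 => //; exact: kpow_ge0.
rewrite kcomp_deltal// excursion_lawE; congr (_ + _).
by apply: eq_esum => n _; rewrite conv_pow_regenE.
Qed.

End RegenerationWalk.
End Regeneration.

(** * The Poisson equation and a strictly contracting tilt *)

Section StationaryRows.
Variables (R : realType) (d p : nat) (mu : jump R d p).
Local Notation X := 'rV[int]_d.
Local Notation S := (state d p).
Hypotheses (p_gt0 : (0 < p)%N) (mu_jump : is_jump_matrix mu) (irr : irreducible mu).

Let mu_ge0 i j x : 0 <= mu i j x := mu_jump.1 i j x.

Definition transition_mx : 'M[R]_p := \matrix_(i, j) Mtrans mu i j.

Definition stationary_row (y : 'rV[R]_p) : Prop := y *m transition_mx = y.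

Lemma rsummable_jump i j : rsummable (mu i j).
Proof.
rewrite rsummable_esum//; apply: (@le_lt_trans _ _ 1%E); last exact: ltry.
rewrite -(mu_jump.2 i) (bigD1 j)//= leeDl//; apply: sume_ge0 => k _.
by apply: esum_ge0 => x _; rewrite lee_fin.
Qed.

Lemma MtransE i j : Mtrans mu i j = sumR (mu i j).
Proof. by rewrite ge0_sumR. Qed.

Lemma Mtrans_ge0 i j : 0 <= Mtrans mu i j.
Proof. by rewrite MtransE; exact: sumR_ge0. Qed.

Lemma sum_Mtrans i : \sum_(j < p) Mtrans mu i j = 1.
Proof.
apply/EFin_inj; rewrite -sumEFin -(mu_jump.2 i); apply: eq_bigr => j _.
by rewrite MtransE ge0_sumRE//; exact: rsummable_jump.
Qed.

Lemma stationary_rowE y : stationary_row y -> forall j, y 0 j = \sum_i y 0 i * Mtrans mu i j.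
Proof. by move=> yP j; rewrite -{1}yP mxE; apply: eq_bigr => i _; rewrite mxE. Qed.

Lemma stationary_row_norm y : stationary_row y -> stationary_row (map_mx Num.norm y).
Proof.
move=> yP; have yE := stationary_rowE yP.
pose excess j := \sum_i `|y 0 i| * Mtrans mu i j - `|y 0 j|.
have excess0 j : true -> 0 <= excess j.
  move=> _; rewrite subr_ge0 yE (le_trans (ler_norm_sum _ _ _))//; apply: ler_sum => i _.
  by rewrite normrM (ger0_norm (Mtrans_ge0 _ _)).
have total0 : \sum_j excess j = 0.
  rewrite sumrB exchange_big /= -sumrB big1// => i _.
  by rewrite -mulr_sumr sum_Mtrans mulr1 subrr.
apply/rowP => j; have /eqP := psumr_eq0P excess0 total0 (i := j) isT.
rewrite subr_eq0 => /eqP sum_eq; rewrite !mxE -sum_eq.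
by apply: eq_bigr => i _; rewrite !mxE.
Qed.

Lemma stationary_row_reach (y : 'rV[R]_p) : (forall i, 0 <= y 0 i) -> stationary_row y ->
  forall n (s t : S), (0 < Pn mu n s t)%E -> 0 < y 0 s.2 -> 0 < y 0 t.2.
Proof.
move=> y0 yP; have step0 := step_kernel_ge0 mu_ge0.
elim=> [|n IH] s t; first by rewrite /=; case: eqP => [<-//|_]; rewrite ltxx.
rewrite Pn_kpow => /kcomp_gt0[|//|u su ut] ys; first exact: kpow_ge0.
have yu : 0 < y 0 u.2 by apply: (IH s u); rewrite ?Pn_kpow.
rewrite (stationary_rowE yP) (bigD1 u.2)//=; apply: ltr_wpDr.
  by apply: sumr_ge0 => i _; rewrite mulr_ge0// Mtrans_ge0.
rewrite mulr_gt0// MtransE.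
by apply: lt_le_trans (sumR_ge_term (t.1 - u.1) _ (rsummable_jump _ _)).
Qed.

Lemma stationary_row_gt0 y i : stationary_row y -> 0 < y 0 i -> forall j, 0 < y 0 j.
Proof.
move=> yP yi j; pose z := map_mx Num.norm y + y.
have zE k : z 0 k = `|y 0 k| + y 0 k by rewrite !mxE.
have zP : stationary_row z by rewrite /stationary_row mulmxDl (stationary_row_norm yP) yP.
have z0 k : 0 <= z 0 k by rewrite zE -lerBlDr sub0r -normrN ler_norm.
have [n path] := irr (0, i) (0, j).
have : 0 < z 0 j by apply: (stationary_row_reach z0 zP path); rewrite zE /= ltr_wpDl.
by rewrite zE; case: (leP (y 0 j) 0) => // yj; rewrite ler0_norm// addNr ltxx.
Qed.

Lemma stationary_row_eq0 y : stationary_row y -> \sum_i y 0 i = 0 -> y = 0.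
Proof.
move=> yP y_sum; apply/rowP => i; rewrite mxE; apply/eqP; apply: contraT => yi.
have sum_gt0 (z : 'rV[R]_p) : stationary_row z -> 0 < z 0 i -> 0 < \sum_j z 0 j.
  move=> zP zi; rewrite (bigD1 i)//= ltr_wpDr//; apply: sumr_ge0 => j _.
  exact: ltW (stationary_row_gt0 zP zi j).
have [yp|yn|y00] := ltgtP 0 (y 0 i); last by rewrite y00 eqxx in yi.
  by have := sum_gt0 y yP yp; rewrite y_sum ltxx.
have : 0 < \sum_j (- y) 0 j.
  by apply: sum_gt0; [rewrite /stationary_row mulNmx yP | rewrite mxE oppr_gt0].
by under eq_bigr do rewrite mxE; rewrite sumrN y_sum oppr0 ltxx.
Qed.

Lemma stationary_row_exists : exists y : 'rV[R]_p,
  [/\ stationary_row y, forall i, 0 <= y 0 i & \sum_i y 0 i = 1].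
Proof.
have : \det (1%:M - transition_mx) == 0.
  rewrite -det_tr; apply/det0P; exists (const_mx 1).
    by apply/eqP => /rowP/(_ (Ordinal p_gt0)); rewrite !mxE => /eqP; rewrite oner_eq0.
  apply/rowP => i; rewrite !mxE.
  under eq_bigr => j _ do rewrite !mxE mul1r.
  rewrite sumrB sum_Mtrans (bigD1 i)//= eqxx big1 ?addr0 ?subrr//.
  by move=> j ji; rewrite eq_sym (negPf ji).
move=> /det0P[y y_neq0 /eqP]; rewrite mulmxBr mulmx1 subr_eq0 => /eqP yP.
have absP := stationary_row_norm (esym yP).
have sum_gt0 : 0 < \sum_i `|y 0 i|.
  have [i yi] : exists i, y 0 i != 0.
    apply/existsP; apply: contraNT y_neq0 => /existsPn y0; apply/eqP/rowP => i.
    by rewrite mxE; apply/eqP; have := y0 i; rewrite negbK.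
  by rewrite (bigD1 i)//= ltr_wpDr ?normr_gt0//; exact: sumr_ge0.
exists ((\sum_i `|y 0 i|)^-1 *: map_mx Num.norm y); split.
- by rewrite /stationary_row -scalemxAl absP.
- by move=> i; rewrite !mxE mulr_ge0// invr_ge0 ltW.
under eq_bigr do rewrite !mxE.
by rewrite -mulr_sumr mulVf// gt_eqF.
Qed.

Lemma poisson_equation_solvable (y : 'rV[R]_p) (b : 'cV[R]_p) :
  stationary_row y -> \sum_i y 0 i = 1 -> y *m b = 0 ->
  exists w : 'cV[R]_p, (1%:M - transition_mx) *m w = b.
Proof.
move=> yP y1 yb; set A := 1%:M - transition_mx.
have annihilates (z : 'rV[R]_p) : z *m A = 0 -> z *m b = 0.
  rewrite mulmxBr mulmx1 => /eqP; rewrite subr_eq0 => /eqP zP.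
  have /eqP : z - (\sum_i z 0 i) *: y = 0.
    apply: stationary_row_eq0; first by rewrite /stationary_row mulmxBl -scalemxAl yP -zP.
    by under eq_bigr do rewrite !mxE; rewrite sumrB -mulr_sumr y1 mulr1 subrr.
  by rewrite subr_eq0 => /eqP ->; rewrite -scalemxAl yb scaler0.
have : (b^T <= A^T)%MS.
  rewrite submxE; apply/eqP; apply: trmx_inj; rewrite trmx_mul trmxK trmx0.
  apply/row_matrixP => i; rewrite row_mul row0; apply: annihilates.
  have coker0 : (cokermx A^T)^T *m A = 0 by rewrite -{2}[A]trmxK -trmx_mul mulmx_coker trmx0.
  by rewrite -row_mul coker0 row0.
by move=> /submxP[D bE]; exists D^T; apply: trmx_inj; rewrite trmx_mul trmxK bE.
Qed.

End StationaryRows.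

Section ContractingTilt.
Variables (R : realType) (d p : nat) (mu : jump R d p).
Local Notation X := 'rV[int]_d.
Local Notation S := (state d p).
Hypotheses (p_gt0 : (0 < p)%N) (mu_jump : is_jump_matrix mu) (irr : irreducible mu).
Hypotheses (mu_moments : finite_exp_moments mu) (nc : non_centered mu).

Let mu_ge0 i j x : 0 <= mu i j x := mu_jump.1 i j x.

(* The Poisson equation compensates the fluctuations of the local drifts in a direction
   opposite to the global drift. *)
Lemma drift_corrector_exists : exists (v : 'rV[R]_d) (w : 'cV[R]_p) (rho : R),
  [/\ `|v| <= 1, 0 < rho & forall i, \sum_k Mtrans mu i k * w k 0 =
        w i 0 - \sum_k dotp v (local_drift mu i k) - rho].
Proof.
have [y [yP y0 y1]] := stationary_row_exists p_gt0 mu_jump.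
have y_stationary : stationary mu (fun i => y 0 i).
  by split => //; split => // j; rewrite -(stationary_rowE yP).
pose m := global_drift mu (fun i => y 0 i); pose rho := enorm m.
have rho0 : 0 < rho.
  rewrite lt0r enorm_ge0 andbT; apply: contraNneq (nc y_stationary) => rho0.
  by apply/eqP; apply: dotp_le0_eq0; rewrite -enorm_sqr -/m -/rho rho0 expr0n.
pose v : 'rV[R]_d := - rho^-1 *: m.
have vm : dotp v m = - rho by rewrite dotpZl -enorm_sqr -/rho; field; rewrite gt_eqF.
pose vdrift i := \sum_(k < p) dotp v (local_drift mu i k).
have vmE : dotp v m = \sum_i y 0 i * vdrift i.
  rewrite /m /global_drift dotp_sumr; apply: eq_bigr => i _.
  by rewrite dotp_sumr mulr_sumr; apply: eq_bigr => k _; rewrite dotpZr.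
have y_centered : y *m (\col_i (vdrift i + rho)) = 0.
  apply/rowP => k; rewrite ord1 !mxE.
  under eq_bigr do rewrite !mxE mulrDr.
  by rewrite big_split /= -vmE vm -mulr_suml y1 mul1r addNr.
have [w wE] := poisson_equation_solvable mu_jump irr yP y1 y_centered.
exists v, w, rho; split => // [|i].
  by rewrite normrZ normrN normfV (gtr0_norm rho0) mulrC ler_pdivrMr// mul1r norm_le_enorm.
have /colP/(_ i) := wE; rewrite mulmxBl mul1mx !mxE.
have -> : \sum_j transition_mx mu i j * w j 0 = \sum_k Mtrans mu i k * w k 0.
  by apply: eq_bigr => k _; rewrite mxE.
by rewrite -/(vdrift i); lra.
Qed.

Lemma jump_exp_moment : exists2 M : R, 0 < M & forall i k, exp_moment_le 1 M (mu i k).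
Proof.
pose E i k := sumR (fun x => expR (1 * l1norm R x) * mu i k x).
have s i k : rsummable (fun x => expR (1 * l1norm R x) * mu i k x).
  rewrite rsummable_esum; last by move=> x; rewrite mulr_ge0 ?expR_ge0.
  apply: le_lt_trans (jump_tilted_moment_lty mu_ge0 mu_moments 0 i k ler01).
  by apply: le_esum => x _; rewrite dotpC dotp0r add0r.
have E0 i k : 0 <= E i k by apply: sumR_ge0 => x; rewrite mulr_ge0 ?expR_ge0.
exists (\sum_i \sum_k E i k + 1) => [|i k].
  by rewrite ltr_wpDl//; apply: sumr_ge0 => i _; exact: sumr_ge0.
split => //; apply: (@le_trans _ _ (\sum_i \sum_k E i k)); last by rewrite lerDl.
rewrite (bigD1 i)//= (bigD1 k)//= -addrA lerDl addr_ge0//; first exact: sumr_ge0.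
by apply: sumr_ge0 => j _; exact: sumr_ge0.
Qed.

Lemma kcomp_step_tilt (al : 'rV[R]_d) (h : 'I_p -> R) i : (forall k, 0 <= h k) ->
  (forall k, rsummable (tilt al (mu i k))) ->
  kcomp (step_kernel mu) (exp_weight al 0 h) ((0, i) : S) tt =
  (\sum_k h k * sumR (tilt al (mu i k)))%:E.
Proof.
move=> h0 s; rewrite kcomp_unit; [|exact: step_kernel_ge0|exact: exp_weight_ge0].
rewrite -sumEFin; apply: eq_bigr => k _.
have tilt0 x : 0 <= tilt al (mu i k) x by exact: tilt_ge0.
rewrite EFinM ge0_sumRE// -esumZl; last 2 first.
- by move=> x; rewrite lee_fin.
- by rewrite lee_fin.
apply: eq_esum => x _; rewrite /step_kernel exp_weight0 /P1 /tilt /= subr0 -!EFinM.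
by congr _%:E; ring.
Qed.

Lemma mul_taylor2_le (t w P q z C : R) : 0 <= t <= 1 -> 0 <= C -> 0 <= 1 + t * w ->
  z <= P + t * q + t ^+ 2 * C ->
  (1 + t * w) * z <= P + t * (q + P * w) + t ^+ 2 * (C + `|w| * `|q| + C * `|w|).
Proof.
move=> /andP[t0 t1] C0 tw0 z_le; apply: (le_trans (ler_wpM2l tw0 z_le)).
have wq : w * q <= `|w| * `|q| by rewrite -normrM ler_norm.
have t2 : 0 <= t ^+ 2 by exact: sqr_ge0.
have second_order : t ^+ 2 * (w * q) <= t ^+ 2 * (`|w| * `|q|) by rewrite ler_wpM2l.
have third_order : t ^+ 2 * (C * (t * w)) <= t ^+ 2 * (C * `|w|).
  rewrite ler_wpM2l// ler_wpM2l//; apply: (le_trans (ler_norm _)).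
  by rewrite normrM (ger0_norm t0) ler_piMl.
lra.
Qed.

Lemma tilted_jump_expansion (v : 'rV[R]_d) (w : 'cV[R]_p) : `|v| <= 1 ->
  exists2 C : R, 0 <= C & forall (t : R) i, 0 < t <= 1 / 4 -> (forall k, 0 <= 1 + t * w k 0) ->
  (forall k, rsummable (tilt (t *: v) (mu i k))) /\
  \sum_k (1 + t * w k 0) * sumR (tilt (t *: v) (mu i k)) <=
  1 + t * (\sum_k dotp v (local_drift mu i k) + \sum_k Mtrans mu i k * w k 0) + t ^+ 2 * C.
Proof.
move=> v1; have [M M0 mu_moment] := jump_exp_moment.
pose q i k := dotp v (local_drift mu i k).
pose C := (8 / 1) ^+ 2 * M; have C0 : 0 <= C by rewrite mulr_ge0 ?sqr_ge0// ltW.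
pose B i k := C + `|w k 0| * `|q i k| + C * `|w k 0|.
have B0 i k : 0 <= B i k by rewrite !addr_ge0// mulr_ge0.
exists (\sum_i \sum_k B i k) => [|t i /andP[t0 t4] tw0].
  by apply: sumr_ge0 => i _; exact: sumr_ge0.
have mu_moment0 k : exp_moment_le 1 M (tilt 0 (mu i k)) by rewrite tilt0.
have t4' : `|t| <= 1 / 4 by rewrite gtr0_norm.
have close : `|t *: v - 0| <= 1 / 4.
  by rewrite subr0 normrZ -[leRHS]mulr1; apply: ler_pM.
split=> [k|].
  apply: (exp_moment_rsummable (del := 1 / 2)); first by rewrite divr_gt0.
  exact: (exp_moment_le_tilt ltr01 (mu_moment0 k) close).
have taylor k : sumR (tilt (t *: v) (mu i k)) <= Mtrans mu i k + t * q i k + t ^+ 2 * C.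
  have := sumR_tilt_le_taylor2 ltr01 (mu_moment0 k) v1 t4'.
  by rewrite add0r tilt0 -(MtransE mu_jump).
have t01 : 0 <= t <= 1 by rewrite ltW//=; lra.
apply: (le_trans (ler_sum _ (fun k _ => mul_taylor2_le t01 C0 (tw0 k) (taylor k)))).
rewrite !big_split /= (sum_Mtrans mu_jump) -!mulr_sumr big_split /= lerD2l ler_wpM2l ?sqr_ge0//.
rewrite [leRHS](bigD1 i)//= lerDl.
by apply: sumr_ge0 => j _; exact: sumr_ge0.
Qed.

Lemma contracting_weight_exists : exists (al : 'rV[R]_d) (h : 'I_p -> R) (eta : R),
  [/\ forall i, 0 < h i, 0 < eta & forall i,
    (eta%:E + kcomp (step_kernel mu) (exp_weight al 0 h) ((0%R, i) : S) tt <= (h i)%:E)%E].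
Proof.
have [v [w [rho [v1 rho0 corrector]]]] := drift_corrector_exists.
have [C C0 expansion] := tilted_jump_expansion w v1.
pose B := \sum_k `|w k 0|; have B0 : 0 <= B by exact: sumr_ge0.
have wB i : `|w i 0| <= B by rewrite /B (bigD1 i)//= lerDl sumr_ge0.
pose t := Num.min (1 / 4) (Num.min (1 / (2 * (B + 1))) (rho / (2 * (C + 1)))).
have B1 : 0 < 2 * (B + 1) by lra.
have C1 : 0 < 2 * (C + 1) by lra.
have t0 : 0 < t by rewrite !lt_min !divr_gt0.
have t4 : t <= 1 / 4 by rewrite ge_min lexx.
have tB : t * (2 * (B + 1)) <= 1 by rewrite -ler_pdivlMr// !ge_min lexx orbT.
have tC : t * (2 * (C + 1)) <= rho by rewrite -ler_pdivlMr// !ge_min lexx !orbT.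
have h0 i : 0 < 1 + t * w i 0.
  have : t * `|w i 0| <= t * B by rewrite ler_pM2l.
  have : - (t * `|w i 0|) <= t * w i 0.
    by rewrite -mulrN ler_pM2l// lerNl -normrN ler_norm.
  lra.
exists (t *: v), (fun i => 1 + t * w i 0), (t * rho / 2); split => // [|i].
  by rewrite !divr_gt0 ?mulr_gt0.
have h_ge0 k : 0 <= 1 + t * w k 0 := ltW (h0 k).
have t04 : 0 < t <= 1 / 4 by rewrite t0.
have [s sum_le] := expansion t i t04 h_ge0.
rewrite kcomp_step_tilt// -EFinD lee_fin (le_trans (lerD (lexx _) sum_le))// corrector.
have : t * (t * C) <= t * (rho / 2) by rewrite ler_pM2l//; lra.
lra.
Qed.

End ContractingTilt.

(** * From the walk to the Markov-additive process *)

Record walk_decomposition (R : realType) (d p : nat) (mu : jump R d p)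
    (nu : 'rV[int]_d -> R) (kap exc : 'I_p -> 'I_p -> 'rV[int]_d -> R) (al0 : 'rV[R]_d) :
    Prop := WalkDecomposition {
  step_law_gt0 : forall x, 0 < nu x;
  start_gt0 : forall i j x, 0 < kap i j x;
  excursion_ge0 : forall i j x, 0 <= exc i j x;
  step_law_moments : exp_moments_on_sublevel nu nu;
  start_moments : forall i j, exp_moments_on_sublevel nu (kap i j);
  excursion_moments : forall i j, exp_moments_on_sublevel nu (exc i j);
  subcritical_tilt : mgf_sublevel nu al0 /\ sumR (tilt al0 nu) < 1;
  green_walk : forall i j x, green mu ((0 : 'rV[int]_d), i) (x, j) =
    ((exc i j x)%:E + \esum_(n in [set: nat]) (conv_pow (kap i j) nu n x)%:E)%E }.

Section WalkDecomposition.
Variables (R : realType) (d p : nat) (mu : jump R d p).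
Local Notation X := 'rV[int]_d.
Local Notation S := (state d p).
Hypotheses (d_gt0 : (0 < d)%N) (p_gt0 : (0 < p)%N).
Hypotheses (mu_jump : is_jump_matrix mu) (irr : irreducible mu).
Hypotheses (mu_moments : finite_exp_moments mu) (nc : non_centered mu).

Let mu_ge0 i j x : 0 <= mu i j x := mu_jump.1 i j x.

Let i0 : 'I_p := Ordinal p_gt0.

Let regen_lty n s t : (kpow (regen_kernel mu i0) n s t < +oo)%E.
Proof.
have [al [h [eta [h0 eta0 contraction]]]] :=
  contracting_weight_exists p_gt0 mu_jump irr mu_moments nc.
exact: (kpow_regen_lty i0 mu_ge0 h0 eta0 contraction).
Qed.

Let green_lty n s t :
  (kcomp (kpow (regen_kernel mu i0) n) (unmarked_green mu i0) s t < +oo)%E.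
Proof.
have [al [h [eta [h0 eta0 contraction]]]] :=
  contracting_weight_exists p_gt0 mu_jump irr mu_moments nc.
exact: (kpow_regen_unmarked_lty i0 mu_ge0 h0 eta0 contraction).
Qed.

Let nu := regen_law mu i0.

Let nuE x : (nu x)%:E = regen_kernel mu i0 (0, i0) (x, i0) := regen_lawE mu_ge0 regen_lty x.

Let esum_tilt_nu al : (\esum_(x in [set: X]) (tilt al nu x)%:E =
  \esum_(x in [set: X])
    (regen_kernel mu i0 (0%R, i0) (x, i0) * (expR (dotp al (toR R x)))%:E))%E.
Proof. by apply: eq_esum => x _; rewrite -nuE -EFinM mulrC. Qed.

Let tilt_nu_ge0 al x : 0 <= tilt al nu x.
Proof. by apply: tilt_ge0 => y; apply: fine_ge0; exact: regen_kernel_ge0. Qed.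

Lemma exp_moments_on_sublevel_regen (K : S -> S -> \bar R) i j : kernel_ge0 K ->
  (forall x : X, K (0%R, i) (x, j) < +oo)%E ->
  (forall al del, exp_finite al del (unmarked_green mu i0) ->
     exp_finite al del (regen_kernel mu i0) ->
     exp_finite al del (kcomp (regen_kernel mu i0) (unmarked_green mu i0)) ->
     exp_finite al del K) ->
  exp_moments_on_sublevel nu (fun x => fine (K ((0 : X), i) (x, j))).
Proof.
move=> K0 K_lty K_finite al [s _].
have regen_finite : (\esum_(x in [set: X])
    (regen_kernel mu i0 (0%R, i0) (x, i0) * (expR (dotp al (toR R x)))%:E) < +oo)%E.
  by rewrite -esum_tilt_nu -rsummable_esum.
have [del del0 [green_fin regen_fin start_fin]] :=
  exp_finite_regen mu_ge0 d_gt0 irr mu_moments regen_finite.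
by exists del => //; apply: exp_finite_rsummable => //; exact: K_finite.
Qed.

Lemma regen_law_subcritical : exists al0, mgf_sublevel nu al0 /\ sumR (tilt al0 nu) < 1.
Proof.
have [al [h [eta [h0 eta0 contraction]]]] :=
  contracting_weight_exists p_gt0 mu_jump irr mu_moments nc.
have mass_le : (\esum_(x in [set: X]) (tilt al nu x)%:E <= ((h i0 - eta) / h i0)%:E)%E.
  have := regen_mass_lt1 i0 mu_ge0 h0 eta0 contraction; rewrite -esum_tilt_nu.
  have : (0 <= \esum_(x in [set: X]) (tilt al nu x)%:E)%E.
    by apply: esum_ge0 => x _; rewrite lee_fin.
  case: (\esum_(x in _) _)%E => [r _| _|//]; last by rewrite gt0_muley ?lte_fin// addye.
  by rewrite -EFinM -EFinD !lee_fin ler_pdivlMr//; lra.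
have s : rsummable (tilt al nu) by rewrite rsummable_esum//; apply: le_lt_trans mass_le (ltry _).
have mass_lt1 : sumR (tilt al nu) < 1.
  move: mass_le; rewrite -ge0_sumRE// lee_fin => /le_lt_trans; apply.
  by rewrite ltr_pdivrMr// mul1r; lra.
by exists al; split => //; split => //; exact: ltW.
Qed.

Theorem walk_decomposition_exists : exists nu kap exc al0,
  walk_decomposition mu nu kap exc al0.
Proof.
have [al0 subcritical] := regen_law_subcritical.
have green0 := unmarked_green_ge0 i0 mu_ge0; have regen0 := regen_kernel_ge0 i0 mu_ge0.
have startE := start_lawE mu_ge0 green_lty; have excE := excursion_lawE mu_ge0 green_lty.
exists nu, (start_law mu i0), (excursion_law mu i0), al0; split => //.
- by move=> x; rewrite -lte_fin nuE; exact: regen_kernel_gt0.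
- move=> i j x; rewrite -lte_fin startE; apply/kcomp_gt0 => //.
  by exists (0, i0); [exact: regen_kernel_gt0 | exact: unmarked_green_gt0].
- by move=> i j x; apply: fine_ge0; exact: green0.
- by apply: exp_moments_on_sublevel_regen => // x; rewrite -nuE ltry.
- move=> i j; apply: exp_moments_on_sublevel_regen => // [|x]; first exact: kcomp_ge0.
  by rewrite -startE ltry.
- by move=> i j; apply: exp_moments_on_sublevel_regen => // x; rewrite -excE ltry.
by move=> i j x; exact: green_regen_walk.
Qed.

End WalkDecomposition.

Section RayLimits.
Variables (R : realType) (d : nat).
Local Notation X := 'rV[int]_d.
Implicit Types (c : 'rV[R]_d -> 'rV[R]_d) (chi : 'rV[R]_d -> R) (nu f : X -> R).

Definition ray_scaling_limit c (G : X -> \bar R) chi : Prop :=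
  forall e : R, 0 < e -> exists2 r0 : R, 0 < r0 & forall u x (r : R),
  sphere u -> toR R x = r *: u -> r0 <= r -> exists2 g : R, G x = g%:E &
  `|Num.sqrt r ^+ d.-1 * expR (dotp (c u) (toR R x)) * g - chi u| <= e.

Lemma esum_nat_close (a : nat -> R) (K b e : R) : 0 < K -> (forall n, 0 <= a n) ->
  (\forall N \near \oo, `|K * (\sum_(n < N) a n) - b| <= e) ->
  exists2 Z : R, (\esum_(n in [set: nat]) (a n)%:E = Z%:E)%E & `|K * Z - b| <= e.
Proof.
move=> K0 a0 [N0 _ close]; have a0' n : (0 <= (a n)%:E)%E by rewrite lee_fin.
have sum_le : (\esum_(n in [set: nat]) (a n)%:E <= ((b + e) / K)%:E)%E.
  apply: esum_nat_le => // n; rewrite sumEFin lee_fin ler_pdivlMr// mulrC.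
  have := close (maxn n N0) (leq_maxr _ _); rewrite /= ler_norml => /andP[_ close_max].
  apply: (@le_trans _ _ (K * \sum_(k < maxn n N0) a k)); last by lra.
  rewrite ler_pM2l// -(big_mkord xpredT a) -(big_mkord xpredT a).
  rewrite (@big_cat_nat _ _ _ n 0 (maxn n N0))//= ?leq_maxl// lerDl.
  by apply: sumr_ge0.
have fin : (\esum_(n in [set: nat]) (a n)%:E)%E \is a fin_num.
  by rewrite ge0_fin_numE ?esum_ge0//; apply: le_lt_trans sum_le (ltry _).
exists (fine (\esum_(n in [set: nat]) (a n)%:E)%E); first by rewrite fineK.
have sum_ge := esum_nat_ge N0 a0'; move: sum_le sum_ge.
rewrite sumEFin -(fineK fin) !lee_fin; move: (fine _) => Z Z_le Z_ge.
have := close N0 (leqnn _); rewrite /= !ler_norml => /andP[close_ge _]; apply/andP; split.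
  by apply: (le_trans close_ge); rewrite lerD2r ler_pM2l.
by rewrite lerBlDr addrC mulrC -ler_pdivlMr.
Qed.

Lemma exp_moment_ray_small nu f c : (forall x, 0 < nu x) -> (forall x, 0 <= f x) ->
  exp_moments_on_sublevel nu f -> (forall u, sphere u -> mgf_sublevel nu (c u)) ->
  forall e : R, 0 < e -> exists2 r0 : R, 0 < r0 & forall u x (r : R),
  sphere u -> toR R x = r *: u -> r0 <= r -> Num.sqrt r ^+ d.-1 * tilt (c u) f x <= e.
Proof.
move=> nu0 f0 f_moments c_sub e e0.
have [del [M [del0 M0 moment]]] := sublevel_uniform_exp_moment nu0 f0 f_moments.
have [r0 r1 small] := sqrt_exprn_expRN_small d.-1 del0 (ltW M0) e0.
exists r0 => [|u x r su xr r_ge]; first exact: lt_le_trans r1.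
have r_gt0 : 0 < r by apply: lt_le_trans r_ge; exact: lt_le_trans r1.
apply: le_trans (small r r_ge); rewrite ler_wpM2l ?exprn_ge0 ?sqrtr_ge0//.
have [tilt0 s tM] := moment _ (c_sub u su).
have term_le := le_trans (sumR_ge_term x (fun z => mulr_ge0 (expR_ge0 _) (tilt0 z)) s) tM.
apply: (@le_trans _ _ (M * expR (- (del * l1norm R x)))).
  by rewrite expRN ler_pdivlMr ?expR_gt0// mulrC.
rewrite ler_pM2l// ler_expR lerN2 ler_pM2l//; apply: le_trans (enorm_le_l1norm R x).
by rewrite xr enormZ (su : enorm u = 1) mulr1 gtr0_norm.
Qed.

Lemma ray_scaling_limit_green c chi nu kap exc (G : X -> \bar R) :
  (forall x, 0 < nu x) -> (forall x, 0 <= kap x) -> (forall x, 0 <= exc x) ->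
  exp_moments_on_sublevel nu exc -> (forall u, sphere u -> mgf_sublevel nu (c u)) ->
  ray_asymptotics c (conv_pow kap nu) chi ->
  (forall x, G x = ((exc x)%:E + \esum_(n in [set: nat]) (conv_pow kap nu n x)%:E)%E) ->
  ray_scaling_limit c G chi.
Proof.
move=> nu0 kap0 exc0 exc_moments c_sub walk GE e e0; have e2 : 0 < e / 2 by rewrite divr_gt0.
have [r1 r10 walk_close] := walk _ e2.
have [r2 r20 exc_small] := exp_moment_ray_small nu0 exc0 exc_moments c_sub e2.
exists (r1 + r2) => [|u x r su xr r_ge]; first exact: addr_gt0.
have r1r : r1 <= r by lra.
have r2r : r2 <= r by lra.
have r0 : 0 < r by lra.
pose K := Num.sqrt r ^+ d.-1 * expR (dotp (c u) (toR R x)).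
have K0 : 0 < K by rewrite mulr_gt0 ?expR_gt0// exprn_gt0// sqrtr_gt0.
have conv0 n : 0 <= conv_pow kap nu n x by apply: conv_pow_ge0 => // y; exact: ltW.
have conv_close : \forall N \near \oo, `|K * (\sum_(n < N) conv_pow kap nu n x) - chi u| <= e / 2.
  apply: filterS (walk_close u x r su xr r1r) => N.
  have -> : \sum_(n < N) tilt (c u) (conv_pow kap nu n) x =
      expR (dotp (c u) (toR R x)) * \sum_(n < N) conv_pow kap nu n x by rewrite mulr_sumr.
  by rewrite mulrA.
have [Z ZE Z_close] := esum_nat_close K0 conv0 conv_close.
exists (exc x + Z); first by rewrite GE ZE.
rewrite -/K mulrDr -addrA (splitr e) (le_trans (ler_normD _ _))// lerD//.
rewrite ger0_norm; last by rewrite mulr_ge0// ltW.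
by rewrite /K -mulrA; exact: exc_small.
Qed.

Lemma ray_scaling_limit_equivalent c (G : X -> \bar R) chi (C1 eps : R) : (0 < d)%N ->
  0 < C1 -> (forall u, sphere u -> C1 <= chi u) -> ray_scaling_limit c G chi -> 0 < eps ->
  exists M : R, forall x : X, M < enorm (toR R x) ->
  let y : 'rV[R]_d := toR R x in
  let u := (enorm y)^-1 *: y in
  let f := chi u * (enorm y `^ (- ((d%:R - 1) / 2))) * expR (- dotp (c u) y) in
  (`| G x - f%:E | <= (eps * f)%:E)%E.
Proof.
move=> d0 C10 chi_ge limit eps0; have [r0 r00 close] := limit _ (mulr_gt0 eps0 C10).
exists r0 => x x_far; cbv zeta; set y := toR R x; set u := (enorm y)^-1 *: y.
have y0 : 0 < enorm y by exact: lt_trans x_far.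
have su : sphere u by exact: sphere_normalize.
have yu : y = enorm y *: u by rewrite /u scalerA mulfV ?scale1r// gt_eqF.
have [g gE g_close] := close u x (enorm y) su yu (ltW x_far).
set K := _ * expR _ in g_close.
have K0 : 0 < K by rewrite mulr_gt0 ?expR_gt0// exprn_gt0// sqrtr_gt0.
have -> : chi u * (enorm y `^ (- ((d%:R - 1) / 2))) * expR (- dotp (c u) y) = chi u / K.
  have -> : d%:R - 1 = d.-1%:R :> R by rewrite -{1}(prednK d0) -natr1 addrK.
  by rewrite powRN_half// /K invfM expRN mulrA.
rewrite gE -EFinB abse_EFin lee_fin.
have -> : g - chi u / K = (K * g - chi u) / K by field; rewrite gt_eqF.
rewrite normrM normfV (gtr0_norm K0) mulrA ler_wpM2r ?invr_ge0 ?(ltW K0)//.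
by apply: (le_trans g_close); rewrite ler_pM2l// chi_ge.
Qed.

Lemma support_map_continuous nu c del M eps lam0 lam1 Lc :
  support_map nu c del M eps lam0 lam1 Lc -> {within @sphere R d, continuous c}.
Proof.
move=> supp; have [_ _ _ _ Lc0] := support_pos supp.
apply: (within_continuous_lipschitz ltr01 Lc0) => u v su sv _.
exact: (support_lipschitz supp su sv).
Qed.

Lemma support_walk_asymptotics nu kap c del M eps lam0 lam1 Lc : (0 < d)%N ->
  (forall x, 0 < nu x) -> (forall x, 0 < kap x) -> exp_moments_on_sublevel nu kap ->
  support_map nu c del M eps lam0 lam1 Lc -> exists chi,
  [/\ {within @sphere R d, continuous chi}, forall u, sphere u -> 0 < chi u &
      ray_asymptotics c (conv_pow kap nu) chi].
Proof.
move=> d0 nu0 kap0 kap_moments supp; have [/andP[del0 _] M0 _ _ _] := support_pos supp.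
have [del' [M' [del'0 M'0 kap_moment]]] :=
  sublevel_uniform_exp_moment nu0 (fun x => ltW (kap0 x)) kap_moments.
pose del2 := Num.min del del'; have del20 : 0 < del2 by rewrite lt_min del0.
have supp2 : support_map nu c del2 (M + M') eps lam0 lam1 Lc.
  by apply: support_map_weaken supp; rewrite ?del20 ?ge_min ?lexx// lerDl ltW.
apply: (walk_ray_asymptotics d0 nu0 kap0 supp2) => u su.
apply: exp_moment_le_weaken (kap_moment _ (support_sublevel supp su)).
  by rewrite (ltW del20) ge_min lexx orbT.
by rewrite lerDr ltW.
Qed.

Lemma sphere_family_bounds (I : finType) (i0 : I) (chi : I -> 'rV[R]_d -> R) : (0 < d)%N ->
  (forall i, {within @sphere R d, continuous (chi i)}) ->
  (forall i u, sphere u -> 0 < chi i u) ->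
  exists C1 C2 : R, [/\ 0 < C1, 0 < C2 & forall i u, sphere u -> C1 <= chi i u <= C2].
Proof.
move=> d0 chi_cont chi0.
have bounds i : exists b : R * R, [/\ 0 < b.1, 0 < b.2 &
    forall u, sphere u -> b.1 <= chi i u <= b.2].
  have [a [b [a0 b0 ab]]] := sphere_continuous_bounds d0 (chi_cont i) (chi0 i).
  by exists (a, b).
have [b b_bounds] := boolp.choice bounds.
have sum_ge (F : I -> R) i : (forall k, 0 < F k) -> F i <= \sum_k F k.
  by move=> F0; rewrite (bigD1 i)//= lerDl; apply: sumr_ge0 => k _; exact: ltW.
have low0 k : 0 < (b k).1^-1 by rewrite invr_gt0; case: (b_bounds k).
have up0 k : 0 < (b k).2 by case: (b_bounds k).
exists (\sum_k (b k).1^-1)^-1, (\sum_k (b k).2); split => [||i u su].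
- by rewrite invr_gt0; apply: lt_le_trans (sum_ge _ i0 low0).
- exact: lt_le_trans (sum_ge _ i0 up0).
have [b1 _ /(_ u su)/andP[low up]] := b_bounds i; apply/andP; split.
  apply: le_trans low; rewrite -[leRHS]invrK lef_pV2 ?posrE//; first exact: (sum_ge _ i low0).
  by apply: lt_le_trans (sum_ge _ i0 low0).
by apply: (le_trans up); exact: (sum_ge (fun k => (b k).2)).
Qed.

End RayLimits.

Theorem theorem1p5 (R : realType) (d p : nat) (mu : jump R d p) :
  (0 < d)%N -> (0 < p)%N ->
  is_jump_matrix mu -> irreducible mu -> aperiodic mu ->
  finite_exp_moments mu -> non_centered mu ->
  exists (c : 'rV[R]_d -> 'rV[R]_d) (chi : 'I_p -> 'I_p -> 'rV[R]_d -> R) (C1 C2 : R),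
    [/\ 0 < C1 /\ 0 < C2,
        {within @sphere R d, continuous c},
        (forall i j, {within @sphere R d, continuous (chi i j)}),
        (forall i j u, sphere u -> C1 <= chi i j u <= C2) &
        (forall (i j : 'I_p) (eps : R), 0 < eps ->
           exists M : R, forall x : 'rV[int]_d,
             M < enorm (toR R x) ->
             let y : 'rV[R]_d := toR R x in
             let u := (enorm y)^-1 *: y in
             let f := chi i j u * (enorm y `^ (- ((d%:R - 1) / 2))) *
                        expR (- dotp (c u) y) in
             (`| green mu ((0%R : 'rV[int]_d), i) (x, j) - f%:E | <= (eps * f)%:E)%E)].
Proof.
move=> d0 p0 mu_jump irr _ moments nc.
have [nu [kap [exc [al0 dec]]]] := walk_decomposition_exists d0 p0 mu_jump irr moments nc.
have nu0 := step_law_gt0 dec; have [al0_sub al0_lt1] := subcritical_tilt dec.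
have [c [del [M [eps [lam0 [lam1 [Lc supp]]]]]]] :=
  support_map_exists d0 nu0 (step_law_moments dec) al0_sub al0_lt1.
have [chi chi_spec] := boolp.choice (fun z : 'I_p * 'I_p =>
  support_walk_asymptotics d0 nu0 (start_gt0 dec z.1 z.2) (start_moments dec z.1 z.2) supp).
have [C1 [C2 [C10 C20 chi_bounds]]] : exists C1 C2 : R, [/\ 0 < C1, 0 < C2 &
    forall z u, sphere u -> C1 <= chi z u <= C2].
  apply: (sphere_family_bounds (Ordinal p0, Ordinal p0) d0) => z.
    by case: (chi_spec z).
  by case: (chi_spec z).
exists c, (fun i j => chi (i, j)), C1, C2; split=> [//||i j|i j|i j e e0].
- exact: support_map_continuous supp.
- by case: (chi_spec (i, j)).
- exact: chi_bounds.
have [_ _ walk] := chi_spec (i, j).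
have limit := ray_scaling_limit_green nu0 (fun x => ltW (start_gt0 dec i j x))
  (excursion_ge0 dec i j) (excursion_moments dec i j) (support_sublevel supp) walk
  (green_walk dec i j).
apply: ray_scaling_limit_equivalent d0 C10 _ limit e0 => u su.
by case/andP: (chi_bounds (i, j) u su).
Qed.
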